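(* There exist constants $h_0>0$ and $C>0$, independent of $h$ and of the interface location relative to the mesh (they may depend on $\Omega,\Gamma,\beta^\pm,\kappa_1,\kappa_2$), such that the following holds for every three-dimensional mesh $\mathcal T_h$ as in the context with $h\le h_0$ for which every interface element has all face angles $\le\pi/2$ and all dihedral angles $\le\pi/2$, and every $v\in\widetilde H^2(\Omega)$: $$\sum_{T\in\mathcal T_h}|v-I_h^{\rm IFE}v|^2_{H^m(T^+\cup T^-)}\le Ch^{4-2m}\|v\|^2_{H^2(\Omega^+\cup\Omega^-)},\qquad m=0,1.$$
   Context: **Geometry.** $\Omega\subset\mathbb R^3$ is a convex polyhedral domain; $\Gamma\subset\Omega$ is a compact $C^2$ surface without boundary dividing $\Omega$ into disjoint open sub-domains $\Omega^+,\Omega^-$, with $\Omega^-$ lying strictly inside $\Omega$. $\beta=\beta^\pm$ on $\Omega^\pm$ with constants $\beta^\pm>0$; $\mathbf n$ is the unit normal of $\Gamma$ pointing toward $\Omega^+$. $\widetilde H^2(\Omega)=\{v\in L^2(\Omega): v|_{\Omega^\pm}\in H^2(\Omega^\pm),\ [v]_{\Gamma}=0,\ [\beta\nabla v\cdot\mathbf n]_{\Gamma}=0\}$, where $[w]_\Gamma=w^+-w^-$ is the jump of traces from $\Omega^\pm$. For $\Lambda\subset\Omega$, $\Lambda^\pm=\Lambda\cap\Omega^\pm$, $|v|^2_{H^m(\Lambda^+\cup\Lambda^-)}=|v|^2_{H^m(\Lambda^+)}+|v|^2_{H^m(\Lambda^-)}$ (with $|\cdot|_{H^0}=\|\cdot\|_{L^2}$),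 similarly for norms. Functions in $\widetilde H^2(\Omega)$ are continuous on $\overline\Omega$. **Mesh.** $\mathcal T_h$ is a conforming simplicial triangulation of $\Omega$ into open tetrahedra, $h_T=\mathrm{diam}\,T$, $h=\max_Th_T$, quasi-uniform: $\kappa_1h\le h_T\le\kappa_2\rho_T$, with $\rho_T$ the diameter of the largest inscribed ball and $\kappa_1,\kappa_2>0$ fixed. $\mathcal T_h^\Gamma=\{T\in\mathcal T_h:T\cap\Gamma\neq\emptyset\}$ is the set of interface elements. **IFE space.** For each $T\in\mathcal T_h^\Gamma$ fix a point $x^*\in\Gamma\cap\overline T$; let $\Gamma_{h,T}^{ext}$ be the plane tangent to $\Gamma$ at $x^*$ and $\mathbf n_h=\mathbf n(x^* )$. $S_h(T)$ is the set of functions $\phi$ on $T$ with $\phi|_{T^\pm}=\phi^\pm|_{T^\pm}$, where $\phi^\pm$ are affine functions such that $\phi^+=\phi^-$ on $\Gamma_{h,T}^{ext}$ and $\beta^+\nabla\phi^+\cdot\mathbf n_h=\beta^-\nabla\phi^-\cdot\mathbf n_h$. The value of $\phi$ at a vertex $A$ of $T$ is $\phi^\pm(A)$ if $A\in\Omega^\pm$ (vertices on $\Gamma$ are assigned to one fixed side). $V_h^{\rm IFE}$ consists of the functions that belong to $S_h(T)$ on each $T\in\mathcal T_h^\Gamma$, are affine on all other elements, and are continuous at (have a single value at) every vertex. Under the angle conditions and for $h\le h_0$, functions in $V_h^{\rm IFE}$ are uniquely determined by their vertex values; $I_h^{\rm IFE}v\in V_h^{\rm IFE}$ is the function agreeing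 with $v$ at all vertices. *)

(* Defs.v *)
From HB Require Import structures.
From mathcomp Require Import all_boot all_order all_algebra.
From mathcomp Require Import all_classical all_reals all_analysis.

Set Implicit Arguments.
Unset Strict Implicit.
Unset Printing Implicit Defensive.

Import Order.TTheory GRing.Theory Num.Theory.
Import numFieldNormedType.Exports.

Local Open Scope classical_set_scope.
Local Open Scope ring_scope.

(* The plane and space as iterated products: this is the form on which the
   library provides product Lebesgue measure.  The library norm on products is
   the sup norm, which is used only for the topology; all metric notions go
   through [dot] and [enorm]. *)
Notation pt2 R := (R * R)%type.
Notation pt3 R := (R * R * R)%type.

Section Euclidean.
Context {R : realType}.

Definition dot (x y : pt3 R) : R :=
  x.1.1 * y.1.1 + x.1.2 * y.1.2 + x.2 * y.2.

Definition enorm (x : pt3 R) : R := Num.sqrt (dot x x).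

Definition basis3 (i : 'I_3) : pt3 R :=
  ((i == 0%N :> nat)%:R, (i == 1%N :> nat)%:R, (i == 2%N :> nat)%:R).

Definition angle (u v : pt3 R) : R := acos (dot u v / (enorm u * enorm v)).

Definition orth_part (e u : pt3 R) : pt3 R := u - (dot u e / dot e e) *: e.

Definition diam (A : set (pt3 R)) : R :=
  sup [set d | exists x y, [/\ A x, A y & d = enorm (x - y)]].

Definition inball_diam (A : set (pt3 R)) : R :=
  sup [set d | exists c r,
         [/\ 0 < r, [set x | enorm (x - c) < r] `<=` A & d = r *+ 2]].

End Euclidean.

Section Smoothness.
Context {R : realType} {V W : normedModType R}.

Definition iter_deriv (vs : seq V) (f : V -> W) : V -> W :=
  foldr (fun v g x => 'D_v g x) f vs.

(* [f] is C^k on the open set [D]: [derive] is total, so existence of the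
   derivatives has to be required separately. *)
Definition Ck_on (k : nat) (D : set V) (f : V -> W) : Prop :=
  forall vs : seq V, (size vs <= k)%N -> forall x, D x ->
    {for x, continuous (iter_deriv vs f)} /\
    ((size vs < k)%N -> forall v, derivable (iter_deriv vs f) x v).

Definition smooth (f : V -> W) : Prop := forall k, Ck_on k setT f.

End Smoothness.

Section Sobolev.
Context {R : realType}.

Definition leb2 := (@lebesgue_measure R \x @lebesgue_measure R)%E.
Definition leb3 := (leb2 \x @lebesgue_measure R)%E.

Definition test_function (U : set (pt3 R)) (phi : pt3 R -> R) : Prop :=
  smooth phi /\
  exists K, [/\ compact K, K `<=` U & forall x, ~ K x -> phi x = 0].

Definition in_L2 (U : set (pt3 R)) (u : pt3 R -> R) : Prop :=
  measurable_fun U u /\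
  (\int[leb3]_(x in U) ((u x) ^+ 2)%:E < +oo)%E.

(* [g] is the weak derivative of [u] on [U] along the directions [vs], both
   functions being in L^2(U) *)
Definition is_wderiv (U : set (pt3 R)) (vs : seq (pt3 R))
    (u g : pt3 R -> R) : Prop :=
  [/\ in_L2 U u, in_L2 U g & forall phi, test_function U phi ->
    (\int[leb3]_(x in U) (u x * iter_deriv vs phi x)%R%:E =
     ((-1) ^+ size vs)%:E * \int[leb3]_(x in U) (g x * phi x)%R%:E)%E].

(* directions of the partial derivative of multi-index [a] *)
Definition mdirs (a : 'I_3 -> nat) : seq (pt3 R) :=
  flatten [seq nseq (a i) (basis3 i) | i <- enum 'I_3].

(* |u|^2_{H^k(U)}: sum over the multi-indices of order [k].  A weak derivative
   is unique almost everywhere, so each infimum ranges over a single value, and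
   it is +oo when the weak derivative does not exist in L^2(U). *)
Definition Hsemi2 (k : nat) (U : set (pt3 R)) (u : pt3 R -> R) : \bar R :=
  (\sum_(a : {ffun 'I_3 -> 'I_k.+1} | (\sum_i (a i : nat) == k)%N)
    ereal_inf [set (\int[leb3]_(x in U) ((g x) ^+ 2)%:E)%E |
                g in is_wderiv U (mdirs (fun i => a i)) u])%E.

Definition Hnorm2 (m : nat) (U : set (pt3 R)) (u : pt3 R -> R) : \bar R :=
  (\sum_(k < m.+1) Hsemi2 k U u)%E.

Definition in_H (m : nat) (U : set (pt3 R)) (u : pt3 R -> R) : Prop :=
  (Hnorm2 m U u < +oo)%E.

End Sobolev.

Section Surface.
Context {R : realType}.

Definition grad (psi : pt3 R -> R) (x : pt3 R) : pt3 R :=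
  ('D_(basis3 0) psi x, 'D_(basis3 1) psi x, 'D_(basis3 2%:R) psi x).

Definition local_equation (G U : set (pt3 R)) (psi : pt3 R -> R) : Prop :=
  [/\ open U, Ck_on 2 U psi, forall x, U x -> grad psi x <> 0 &
      G `&` U = [set x | psi x = 0] `&` U].

Definition C2_surface (G : set (pt3 R)) : Prop :=
  forall x, G x -> exists U psi, U x /\ local_equation G U psi.

Definition normal_to (G : set (pt3 R)) (x nu : pt3 R) : Prop :=
  exists U psi, [/\ U x, local_equation G U psi &
                    exists c, nu = c *: grad psi x].

Definition area_element (X : pt2 R -> pt3 R) (s : pt2 R) : R :=
  let a := 'D_(1, 0) X s in let b := 'D_(0, 1) X s in
  Num.sqrt (dot a a * dot b b - dot a b ^+ 2).

Definition regular_patch (G : set (pt3 R)) (D : set (pt2 R))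
    (X : pt2 R -> pt3 R) : Prop :=
  [/\ open D, Ck_on 1 D X, {in D &, injective X}, X @` D `<=` G &
      forall s, D s -> 0 < area_element X s].

(* Surface integral over [G] of a nonnegative Borel function.  The parameter
   domain of a patch need not be connected, hence a compact surface is covered
   by a single patch up to a set of zero area, and the supremum is the usual
   surface integral. *)
Definition surf_int (G : set (pt3 R)) (f : pt3 R -> R) : \bar R :=
  ereal_sup [set I | exists D X, regular_patch G D X /\
    I = (\int[leb2]_(s in D) (f (X s) * area_element X s)%:E)%E].

(* [t] represents the trace on [G] of [u] in H^1(U), where [G] is part of the
   boundary of [U]: the trace operator is the continuous extension to H^1(U),
   with values in L^2(G), of the restriction of smooth functions to [G]. *)
Definition is_trace (U G : set (pt3 R)) (u t : pt3 R -> R) : Prop :=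
  [/\ measurable_fun setT t, (surf_int G (fun x => t x ^+ 2)%R < +oo)%E &
      exists w : nat -> pt3 R -> R,
      [/\ forall k, smooth (w k),
          (fun k => Hnorm2 1 U (fun x => w k x - u x)) @ \oo --> 0%E &
          (fun k => surf_int G (fun x => (w k x - t x) ^+ 2)) @ \oo --> 0%E]].

End Surface.

Section Interface.
Context {R : realType}.
Implicit Types (Omega G Op Om : set (pt3 R)) (n : pt3 R -> pt3 R).

Definition convex_polyhedral_domain Omega : Prop :=
  [/\ Omega !=set0, bounded_set Omega &
      exists (k : nat) (a : 'I_k -> pt3 R) (b : 'I_k -> R),
        Omega = [set x | forall i, dot (a i) x < b i]].

Definition subdomain Omega (U : set (pt3 R)) : Prop :=
  [/\ U !=set0, open U, connected U & U `<=` Omega].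

(* [Op], [Om] are the two sides of the interface [G]; the field [n] is only
   relevant on [G]. *)
Definition interface_geometry Omega G Op Om n : Prop :=
  [/\ convex_polyhedral_domain Omega,
      [/\ compact G, C2_surface G & G `<=` Omega],
      [/\ subdomain Omega Op, subdomain Omega Om,
          Op `&` Om = set0 & Omega `\` G = Op `|` Om],
      closure Om `<=` Omega &
      forall x, G x ->
        [/\ normal_to G x (n x), enorm (n x) = 1 &
            exists2 d, 0 < d & forall t, 0 < t < d ->
              Op (x + t *: n x) /\ Om (x - t *: n x)]].

Definition jump_zero G Op Om (v : pt3 R -> R) : Prop :=
  exists tp tm, [/\ is_trace Op G v tp, is_trace Om G v tm &
    surf_int G (fun x => (tp x - tm x) ^+ 2) = 0%E].

(* [gp i], [gm i] are the first weak derivatives of [v] on the two sides and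
   [tp i], [tm i] their traces *)
Definition flux_jump_zero G Op Om n (bp bm : R) (v : pt3 R -> R) : Prop :=
  exists gp gm tp tm : 'I_3 -> pt3 R -> R,
  [/\ forall i, is_wderiv Op [:: basis3 i] v (gp i) /\
                is_trace Op G (gp i) (tp i),
      forall i, is_wderiv Om [:: basis3 i] v (gm i) /\
                is_trace Om G (gm i) (tm i) &
      surf_int G (fun x =>
        (bp * (\sum_i tp i x * dot (basis3 i) (n x)) -
         bm * (\sum_i tm i x * dot (basis3 i) (n x))) ^+ 2) = 0%E].

Definition in_Htilde2 Omega G Op Om n (bp bm : R) (v : pt3 R -> R) : Prop :=
  [/\ in_L2 Omega v, in_H 2 Op v, in_H 2 Om v,
      jump_zero G Op Om v & flux_jump_zero G Op Om n bp bm v].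

End Interface.

Section Mesh.
Context {R : realType}.

Definition tet (a : 'I_4 -> pt3 R) : set (pt3 R) :=
  [set x | exists l : 'I_4 -> R, [/\ forall k, 0 < l k, \sum_k l k = 1 &
             x = \sum_k l k *: a k]].

(* convex hull of those vertices [a k] which satisfy [P] *)
Definition hull (a : 'I_4 -> pt3 R) (P : set (pt3 R)) : set (pt3 R) :=
  [set x | exists l : 'I_4 -> R,
     [/\ forall k, 0 <= l k, forall k, l k != 0 -> P (a k),
         \sum_k l k = 1 & x = \sum_k l k *: a k]].

Definition affinely_independent (a : 'I_4 -> pt3 R) : Prop :=
  forall l : 'I_4 -> R, \sum_k l k = 0 -> \sum_k l k *: a k = 0 ->
    forall k, l k = 0.

(* The mesh has [N] elements, the [i]-th one being the open tetrahedron with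
   vertices [a i k]. *)
Definition conforming_mesh (Omega : set (pt3 R)) (N : nat)
    (a : 'I_N -> 'I_4 -> pt3 R) : Prop :=
  [/\ forall i, affinely_independent (a i),
      closure Omega = \bigcup_i hull (a i) setT &
      forall i j, i != j ->
        tet (a i) `&` tet (a j) = set0 /\
        hull (a i) setT `&` hull (a j) setT = hull (a i) (range (a j))].

Definition mesh_size (N : nat) (a : 'I_N -> 'I_4 -> pt3 R) : R :=
  \big[Num.max/0]_i diam (tet (a i)).

Definition quasi_uniform (k1 k2 : R) (N : nat)
    (a : 'I_N -> 'I_4 -> pt3 R) : Prop :=
  forall i, k1 * mesh_size a <= diam (tet (a i)) /\
            diam (tet (a i)) <= k2 * inball_diam (tet (a i)).

Definition face_angles_le_right (a : 'I_4 -> pt3 R) : Prop :=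
  forall k l m, uniq [:: k; l; m] -> angle (a l - a k) (a m - a k) <= pi / 2.

(* The dihedral angle at the edge [i j], between the faces [i j k] and
   [i j l], is the angle between the parts orthogonal to the edge. *)
Definition dihedral_angles_le_right (a : 'I_4 -> pt3 R) : Prop :=
  forall i j k l, uniq [:: i; j; k; l] ->
    angle (orth_part (a j - a i) (a k - a i))
          (orth_part (a j - a i) (a l - a i)) <= pi / 2.

Definition interface_element (G : set (pt3 R)) (a : 'I_4 -> pt3 R) : Prop :=
  tet a `&` G !=set0.

End Mesh.

Section IFE.
Context {R : realType}.

(* affine function given by its gradient and its value at the origin *)
Definition affine := (pt3 R * R)%type.

Definition aff (p : affine) (x : pt3 R) : R := dot p.1 x + p.2.

(* The pair (phi^+, phi^-) of affine functions defining phi on an element *)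
Definition piece := (affine * affine)%type.

Definition in_Sh (n : pt3 R -> pt3 R) (bp bm : R) (xs : pt3 R)
    (p : piece) : Prop :=
  (forall x, dot (n xs) (x - xs) = 0 -> aff p.1 x = aff p.2 x) /\
  bp * dot p.1.1 (n xs) = bm * dot p.2.1 (n xs).

(* Value at a vertex [A] in the closure of Omega.  Vertices on [G] are assigned
   to the side of Omega^+ if [s] and of Omega^- otherwise; the remaining
   vertices lie in Omega^- or else in Omega^+ or on the boundary of Omega. *)
Definition nodal_value (G Om : set (pt3 R)) (s : bool) (p : piece)
    (A : pt3 R) : R :=
  if `[< Om A >] || (`[< G A >] && ~~ s) then aff p.2 A else aff p.1 A.

(* [w] is an element of the IFE space, given on the i-th element by [p i].
   The argument [xs i] is the point x^* of the element [i], which matters for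
   interface elements only. *)
Definition in_Vh (G Op Om : set (pt3 R)) (n : pt3 R -> pt3 R)
    (bp bm : R) (s : bool) (N : nat) (a : 'I_N -> 'I_4 -> pt3 R)
    (xs : 'I_N -> pt3 R) (p : 'I_N -> piece) (w : pt3 R -> R) : Prop :=
  [/\ forall i, interface_element G (a i) -> in_Sh n bp bm (xs i) (p i),
      forall i, ~ interface_element G (a i) -> (p i).1 = (p i).2,
      forall i, {in tet (a i) `&` Op, w =1 aff (p i).1},
      forall i, {in tet (a i) `&` Om, w =1 aff (p i).2} &
      forall i j k l, a i k = a j l ->
        nodal_value G Om s (p i) (a i k) = nodal_value G Om s (p j) (a j l)].

Definition is_IFE_interpolant (G Op Om : set (pt3 R))
    (n : pt3 R -> pt3 R) (bp bm : R) (s : bool) (N : nat)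
    (a : 'I_N -> 'I_4 -> pt3 R) (xs : 'I_N -> pt3 R)
    (v w : pt3 R -> R) : Prop :=
  exists2 p, in_Vh G Op Om n bp bm s a xs p w &
    forall i k, nodal_value G Om s (p i) (a i k) = v (a i k).

End IFE.

(* Main.v *)
(* On an interface element with vertices near [x^*], both one-sided restrictions
   of [v] have affine approximations [p+], [p-] (Deny-Lions on a star-shaped
   subdomain of each side, then a Morrey-type bound at single points), with an
   error controlled by the energy [E] of [v] near the element.  Continuity of [v]
   at points of the interface bounds [p+ - p-] at [x^*] and in tangential
   directions, and a trace inequality bounds the jump of [beta grad p . n];
   hence [(p+, p-)] is close to a shape function.  What remains is stability:
   a shape function with nodal values of size [e] has size [e] and gradient of
   size [e / h].  It is determined by its gradient along [n], which solves a
   scalar equation with coefficient [1 + (beta-/beta+ - 1) theta]; here [theta]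
   is the [n]-component of the gradient of the Lagrange interpolant of the
   positive part of the signed distance, and since the gradients of the
   barycentric coordinates have nonpositive inner products (no obtuse dihedral
   angle), [theta] lies in [0, 1] up to [O(h)].  Summation uses that the
   neighbourhoods of the elements overlap boundedly, by a volume count.  No
   extension theorem is needed: each weak-derivative estimate is obtained by
   testing against smooth functions. *)
Require Import Defs.
From HB Require Import structures.
From mathcomp Require Import all_boot all_order all_algebra.
From mathcomp Require Import all_classical all_reals all_analysis.
From mathcomp Require Import measurable_realfun.
From mathcomp Require Import ring lra zify.
Set Implicit Arguments.
Unset Strict Implicit.
Unset Printing Implicit Defensive.
Import Order.TTheory GRing.Theory Num.Theory.
Import numFieldNormedType.Exports.
Local Open Scope classical_set_scope.
Local Open Scope ring_scope.

(** * Lebesgue measure on space *)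

(** The parts of an element on the two sides of the interface can be arbitrarily thin, so no
    inequality posed on such a part has a constant independent of the position of the interface. The
    analytic estimates are therefore made on the portion of one side within a fixed multiple of [h]
    of [x^*], whose shape is controlled, and are only afterwards restricted to the thin parts. There
    the common scale is [e = sqrt (h * E)]: affine errors have values of size [e] and gradients of
    size [e / h], and their squares times the volume [h^3] give [h^4 E] and [h^2 E]. The energy also
    contains first derivatives of [v], because surface and tangent plane differ by [O(h^2)] and
    their normals by [O(h)], and these errors multiply the gradient of [v]. Apart from [bp] and
    [bm], all constants come from a radius [r] and a curvature bound [C] of the interface and from a
    lower bound [kap] for the ratio of inscribed diameter to mesh size. *)

Section LebesgueInstances.
Variable R : realType.
Local Notation R' := (measurableTypeR R).

(* The product of two sigma-finite measures is canonically a measure only; the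
   aliases [mu2], [mu3] of [leb2], [leb3] carry the sigma-finite structures. *)
Lemma product_sigma_finite d1 d2 (T1 : measurableType d1) (T2 : measurableType d2)
    (m1 : {sigma_finite_measure set T1 -> \bar R})
    (m2 : {sigma_finite_measure set T2 -> \bar R}) :
  sigma_finite setT (m1 \x m2)%E.
Proof.
have /sigma_finiteP[F [TF ndF oF]] := sigma_finiteT m1.
have /sigma_finiteP[H [TH ndH oH]] := sigma_finiteT m2.
exists (fun k => F k `*` H k).
  apply/seteqP; split=> [[x y] _|//].
  have [i _ Fi] : (\bigcup_k F k) x by rewrite -TF.
  have [j _ Hj] : (\bigcup_k H k) y by rewrite -TH.
  exists (maxn i j) => //; split => /=.
  - by apply: (subsetPset _ _ (ndF _ _ (leq_maxl i j))).
  - by apply: (subsetPset _ _ (ndH _ _ (leq_maxr i j))).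
move=> k; have [mF Fo] := oF k; have [mH Ho] := oH k.
split; first exact: measurableX.
by rewrite product_measure1E// lte_mul_pinfty// ge0_fin_numE.
Qed.

Definition mu2 : set (R' * R') -> \bar R :=
  (@lebesgue_measure R \x @lebesgue_measure R)%E.
HB.instance Definition _ := Measure.on mu2.
HB.instance Definition _ := Measure_isSigmaFinite.Build _ _ _ mu2
  (product_sigma_finite (@lebesgue_measure R) (@lebesgue_measure R)).

Definition mu3 : set (R' * R' * R') -> \bar R := (mu2 \x @lebesgue_measure R)%E.
HB.instance Definition _ := Measure.on mu3.
HB.instance Definition _ := Measure_isSigmaFinite.Build _ _ _ mu3
  (product_sigma_finite mu2 (@lebesgue_measure R)).

Lemma leb2E : @leb2 R = mu2. Proof. by []. Qed.
Lemma leb3E : @leb3 R = mu3. Proof. by []. Qed.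

End LebesgueInstances.

Notation "\int3_ ( x 'in' U ) F" := (integral (@mu3 _) U (fun x : pt3 _ => F%E))
  (at level 36, F at level 36, x, U at level 50, only parsing).
Notation "\int3_ x F" := (integral (@mu3 _) setT (fun x : pt3 _ => F%E))
  (at level 36, F at level 36, x at level 0, only parsing).

(** * Translation invariance of the product measures *)

Section LebesgueInvariance.
Variable R : realType.
Local Notation R' := (measurableTypeR R).

Lemma mu2_fubini (f : pt2 R -> \bar R) : measurable_fun (setT : set (pt2 R)) f ->
  (forall x, 0 <= f x)%E ->
  (\int[@mu2 R]_x f x =
   \int[lebesgue_measure]_x1 \int[lebesgue_measure]_x2 f (x1, x2))%E.
Proof. by move=> mf f0; rewrite fubini_tonelli1. Qed.

Lemma mu3_fubini (f : pt3 R -> \bar R) : measurable_fun (setT : set (pt3 R)) f ->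
  (forall x, 0 <= f x)%E ->
  (\int[@mu3 R]_x f x = \int[@mu2 R]_x1 \int[lebesgue_measure]_x2 f (x1, x2))%E.
Proof. by move=> mf f0; rewrite fubini_tonelli1. Qed.

(** The image of the measure under a translation agrees with it on half-open intervals, which
    determines it. Rectangles play the same role in two and three dimensions. *)
Lemma leb_shift (y : R) (A : set R) : measurable A ->
  lebesgue_measure ((fun x => x + y) @^-1` A) = lebesgue_measure A.
Proof.
move=> mA.
have mf : measurable_fun setT ((fun x => x + y) : measurableTypeR R -> measurableTypeR R).
  exact: measurable_funD.
rewrite -[LHS]/(pushforward lebesgue_measure ((fun x => x + y) : _ -> measurableTypeR R) A).
apply/esym/lebesgue_measure_unique => //= _ [[a b]] _ <-.
rewrite /pushforward /=.
have -> : (fun x => x + y) @^-1` `]a, b] = `]a - y, b - y]%classic.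
  by apply/seteqP; split=> x /=; rewrite !in_itv/= ltrBlDr lerBrDr.
rewrite !lebesgue_measure_itv/= !lte_fin ltrD2r.
by case: ifP => // _; rewrite -!EFinD; congr EFin; ring.
Qed.

Lemma mu2_shift (y : pt2 R) (A : set (pt2 R)) : measurable A ->
  (@mu2 R) ((fun x => x + y) @^-1` A) = (@mu2 R) A.
Proof.
move=> mA.
have mf : measurable_fun setT ((fun x => x + y) : pt2 R -> pt2 R).
  by apply/measurable_fun_pairP; split; apply: measurable_funD.
apply/esym; apply: (product_measure_unique
  (m' := pushforward (@mu2 R) ((fun x => x + y) : R' * R' -> R' * R'))) => //.
move=> B C mB mC; 
rewrite -[LHS]/(mu2 (((fun x => x + y.1) @^-1` B) `*` ((fun x => x + y.2) @^-1` C))).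
have mT (z : R) (D : set R) : measurable D -> measurable ((fun x => x + z) @^-1` D).
  by move=> mD; rewrite -[X in measurable X]setTI; apply: measurable_funD.
rewrite /mu2 product_measure1E; [|exact: mT|exact: mT].
by congr (_ * _)%E; exact: leb_shift.
Qed.

Lemma measurable_shift3 (y : pt3 R) :
  measurable_fun setT ((fun x => x + y) : pt3 R -> pt3 R).
Proof.
apply/measurable_fun_pairP; split; last first.
  by apply: measurable_funD => //; exact: measurable_snd.
apply/measurable_fun_pairP; split; apply: measurable_funD => //.
  by apply: measurableT_comp => //; exact: measurable_fst.
by apply: (measurableT_comp measurable_snd); exact: measurable_fst.
Qed.

Lemma mu3_shift (y : pt3 R) (A : set (pt3 R)) : measurable A ->
  (@mu3 R) ((fun x => x + y) @^-1` A) = (@mu3 R) A.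
Proof.
move=> mA; have mf := measurable_shift3 y.
apply/esym; apply: (product_measure_unique
  (m' := pushforward (@mu3 R) ((fun x => x + y) : R' * R' * R' -> R' * R' * R'))) => //.
move=> B C mB mC.
rewrite -[LHS]/(mu3 (((fun x => x + y.1) @^-1` B) `*` ((fun x => x + y.2) @^-1` C))).
have mT (D : set R) : measurable D -> measurable ((fun x => x + y.2) @^-1` D).
  by move=> mD; rewrite -[X in measurable X]setTI; apply: measurable_funD.
have mT2 (D : set (pt2 R)) : measurable D -> measurable ((fun x => x + y.1) @^-1` D).
  move=> mD; rewrite -[X in measurable X]setTI.
  have mf2 : measurable_fun setT ((fun x => x + y.1) : pt2 R -> pt2 R); last exact: mf2.
  by apply/measurable_fun_pairP; split; apply: measurable_funD.
rewrite /mu3 product_measure1E; [|exact: mT2|exact: mT].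
by congr (_ * _)%E; [exact: mu2_shift|exact: leb_shift].
Qed.

Lemma integral_shift3 (y : pt3 R) (f : pt3 R -> \bar R) :
  measurable_fun (setT : set (pt3 R)) f -> (forall x, 0 <= f x)%E ->
  (\int3_x f (x + y)%R = \int3_x f x)%E.
Proof.
move=> mf f0.
have ms := measurable_shift3 y.
transitivity (\int[pushforward (@mu3 R) ((fun x => (x + y)%R) : R' * R' * R' -> R' * R' * R')]_x f x)%E.
  by rewrite ge0_integral_pushforward.
by apply: eq_measure_integral => A mA _; exact: mu3_shift.
Qed.

End LebesgueInvariance.

(** * Open sets of space: countable covers and measurability *)

Section OpenSets.
Variable R : realType.
Implicit Types (U : set (pt3 R)).

Lemma ball3E (z : pt3 R) r x : ball z r x <->
  [/\ `|z.1.1 - x.1.1| < r, `|z.1.2 - x.1.2| < r & `|z.2 - x.2| < r].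
Proof. by split=> [[[? ?] ?]|[? ? ?]]. Qed.

Lemma measurable_ball1 (z r : R) : measurable (ball z r).
Proof. by rewrite ball_itv; exact: measurable_itv. Qed.

Lemma measurable_ball3 (z : pt3 R) r : measurable (ball z r).
Proof.
have -> : ball z r = (ball z.1.1 r `*` ball z.1.2 r) `*` ball z.2 r by [].
by apply: measurableX; [apply: measurableX|]; exact: measurable_ball1.
Qed.

Lemma mu3_ball (z : pt3 R) r : 0 <= r -> mu3 (ball z r) = ((r *+ 2) ^+ 3)%:E.
Proof.
move=> r0.
rewrite -[LHS]/(mu3 ((ball z.1.1 r `*` ball z.1.2 r) `*` ball z.2 r)).
rewrite /mu3 product_measure1E; last 2 first.
- by apply: measurableX; exact: measurable_ball1.
- exact: measurable_ball1.
rewrite /mu2 [X in (X * _)%E]product_measure1E; last 2 first.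
- exact: measurable_ball1.
- exact: measurable_ball1.
transitivity ((r *+ 2)%:E * (r *+ 2)%:E * (r *+ 2)%:E)%E.
  by congr (_ * _ * _)%E; exact: lebesgue_measure_ball.
by rewrite -!EFinM; congr EFin; rewrite !exprS expr0 mulr1 mulrA.
Qed.

Lemma mu2_ball (z : pt2 R) r : 0 <= r -> mu2 (ball z r) = ((r *+ 2) ^+ 2)%:E.
Proof.
move=> r0.
rewrite -[LHS]/(mu2 (ball z.1 r `*` ball z.2 r)).
rewrite /mu2 product_measure1E; last 2 first.
- exact: measurable_ball1.
- exact: measurable_ball1.
by rewrite expr2 EFinM; congr (_ * _)%E; exact: lebesgue_measure_ball.
Qed.

(** Balls with rational centre and radius are enumerated, and those whose closure leaves [U] are
    discarded. Closed balls inside [U] are asked for because bumps supported in finitely many of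
    them must be test functions of [U]. *)
Lemma open_ball_cover U : open U ->
  exists (c : nat -> pt3 R) (r : nat -> R),
    (forall k, closed_ball (c k) (r k) `<=` U) /\ U = \bigcup_k ball (c k) (r k).
Proof.
move=> oU.
pose ctr (q : rat * rat * rat) : pt3 R := (ratr q.1.1, ratr q.1.2, ratr q.2).
pose P (a : rat * rat * rat * rat) := `[< closed_ball (ctr a.1) (ratr a.2) `<=` U >].
pose A k := if unpickle k is Some a then (if P a then Some a else None) else None.
exists (fun k => if A k is Some a then ctr a.1 else 0).
(* A negative radius makes the ball empty for codes that are discarded. *)
exists (fun k => if A k is Some a then ratr a.2 else -1); split.
  move=> k; rewrite /A; case: unpickle => [a|]; last first.
    by rewrite closed_ball0// lerN10.
  by rewrite /P; case: asboolP => // _; rewrite closed_ball0// lerN10.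
apply/seteqP; split=> x; last first.
  move=> [k _]; rewrite /A; case: unpickle => [a|]; last first.
    by move=> /ball3E[h _ _]; have := normr_ge0 ((0 : pt3 R).1.1 - x.1.1); lra.
  rewrite /P; case: asboolP => [h|_]; last first.
    by move=> /ball3E[h _ _]; have := normr_ge0 ((0 : pt3 R).1.1 - x.1.1); lra.
  by move=> hx; apply: h; exact: subset_closed_ball.
move=> Ux.
have /nbhs_ballP[e /= e0 he] : nbhs x U by apply: open_nbhs_nbhs.
have rat_near (a : R) (d : R) : 0 < d -> exists q : rat, `|ratr q - a| < d.
  move=> d0; have [q] : exists q : rat, ratr q \in `]a - d, a + d[.
    by apply: rat_in_itvoo; rewrite ltrD2l; lra.
  by rewrite in_itv/= => /andP[? ?]; exists q; rewrite ltr_norml; apply/andP; split; lra.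
have [s /andP[s0 se]] : exists s : rat, (0 < ratr s :> R) && (ratr s < e / 2).
  have [s] : exists q : rat, ratr q \in `]0, e / 2[ by apply: rat_in_itvoo; rewrite divr_gt0.
  by rewrite in_itv/= => h; exists s.
have [q1 h1] := rat_near x.1.1 _ s0; have [q2 h2] := rat_near x.1.2 _ s0.
have [q3 h3] := rat_near x.2 _ s0.
have xb : ball (ctr (q1, q2, q3)) (ratr s) x by [].
exists (pickle ((q1, q2, q3), s)) => //; rewrite /A pickleK.
have -> : P ((q1, q2, q3), s) => //.
apply/asboolP => y /= yc; apply: he.
have [z [hz1 hz2]] : exists z, ball (ctr (q1, q2, q3)) (ratr s) z /\ ball y (e/2 - ratr s) z.
  have /(_ (ball y (e/2 - ratr s))) [|z [? ?]] := yc.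
    by apply: nbhsx_ballx; rewrite subr_gt0.
  by exists z.
rewrite (splitr e); apply: (@ball_triangle _ _ (ctr (q1, q2, q3))).
  by apply: ball_sym; apply: le_ball xb; exact: ltW.
have -> : e / 2 = ratr s + (e/2 - ratr s) by ring.
by apply: ball_triangle hz1 _; exact: ball_sym.
Qed.

Lemma open_measurable3 U : open U -> measurable U.
Proof.
move=> /open_ball_cover[c [r [_ ->]]].
by apply: bigcup_measurable => k _; exact: measurable_ball3.
Qed.

Lemma open_continuous_measurable3 U (f : pt3 R -> R) : open U ->
  {in U, continuous f} -> measurable_fun U f.
Proof.
move=> oU cf mU; apply: (measurability _ (RGenOInfty.measurableE R)) => //.
move=> _ [_ [a ->] <-]; apply: open_measurable3.
rewrite openE => x [Ux /= fx].
have := cf x (mem_set Ux).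
move=> /(_ `]a, +oo[%classic) h.
have : nbhs x (f @^-1` `]a, +oo[%classic).
  by apply: h; apply: open_nbhs_nbhs; split => //; exact: interval_open.
move=> h1; have h2 : nbhs x U by apply: open_nbhs_nbhs.
by rewrite /interior; apply: filterI.
Qed.

Lemma continuous_measurable3 (f : pt3 R -> R) : continuous f ->
  measurable_fun (setT : set (pt3 R)) f.
Proof.
by move=> cf; apply: open_continuous_measurable3 => [|x _]; [exact: openT|exact: cf].
Qed.

End OpenSets.

(** * Smooth functions *)

Lemma dist_triangle_half (R : realFieldType) (e A B C : R) :
  `|A - B| < e / 2 -> `|A - C| < e / 2 -> `|C - B| <= e.
Proof.
by rewrite !ltr_norml ler_norml => /andP[? ?] /andP[? ?]; apply/andP; split; lra.
Qed.

Lemma exists_small_factor (R : realFieldType) (m a b : R) : 0 < m -> 0 <= a -> 0 <= b ->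
  exists2 h : R, 0 < h & h * (a + b) < m.
Proof.
move=> m0 a0 b0; have s0 : 0 < a + b + 1 by lra.
exists (m / (a + b + 1)); first exact: divr_gt0.
by rewrite mulrAC ltr_pdivrMr// ltr_pM2l//; lra.
Qed.

Section Derivatives.
Variables (R : realType) (V : normedModType R).
Implicit Types (f g : V -> R) (x u v : V) (l : R).

(** The form in which derivatives are computed by hand below, for extended functions and composites
    that vary along one line only. *)
Lemma is_derive_epsP f x v l : is_derive x v f l <->
  forall e : R, 0 < e -> exists2 d : R, 0 < d & forall h : R, h != 0 -> `|h| < d ->
    `|h^-1 * (f (x + h *: v) - f x) - l| <= e.
Proof.
split.
  move=> [df dl] e e0.
  have : (fun h => h^-1 *: ((f \o shift x) (h *: v) - f x)) @ 0^' --> l.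
    by rewrite -dl; exact: df.
  move=> /cvgrPdist_le /(_ e e0) [d /= d0 hd]; exists d => // h h0 hlt.
  have := hd h; rewrite /= sub0r normrN => /(_ hlt h0).
  by rewrite distrC [h *: v + x]addrC.
move=> H.
have cl : (fun h => h^-1 *: ((f \o shift x) (h *: v) - f x)) @ 0^' --> l.
  apply/cvgrPdist_le => e e0; have [d d0 hd] := H e e0.
  exists d => //= h hlt h0; have {}hlt : `|h| < d by move: hlt; rewrite /ball_ /= sub0r normrN.
  by rewrite distrC [h *: v + x]addrC; exact: hd.
split; first by apply/cvg_ex; exists l.
by rewrite /derive; apply: cvg_lim.
Qed.

End Derivatives.

Section DerivativesLine.
Variables (R : realType) (V : normedModType R).
Implicit Types (f g : V -> R) (x u v : V) (s t a b l : R).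

Lemma is_derive_line f x v t l : is_derive (x + t *: v) v f l ->
  is_derive t 1 (fun s : R => f (x + s *: v)) l.
Proof.
move=> /is_derive_epsP H; apply/is_derive_epsP => e /H[d d0 hd].
exists d => // h h0 hlt; have := hd h h0 hlt.
by rewrite -addrA -scalerDl [h *: 1]mulr1.
Qed.

(** The sign of [t] is free, so the intermediate point is located only by its absolute value; hence
    derivability is required on the symmetric segment. *)
Lemma MVT_line f x v t :
  (forall s : R, `|s| <= `|t| -> derivable f (x + s *: v) v) ->
  exists2 s : R, `|s| <= `|t| & f (x + t *: v) - f x = t * 'D_v f (x + s *: v).
Proof.
move=> df.
pose g (s : R) := f (x + s *: v).
have dg (s : R) : `|s| <= `|t| -> is_derive s (1 : R) g ('D_v f (x + s *: v)).
  by move=> /df h; apply: is_derive_line; exact: derivableP.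
have cg (a b : R) : (forall s : R, s \in `[a, b] -> `|s| <= `|t|) ->
    {within `[a, b], continuous g}.
  move=> hs; apply: derivable_within_continuous => s /hs /dg h.
  exact: (@ex_derive _ _ _ _ _ _ _ h).
have [t0|t0] := leP 0 t.
  have hs (s : R) : s \in `[0, t] -> `|s| <= `|t|.
    by rewrite in_itv/= => /andP[s0 st]; rewrite !ger0_norm.
  have [|s hs1] := MVT_segment (df := fun s => 'D_v f (x + s *: v)) t0 _ (cg _ _ hs).
    move=> s hs1; apply: dg; apply: hs; exact: subset_itv_oo_cc hs1.
  rewrite /g scale0r addr0 subr0 mulrC => E.
  by exists s => //; exact: hs.
have hs (s : R) : s \in `[t, 0] -> `|s| <= `|t|.
  by rewrite in_itv/= => /andP[ts s0]; rewrite (ler0_norm s0) (ltr0_norm t0) lerN2.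
have [|s hs1] := MVT_segment (df := fun s => 'D_v f (x + s *: v)) (ltW t0) _ (cg _ _ hs).
  move=> s hs1; apply: dg; apply: hs; exact: subset_itv_oo_cc hs1.
rewrite /g scale0r addr0 sub0r => E.
exists s; first exact: hs.
by rewrite -opprB E mulrN opprK mulrC.
Qed.

Definition C1_at (D : set V) f := [/\ forall x, D x -> {for x, continuous f},
  forall x v, D x -> derivable f x v &
  forall x v, D x -> {for x, continuous ('D_v f)}].

Lemma Ck1_C1 D f k : (0 < k)%N -> Ck_on k D f -> C1_at D f.
Proof.
move=> k0 H; split.
- by move=> x Dx; have [] := H [::] _ x Dx.
- by move=> x v Dx; have [_ /(_ k0)] := H [::] isT x Dx; exact.
- by move=> x v Dx; have [] := H [:: v] k0 x Dx.
Qed.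

Lemma Ck_D D f k v : Ck_on k.+1 D f -> Ck_on k D ('D_v f).
Proof.
move=> H vs szs x Dx.
have -> : iter_deriv vs ('D_v f) = iter_deriv (rcons vs v) f.
  by rewrite /iter_deriv -cats1 foldr_cat.
have := H (rcons vs v); rewrite size_rcons => /(_ szs x Dx) [? K].
by split => // ?; apply: K.
Qed.

Lemma continuous_ball f x : {for x, continuous f} -> forall e : R, 0 < e ->
  exists2 d : R, 0 < d & forall y, `|y - x| < d -> `|f y - f x| < e.
Proof.
move=> /cvgrPdist_lt cf e /cf /nbhs_ballP[d /= d0 hd]; exists d => // y hy.
by rewrite distrC; apply: hd; rewrite -ball_normE/= distrC.
Qed.

(** Linearity in the direction is not automatic for directional derivatives. The increment is split
    into a leg along [u] and a leg along [v]; the mean value theorem on each leg and the continuity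
    of the two derivatives give the limit. *)
Lemma is_derive_lin (D : set V) f x u v a b : open D -> D x -> C1_at D f ->
  is_derive x (a *: u + b *: v) f (a * 'D_u f x + b * 'D_v f x).
Proof.
move=> oD Dx [cf df cDf]; apply/is_derive_epsP => e e0.
pose K := `|a| + `|b| + 1.
have K0 : 0 < K by rewrite ltr_wpDl// addr_ge0.
have eK : 0 < e / K by exact: divr_gt0.
have [d1 d10 h1] := continuous_ball (cDf x u Dx) eK.
have [d2 d20 h2] := continuous_ball (cDf x v Dx) eK.
have /nbhs_ballP[d3 /= d30 h3] : nbhs x D by apply: open_nbhs_nbhs.
pose d := Num.min d1 (Num.min d2 d3).
have d0 : 0 < d by rewrite !lt_min d10 d20.
pose M := `|a| * `|u| + `|b| * `|v| + 1.
have M0 : 0 < M by rewrite ltr_wpDl// addr_ge0// mulr_ge0.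
exists (d / M); first exact: divr_gt0.
move=> h h0; rewrite ltr_pdivlMr// => hM.
have near (s t : R) : `|s| <= `|h * a| -> `|t| <= `|h * b| -> `|x + s *: u + t *: v - x| < d.
  move=> hs ht; rewrite -[x + _ + _]addrA addrAC subrr add0r.
  apply: le_lt_trans (ler_normD _ _) _; rewrite !normrZ.
  apply: le_lt_trans hM; rewrite mulrDr mulrDr !mulrA -!normrM.
  rewrite -addrA; apply: lerD; first exact: ler_wpM2r.
  by rewrite -[leLHS]addr0; apply: lerD; rewrite ?mulr1//; exact: ler_wpM2r.
have inD (s t : R) : `|s| <= `|h * a| -> `|t| <= `|h * b| -> D (x + s *: u + t *: v).
  move=> hs ht; apply: h3; rewrite -ball_normE/= distrC.
  by apply: lt_le_trans (near s t hs ht) _; rewrite /d !ge_min lexx !orbT.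
have [|s hs Es] := @MVT_line f x u (h * a).
  move=> s hs; apply: df; have := inD s 0 hs; rewrite normr0 scale0r addr0.
  by apply.
have [|t ht Et] := @MVT_line f (x + (h * a) *: u) v (h * b).
  by move=> t ht; apply: df; apply: inD.
have -> : x + h *: (a *: u + b *: v) = x + (h * a) *: u + (h * b) *: v.
  by rewrite scalerDr !scalerA addrA.
have -> : f (x + (h * a) *: u + (h * b) *: v) - f x =
  h * (b * 'D_v f (x + (h * a) *: u + t *: v) + a * 'D_u f (x + s *: u)).
  by rewrite mulrDr !mulrA -Et -Es addrA subrK.
rewrite mulrA mulVf// mul1r.
rewrite [a * _ + b * _ in X in `|X|]addrC opprD addrACA -!mulrBr.
apply: le_trans (ler_normD _ _) _; rewrite !normrM.
have e1 : `|'D_u f (x + s *: u) - 'D_u f x| <= e / K.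
  apply/ltW/h1; have := near s 0 hs; rewrite normr0 scale0r addr0 => /(_ (normr_ge0 _)).
  by move=> /lt_le_trans; apply; rewrite /d !ge_min lexx.
have e2 : `|'D_v f (x + (h * a) *: u + t *: v) - 'D_v f x| <= e / K.
  apply/ltW/h2; have := near (h * a) t (lexx _) ht.
  by move=> /lt_le_trans; apply; rewrite /d !ge_min lexx orbT.
apply: (@le_trans _ _ ((`|a| + `|b|) * (e / K))).
  by rewrite addrC mulrDl; apply: lerD; apply: ler_wpM2l.
by rewrite mulrCA ger_pMr// ler_pdivrMr// mul1r /K lerDl.
Qed.

Lemma derive_lin (D : set V) f x u v a b : open D -> D x -> C1_at D f ->
  'D_(a *: u + b *: v) f x = a * 'D_u f x + b * 'D_v f x.
Proof. by move=> oD Dx C1; have [_] := @is_derive_lin D f x u v a b oD Dx C1. Qed.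

(** The second difference over the parallelogram spanned by [h u] and [h v] is symmetric, and two
    applications of the mean value theorem express it as [h^2] times either mixed derivative at a
    nearby point. *)
Lemma derive_comm f x u v : C1_at setT f -> C1_at setT ('D_u f) -> C1_at setT ('D_v f) ->
  'D_u ('D_v f) x = 'D_v ('D_u f) x.
Proof.
move=> [cf df _] [cu du ddu] [cv dv ddv].
have key (a b : V) (h : R) : (forall x v, derivable f x v) ->
    (forall x v, derivable ('D_a f) x v) -> exists s t : R, [/\ `|s| <= `|h|, `|t| <= `|h| &
    f (x + h *: a + h *: b) - f (x + h *: a) - f (x + h *: b) + f x =
    h * (h * 'D_b ('D_a f) (x + s *: a + t *: b))].
  move=> dfa dfb.
  pose g y := f (y + h *: b) - f y.
  have isg y : is_derive y a g ('D_a f (y + h *: b) - 'D_a f y).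
    apply: is_deriveB; last exact: derivableP.
    have /is_derive_epsP H := derivableP (dfa (y + h *: b) a).
    apply/is_derive_epsP => e /H[d d0 hd]; exists d => // k k0 kd.
    by rewrite addrAC; exact: hd.
  have [|s hs Es] := @MVT_line g x a h.
    by move=> s _; exact: (@ex_derive _ _ _ _ _ _ _ (isg _)).
  have [|t ht Et] := @MVT_line ('D_a f) (x + s *: a) b h.
    by move=> t _; exact: dfb.
  exists s, t; split => //.
  rewrite -Et -(@derive_val _ _ _ _ _ _ _ (isg (x + s *: a))) -Es /g.
  by rewrite [x + h *: b]addrC; ring.
apply/eqP; rewrite -subr_eq0 -normr_le0; apply/ler_addgt0Pr => e e0; rewrite add0r.
have e20 : 0 < e / 2 by exact: divr_gt0.
have [d1 d10 h1] := continuous_ball (ddv x u I) e20.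
have [d2 d20 h2] := continuous_ball (ddu x v I) e20.
have [h h0 hM] : exists2 h : R, 0 < h & h * (`|u| + `|v|) < Num.min d1 d2.
  by apply: exists_small_factor; rewrite ?lt_min ?d10.
have near (a b : V) (s t : R) : `|s| <= `|h| -> `|t| <= `|h| -> `|a| + `|b| = `|u| + `|v| ->
    `|x + s *: a + t *: b - x| < Num.min d1 d2.
  move=> hs ht E; rewrite -[x + _ + _]addrA addrAC subrr add0r.
  apply: le_lt_trans (ler_normD _ _) _; rewrite !normrZ.
  apply: le_lt_trans hM; rewrite -E mulrDr -(ger0_norm (ltW h0)).
  by apply: lerD; exact: ler_wpM2r.
have [s1 [t1 [hs1 ht1 E1]]] := key u v h (fun x v => df x v I) (fun x v => du x v I).
have [s2 [t2 [hs2 ht2 E2]]] := key v u h (fun x v => df x v I) (fun x v => dv x v I).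
have E : 'D_v ('D_u f) (x + s1 *: u + t1 *: v) = 'D_u ('D_v f) (x + s2 *: v + t2 *: u).
  apply: (mulfI (lt0r_neq0 h0)); apply: (mulfI (lt0r_neq0 h0)).
  apply: etrans (esym E1) (etrans _ E2).
  by rewrite [x + h *: v + h *: u]addrAC [f _ - f _ - f (_ + _ *: v)]addrAC.
have n1 := h2 _ (lt_le_trans (near u v s1 t1 hs1 ht1 erefl) _).
have n2 := h1 _ (lt_le_trans (near v u s2 t2 hs2 ht2 (addrC _ _)) _).
apply: dist_triangle_half (n2 _); last by rewrite ge_min lexx.
by rewrite -E; apply: n1; rewrite ge_min lexx orbT.
Qed.

(** A coinduction principle: [smooth] speaks of all iterated derivatives, so it suffices to exhibit
    a class of continuous, derivable functions that is stable under every directional derivative. *)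
Lemma smooth_coind (P : (V -> R) -> Prop) :
  (forall f, P f -> [/\ continuous f, forall x v, derivable f x v &
     forall v, P ('D_v f)]) ->
  forall f, P f -> smooth f.
Proof.
move=> H f Pf k vs _ x _.
have Q : P (iter_deriv vs f).
  by elim: vs => [|v vs IH] //=; have [_ _] := H _ IH; exact.
by have [c d _] := H _ Q; split => [|_ v]; [exact: c|exact: d].
Qed.

Lemma smoothP f : smooth f -> [/\ continuous f, forall x v, derivable f x v &
  forall v, smooth ('D_v f)].
Proof.
move=> sf; split.
- by move=> x; have [] := sf 0%N [::] isT x I.
- by move=> x v; have [_ /(_ isT)] := sf 1%N [::] isT x I; exact.
- by move=> v k; apply: Ck_D; exact: sf.
Qed.

Lemma smooth_C1 f : smooth f -> C1_at setT f.
Proof. by move=> sf; apply: (@Ck1_C1 _ _ 1) => //; exact: sf. Qed.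

Lemma smoothD f g : smooth f -> smooth g -> smooth (fun x => f x + g x).
Proof.
move=> sf sg; apply: (@smooth_coind (fun h => exists f g, [/\ smooth f, smooth g &
  h = (fun x => f x + g x)])); last by exists f, g.
move=> _ {sf sg} [{}f [{}g [/smoothP[cf df sf] /smoothP[cg dg sg] ->]]]; split.
- by move=> x; apply: cvgD; [exact: cf|exact: cg].
- by move=> x v; apply: derivableD.
- move=> v; exists ('D_v f), ('D_v g); split => //.
  by apply/funext => x; rewrite -deriveD.
Qed.

Lemma smoothZ f (a : R) : smooth f -> smooth (fun x => a * f x).
Proof.
move=> sf; apply: (@smooth_coind (fun h => exists2 f, smooth f &
  h = (fun x => a * f x))); last by exists f.
move=> _ {sf} [{}f /smoothP[cf df sf] ->]; split.
- by move=> x; apply: cvgM; [exact: cvg_cst|exact: cf].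
- by move=> x v; apply: derivableZ.
- move=> v; exists ('D_v f) => //.
  by apply/funext => x; rewrite -[RHS]/(a *: _) -deriveZ.
Qed.

Lemma derive_translate f y v x : 'D_v (fun z => f (z + y)) x = 'D_v f (x + y).
Proof.
rewrite /derive.
suff -> : (fun h : R => h^-1 *: (((fun z => f (z + y)) \o shift x) (h *: v) - f (x + y))) =
  (fun h => h^-1 *: ((f \o shift (x + y)) (h *: v) - f (x + y))) by [].
by apply/funext => h /=; rewrite addrA.
Qed.

Lemma smooth_translate f y : smooth f -> smooth (fun x => f (x + y)).
Proof.
move=> sf; apply: (@smooth_coind (fun h => exists2 f, smooth f &
  h = (fun x => f (x + y)))); last by exists f.
move=> _ {sf} [{}f /smoothP[cf df sf] ->]; split.
- move=> x; apply: (@continuous_comp _ _ _ (fun z => z + y) f); last exact: cf.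
  by apply: cvgD; [exact: cvg_id|exact: cvg_cst].
- move=> x v; have := df (x + y) v; rewrite /derivable.
  by under [X in cvg (X @ _) -> _]eq_fun do rewrite /= addrA.
- by move=> v; exists ('D_v f) => //; apply/funext => x; exact: derive_translate.
Qed.

End DerivativesLine.

(** * Square-integrable functions *)

Definition N2 {R : realType} (U : set (pt3 R)) (f : pt3 R -> R) : \bar R :=
  \int3_(x in U) ((f x) ^+ 2)%:E.

(** [fine] sends infinite values to 0, so this is the inner product only for functions in [in_L2];
    [ipE] is the bridge to the integral. *)
Definition ip {R : realType} (U : set (pt3 R)) (f g : pt3 R -> R) : R :=
  fine (\int3_(x in U) (f x * g x)%:E).

Section SquareIntegrable.
Variable R : realType.
Implicit Types (U A B : set (pt3 R)) (f g h u : pt3 R -> R) (c t : R).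

Lemma integral_support U A (f : pt3 R -> \bar R) : A `<=` U ->
  (forall x, U x -> ~ A x -> f x = 0%E) ->
  (\int3_(x in U) f x = \int3_(x in A) f x)%E.
Proof.
move=> AU f0; rewrite integral_mkcond [RHS]integral_mkcond.
congr (integral _ _ _); apply/funext => x; rewrite !patchE.
have [xA|xA] := boolP (x \in A).
  by rewrite (mem_set (AU _ (set_mem xA))).
case: ifPn => // xU; apply: f0; first exact: set_mem.
by move=> Ax; move/negP: xA; apply; exact: mem_set.
Qed.

Lemma N2_ge0 U f : (0 <= N2 U f)%E.
Proof. by apply: integral_ge0 => x _; rewrite lee_fin sqr_ge0. Qed.

Lemma measurable_sq U f : measurable_fun U f ->
  measurable_fun U (fun x => ((f x) ^+ 2)%:E).
Proof. by move=> mf; apply/measurable_EFinP; exact: measurable_funX. Qed.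

Lemma N2_le U f g : measurable U -> measurable_fun U f -> measurable_fun U g ->
  (forall x, U x -> `|f x| <= `|g x|) -> (N2 U f <= N2 U g)%E.
Proof.
move=> mU mf mg fg; apply: ge0_le_integral => //.
- by move=> x _; rewrite lee_fin sqr_ge0.
- exact: measurable_sq.
- exact: measurable_sq.
- move=> x Ux; rewrite lee_fin -(real_normK (num_real (f x))) -(real_normK (num_real (g x))).
  by rewrite ler_sqr ?nnegrE// fg.
Qed.

Lemma N2_sub A U f : measurable A -> measurable U -> A `<=` U ->
  measurable_fun U f -> (N2 A f <= N2 U f)%E.
Proof.
move=> mA mU AU mf; apply: ge0_subset_integral => //.
  exact: measurable_sq.
by move=> x _; rewrite lee_fin sqr_ge0.
Qed.

Lemma N2_eq U f g : {in U, f =1 g} -> N2 U f = N2 U g.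
Proof. by move=> fg; apply: eq_integral => x xU; rewrite fg. Qed.

Lemma N2Z U f c : measurable U -> measurable_fun U f ->
  (N2 U (fun x => c * f x)%R = (c ^+ 2)%:E * N2 U f)%E.
Proof.
move=> mU mf; rewrite /N2 -ge0_integralZl//.
- by apply: eq_integral => x _; rewrite -EFinM exprMn.
- exact: measurable_sq.
- by move=> x _; rewrite lee_fin sqr_ge0.
- by rewrite lee_fin sqr_ge0.
Qed.

Lemma N2D U f g : measurable U -> measurable_fun U f -> measurable_fun U g ->
  (N2 U (fun x => f x + g x)%R <= 2%:E * N2 U f + 2%:E * N2 U g)%E.
Proof.
move=> mU mf mg; rewrite /N2 -!ge0_integralZl//; last 4 first.
- exact: measurable_sq.
- by move=> x _; rewrite lee_fin sqr_ge0.
- exact: measurable_sq.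
- by move=> x _; rewrite lee_fin sqr_ge0.
rewrite -ge0_integralD//; last 4 first.
- by move=> x _; rewrite -EFinM lee_fin mulr_ge0// sqr_ge0.
- by apply: measurable_funeM; exact: measurable_sq.
- by move=> x _; rewrite -EFinM lee_fin mulr_ge0// sqr_ge0.
- by apply: measurable_funeM; exact: measurable_sq.
apply: ge0_le_integral => //.
- by move=> x _; rewrite lee_fin sqr_ge0.
- by apply: measurable_sq; exact: measurable_funD.
- by apply: emeasurable_funD; apply: measurable_funeM; exact: measurable_sq.
- move=> x _; rewrite -!EFinM -EFinD lee_fin.
  have := sqr_ge0 (f x - g x); nra.
Qed.

Lemma in_L2_measurable U f : in_L2 U f -> measurable_fun U f.
Proof. by case. Qed.

Lemma in_L2_fin U f : in_L2 U f -> N2 U f \is a fin_num.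
Proof. by case=> _ h; rewrite ge0_fin_numE// N2_ge0. Qed.

Lemma in_L2_sub A U f : measurable A -> measurable U -> A `<=` U ->
  in_L2 U f -> in_L2 A f.
Proof.
move=> mA mU AU [mf lf]; split; first exact: measurable_funS mf.
by apply: le_lt_trans lf; exact: N2_sub.
Qed.

Lemma in_L2_eq U f g : {in U, f =1 g} -> in_L2 U f -> in_L2 U g.
Proof.
move=> fg [mf lf]; split; first exact: eq_measurable_fun mf.
by rewrite -[X in (X < _)%E]/(N2 U g) -(N2_eq fg).
Qed.

Lemma in_L2Z U f c : measurable U -> in_L2 U f -> in_L2 U (fun x => c * f x).
Proof.
move=> mU lf; split; first by apply: measurable_funM => //; exact: in_L2_measurable.
rewrite -[X in (X < _)%E]/(N2 _ _) N2Z//; last exact: in_L2_measurable.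
by rewrite lte_mul_pinfty ?lee_fin ?sqr_ge0//; case: lf.
Qed.

Lemma in_L2D U f g : measurable U -> in_L2 U f -> in_L2 U g ->
  in_L2 U (fun x => f x + g x).
Proof.
move=> mU [mf lf] [mg lg]; split; first exact: measurable_funD.
apply: le_lt_trans (N2D mU mf mg) _.
by rewrite lte_add_pinfty// lte_mul_pinfty// lee_fin.
Qed.

Lemma in_L2B U f g : measurable U -> in_L2 U f -> in_L2 U g ->
  in_L2 U (fun x => f x - g x).
Proof.
move=> mU lf lg; apply: (@in_L2_eq _ (fun x => f x + (-1) * g x)).
  by move=> x _; rewrite mulN1r.
by apply: in_L2D => //; exact: in_L2Z.
Qed.

Lemma in_L2_integrable U f g : measurable U -> in_L2 U f -> in_L2 U g ->
  (@mu3 R).-integrable U (fun x => (f x * g x)%:E).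
Proof.
move=> mU lf lg; have [mf _] := lf; have [mg _] := lg.
have H : (@mu3 R).-integrable U (fun x => ((f x) ^+ 2 + (g x) ^+ 2)%:E).
  apply/integrableP; split.
    by apply/measurable_EFinP; apply: measurable_funD; exact: measurable_funX.
  have -> : \int3_(x in U) (`|((f x) ^+ 2 + (g x) ^+ 2)%:E|)%E = (N2 U f + N2 U g)%E.
    rewrite /N2 -ge0_integralD//; try exact: measurable_sq.
    + by apply: eq_integral => x _; rewrite gee0_abs ?lee_fin ?addr_ge0 ?sqr_ge0.
    + by move=> x _; rewrite lee_fin sqr_ge0.
    + by move=> x _; rewrite lee_fin sqr_ge0.
  by rewrite lte_add_pinfty//; [case: lf|case: lg].
apply: le_integrable H => //.
- by apply/measurable_EFinP; exact: measurable_funM.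
- move=> x _; rewrite /= lee_fin [leRHS]ger0_norm ?addr_ge0 ?sqr_ge0//.
  by rewrite ler_norml; apply/andP; split;
    have := sqr_ge0 (f x - g x); have := sqr_ge0 (f x + g x); nra.
Qed.

Lemma ipE U f g : measurable U -> in_L2 U f -> in_L2 U g ->
  (\int3_(x in U) (f x * g x)%:E = (ip U f g)%:E)%E.
Proof.
move=> mU lf lg; rewrite /ip fineK//.
exact: integrable_fin_num (in_L2_integrable mU lf lg).
Qed.

Lemma ipC U f g : ip U f g = ip U g f.
Proof. by rewrite /ip; under eq_integral do rewrite mulrC. Qed.

Lemma ip_eq U f g h : {in U, f =1 g} -> ip U f h = ip U g h.
Proof. by move=> fg; rewrite /ip; congr fine; apply: eq_integral => x xU; rewrite fg. Qed.

Lemma ipDl U f g h : measurable U -> in_L2 U f -> in_L2 U g -> in_L2 U h ->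
  ip U (fun x => f x + g x) h = ip U f h + ip U g h.
Proof.
move=> mU lf lg lh; apply: EFin_inj.
rewrite EFinD -!ipE//; last exact: in_L2D.
rewrite -integralD//; try exact: in_L2_integrable.
by apply: eq_integral => x _; rewrite -EFinD mulrDl.
Qed.

Lemma ipZl U f h c : measurable U -> in_L2 U f -> in_L2 U h ->
  ip U (fun x => c * f x) h = c * ip U f h.
Proof.
move=> mU lf lh; apply: EFin_inj.
rewrite EFinM -!ipE//; last exact: in_L2Z.
rewrite -integralZl//; last exact: in_L2_integrable.
by apply: eq_integral => x _; rewrite -EFinM mulrA.
Qed.

Lemma ipBl U f g h : measurable U -> in_L2 U f -> in_L2 U g -> in_L2 U h ->
  ip U (fun x => f x - g x) h = ip U f h - ip U g h.
Proof.
move=> mU lf lg lh.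
rewrite (@ip_eq _ _ (fun x => f x + (-1) * g x)) ?ipDl ?ipZl ?mulN1r//.
- exact: in_L2Z.
- by move=> x _; rewrite mulN1r.
Qed.

Lemma N2_ip U f : in_L2 U f -> N2 U f = (ip U f f)%:E.
Proof.
move=> lf; rewrite /ip.
have -> : \int3_(x in U) (f x * f x)%:E = N2 U f.
  by apply: eq_integral => x _; rewrite expr2.
by rewrite fineK// in_L2_fin.
Qed.

Lemma ip_ge0 U f : 0 <= ip U f f.
Proof.
by rewrite /ip fine_ge0//; apply: integral_ge0 => x _; rewrite lee_fin -expr2 sqr_ge0.
Qed.

Lemma ip_CS U f g : measurable U -> in_L2 U f -> in_L2 U g ->
  ip U f g ^+ 2 <= ip U f f * ip U g g.
Proof.
move=> mU lf lg.
have H t : 0 <= ip U f f - 2 * t * ip U f g + t ^+ 2 * ip U g g.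
  have ltg : in_L2 U (fun x => t * g x) by exact: in_L2Z.
  have := ip_ge0 U (fun x => f x - t * g x).
  rewrite ipBl//; last exact: in_L2B.
  rewrite ipZl//; last exact: in_L2B.
  rewrite ipC [X in _ - t * X]ipC !ipBl// !ipZl// [ip U g f]ipC.
  by move/le_trans; apply; rewrite le_eqVlt; apply/orP; left; apply/eqP; ring.
have A0 := ip_ge0 U f; have C0 := ip_ge0 U g.
move: A0 C0 H; move: (ip U f f) (ip U f g) (ip U g g) => a b c A0 C0 H.
have [c0|c0] := eqVneq c 0.
  have [->|b0] := eqVneq b 0; first by rewrite expr0n mulr_ge0.
  (* With [c = 0] the quadratic polynomial in [t] is affine, and at this point it takes the value
     -1. *)
  have := H ((a + 1) / (2 * b)); rewrite c0 mulr0 addr0.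
  have -> : 2 * ((a + 1) / (2 * b)) * b = a + 1 by field.
  lra.
have cp : 0 < c by rewrite lt_def c0.
have := H (b / c); have -> : a - 2 * (b / c) * b + (b / c) ^+ 2 * c = (a * c - b ^+ 2) / c.
  by field.
by rewrite ler_pdivlMr// mul0r subr_ge0.
Qed.

Lemma in_L2_bounded U f c : measurable U -> (mu3 U < +oo)%E -> measurable_fun U f ->
  (forall x, U x -> `|f x| <= c) -> in_L2 U f.
Proof.
move=> mU fU mf hf; split => //.
apply: (@le_lt_trans _ _ (\int3_(x in U) (c ^+ 2)%:E)).
  apply: ge0_le_integral => //.
  - by move=> x _; rewrite lee_fin sqr_ge0.
  - exact: measurable_sq.
  - move=> x Ux; rewrite lee_fin -(real_normK (num_real (f x))).
    by rewrite ler_sqr ?nnegrE ?hf//; apply: le_trans (hf x Ux).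
by rewrite integral_cst// lte_mul_pinfty// lee_fin sqr_ge0.
Qed.

Lemma bounded_support (K : set (pt3 R)) f : compact K -> continuous f ->
  (forall x, ~ K x -> f x = 0) ->
  exists M : R, [/\ 0 < M, K `<=` ball 0 M & forall x, `|f x| <= M].
Proof.
move=> cK cf f0.
have [M1 [_ HM1]] := compact_bounded cK.
have cfK : compact (f @` K).
  by apply: continuous_compact => //; exact: continuous_subspaceT.
have [M2 [_ HM2]] := compact_bounded cfK.
pose M := `|M1| + `|M2| + 2.
have M1M : M1 < M - 1 by rewrite /M; have := ler_norm M1; have := normr_ge0 M2; lra.
have M2M : M2 < M by rewrite /M; have := ler_norm M2; have := normr_ge0 M1; lra.
exists M; split.
- by rewrite /M; have := normr_ge0 M1; have := normr_ge0 M2; lra.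
- move=> x Kx; rewrite -ball_normE/= sub0r normrN.
  by have := HM1 _ M1M x Kx; rewrite /=; lra.
- move=> x; have [Kx|Kx] := pselect (K x); first by apply: (HM2 _ M2M); exists x.
  by rewrite f0// normr0 /M; have := normr_ge0 M1; have := normr_ge0 M2; lra.
Qed.

Lemma in_L2_support U (K : set (pt3 R)) f : measurable U -> compact K -> continuous f ->
  (forall x, ~ K x -> f x = 0) -> in_L2 U f.
Proof.
move=> mU cK cf f0; have [M [M0 KM fM]] := bounded_support cK cf f0.
have mf : measurable_fun setT f by exact: continuous_measurable3.
have mB := @measurable_ball3 R 0 M.
split; first exact: measurable_funS mf.
rewrite -[X in (X < _)%E]/(N2 U f).
apply: (@le_lt_trans _ _ (N2 setT f)); first exact: N2_sub.
rewrite /N2 (@integral_support _ (ball 0 M))//.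
  have [] // : in_L2 (ball 0 M) f.
  apply: (@in_L2_bounded _ _ M) => //; last exact: measurable_funS mf.
  by rewrite mu3_ball ?ltry// ltW.
by move=> x _ /(contra_not (KM x)) Kx; rewrite f0// expr0n.
Qed.

End SquareIntegrable.

(** * Density of test functions *)

Section Bump.
Variable R : realType.
Implicit Types (p : {poly R}) (t : R).

(* The functions p(1/t) exp(-1/t), extended by 0 to t <= 0, are stable under
   differentiation: the derivative has polynomial X^2 (p - p'). *)
Definition flat p t : R := if 0 < t then p.[t^-1] * expR (- t^-1) else 0.

Lemma poly_le_pow p : exists c : R, forall u, 1 <= u -> `|p.[u]| <= c * u ^+ size p.
Proof.
elim/poly_ind: p => [|p a [c hc]].
  by exists 0 => u _; rewrite horner0 normr0 mul0r.
exists (`|c| + `|a|) => u u1; rewrite hornerMXaddC.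
have u0 : 0 <= u by lra.
have [/eqP|p0] := boolP (p == 0).
  move=> ->; rewrite horner0 mul0r add0r.
  apply: le_trans (_ : `|a| * 1 <= _); first by rewrite mulr1.
  by apply: ler_pM => //; [rewrite lerDr|exact: exprn_ege1].
rewrite size_MXaddC (negbTE p0)/=.
apply: le_trans (ler_normD _ _) _; rewrite mulrDl normrM (ger0_norm u0).
apply: lerD.
  rewrite exprSr mulrA ler_wpM2r//; apply: le_trans (hc u u1) _.
  by rewrite ler_wpM2r ?exprn_ge0// ler_norm.
by rewrite ler_peMr// exprn_ege1.
Qed.

(** The exponential series gives [exp (-1/t) <= k! t^k]. Taking [k] two above the growth exponent of
    [p] leaves [t^2], which makes the derivative at 0 vanish. *)
Lemma flat_small p : exists2 c : R, 0 < c & forall t, 0 < t <= 1 -> `|flat p t| <= c * t ^+ 2.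
Proof.
have [c hc] := poly_le_pow p.
pose k := (size p).+2.
exists ((`|c| + 1) * k`!%:R); first by rewrite mulr_gt0 ?ltr0n ?fact_gt0// ltr_wpDl.
move=> t /andP[t0 t1]; rewrite /flat t0.
set u := t^-1; have u1 : 1 <= u by rewrite invf_ge1.
have u0 : 0 < u by rewrite invr_gt0.
have e1 : u ^+ k / k`!%:R <= expR u.
  by apply: le_trans (expR_ge1Dxn (size p).+1 (ltW u0)); rewrite lerDr.
have f0 : 0 < k`!%:R :> R by rewrite ltr0n fact_gt0.
have e2 : expR (- u) <= k`!%:R / u ^+ k.
  rewrite expRN -[leRHS]invrK invfM invrK lef_pV2 ?posrE ?expR_gt0 //.
    by rewrite mulrC.
  by apply: mulr_gt0; rewrite ?invr_gt0// exprn_gt0.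
rewrite normrM (ger0_norm (expR_ge0 _)).
have -> : t = u^-1 by rewrite invrK.
apply: (@le_trans _ _ ((`|c| + 1) * u ^+ size p * (k`!%:R / u ^+ k))).
  apply: ler_pM => //.
  apply: le_trans (hc u u1) _; rewrite ler_wpM2r ?exprn_ge0 ?(ltW u0)//.
  by have := ler_norm c; lra.
rewrite le_eqVlt; apply/orP; left; apply/eqP; rewrite /k !exprS.
have un : u ^+ size p != 0 by rewrite expf_neq0 ?gt_eqF.
have un' : u != 0 by rewrite gt_eqF.
by field; rewrite un un'.
Qed.

Lemma is_derive_flat p t : is_derive t 1 (flat p) (flat ('X^2 * (p - p^`())) t).
Proof.
case: (ltgtP 0 t) => [t0|t0|<-].
- have H : is_derive t 1 (fun s => p.[s^-1] * expR (- s^-1)) (flat ('X^2 * (p - p^`())) t).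
    have tn : t != 0 by rewrite gt_eqF.
    have di : is_derive t (1 : R) (fun s : R => s^-1) (- t ^- 2).
      by have := @is_deriveV R id t 1 1 tn (is_derive_id _ _); rewrite /GRing.scale/= mulr1.
    have dp : is_derive t 1 (fun s : R => p.[s^-1]) (- t ^- 2 * p^`().[t^-1]).
      have -> : - t ^- 2 * p^`().[t^-1] = p^`().[t^-1] * - t ^- 2 by rewrite mulrC.
      by apply: (@is_derive1_comp _ (horner p) (fun s => s^-1)).
    have de : is_derive t 1 (fun s : R => expR (- s^-1)) (expR (- t^-1) * - - t ^- 2).
      by apply: (@is_derive1_comp _ (@expR R) (fun s => - s^-1)).
    apply: is_derive_eq; rewrite /flat t0 hornerM hornerXn hornerD hornerN /=.
    rewrite ![_ *: _]mulrC /GRing.scale/= exprVn; ring.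
  apply: near_eq_is_derive _ H.
  near=> s; rewrite /flat; have -> // : 0 < s.
  by near: s; exact: lt_nbhsr.
- have H : is_derive t (1 : R) (fun s : R => 0 : R) 0 by exact: is_derive_cst.
  have -> : flat ('X^2 * (p - p^`())) t = 0 by rewrite /flat ltNge (ltW t0).
  apply: near_eq_is_derive _ H.
  near=> s; rewrite /flat ltNge; have -> // : s <= 0.
  by apply: ltW; near: s; exact: lt_nbhsl.
- have -> : flat ('X^2 * (p - p^`())) 0 = 0 by rewrite /flat ltxx.
  apply/is_derive_epsP => e e0; have [c c0 hc] := flat_small p.
  exists (Num.min 1 (e / c)); first by rewrite lt_min ltr01 divr_gt0.
  move=> h h0; rewrite lt_min => /andP[h1 he].
  rewrite add0r [h *: 1]mulr1 {2}/flat ltxx !subr0 normrM normfV.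
  have hp : 0 < `|h| by rewrite normr_gt0.
  rewrite mulrC ler_pdivrMr//.
  have [hpos|hneg] := ltP 0 h; last by rewrite /flat ltNge hneg normr0 mulr_ge0// ltW.
  have := hc h; rewrite hpos -{1}(gtr0_norm hpos) (ltW h1) => /(_ isT) /le_trans; apply.
  rewrite (gtr0_norm hpos) expr2 mulrA ler_pM2r// -ler_pdivlMl// mulrC.
  by rewrite -(gtr0_norm hpos) ltW.
Unshelve. all: by end_near.
Qed.

Lemma continuous_flat p : continuous (flat p).
Proof.
move=> t; apply: differentiable_continuous; apply/derivable1_diffP.
exact: (@ex_derive _ _ _ _ _ _ _ (is_derive_flat p t)).
Qed.

End Bump.

Section SmoothBump.
Variable R : realType.
Implicit Types (w x v c : pt3 R) (b r : R).

Lemma continuous_dot w : continuous (dot w).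
Proof.
move=> x; rewrite /dot; apply: cvgD; [apply: cvgD|]; apply: cvgM; try exact: cvg_cst.
- by apply: continuous_comp; exact: cvg_fst.
- by apply: (@continuous_comp _ _ _ fst snd); [exact: cvg_fst|exact: cvg_snd].
- exact: cvg_snd.
Qed.

Lemma dotDr w x v : dot w (x + v) = dot w x + dot w v.
Proof. by rewrite /dot /=; ring. Qed.

Lemma dotZr w (t : R) v : dot w (t *: v) = t * dot w v.
Proof. by rewrite /dot /= /GRing.scale/=; ring. Qed.

Lemma is_derive_flat_affine (p : {poly R}) w b x v :
  is_derive x v (fun x => flat p (dot w x + b))
    (flat ('X^2 * (p - p^`())) (dot w x + b) * dot w v).
Proof.
(* Orthogonally to [w] the function is constant. This case is apart because the one-dimensional
   increment [h * dot w v] used next must be nonzero. *)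
have [w0|w0] := eqVneq (dot w v) 0.
  apply/is_derive_epsP => e e0; exists 1 => // h h0 _.
  by rewrite dotDr dotZr w0 !mulr0 addr0 subrr mulr0 subr0 normr0 ltW.
have /is_derive_epsP H := is_derive_flat p (dot w x + b).
apply/is_derive_epsP => e e0.
have e1 : 0 < e / `|dot w v| by rewrite divr_gt0// normr_gt0.
have [d d0 hd] := H _ e1; exists (d / `|dot w v|); first by rewrite divr_gt0// normr_gt0.
move=> h h0; rewrite ltr_pdivlMr ?normr_gt0// -normrM => hlt.
have hw : h * dot w v != 0 by rewrite mulf_neq0.
have := hd _ hw hlt; rewrite ler_pdivlMr ?normr_gt0// -normrM [_ *: 1]mulr1.
apply: le_trans; rewrite le_eqVlt; apply/orP; left; apply/eqP.
rewrite dotDr dotZr addrAC mulrBl; congr (`|_ - _|).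
by rewrite invfM -!mulrA [X in _ = _ * (_ * X)]mulrC mulKf.
Qed.

(** The closure is chosen so that differentiation stays inside it: constants account for the factor
    [dot w v], sums and products for the Leibniz rule. *)
Inductive bump_algebra : (pt3 R -> R) -> Prop :=
| Bump_cst (a : R) : bump_algebra (fun=> a)
| Bump_flat (p : {poly R}) w b : bump_algebra (fun x => flat p (dot w x + b))
| Bump_add f g : bump_algebra f -> bump_algebra g -> bump_algebra (fun x => f x + g x)
| Bump_mul f g : bump_algebra f -> bump_algebra g -> bump_algebra (fun x => f x * g x).

Lemma bump_smooth f : bump_algebra f -> smooth f.
Proof.
apply: smooth_coind => {}f; elim=> {f}.
- move=> a; split; [exact: cst_continuous|by move=> x v; exact: derivable_cst|].
  move=> v; have -> : 'D_v (fun=> a) = (fun=> 0 : R) by apply/funext => x; rewrite derive_cst.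
  exact: Bump_cst.
- move=> p w b; split.
  + move=> x; apply: (@continuous_comp _ _ _ (fun x => dot w x + b) (flat p)).
      by apply: cvgD; [exact: continuous_dot|exact: cvg_cst].
    exact: continuous_flat.
  + by move=> x v; exact: (@ex_derive _ _ _ _ _ _ _ (is_derive_flat_affine p w b x v)).
  + move=> v.
    have -> : 'D_v (fun x => flat p (dot w x + b)) =
       (fun x => flat ('X^2 * (p - p^`())) (dot w x + b) * dot w v).
      by apply/funext => x; exact: (@derive_val _ _ _ _ _ _ _ (is_derive_flat_affine p w b x v)).
    by apply: Bump_mul; [exact: Bump_flat|exact: Bump_cst].
- move=> f g _ [cf df bf] _ [cg dg bg]; split.
  + by move=> x; apply: cvgD; [exact: cf|exact: cg].
  + by move=> x v; exact: derivableD.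
  + move=> v; have -> : 'D_v (fun x => f x + g x) = (fun x => 'D_v f x + 'D_v g x).
      by apply/funext => x; rewrite -deriveD.
    by apply: Bump_add; [exact: bf|exact: bg].
- move=> f g Bf [cf df bf] Bg [cg dg bg]; split.
  + by move=> x; apply: cvgM; [exact: cf|exact: cg].
  + by move=> x v; exact: derivableM.
  + move=> v; have -> : 'D_v (fun x => f x * g x) = (fun x => f x * 'D_v g x + g x * 'D_v f x).
      by apply/funext => x; exact: deriveM.
    by apply: Bump_add; apply: Bump_mul => //; exact: bg || exact: bf.
Qed.

Lemma flat1_itv (t : R) : 0 <= flat 1 t <= 1.
Proof.
rewrite /flat; case: ltP => [t0|_]; last by rewrite lexx ler01.
by rewrite hornerC mul1r expR_ge0 expR_le1 oppr_le0 invr_ge0 ltW.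
Qed.

Lemma flat1_cvg (s : R) : 0 < s -> (fun k : nat => flat 1 (k.+1%:R * s)) @ \oo --> (1 : R).
Proof.
move=> s0.
have E : (fun k : nat => flat 1 (k.+1%:R * s)) = (fun k => expR (- (s^-1 * k.+1%:R^-1))).
  apply/funext => k; rewrite /flat mulr_gt0// hornerC mul1r; congr (expR (- _)).
  by rewrite invfM mulrC.
rewrite E -[X in _ --> X](@expR0 R).
apply: (cvg_comp (fun k : nat => - (s^-1 * k.+1%:R^-1)) (@expR R) _ (@continuous_expR R 0)).
have -> : (0 : R) = - (s^-1 * 0) by rewrite mulr0 oppr0.
by apply: cvgN; apply: cvgM; [exact: cvg_cst|exact: cvg_harmonic].
Qed.

(** Balls for the product norm are cubes; there is one flat factor for each of the six faces. The
    dilation [k.+1] makes the product tend to 1 at every point of the open cube. *)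
Definition box_bump (k : nat) c r x : R :=
  flat 1 (k.+1%:R * (r - (c.1.1 - x.1.1))) * flat 1 (k.+1%:R * (r + (c.1.1 - x.1.1))) *
  (flat 1 (k.+1%:R * (r - (c.1.2 - x.1.2))) * flat 1 (k.+1%:R * (r + (c.1.2 - x.1.2)))) *
  (flat 1 (k.+1%:R * (r - (c.2 - x.2))) * flat 1 (k.+1%:R * (r + (c.2 - x.2)))).

Lemma smooth_box_bump k c r : bump_algebra (box_bump k c r).
Proof.
have aux w (b : R) (f : pt3 R -> R) : (forall x, f x = dot w x + b) ->
    bump_algebra (fun x => flat 1 (f x)).
  move=> H; have -> : f = (fun x => dot w x + b) by apply/funext.
  exact: Bump_flat.
pose m : R := k.+1%:R.
have D (a1 a2 a3 : R) x : dot (a1, a2, a3) x = a1 * x.1.1 + a2 * x.1.2 + a3 * x.2 by [].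
rewrite /box_bump; do ![apply: Bump_mul].
- by apply: (aux (m, 0, 0) (m * (r - c.1.1))) => x; rewrite D /m; ring.
- by apply: (aux (- m, 0, 0) (m * (r + c.1.1))) => x; rewrite D /m; ring.
- by apply: (aux (0, m, 0) (m * (r - c.1.2))) => x; rewrite D /m; ring.
- by apply: (aux (0, - m, 0) (m * (r + c.1.2))) => x; rewrite D /m; ring.
- by apply: (aux (0, 0, m) (m * (r - c.2))) => x; rewrite D /m; ring.
- by apply: (aux (0, 0, - m) (m * (r + c.2))) => x; rewrite D /m; ring.
Qed.

Lemma box_bump_itv k c r x : 0 <= box_bump k c r x <= 1.
Proof.
have M (a b : R) : 0 <= a <= 1 -> 0 <= b <= 1 -> 0 <= a * b <= 1.
  by move=> /andP[a0 a1] /andP[b0 b1]; rewrite mulr_ge0// mulr_ile1.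
by rewrite /box_bump; apply: (M); [apply: (M); apply: (M)|apply: (M)]; exact: flat1_itv.
Qed.

Lemma box_bump_out k c r x : ~ ball c r x -> box_bump k c r x = 0.
Proof.
move=> H.
have key (a : R) : ~ (`|a| < r) ->
    flat 1 (k.+1%:R * (r - a)) * flat 1 (k.+1%:R * (r + a)) = 0.
  move=> /negP; rewrite -leNgt ler_normr => /orP[h|h].
    by rewrite [X in X * _]/flat pmulr_rgt0// ltNge (_ : r - a <= 0) ?mul0r//; lra.
  by rewrite [X in _ * X]/flat pmulr_rgt0// ltNge (_ : r + a <= 0) ?mulr0//; lra.
have [h1|h1] := pselect (`|c.1.1 - x.1.1| < r); last by rewrite /box_bump key// !mul0r.
have [h2|h2] := pselect (`|c.1.2 - x.1.2| < r).
  have [h3|h3] := pselect (`|c.2 - x.2| < r); first by case: H; apply/ball3E.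
  by rewrite /box_bump [X in _ * X]key// mulr0.
by rewrite /box_bump [X in _ * X * _]key// mulr0 mul0r.
Qed.

Lemma box_bump_cvg c r x : ball c r x -> (fun k => box_bump k c r x) @ \oo --> (1 : R).
Proof.
move=> /ball3E[h1 h2 h3].
have key (a : R) : `|a| < r ->
    (fun k : nat => flat 1 (k.+1%:R * (r - a)) * flat 1 (k.+1%:R * (r + a))) @ \oo --> (1 : R).
  rewrite ltr_norml => /andP[a1 a2]; rewrite -[X in _ --> X](mulr1 1).
  by apply: cvgM; apply: flat1_cvg; lra.
rewrite -[X in _ --> X](mulr1 1); apply: cvgM; last exact: key.
by rewrite -[X in _ --> X](mulr1 1); apply: cvgM; exact: key.
Qed.

Lemma compact_closed_ball3 c r : 0 < r -> compact (closed_ball c r).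
Proof.
move=> r0.
pose I (a : R) := `[a - r, a + r]%classic.
have -> : closed_ball c r = (I c.1.1 `*` I c.1.2) `*` I c.2.
  have E (a y : R) : (`|a - y| <= r) <-> y \in `[a - r, a + r].
    by rewrite in_itv/= ler_norml; split=> /andP[? ?]; apply/andP; split; lra.
  rewrite closed_ballE//; apply/seteqP; split=> x; rewrite /closed_ball_ /=.
    rewrite !prod_normE /= !ge_max => /andP[/andP[/E h1 /E h2] /E h3].
    by [].
  by move=> [[/E h1 /E h2] /E h3]; rewrite !prod_normE /= !ge_max h1 h2 h3.
by apply: compact_setX; [apply: compact_setX|]; exact: segment_compact.
Qed.

End SmoothBump.

Section Density.
Variables (R : realType) (U : set (pt3 R)).
Hypotheses (oU : open U) (bU : (mu3 U < +oo)%E).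
Implicit Types (f g phi : pt3 R -> R) (A B : set (pt3 R)).

Lemma test_functionD f g : test_function U f -> test_function U g ->
  test_function U (fun x => f x + g x).
Proof.
move=> [sf [K [cK KU f0]]] [sg [L [cL LU g0]]]; split; first exact: smoothD.
exists (K `|` L); split; first exact: compactU.
  by move=> x [/KU|/LU].
by move=> x /not_orP[/f0 -> /g0 ->]; rewrite addr0.
Qed.

Lemma test_functionZ f (a : R) : test_function U f -> test_function U (fun x => a * f x).
Proof.
move=> [sf [K [cK KU f0]]]; split; first exact: smoothZ.
by exists K; split => // x /f0 ->; rewrite mulr0.
Qed.

Lemma test_continuous f : test_function U f -> continuous f.
Proof. by move=> [/smoothP[]]. Qed.

Lemma test_measurable f : test_function U f -> measurable_fun setT f.
Proof. by move=> tf; apply: continuous_measurable3; exact: test_continuous. Qed.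

Lemma test_L2 f A : measurable A -> test_function U f -> in_L2 A f.
Proof.
move=> mA tf; have := test_continuous tf; case: tf => _ [K [cK _ f0]] cf.
exact: in_L2_support f0.
Qed.

(** The distance is taken over the whole space although the test functions live in [U]; truncated
    functions, zero outside [U], are the ones to be approximated. *)
Definition approximable f := measurable_fun setT f /\
  forall e : R, 0 < e -> exists2 phi, test_function U phi &
    (N2 setT (fun x => f x - phi x)%R <= e%:E)%E.

Lemma approximableD f g : approximable f -> approximable g ->
  approximable (fun x => f x + g x).
Proof.
move=> [mf Hf] [mg Hg]; split; first exact: measurable_funD.
move=> e e0; have e4 : 0 < e / 4 by rewrite divr_gt0.
have [p tp hp] := Hf _ e4; have [q tq hq] := Hg _ e4.
exists (fun x => p x + q x); first exact: test_functionD.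
have -> : (fun x => f x + g x - (p x + q x)) = (fun x => (f x - p x) + (g x - q x)).
  by apply/funext => x; ring.
apply: le_trans (N2D measurableT _ _) _.
- by apply: measurable_funB => //; exact: test_measurable.
- by apply: measurable_funB => //; exact: test_measurable.
apply: (@le_trans _ _ (2%:E * (e/4)%:E + 2%:E * (e/4)%:E)%E).
  by apply: leeD; apply: lee_wpmul2l => //; rewrite lee_fin.
by rewrite -!EFinM -EFinD lee_fin; lra.
Qed.

Lemma approximable_lim f (F : nat -> pt3 R -> R) : measurable_fun setT f ->
  (forall k, approximable (F k)) ->
  (forall e : R, 0 < e -> exists k, (N2 setT (fun x => f x - F k x)%R <= e%:E)%E) ->
  approximable f.
Proof.
move=> mf HF H; split => // e e0; have e4 : 0 < e / 4 by rewrite divr_gt0.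
have [k hk] := H _ e4; have [mFk /(_ _ e4)[p tp hp]] := HF k.
exists p => //.
have -> : (fun x => f x - p x) = (fun x => (f x - F k x) + (F k x - p x)).
  by apply/funext => x; ring.
apply: le_trans (N2D measurableT _ _) _.
- exact: measurable_funB.
- by apply: measurable_funB => //; exact: test_measurable.
apply: (@le_trans _ _ (2%:E * (e/4)%:E + 2%:E * (e/4)%:E)%E).
  by apply: leeD; apply: lee_wpmul2l => //; rewrite lee_fin.
by rewrite -!EFinM -EFinD lee_fin; lra.
Qed.

Lemma approximable_test f : test_function U f -> approximable f.
Proof.
move=> tf; split; first exact: test_measurable.
move=> e e0; exists f => //.
have -> : (fun x => f x - f x) = (fun=> 0) by apply/funext => x; rewrite subrr.
by rewrite /N2; under eq_integral do rewrite expr0n; rewrite integral0 lee_fin ltW.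
Qed.

Lemma approximable0 : approximable (fun=> 0).
Proof.
apply: approximable_test; split; first exact/bump_smooth/Bump_cst.
by exists set0; split => //; exact: compact0.
Qed.

Lemma approximableZ f (a : R) : approximable f -> approximable (fun x => a * f x).
Proof.
move=> [mf Hf]; split; first exact: measurable_funM.
move=> e e0.
have a0 : 0 < a ^+ 2 + 1 by rewrite ltr_wpDl// sqr_ge0.
have [p tp hp] := Hf _ (divr_gt0 e0 a0).
exists (fun x => a * p x); first exact: test_functionZ.
have -> : (fun x => a * f x - a * p x) = (fun x => a * (f x - p x)).
  by apply/funext => x; ring.
rewrite N2Z//; last by apply: measurable_funB => //; exact: test_measurable.
apply: (@le_trans _ _ ((a ^+ 2)%:E * (e / (a ^+ 2 + 1))%:E)%E).
  by apply: lee_wpmul2l => //; rewrite lee_fin sqr_ge0.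
by rewrite -EFinM lee_fin mulrCA ger_pMr// ler_pdivrMr// mul1r lerDl.
Qed.

Lemma approximable_dominated f (F : nat -> pt3 R -> R) g : measurable_fun setT f ->
  (forall k, approximable (F k)) -> in_L2 setT g ->
  (forall x, (fun k => F k x) @ \oo --> f x) ->
  (forall k x, `|f x - F k x| <= g x) -> approximable f.
Proof.
move=> mf HF lg cF dF; apply: (approximable_lim mf HF) => e e0.
have mF k : measurable_fun setT (F k) by case: (HF k).
have [mg _] := lg.
pose h k (x : pt3 R) := ((f x - F k x) ^+ 2)%:E.
have [] := @dominated_convergence _ _ R (@mu3 R) setT measurableT h (fun=> 0%E)
  (fun x => ((g x) ^+ 2)%:E).
- by move=> k; apply: measurable_sq; exact: measurable_funB.
- exact: measurable_cst.
- apply: aeW => x _; rewrite /h; apply: cvg_EFin; first exact: nearW.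
  have -> : fine \o (fun k => ((f x - F k x) ^+ 2)%:E) = (fun k => (f x - F k x) * (f x - F k x)).
    by apply/funext => k /=; rewrite expr2.
  have -> : (0 : R) = (f x - f x) * (f x - f x) by rewrite subrr mulr0.
  by apply: cvgM; (apply: cvgB; [exact: cvg_cst|exact: cF]).
- have := in_L2_integrable measurableT lg lg.
  by apply: eq_integrable => // x _; rewrite expr2.
- apply: aeW => x k _; rewrite /h gee0_abs ?lee_fin ?sqr_ge0//.
  rewrite -(real_normK (num_real (f x - F k x))) ler_sqr ?nnegrE// ?dF//.
  exact: le_trans (dF k x).
move=> _ _; rewrite integral0 => /fine_cvgP[Hfin] /cvgrPdist_le /(_ e e0) Hd.
have [k [h1 h2]] : exists k, (\int3_x h k x)%E \is a fin_num /\
    `|0 - fine (\int3_x h k x)%E| <= e.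
  have [N _ HN] := filterI Hfin Hd.
  by exists N; have := HN N (leqnn N).
exists k; rewrite -[N2 _ _]/(\int3_x h k x)%E -(fineK h1) lee_fin.
by move: h2; rewrite sub0r normrN; apply: le_trans; exact: ler_norm.
Qed.

End Density.

Section DensityIndic.
Variables (R : realType) (U : set (pt3 R)).
Hypotheses (oU : open U) (bU : (mu3 U < +oo)%E).
Implicit Types (f g phi : pt3 R -> R) (A B : set (pt3 R)).

Lemma in_L2_indic A : measurable A -> in_L2 setT (\1_(A `&` U) : pt3 R -> R).
Proof.
move=> mA; have mU := open_measurable3 oU.
have mAU : measurable (A `&` U) by exact: measurableI.
have mI : measurable_fun setT (\1_(A `&` U) : pt3 R -> R) by exact: measurable_indic.
split => //; rewrite -[X in (X < _)%E]/(N2 setT _) /N2 (@integral_support _ _ U)//.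
  have [] // : in_L2 U (\1_(A `&` U) : pt3 R -> R).
  apply: (@in_L2_bounded _ _ _ 1 mU bU (measurable_funS measurableT (@subsetT _ _) mI)).
  by move=> x _; rewrite indicE ger0_norm// lern1 leq_b1.
move=> x _ Ux; rewrite indicE memNset ?expr0n//.
by move=> [].
Qed.

(** One minus the product of the complements of bumps is a smooth union of cubes. It is supported in
    finitely many closed balls of [O] and takes values between 0 and 1. At a point of [O] it tends
    to 1, since the factor of a ball containing the point tends to 0 and the others are at most
    1. *)
Lemma approximable_open O : open O -> O `<=` U -> approximable U (\1_O : pt3 R -> R).
Proof.
move=> oO OU; have [c [r [cO EO]]] := open_ball_cover oO.
have mO := open_measurable3 oO.
pose F k (x : pt3 R) : R := 1 - \prod_(i < k) (1 - box_bump k (c i) (r i) x).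
have bF k : bump_algebra (F k).
  rewrite /F; have -> : (fun x => 1 - \prod_(i < k) (1 - box_bump k (c i) (r i) x)) =
    (fun x => (fun=> 1) x + (fun=> -1) x * (fun x => \prod_(i < k) (1 - box_bump k (c i) (r i) x)) x).
    by apply/funext => x; rewrite mulN1r.
  apply: Bump_add; first exact: Bump_cst.
  apply: Bump_mul; first exact: Bump_cst.
  have P (n : nat) : bump_algebra (fun x => \prod_(i < n) (1 - box_bump k (c i) (r i) x)).
    elim: n => [|n IH].
      by under eq_fun do rewrite big_ord0; exact: Bump_cst.
    under eq_fun do rewrite big_ord_recr.
    apply: Bump_mul => //.
    have -> : (fun x => 1 - box_bump k (c n) (r n) x) =
      (fun x => (fun=> 1) x + (fun=> -1) x * box_bump k (c n) (r n) x).
      by apply/funext => x; rewrite mulN1r.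
    apply: Bump_add; first exact: Bump_cst.
    by apply: Bump_mul; [exact: Bump_cst|exact: smooth_box_bump].
  exact: P.
have F0 k x : ~ (exists2 i : 'I_k, 0 < r i & closed_ball (c i) (r i) x) -> F k x = 0.
  move=> H; rewrite /F big1 ?subrr// => i _; rewrite box_bump_out ?subr0//.
  move=> hb; apply: H; exists i; last exact: subset_closed_ball.
  by case/ball3E: hb => h _ _; apply: le_lt_trans h.
have tF k : test_function U (F k).
  split; first exact: bump_smooth.
  pose K i := if 0 < r i then closed_ball (c i) (r i) else set0.
  exists (\big[setU/set0]_(i < k) K i); split.
  - elim/big_ind : _ => [|A B|i _]; [exact: compact0|exact: compactU|].
    by rewrite /K; case: ifP => // ri; [exact: compact_closed_ball3|exact: compact0].
  - rewrite -bigcup_mkord => x [i _]; rewrite /K; case: ifP => // _ /cO; exact: OU.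
  - move=> x H; apply: F0 => -[i ri xi]; apply: H; rewrite -bigcup_mkord.
    by exists i => //=; rewrite /K ri.
have pI k x : 0 <= \prod_(i < k) (1 - box_bump k (c i) (r i) x) <= 1.
  apply/andP; split; first apply: prodr_ge0 => i _.
    by have /andP[] := box_bump_itv k (c i) (r i) x; lra.
  apply: prodr_ile1 => i _.
  by have /andP[? ?] := box_bump_itv k (c i) (r i) x; apply/andP; split; lra.
have FO k x : ~ O x -> F k x = 0.
  by move=> Ox; apply: F0 => -[i _ /cO].
have LO : in_L2 setT (\1_O : pt3 R -> R).
  by have := in_L2_indic mO; rewrite setIidl.
apply: (approximable_dominated (F := F) _ (fun k => approximable_test (tF k)) LO).
- exact: measurable_indic.
- move=> x; have [Ox|Ox] := pselect (O x); last first.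
    rewrite indicE memNset//; have -> : (fun k => F k x) = (fun=> 0); last exact: cvg_cst.
    by apply/funext => k; rewrite FO.
  rewrite indicE mem_set//=.
  have [j _ xj] : (\bigcup_k ball (c k) (r k)) x by rewrite -EO.
  have := box_bump_cvg xj; move=> /cvgrPdist_le H.
  apply/cvgrPdist_le => e e0; near=> k; have [] := pI k x.
  have jk : (j < k)%N by near: k; exact: nbhs_infty_gt.
  have hb : `|1 - box_bump k (c j) (r j) x| <= e by near: k; exact: H.
  move=> /andP[p0 p1]; rewrite /F opprB addrCA subrr addr0 ger0_norm//.
  apply: le_trans hb; rewrite (bigD1 (Ordinal jk))//=.
  have b0 : 0 <= 1 - box_bump k (c j) (r j) x.
    by have /andP[] := box_bump_itv k (c j) (r j) x; lra.
  rewrite ger0_norm//; apply: ler_piMr => //.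
  apply: prodr_ile1 => i _.
  by have /andP[? ?] := box_bump_itv k (c i) (r i) x; apply/andP; split; lra.
- move=> k x; rewrite indicE; have [Ox|Ox] := pselect (O x); last first.
    by rewrite FO// memNset// subrr normr0.
  rewrite mem_set//= /F; have /andP[p0 p1] := pI k x.
  by rewrite opprB addrCA subrr addr0 ger0_norm.
Unshelve. all: by end_near.
Qed.

(** The coordinates are measurable for the sigma-algebra generated by the open sets, so that the
    latter contains the product sigma-algebra. Measurable sets thus become accessible by Dynkin
    induction from open sets. *)
Lemma measurable_open_gen : @measurable _ (pt3 R) = <<s (@open (pt3 R)) >>.
Proof.
apply/seteqP; split => A; last first.
  apply: smallest_sub; first exact: sigma_algebra_measurable.
  by move=> B; exact: open_measurable3.
move=> mA.
pose T' := g_sigma_algebraType (@open (pt3 R)).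
have coord (p : pt3 R -> R) : continuous p -> measurable_fun setT (p : T' -> R).
  move=> cp _; apply: (measurability _ (RGenOInfty.measurableE R)) => //.
  move=> _ [_ [a ->] <-]; rewrite setTI; apply: sub_sigma_algebra.
  by move/continuousP: cp; apply; exact: interval_open.
have mid : measurable_fun setT (id : T' -> pt3 R).
  apply/measurable_fun_pairP; split; first apply/measurable_fun_pairP; try split.
  - apply: (coord (fst \o fst)) => x; apply: (@continuous_comp _ _ _ fst fst); exact: cvg_fst.
  - by apply: (coord (snd \o fst)) => x; apply: (@continuous_comp _ _ _ fst snd);
      [exact: cvg_fst|exact: cvg_snd].
  - by apply: (coord snd) => x; exact: cvg_snd.
by have := mid measurableT A mA; rewrite setTI.
Qed.

(** The sets with this property form a Dynkin system containing the open sets, which are stable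
    under intersection. The intersection with [U], of finite measure, supplies the dominating
    function for countable unions. *)
Lemma approximable_indic A : measurable A -> approximable U (\1_(A `&` U) : pt3 R -> R).
Proof.
move=> mA; have mU := open_measurable3 oU.
have : <<s (@open (pt3 R)) >> A by rewrite -measurable_open_gen.
apply: (dynkin_induction (P := fun A => approximable U (\1_(A `&` U) : pt3 R -> R)) measurable_open_gen).
- by move=> B C; exact: openI.
- by rewrite setTI; exact: approximable_open.
- by move=> O oO; apply: approximable_open; [exact: openI|exact: subIsetr].
- move=> B mB aB.
  have -> : (\1_(~` B `&` U) : pt3 R -> R) = (fun x => \1_U x + (-1) * \1_(B `&` U) x).
    apply/funext => x; rewrite !indicE !in_setI in_setC.
    by case: (x \in B); case: (x \in U) => /=; ring.
  by apply: approximableD; [exact: approximable_open|exact: approximableZ].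
- move=> F mF tF aF.
  pose S n (x : pt3 R) : R := \sum_(i < n) \1_(F i `&` U) x.
  have aS n : approximable U (S n).
    rewrite /S; elim: n => [|n IH].
      by under eq_fun do rewrite big_ord0; exact: approximable0.
    under eq_fun do rewrite big_ord_recr.
    by apply: approximableD.
  have S0 n x : (forall j, ~ (F j `&` U) x) -> S n x = 0.
    by move=> H; rewrite /S big1// => i _; rewrite indicE memNset.
  have S1 n x j : (F j `&` U) x -> S n x = (j < n)%:R.
    move=> [Fj Ux].
    have other i : i != j -> \1_(F i `&` U) x = 0 :> R.
      move=> ij; rewrite indicE memNset// => -[Fi _].
      by move/eqP: ij; apply; apply: (tF i j I I); exists x.
    case: ltnP => jn.
      rewrite /S (bigD1 (Ordinal jn))//= indicE mem_set//= big1 ?addr0// => i ij.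
      by apply: other.
    rewrite /S big1// => i _; apply: other.
    by apply/eqP => E; have := ltn_ord i; rewrite E ltnNge jn.
  apply: (approximable_dominated (F := S) (g := \1_U)) => //.
  + by apply: measurable_indic; apply: measurableI => //; exact: bigcup_measurable.
  + by have := in_L2_indic measurableT; rewrite setTI.
  + move=> x; have [[[j _ Fj] Ux]|H] := pselect ((\bigcup_k F k `&` U) x).
      rewrite indicE mem_set//=; last by split => //; exists j.
      apply: cvg_near_cst; near=> n; rewrite (S1 n x j)//.
      by have -> : (j < n)%N by near: n; exact: nbhs_infty_gt.
    rewrite indicE memNset//=.
    have -> : (fun n => S n x) = (fun=> 0); last exact: cvg_cst.
    by apply/funext => n; rewrite S0// => j [Fj Ux]; apply: H; split => //; exists j.
  + move=> n x; have [[[j _ Fj] Ux]|H] := pselect ((\bigcup_k F k `&` U) x).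
      rewrite !indicE !mem_set//=; last by split => //; exists j.
      by rewrite (S1 n x j)//; case: (j < n)%N; rewrite ?subrr ?subr0 ?normr0 ?normr1.
    rewrite S0 ?subr0; last by move=> j [Fj Ux]; apply: H; split => //; exists j.
    by rewrite indicE memNset// normr0 indicE ler0n.
Unshelve. all: by end_near.
Qed.

Import HBNNSimple.

Lemma approximable_L2_ge0 f : in_L2 setT f -> (forall x, 0 <= f x) ->
  (forall x, ~ U x -> f x = 0) -> approximable U f.
Proof.
move=> lf f0 fU; have [mf _] := lf.
have mE : measurable_fun setT (EFin \o f) by exact/measurable_EFinP.
have [g [ndg cg]] := approximation measurableT mE (fun x _ => f0 x).
have cg' x : (fun k => g k x) @ \oo --> f x.
  have := cg x I; move/fine_cvgP => [_]; apply: cvg_trans.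
  by apply: near_eq_cvg; exact: nearW.
have gf k x : g k x <= f x.
  rewrite -(cvg_lim _ (cg' x))//; apply: nondecreasing_cvgn_le.
    by move=> i j ij; have /lefP := ndg i j ij; apply.
  by apply/cvg_ex; exists (f x).
apply: (approximable_dominated (F := g) (g := f)) => // [k|k x]; last first.
  by rewrite ger0_norm ?subr_ge0 ?gf// gerBl.
pose s := finmap.enum_fset (fset_set (range (g k))).
have -> : (g k : pt3 R -> R) =
    (fun x => \sum_(i < size s) s`_i * \1_((g k @^-1` [set s`_i]) `&` U) x).
  apply/funext => x; have [Ux|Ux] := pselect (U x).
    rewrite fimfunEord; apply: eq_bigr => i _.
    by rewrite !indicE in_setI [x \in U]mem_set// andbT.
  rewrite big1; last by move=> i _; rewrite indicE memNset ?mulr0// => -[].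
  by apply/eqP; rewrite eq_le fun_ge0 andbT -(fU x Ux) gf.
have fin_sum (n : nat) (h : nat -> pt3 R -> R) : (forall i, approximable U (h i)) ->
    approximable U (fun x => \sum_(i < n) h i x).
  move=> H; elim: n => [|n IH].
    by under eq_fun do rewrite big_ord0; exact: approximable0.
  under eq_fun do rewrite big_ord_recr.
  exact: approximableD.
apply: (fin_sum _ (fun i x => s`_i * \1_((g k @^-1` [set s`_i]) `&` U) x)) => i.
by apply: approximableZ; apply: approximable_indic.
Qed.

Lemma approximable_L2 f : in_L2 setT f -> (forall x, ~ U x -> f x = 0) -> approximable U f.
Proof.
move=> lf fU; have [mf _] := lf.
have L (h : pt3 R -> R) : measurable_fun setT h -> (forall x, 0 <= h x <= `|f x|) ->
    approximable U h.
  move=> mh hf; apply: approximable_L2_ge0.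
  - split => //; apply: le_lt_trans (proj2 lf); apply: N2_le => // x _.
    by have /andP[h0 h1] := hf x; rewrite ger0_norm.
  - by move=> x; have /andP[] := hf x.
  - move=> x Ux; have := hf x; rewrite fU// normr0 => hx; apply/eqP.
    by rewrite eq_le andbC.
have -> : f = (fun x => Num.max (f x) 0 + (-1) * Num.max (- f x) 0).
  apply/funext => x; rewrite mulN1r !maxEle.
  by case: (leP (f x) 0) => h; case: leP => h'; lra.
apply: approximableD; last apply: approximableZ; apply: L.
- exact: measurable_maxr.
- move=> x; rewrite le_max lexx orbT/= ge_max ler_norm//=.
- by apply: measurable_maxr => //; exact: measurableT_comp.
- by move=> x; rewrite le_max lexx orbT/= ge_max normr_ge0 -normrN ler_norm.
Qed.

(** Were [A = ip U f f] larger than [M], a test function close enough to [f] would violate the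
    hypothesis. This turns every bound tested against smooth functions into a bound of the norm. *)
Lemma L2_dual f (M : R) : in_L2 U f -> 0 <= M ->
  (forall phi, test_function U phi -> ip U f phi ^+ 2 <= M * ip U phi phi) ->
  (N2 U f <= M%:E)%E.
Proof.
move=> lf M0 H; have mU := open_measurable3 oU.
rewrite N2_ip// lee_fin leNgt; apply/negP => MA.
pose fU := f \_ U.
have fUE x : U x -> fU x = f x by move=> Ux; rewrite /fU patchE mem_set.
have lfU : in_L2 setT fU.
  split; first by apply/(measurable_restrictT f mU); case: lf.
  rewrite -[X in (X < _)%E]/(N2 setT fU) /N2 (@integral_support _ _ U)//.
    by have [] := @in_L2_eq _ U f fU (fun x xU => esym (fUE x (set_mem xU))) lf.
  by move=> x _ Ux; rewrite /fU patchE memNset// expr0n.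
have [|_ afU] := approximable_L2 lfU; first by move=> x Ux; rewrite /fU patchE memNset.
set A := ip U f f in MA *.
pose D := A - M; have D0 : 0 < D by rewrite /D; lra.
have A0 : 0 < A by lra.
(* With [b = ip U f (f - p)] and [c] the squared distance, the hypothesis at [p] expands to
   [b^2 <= M c - A D + 2 b D]. Since [2 b <= A/2 + 2 c], the right side is at most
   [(M + 2 D) c - A D / 2], negative once [c <= e]. *)
pose e := A * D / (4 * (2 * D + M)).
have den : 0 < 4 * (2 * D + M) by lra.
have e0 : 0 < e by rewrite /e divr_gt0// mulr_gt0.
have [p tp hp] := afU e e0.
have lp := test_L2 mU tp.
have ld : in_L2 U (fun x => f x - p x) by exact: in_L2B.
pose b := ip U f (fun x => f x - p x).
pose c := ip U (fun x => f x - p x) (fun x => f x - p x).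
have ce : c <= e.
  rewrite -lee_fin /c -N2_ip//; apply: le_trans hp.
  rewrite (@N2_eq _ U _ (fun x => fU x - p x)); last first.
    by move=> x xU; rewrite fUE//; exact: set_mem.
  apply: N2_sub => //; apply: measurable_funB; first by case: lfU.
  exact: test_measurable tp.
have bc : b ^+ 2 <= A * c by exact: ip_CS.
have c0 : 0 <= c by exact: ip_ge0.
have bE : b = A - ip U f p by rewrite /b ipC ipBl// [ip U p f]ipC.
have cE : c = A - 2 * ip U f p + ip U p p.
  rewrite /c ipBl// ipC ipBl// [X in _ - X]ipC ipBl// [ip U p f]ipC -/A; ring.
have := H p tp.
have -> : ip U f p = A - b by rewrite bE; ring.
have -> : ip U p p = A - 2 * b + c by rewrite cE bE; ring.
have ME : M = A - D by rewrite /D; ring.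
have e1 : (2 * D + M) * c <= A * D / 4.
  apply: le_trans (_ : (2 * D + M) * e <= _); first by rewrite ler_wpM2l//; lra.
  rewrite /e le_eqVlt; apply/orP; left; apply/eqP; field.
  by rewrite gt_eqF//; lra.
have e2 : 2 * b * A <= A * A / 2 + 2 * (A * c).
  by have := sqr_ge0 (A - 2 * b); nra.
have e3 : 2 * b <= A / 2 + 2 * c.
  rewrite -(ler_pM2r A0); apply: le_trans e2 _; rewrite mulrDl; lra.
have AD : 0 < A * D by exact: mulr_gt0.
have e4 : D * (2 * b) <= D * (A / 2 + 2 * c) by rewrite ler_pM2l.
have := sqr_ge0 b; rewrite ME in e1 *; nra.
Qed.

Lemma L2_dual0 f : in_L2 U f ->
  (forall phi, test_function U phi -> ip U f phi = 0) -> N2 U f = 0%E.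
Proof.
move=> lf H; apply/eqP; rewrite eq_le N2_ge0 andbT; apply: L2_dual => //.
by move=> phi /H ->; rewrite expr0n mul0r.
Qed.

End DensityIndic.

(** * Weak derivatives *)

Section Translation.
Variable R : realType.
Implicit Types (U A : set (pt3 R)) (f g phi : pt3 R -> R) (x y v : pt3 R).

Lemma integral_shift_signed y (f : pt3 R -> \bar R) :
  measurable_fun (setT : set (pt3 R)) f ->
  (\int3_x f (x + y)%R = \int3_x f x)%E.
Proof.
move=> mf; rewrite integralE [RHS]integralE; congr (_ - _)%E.
- rewrite -(@integral_shift3 _ y (f^\+)%E) //; last exact: measurable_funepos.
  by apply: eq_integral => x _; rewrite !funeposE.
- rewrite -(@integral_shift3 _ y (f^\-)%E) //; last exact: measurable_funeneg.
  by apply: eq_integral => x _; rewrite !funenegE.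
Qed.

Lemma ip_support U A f g : A `<=` U -> (forall x, U x -> ~ A x -> g x = 0) ->
  ip U f g = ip A f g.
Proof.
move=> AU g0; rewrite /ip (@integral_support _ U A)// => x Ux Ax.
by rewrite g0// mulr0.
Qed.

Lemma ip_shift f g y : measurable_fun setT f -> measurable_fun setT g ->
  ip setT (fun x => f (x + y)) g = ip setT f (fun x => g (x - y)).
Proof.
move=> mf mg; rewrite /ip; congr fine.
rewrite -[RHS](@integral_shift_signed y).
  by apply: eq_integral => x _; rewrite addrK.
apply/measurable_EFinP; apply: measurable_funM => //.
exact: (measurableT_comp mg (measurable_shift3 (- y))).
Qed.

Lemma test_sub U A phi : A `<=` U -> test_function A phi -> test_function U phi.
Proof.
move=> AU [sp [K [cK KA p0]]]; split => //; exists K; split => //.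
exact: subset_trans AU.
Qed.

Lemma test_D U phi v : test_function U phi -> test_function U ('D_v phi).
Proof.
move=> [sp [K [cK KU p0]]]; have [_ _ sD] := smoothP sp; split; first exact: sD.
exists K; split => // x Kx.
have oK : open (~` K) by apply: closed_openC; apply: compact_closed.
have /nbhs_ballP[e /= e0 he] : nbhs x (~` K) by apply: open_nbhs_nbhs.
suff : is_derive x v phi 0 by move=> H; exact: (@derive_val _ _ _ _ _ _ _ H).
apply/is_derive_epsP => d d0.
exists (e / (`|v| + 1)); first by rewrite divr_gt0// ltr_wpDl.
move=> h h0; rewrite ltr_pdivlMr ?ltr_wpDl// => hv.
rewrite !p0// ?subrr ?mulr0 ?subr0 ?normr0 ?ltW//.
apply: he; rewrite -ball_normE/= opprD addrA subrr sub0r normrN normrZ.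
by apply: le_lt_trans hv; rewrite ler_wpM2l// lerDl.
Qed.

Lemma test_translate U A phi y : (forall x, A x -> U (x + y)) -> test_function A phi ->
  test_function U (fun x => phi (x - y)).
Proof.
move=> AU [sp [K [cK KA p0]]]; split; first exact: smooth_translate.
exists ((fun x => x + y) @` K); split.
- apply: continuous_compact => //; apply: continuous_subspaceT => x.
  by apply: cvgD; [exact: cvg_id|exact: cvg_cst].
- by move=> _ [x Kx <-]; apply: AU; exact: KA.
- by move=> x Kx; apply: p0 => Kxy; apply: Kx; exists (x - y) => //; rewrite subrK.
Qed.

Lemma test_bounded U phi : test_function U phi -> exists2 M : R, 0 < M & forall x, `|phi x| <= M.
Proof.
move=> tp; have cp := test_continuous tp; case: tp => _ [K [cK _ p0]].
by have [M [M0 _ h]] := bounded_support cK cp p0; exists M.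
Qed.

Lemma in_L2_cst U (c : R) : measurable U -> (mu3 U < +oo)%E -> in_L2 U (fun=> c).
Proof. by move=> mU fU; apply: (@in_L2_bounded _ _ _ `|c|). Qed.

(** Differentiation under the integral sign. The derivative in the parameter is dominated by a
    constant times the absolute value of [g], which is integrable because [U] has finite measure. *)
Lemma is_derive_ip_translate U g phi y (t : R) : measurable U -> (mu3 U < +oo)%E ->
  in_L2 U g -> test_function setT phi ->
  is_derive t (1 : R) (fun s : R => ip U g (fun x => phi (x - s *: y)))
    (- ip U g (fun x => 'D_y phi (x - t *: y))).
Proof.
move=> mU fU lg tp; have [mg _] := lg.
have tDp := test_D y tp; have [M M0 hM] := test_bounded tDp.
have tps (s : R) : test_function setT (fun x => phi (x - s *: y)) by exact: test_translate tp.
have dphi (s : R) x : is_derive s (1 : R) (fun s : R => phi (x - s *: y)) (- 'D_y phi (x - s *: y)).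
  have [sp _] := tp; have [_ dp _] := smoothP sp.
  have H : is_derive (x + (- s) *: y) y phi ('D_y phi (x + (- s) *: y)) by exact: derivableP.
  have H1 := is_derive_line H.
  have H2 : is_derive s (1 : R) (fun s : R => - s) (- 1) by exact: is_deriveNid.
  have := @is_derive1_comp R (fun s => phi (x + s *: y)) (fun s => - s) s _ _ H1 H2.
  rewrite mulrN1 scaleNr; congr (is_derive _ _ _ _).
  by apply/funext => z /=; rewrite scaleNr.
pose f (s : R) (x : pt3 R) : R := g x * phi (x - s *: y).
have pf (s : R) x : is_derive s (1 : R) (f^~ x) (g x * - 'D_y phi (x - s *: y)).
  rewrite /f; have := @is_deriveZ R R R (fun s : R => phi (x - s *: y)) (g x) s 1 _ (dphi s x).
  by [].
have pE (s : R) x : partial1of2 f s x = g x * - 'D_y phi (x - s *: y).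
  by rewrite /partial1of2 derive1E; exact: (@derive_val _ _ _ _ _ _ _ (pf s x)).
have mG : measurable_fun U (fun x => `|g x|) by exact: measurableT_comp.
have lG : in_L2 U (fun x => `|g x|).
  by split => //; apply: le_lt_trans (proj2 lg); apply: N2_le => // x _; rewrite normr_id.
have t1 : `]t - 1, t + 1[%classic t.
  by rewrite /= in_itv/=; apply/andP; split; rewrite ?gtrBl ?ltrDl.
have h2 (s : R) : `]t - 1, t + 1[%classic s -> (@mu3 R).-integrable U (EFin \o f s).
  by move=> _; apply: (in_L2_integrable mU lg); exact: test_L2 (tps s).
have h3 (s : R) x : `]t - 1, t + 1[%classic s -> U x -> derivable (f^~ x) s 1.
  by move=> _ _; exact: (@ex_derive _ _ _ _ _ _ _ (pf s x)).
have h4 x : 0 <= M * `|g x| by rewrite mulr_ge0// ltW.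
have h5 : (@mu3 R).-integrable U (EFin \o (fun x => M * `|g x|)).
  exact: (in_L2_integrable mU (in_L2_cst M mU fU) lG).
have h6 (s : R) x : `]t - 1, t + 1[%classic s -> U x -> `|partial1of2 f s x| <= M * `|g x|.
  by move=> _ _; rewrite pE normrM normrN mulrC ler_wpM2r.
have H := @cvg_differentiation_under_integral R _ _ (@mu3 R) f U mU t (t - 1) (t + 1)
  t1 h2 h3 (fun x => M * `|g x|) h4 h5 h6.
have E : (\int[@mu3 R]_(x in U) partial1of2 f t x)%R = - ip U g (fun x => 'D_y phi (x - t *: y)).
  rewrite /Rintegral; under eq_integral do rewrite pE.
  rewrite -[LHS]/(ip U g (fun x => - 'D_y phi (x - t *: y))).
  have lD : in_L2 U (fun x => 'D_y phi (x - t *: y)).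
    by apply: (@test_L2 _ setT) => //; exact: test_translate tDp.
  rewrite ipC [in RHS]ipC.
  transitivity (ip U (fun x => (-1) * 'D_y phi (x - t *: y)) g); last by rewrite ipZl// mulN1r.
  by apply: ip_eq => x _; rewrite mulN1r.
split.
  apply/cvg_ex; exists (- ip U g (fun x => 'D_y phi (x - t *: y))).
  rewrite -E; apply: cvg_trans H; apply: near_eq_cvg; apply: nearW => h /=.
  by rewrite [h *: 1]mulr1.
rewrite /derive; apply: cvg_lim => //.
rewrite -E; apply: cvg_trans H; apply: near_eq_cvg; apply: nearW => h /=.
by rewrite [h *: 1]mulr1.
Qed.

Lemma wderiv1P U v u g : measurable U -> is_wderiv U [:: v] u g <->
  [/\ in_L2 U u, in_L2 U g & forall phi, test_function U phi ->
     ip U u ('D_v phi) = - ip U g phi].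
Proof.
move=> mU.
have E phi : in_L2 U u -> in_L2 U g -> test_function U phi ->
  (\int[leb3]_(x in U) (u x * iter_deriv [:: v] phi x)%R%:E =
     ((-1) ^+ size [:: v])%:E * \int[leb3]_(x in U) (g x * phi x)%R%:E)%E <->
  ip U u ('D_v phi) = - ip U g phi.
  move=> lu lg tp; rewrite /= expr1.
  have E1 := ipE mU lu (test_L2 mU (test_D v tp)).
  have E2 := ipE mU lg (test_L2 mU tp).
  split=> H.
    apply: EFin_inj; rewrite -E1 EFinN -mulN1e -E2; exact: H.
  transitivity (ip U u ('D_v phi))%:E; first exact: E1.
  transitivity ((-1)%:E * (ip U g phi)%:E)%E; last by congr (_ * _)%E; exact: esym E2.
  by rewrite H EFinN -EFinM mulN1r.
split=> -[lu lg H]; split => // phi tp; apply/E => //; exact: H.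
Qed.

Lemma wderiv_sub U A vs u g : measurable U -> measurable A -> A `<=` U ->
  is_wderiv U vs u g -> is_wderiv A vs u g.
Proof.
move=> mU mA AU [lu lg H]; split; try exact: (in_L2_sub mA mU AU).
move=> phi tp; have tpU := test_sub AU tp.
have [sp [K [cK KA p0]]] := tp.
have tA (n : nat) (ws : seq (pt3 R)) : test_function A (iter_deriv ws phi).
  by elim: ws => [|w ws IH]; [exact: tp|exact: (test_D w IH)].
have z0 psi : test_function A psi -> forall f x, U x -> ~ A x -> (f x * psi x)%:E = 0%E.
  by move=> [_ [L [_ LA l0]]] f x _ Ax; rewrite l0 ?mulr0// => /LA.
have := H phi tpU.
have E1 := integral_support AU (z0 _ (tA 0%N vs) u).
have E2 := integral_support AU (z0 _ tp g).
move=> E0; apply: etrans (esym E1) _; apply: etrans E0 _.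
by congr (_ * _)%E; exact: E2.
Qed.

Lemma pt3_eq x y : x.1.1 = y.1.1 -> x.1.2 = y.1.2 -> x.2 = y.2 -> x = y.
Proof. by case: x y => -[? ?] ? [[? ?] ?] /= -> -> ->. Qed.

Lemma derive_basis phi y x : smooth phi ->
  'D_y phi x = \sum_(i < 3) dot y (basis3 i) * 'D_(basis3 i) phi x.
Proof.
move=> sp.
have C1 := smooth_C1 sp.
have E : y = 1 *: (y.1.1 *: basis3 0 + y.1.2 *: basis3 1) + y.2 *: basis3 2%:R.
  by apply: pt3_eq; rewrite /basis3 /= /GRing.scale/=; ring.
rewrite {1}E (derive_lin _ _ _ _ openT I C1) mul1r (derive_lin _ _ _ _ openT I C1).
rewrite !big_ord_recl big_ord0 addr0 addrA /dot /=.
have -> : lift ord0 ord0 = 1 :> 'I_3 by exact/val_inj.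
have -> : lift ord0 (lift ord0 ord0) = 2%:R :> 'I_3 by exact/val_inj.
by congr (_ * _ + _ * _ + _ * _); rewrite /basis3 /= ?(mulr0, mulr1, add0r, addr0).
Qed.

Lemma sum_CS (a b : 'I_3 -> R) :
  (\sum_i a i * b i) ^+ 2 <= (\sum_i a i ^+ 2) * (\sum_i b i ^+ 2).
Proof.
rewrite !big_ord_recl !big_ord0 !addr0.
move: (a _) (a _) (a _) (b _) (b _) (b _) => a1 a2 a3 b1 b2 b3.
have := sqr_ge0 (a1 * b2 - a2 * b1); have := sqr_ge0 (a1 * b3 - a3 * b1).
have := sqr_ge0 (a2 * b3 - a3 * b2); nra.
Qed.

Lemma dot_basis_sum y : \sum_i dot y (basis3 i) ^+ 2 = dot y y.
Proof.
rewrite !big_ord_recl big_ord0 addr0 /dot /basis3/= !expr2; ring.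
Qed.

Lemma ip_sum U (f : 'I_3 -> pt3 R -> R) g (c : 'I_3 -> R) : measurable U -> in_L2 U g ->
  (forall i, in_L2 U (f i)) ->
  ip U g (fun x => \sum_i c i * f i x) = \sum_i c i * ip U g (f i).
Proof.
move=> mU lg lf; rewrite !big_ord_recl big_ord0 addr0.
under [X in ip U g X]eq_fun do rewrite !big_ord_recl big_ord0 addr0.
have Z i : in_L2 U (fun x => c i * f i x) by exact: in_L2Z.
rewrite ipC ipDl//; last exact: in_L2D.
by rewrite ipDl// !ipZl// ![ip U _ g]ipC.
Qed.

(* Against a test function, the translate by [t y] has derivative [ip] of the
   directional derivative, so the mean value theorem and duality apply. *)
Lemma N2_translate U A g (dg : 'I_3 -> pt3 R -> R) y : open U -> (mu3 U < +oo)%E ->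
  open A -> A `<=` U -> (forall x (t : R), A x -> 0 <= t <= 1 -> U (x + t *: y)) ->
  (forall i, is_wderiv U [:: basis3 i] g (dg i)) ->
  (N2 A (fun x => g (x + y) - g x)%R <= (dot y y)%:E * \sum_i N2 U (dg i))%E.
Proof.
move=> oU fU oA AU AyU wg.
have mU := open_measurable3 oU; have mA := open_measurable3 oA.
have wgP i := (wderiv1P (basis3 i) g (dg i) mU).1 (wg i).
have lg : in_L2 U g by case: (wgP 0).
have ldg i : in_L2 U (dg i) by case: (wgP i).
have fA : (mu3 A < +oo)%E by apply: le_lt_trans fU; apply: le_measure; rewrite ?inE.
(* Extension by zero makes the change of variables available on the whole space. On [A] both [x] and
   [x + y] lie in [U], so the truncation is not seen there. *)
pose gU := g \_ U.
have gUE x : U x -> gU x = g x by move=> Ux; rewrite /gU patchE mem_set.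
have mgU : measurable_fun setT gU by apply/(measurable_restrictT g mU); case: lg.
have lgU : in_L2 setT gU.
  split => //; rewrite -[X in (X < _)%E]/(N2 setT gU) /N2 (@integral_support _ _ U)//.
    by have [] := @in_L2_eq _ U g gU (fun x xU => esym (gUE x (set_mem xU))) lg.
  by move=> x _ Ux; rewrite /gU patchE memNset// expr0n.
have lgy : in_L2 setT (fun x => gU (x + y)).
  split; first exact: (measurableT_comp mgU (measurable_shift3 y)).
  have := @integral_shift_signed y (fun x => ((gU x) ^+ 2)%:E) (measurable_sq mgU).
  by move=> E; rewrite -[X in (X < _)%E]/(\int3_x ((gU (x + y)) ^+ 2)%:E)%E E; case: lgU.
have Ay x : A x -> U (x + y) by move=> /(AyU x 1); rewrite scale1r ler01 lexx; apply.
have EA : {in A, (fun x => gU (x + y) - gU x) =1 (fun x => g (x + y) - g x)}.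
  by move=> x /set_mem Ax; rewrite !gUE//; [exact: AU|exact: Ay].
rewrite -(N2_eq EA).
pose S := \sum_i ip U (dg i) (dg i).
have S0 : 0 <= S by apply: sumr_ge0 => i _; exact: ip_ge0.
have -> : (\sum_i N2 U (dg i) = S%:E)%E.
  by rewrite /S -sumEFin; apply: eq_bigr => i _; rewrite N2_ip.
have y0 : 0 <= dot y y by rewrite -dot_basis_sum; apply: sumr_ge0 => i _; exact: sqr_ge0.
have lA f : in_L2 setT f -> in_L2 A f by exact: in_L2_sub.
rewrite -EFinM; apply: (L2_dual oA fA).
- by apply: in_L2B => //; exact: lA.
- exact: mulr_ge0.
move=> phi tp; rewrite ipBl//; try exact: lA; last exact: test_L2 tp.
have tpT := test_sub (@subsetT _ A) tp; have [sp _] := tp.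
have mp := test_measurable tp.
have p0 x : ~ A x -> phi x = 0 by case: tp => _ [K [_ KA h]] Ax; apply: h => /KA.
have suppA h : ip A h phi = ip setT h phi.
  by apply/esym; apply: ip_support => // x _; exact: p0.
pose F (s : R) := ip U g (fun x => phi (x - s *: y)).
have E1 : ip A (fun x => gU (x + y)) phi = F 1.
  rewrite suppA ip_shift// /F scale1r (@ip_support setT U)//.
    by apply: ip_eq => x xU; rewrite gUE//; exact: set_mem.
  by move=> x _ Ux; apply: p0 => /Ay; rewrite subrK.
have E0 : ip A gU phi = F 0.
  rewrite /F; under [X in ip U g X]eq_fun do rewrite scale0r subr0.
  rewrite (@ip_support U A)//; last by move=> x _ /p0.
  by apply: ip_eq => x xA; rewrite gUE//; apply: AU; exact: set_mem.
rewrite E1 E0.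
have dF (s : R) : is_derive s (1 : R) F (- ip U g (fun x => 'D_y phi (x - s *: y))).
  exact: is_derive_ip_translate.
have [|s s01 ->] := @MVT_segment R F (fun s => - ip U g (fun x => 'D_y phi (x - s *: y))) 0 1 ler01 (fun s _ => dF s).
  by apply: derivable_within_continuous => s _; exact: (@ex_derive _ _ _ _ _ _ _ (dF s)).
rewrite subr0 mulr1.
pose ps x := phi (x - s *: y).
have tps : test_function U ps.
  by apply: test_translate tp => x Ax; apply: AyU => //; move: s01; rewrite in_itv.
have -> : (fun x => 'D_y phi (x - s *: y)) =
    (fun x => \sum_i dot y (basis3 i) * 'D_(basis3 i) ps x).
  apply/funext => x; rewrite derive_basis//; apply: eq_bigr => i _.
  by rewrite derive_translate.
rewrite ip_sum//; last by move=> i; apply: test_L2 (test_D _ tps).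
rewrite sqrrN; apply: le_trans (sum_CS _ _) _.
rewrite dot_basis_sum -mulrA ler_wpM2l//.
have -> : ip A phi phi = ip U ps ps.
  have -> : ip U ps ps = ip setT ps ps.
    by apply/esym; apply: ip_support => // x _ Ux; case: tps => _ [K [_ KU h]]; apply: h => /KU.
  rewrite suppA; apply: esym; apply: etrans (esym (@ip_shift ps phi (s *: y) _ _)) _.
  - exact: test_measurable (test_sub (@subsetT _ U) tps).
  - exact: mp.
  - by apply: ip_eq => x _; rewrite /ps addrK.
rewrite /S mulr_suml; apply: ler_sum => i _.
have [_ _ /(_ _ tps) ->] := wgP i.
by rewrite sqrrN; apply: ip_CS => //; exact: test_L2 tps.
Qed.

End Translation.

(** * The Poincare and Deny-Lions inequalities *)

Section Poincare.
Variable R : realType.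
Implicit Types (V Q : set (pt3 R)) (x y z q : pt3 R).

(** Otherwise [S - M] would be positive on [Q] with a nonpositive integral, hence zero almost
    everywhere, although [Q] has positive measure. *)
Lemma exists_le_average Q (S : pt3 R -> \bar R) (M : R) : measurable Q ->
  (0 < mu3 Q)%E -> (mu3 Q < +oo)%E -> 0 <= M -> measurable_fun Q S ->
  (forall q, 0 <= S q)%E -> (\int3_(q in Q) S q <= M%:E * mu3 Q)%E ->
  exists2 q, Q q & (S q <= M%:E)%E.
Proof.
move=> mQ Q0 Qoo M0 mS S0 H; apply: contrapT => C.
have lt q : Q q -> (M%:E < S q)%E.
  by move=> Qq; rewrite ltNge; apply/negP => h; apply: C; exists q.
have mD : measurable_fun Q (fun q => S q - M%:E)%E by apply: emeasurable_funB.
have D0 q : Q q -> (0 <= S q - M%:E)%E by move=> /lt/ltW; rewrite sube_ge0.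
have : (\int3_(q in Q) S q = \int3_(q in Q) (S q - M%:E) + M%:E * mu3 Q)%E.
  rewrite -integral_cst// -ge0_integralD//.
  by apply: eq_integral => q _; rewrite subeK.
have Qfin : mu3 Q \is a fin_num by rewrite ge0_fin_numE.
move=> E; move: H; rewrite E -[leRHS]add0e leeD2rE; last by rewrite fin_numM.
move=> I0; have {}I0 : (\int3_(q in Q) `|(S q - M%:E)|)%E = 0%E.
  apply/eqP; rewrite eq_le integral_ge0 ?andbT//.
  apply: le_trans I0; rewrite le_eqVlt; apply/orP; left; apply/eqP.
  by apply: eq_integral => q /set_mem Qq; rewrite gee0_abs ?D0.
have /(ae_eq_integral_abs (@mu3 R) mQ mD) [N [mN N0 QN]] := I0.
have : (mu3 Q <= mu3 N)%E.
  apply: le_measure; rewrite ?inE// => q Qq; apply: QN => /= /(_ Qq) h.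
  have := lt q Qq; rewrite -sube_gt0 ?h ?ltxx//.
by rewrite N0 leNgt Q0.
Qed.

Lemma measurable_add3 : measurable_fun setT (fun p : (pt3 R * pt3 R)%type => p.2 + p.1).
Proof.
have m1 : measurable_fun setT (fun p : (pt3 R * pt3 R)%type => p.1) by exact: measurable_fst.
have m2 : measurable_fun setT (fun p : (pt3 R * pt3 R)%type => p.2) by exact: measurable_snd.
have c (f : pt3 R -> R) : measurable_fun setT f ->
    measurable_fun setT (fun p : (pt3 R * pt3 R)%type => f p.2 + f p.1).
  by move=> mf; apply: measurable_funD; exact: measurableT_comp.
apply/measurable_fun_pairP; split; first apply/measurable_fun_pairP; try split.
- by apply: (c (fst \o fst)); apply: measurableT_comp => //; exact: measurable_fst.
- apply: (c (snd \o fst)); apply: (measurableT_comp measurable_snd); exact: measurable_fst.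
- by apply: (c snd); exact: measurable_snd.
Qed.

Lemma dot_le_norm y (L : R) : `|y| < L -> dot y y <= 3 * L ^+ 2.
Proof.
rewrite prod_normE gt_max prod_normE gt_max -andbA => /and3P[h1 h2 h3].
have s (a : R) : `|a| < L -> a * a <= L ^+ 2.
  move=> h; have L0 : 0 <= L by exact: le_trans (normr_ge0 a) (ltW h).
  by rewrite -expr2 -(real_normK (num_real a)) ler_sqr ?nnegrE// ltW.
by rewrite /dot; have := s _ h1; have := s _ h2; have := s _ h3; lra.
Qed.

Definition star_wrt V Q := forall x q (t : R), V x -> Q q -> 0 <= t <= 1 ->
  V (x + t *: (q - x)).

Lemma measurable_slice x (H : (pt3 R * pt3 R)%type -> \bar R) : measurable_fun setT H ->
  measurable_fun setT (fun q => H (x, q)).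
Proof. by move=> mH; apply: (measurableT_comp mH); exact: measurable_pair1. Qed.

(** Tonelli and the substitution [q = y + x]: the double integral becomes an integral over
    displacements [y], and each slice is a translation difference. *)
Lemma integral_shift_swap (W : (pt3 R * pt3 R)%type -> \bar R) :
  measurable_fun setT W -> (forall p, 0 <= W p)%E ->
  measurable_fun setT (fun y => \int3_x W (x, (y + x)%R))%E /\
  (\int3_q (\int3_x W (x, q)) = \int3_y (\int3_x W (x, (y + x)%R)))%E.
Proof.
move=> mW W0.
have mpair : measurable_fun setT (fun p : (pt3 R * pt3 R)%type => (p.1, p.2 + p.1)).
  by apply/measurable_fun_pairP; split; [exact: measurable_fst|exact: measurable_add3].
pose W' (p : pt3 R * pt3 R) : \bar R := W (p.1, p.2 + p.1).
have mW' : measurable_fun setT W' by exact: (measurableT_comp mW mpair).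
split.
  exact: (@measurable_fun_fubini_tonelli_G _ _ _ _ R (@mu3 R) W' mW' (fun p => W0 _)).
rewrite -(@fubini_tonelli _ _ _ _ R (@mu3 R) (@mu3 R) W mW W0).
rewrite -(@fubini_tonelli _ _ _ _ R (@mu3 R) (@mu3 R) W' mW' (fun p => W0 _)).
apply: eq_integral => x _.
by rewrite -(@integral_shift3 R x (fun q => W (x, q)))//; exact: measurable_slice.
Qed.

Lemma double_integral_le (W : (pt3 R * pt3 R)%type -> \bar R) (K : R) (B : set (pt3 R)) :
  measurable_fun setT W -> (forall p, 0 <= W p)%E -> 0 <= K -> measurable B ->
  (forall y, \int3_x W (x, (y + x)%R) <= K%:E * (\1_B y)%:E)%E ->
  (\int3_q (\int3_x W (x, q)) <= K%:E * mu3 B)%E.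
Proof.
move=> mW W0 K0 mB H.
have [mW' ->] := integral_shift_swap mW W0.
have mI : measurable_fun setT (fun y : pt3 R => (\1_B y)%:E : \bar R).
  by apply/measurable_EFinP; exact: measurable_indic.
have mI0 (y : pt3 R) : setT y -> (0 <= (\1_B y : R)%:E)%E by rewrite lee_fin indicE.
apply: (@le_trans _ _ (\int3_y (K%:E * (\1_B y)%:E)))%E.
  apply: ge0_le_integral => //.
  - by move=> y _; apply: integral_ge0.
  - exact: measurable_funeM.
have -> : (\int3_y (K%:E * (\1_B y)%:E) = K%:E * \int3_y (\1_B y)%:E)%E.
  by apply: ge0_integralZl => //; rewrite lee_fin.
by rewrite integral_indic// setIT.
Qed.

(** The factor [(L / rho)^3] of the Poincare constant is the ratio of the volume of the ball of
    displacements to that of the ball over which [q] is averaged. *)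
Lemma volume_scaling (L rho T : R) : 0 < rho ->
  3 * L ^+ 2 * T * (L *+ 2) ^+ 3 = 3 * L ^+ 2 * (L / rho) ^+ 3 * T * (rho *+ 2) ^+ 3.
Proof. by move=> rho0; rewrite -(mulr_natl L) -(mulr_natl rho); field; rewrite gt_eqF. Qed.

Section PoincareProof.
Variables (m : nat) (V : set (pt3 R)) (z : pt3 R) (rho L : R).
Variables (g : 'I_m -> pt3 R -> R) (gg : 'I_m -> 'I_3 -> pt3 R -> R).
Hypotheses (oV : open V) (fV : (mu3 V < +oo)%E) (rho0 : 0 < rho) (L0 : 0 < L).
Hypotheses (QV : ball z rho `<=` V) (star : star_wrt V (ball z rho)).
Hypothesis dist : forall x q, V x -> ball z rho q -> `|q - x| < L.
Hypothesis wg : forall k i, is_wderiv V [:: basis3 i] (g k) (gg k i).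

Local Notation Q := (ball z rho).
Let G k := g k \_ V.
Let w k x q : R := \1_V x * \1_Q q * (G k x - G k q) ^+ 2.

Let w_ge0 k x q : 0 <= w k x q.
Proof. by rewrite /w mulr_ge0 ?sqr_ge0// mulr_ge0// indicE. Qed.

Let w_out k x q : ~ (V x /\ Q q) -> w k x q = 0.
Proof.
rewrite /w !indicE => H; have [Vx|Vx] := pselect (V x); last by rewrite memNset// !mul0r.
by rewrite [q \in _]memNset ?mulr0 ?mul0r// => Qx; exact: H.
Qed.

Let w_in k x q : V x -> Q q -> w k x q = (g k x - g k q) ^+ 2.
Proof.
move=> Vx Qq; rewrite /w !indicE !mem_set//= !mul1r /G !patchE !mem_set//.
exact: QV.
Qed.

Let mV : measurable V. Proof. exact: open_measurable3. Qed.

Let measurable_w k : measurable_fun setT (fun p : (pt3 R * pt3 R)%type => w k p.1 p.2).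
Proof.
have mG : measurable_fun setT (G k).
  by apply/(measurable_restrictT (g k) mV); case: (wg k 0) => -[].
have mI (D : set (pt3 R)) : measurable D -> measurable_fun setT (\1_D : pt3 R -> R).
  by move=> mD; exact: measurable_indic.
apply: measurable_funM; [apply: measurable_funM|].
- by apply: (measurableT_comp (mI _ mV)); exact: measurable_fst.
- by apply: (measurableT_comp (mI _ (measurable_ball3 _ _))); exact: measurable_snd.
- apply: measurable_funX; apply: measurable_funB.
  + by apply: (measurableT_comp mG); exact: measurable_fst.
  + by apply: (measurableT_comp mG); exact: measurable_snd.
Qed.

(** The family is averaged as a whole, so that a single point [q] serves all the functions [g k]. *)
Let W (p : pt3 R * pt3 R) : \bar R := (\sum_(k < m) (w k p.1 p.2)%:E)%E.

Let W_ge0 p : (0 <= W p)%E.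
Proof. by apply: sume_ge0 => k _; rewrite lee_fin. Qed.

Let measurable_W : measurable_fun setT W.
Proof. by apply: emeasurable_sum => k; apply/measurable_EFinP; exact: measurable_w. Qed.

Let T := \sum_k \sum_i ip V (gg k i) (gg k i).

Let TE : (\sum_k \sum_i N2 V (gg k i) = T%:E)%E.
Proof.
rewrite /T -sumEFin; apply: eq_bigr => k _; rewrite -sumEFin.
by apply: eq_bigr => i _; rewrite N2_ip//; case: (wg k i).
Qed.

Let T_ge0 : 0 <= T.
Proof. by apply: sumr_ge0 => k _; apply: sumr_ge0 => i _; exact: ip_ge0. Qed.

Let integral_sum_w (A : set (pt3 R)) (f : 'I_m -> pt3 R -> R) :
  measurable A -> (forall k, measurable_fun A (f k)) ->
  (forall k x, A x -> 0 <= f k x) ->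
  (\int3_(x in A) (\sum_k (f k x)%:E) = \sum_k \int3_(x in A) (f k x)%:E)%E.
Proof.
move=> mA mf f0; rewrite ge0_integral_sum//.
by move=> k; apply/measurable_EFinP; exact: mf.
Qed.

(** For a fixed displacement the admissible [x] form the open set of points of [V] with [y + x] in
    the ball; star-shapedness keeps the segment from [x] to [y + x] in [V], as the translation
    estimate requires. Displacements of length [L] or more do not occur. *)
Let slice_le y :
  (\int3_x W (x, (y + x)%R) <= (3 * L ^+ 2 * T)%:E * (\1_(ball (0 : pt3 R) L) y)%:E)%E.
Proof.
pose A := [set x | V x /\ Q (y + x)].
have oA : open A.
  apply: openI; first exact: oV.
  have : continuous (fun x : pt3 R => y + x).
    by move=> x; apply: cvgD; [exact: cvg_cst|exact: cvg_id].
  by move/continuousP; apply; exact: ball_open.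
have mA := open_measurable3 oA.
have AV : A `<=` V by move=> x [].
have -> : (\int3_x W (x, (y + x)%R) = \sum_k N2 A (fun x => g k (x + y) - g k x)%R)%E.
  rewrite (@integral_support _ setT A)//; last first.
    by move=> x _ Ax; rewrite /W big1// => k _; rewrite w_out.
  rewrite integral_sum_w//; last first.
    move=> k; apply: (measurable_funS measurableT) => //.
    have mpair : measurable_fun setT (fun x : pt3 R => (x, y + x)).
      apply/measurable_fun_pairP; split; first exact: measurable_id.
      have := measurable_shift3 y; apply: eq_measurable_fun => x _ /=.
      by rewrite addrC.
    exact: (measurableT_comp (measurable_w k) mpair).
  apply: eq_bigr => k _; apply: eq_integral => x /set_mem [Vx Qx].
  by rewrite /= w_in// [y + x]addrC -sqrrN opprB.
have [yL|yL] := pselect (ball (0 : pt3 R) L y); last first.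
  rewrite indicE memNset// mule0 big1// => k _.
  have -> : A = set0; last by rewrite /N2 integral_set0.
  apply/seteqP; split => // x [Vx Qx]; apply: yL.
  by rewrite -ball_normE/= sub0r normrN; have := dist Vx Qx; rewrite addrK.
rewrite indicE mem_set// mule1.
apply: (@le_trans _ _ (\sum_k (dot y y)%:E * \sum_i N2 V (gg k i)))%E.
  apply: lee_sum => k _; apply: (N2_translate oV fV oA AV _ (wg k)) => x t [Vx Qx] t01.
  by have := star Vx Qx t01; rewrite addrK.
rewrite -ge0_sume_distrr; last by move=> k _; apply: sume_ge0 => i _; exact: N2_ge0.
rewrite TE -EFinM lee_fin; apply: ler_wpM2r; first exact: T_ge0.
by apply: dot_le_norm; move: yL; rewrite -ball_normE/= sub0r normrN.
Qed.

(* The integral over [V x Q] of [(g x - g q)^2] is bounded slice by slice, for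
   a fixed displacement [x - q], by the translation estimate. *)
Lemma poincare : exists2 q, Q q &
   (\sum_k N2 V (fun x => g k x - g k q)%R <=
     (3 * L ^+ 2 * (L / rho) ^+ 3)%:E * \sum_k \sum_i N2 V (gg k i))%E.
Proof.
have mQ := @measurable_ball3 R z rho.
have K0 : 0 <= 3 * L ^+ 2 * T by rewrite mulr_ge0// mulr_ge0// sqr_ge0.
have total := double_integral_le measurable_W W_ge0 K0 (measurable_ball3 0 L) slice_le.
pose S q := (\int3_x W (x, q))%E.
have SE q : Q q -> S q = (\sum_k N2 V (fun x => g k x - g k q)%R)%E.
  move=> Qq; rewrite /S (@integral_support _ setT V)//; last first.
    by move=> x _ Vx; rewrite /W big1// => k _; rewrite w_out// => -[].
  rewrite integral_sum_w//; last first.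
    move=> k; apply: (measurable_funS measurableT) => //.
    by apply: (measurableT_comp (measurable_w k)); exact: measurable_pair2.
  apply: eq_bigr => k _; apply: eq_integral => x /set_mem Vx.
  by rewrite /= w_in.
have mS : measurable_fun setT S.
  exact: (@measurable_fun_fubini_tonelli_G _ _ _ _ R (@mu3 R) W measurable_W W_ge0).
have S0 q : (0 <= S q)%E by apply: integral_ge0 => x _; exact: W_ge0.
have r2 : 0 < rho *+ 2 by rewrite mulrn_wgt0.
have rw : 0 <= rho by exact: ltW.
have [q Qq Sq] : exists2 q, Q q & (S q <= (3 * L ^+ 2 * (L / rho) ^+ 3 * T)%:E)%E.
  have volQ : mu3 Q = ((rho *+ 2) ^+ 3)%:E by exact: mu3_ball.
  apply: (exists_le_average mQ _ _ _ _ S0).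
  - by rewrite volQ lte_fin exprn_gt0.
  - by rewrite volQ ltry.
  - apply: mulr_ge0; last exact: T_ge0.
    by apply: mulr_ge0; [rewrite mulr_ge0// sqr_ge0|rewrite exprn_ge0// divr_ge0// ltW].
  - exact: measurable_funS mS.
  apply: (@le_trans _ _ (\int3_q S q)%E).
    apply: ge0_subset_integral; [exact: mQ|exact: measurableT|exact: mS| |exact: subsetT].
    by move=> q _; exact: S0.
  apply: le_trans total _; rewrite volQ mu3_ball ?(ltW L0)// -!EFinM lee_fin.
  by rewrite -(volume_scaling _ _ rho0).
exists q; first exact: Qq.
rewrite -SE; last exact: Qq.
apply: le_trans Sq _.
by rewrite TE -EFinM.
Qed.

End PoincareProof.

End Poincare.

(** * Weak derivatives of smooth and affine functions *)

Section SmoothWeak.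
Variable R : realType.
Implicit Types (U V : set (pt3 R)) (x y z q v : pt3 R) (f g phi : pt3 R -> R).

(** Products alone are not stable under differentiation; by the Leibniz rule finite sums of products
    are. *)
Inductive product_sum : (pt3 R -> R) -> Prop :=
| Product_sum_mul f g : smooth f -> smooth g -> product_sum (fun x => f x * g x)
| Product_sum_add f g : product_sum f -> product_sum g -> product_sum (fun x => f x + g x).

Lemma smoothM f g : smooth f -> smooth g -> smooth (fun x => f x * g x).
Proof.
move=> sf sg; apply: (smooth_coind _ (Product_sum_mul sf sg)).
move=> {f g sf sg} h; elim=> {h} [f g sf sg|f g _ [cf df Df] _ [cg dg Dg]].
  have [cf df Df] := smoothP sf; have [cg dg Dg] := smoothP sg; split.
  - by move=> x; apply: cvgM; [exact: cf|exact: cg].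
  - by move=> x v; exact: derivableM.
  - move=> v; have -> : 'D_v (fun x => f x * g x) = (fun x => f x * 'D_v g x + g x * 'D_v f x).
      by apply/funext => x; exact: deriveM.
    by apply: Product_sum_add; [exact: (Product_sum_mul sf (Dg v))|exact: (Product_sum_mul sg (Df v))].
split.
- by move=> x; apply: cvgD; [exact: cf|exact: cg].
- by move=> x v; exact: derivableD.
- move=> v; have -> : 'D_v (fun x => f x + g x) = (fun x => 'D_v f x + 'D_v g x).
    by apply/funext => x; rewrite -deriveD.
  by apply: Product_sum_add; [exact: Df|exact: Dg].
Qed.

(* The integral of a translate is constant, and so has derivative zero. *)
Lemma integral_derive_test U phi v : measurable U -> (mu3 U < +oo)%E ->
  test_function U phi -> ip U (fun=> 1) ('D_v phi) = 0.
Proof.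
move=> mU fU tp; have tpT := test_sub (@subsetT _ U) tp.
have [sp [K [cK KU p0]]] := tp; have [M [M0 KM _]] := bounded_support cK (test_continuous tp) p0.
(* Translates by [s *: v] with [s] of absolute value below 1 keep their support in this larger
   ball. *)
pose r := M + `|v| + 1; have r0 : 0 < r by rewrite /r ltr_wpDl// addr_ge0// ltW.
pose B := ball (0 : pt3 R) r; have mB : measurable B := measurable_ball3 _ _.
have fB : (mu3 B < +oo)%E by rewrite mu3_ball ?ltry// ltW.
have lB : in_L2 B (fun=> 1 : R) by exact: in_L2_cst.
have H := @is_derive_ip_translate R B (fun=> 1) phi v 0 mB fB lB tpT.
pose c := ip setT (fun=> 1) phi.
have mp := test_measurable tp.
have Hc : is_derive (0 : R) (1 : R) (fun s : R => ip B (fun=> 1) (fun x => phi (x - s *: v))) 0.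
  suff FE (s : R) : `|s| < 1 -> ip B (fun=> 1) (fun x => phi (x - s *: v)) = c.
    apply/is_derive_epsP => e e0; exists 1 => // h h0 h1.
    by rewrite add0r [h *: 1]mulr1 !FE ?normr0// subrr mulr0 subr0 normr0 ltW.
  move=> s1.
  rewrite /c -(@ip_support _ setT)//; last first.
    move=> x _ Bx; apply: p0 => /KM; rewrite -ball_normE/= sub0r normrN => h; apply: Bx.
    rewrite /B -ball_normE/= sub0r normrN -(subrK (s *: v) x).
    apply: le_lt_trans (ler_normD _ _) _; rewrite normrZ /r.
    have h2 : `|s| * `|v| <= 1 * `|v| by rewrite ler_wpM2r// ltW.
    by rewrite -addrA; apply: ltr_leD => //; rewrite mul1r in h2; apply: le_trans h2 _; rewrite lerDl.
  by rewrite -(@ip_shift _ (fun=> 1)).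
have := @derive_val _ _ _ _ _ _ _ H; rewrite (@derive_val _ _ _ _ _ _ _ Hc).
under [X in ip B _ X]eq_fun do rewrite scale0r subr0.
move=> /esym/eqP; rewrite oppr_eq0 => /eqP E.
have tD := test_D v tp.
rewrite -(@ip_support _ setT)//; last by move=> x _; case: tD => _ [K' [_ K'U h]] Ux; apply: h => /K'U.
rewrite (@ip_support _ setT B)// => x _ Bx.
suff : is_derive x v phi 0 by move=> Hx; exact: (@derive_val _ _ _ _ _ _ _ Hx).
have oK : open (~` K) by apply: closed_openC; apply: compact_closed.
have tDK : test_function (ball (0 : pt3 R) M) ('D_v phi).
  by apply: test_D; split => //; exists K.
have MB : ball (0 : pt3 R) M `<=` B.
  by apply: le_ball; rewrite /r -addrA lerDl addr_ge0.
case: tDK => _ [K' [_ K'M h]]; have <- : 'D_v phi x = 0 by apply: h => /K'M/MB.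
have [_ dp _] := smoothP sp; exact: derivableP.
Qed.

(** Integration by parts: the product of [f] with a test function is a test function, and the
    integral of its derivative vanishes. Boundedness of [U] puts [f] and its derivatives in L^2. *)
Lemma wderiv_smooth U f v : measurable U -> (mu3 U < +oo)%E ->
  (exists M : R, U `<=` ball 0 M) -> smooth f -> is_wderiv U [:: v] f ('D_v f).
Proof.
move=> mU fU [M UM] sf; have [cf df Df] := smoothP sf.
have lU h : continuous h -> in_L2 U h.
  move=> ch; have M1 : 0 < `|M| + 1 by rewrite ltr_wpDl.
  have cB : compact (closed_ball (0 : pt3 R) (`|M| + 1)) by exact: compact_closed_ball3.
  have : compact (h @` closed_ball (0 : pt3 R) (`|M| + 1)).
    by apply: continuous_compact => //; exact: continuous_subspaceT.
  move=> /compact_bounded[N [_ HN]].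
  apply: (@in_L2_bounded _ _ _ (N + 1)) => //.
    by apply: (measurable_funS measurableT) => //; exact: continuous_measurable3.
  move=> x Ux; apply: (HN (N + 1)); first by rewrite ltrDl.
  exists x => //; apply: subset_closed_ball; apply: le_ball (UM x Ux).
  by rewrite (le_trans (ler_norm M))// lerDl.
have lf := lU _ cf; have [cDf _ _] := smoothP (Df v); have lDf := lU _ cDf.
apply/(wderiv1P _ _ _ mU); split => // phi tp.
have [sp [K [cK KU p0]]] := tp; have [cp dp Dp] := smoothP sp.
pose Phi x := f x * phi x.
have tPhi : test_function U Phi.
  split; first exact: smoothM.
  by exists K; split => // x Kx; rewrite /Phi p0// mulr0.
have := integral_derive_test v mU fU tPhi.
have -> : 'D_v Phi = (fun x => f x * 'D_v phi x + phi x * 'D_v f x).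
  by apply/funext => x; exact: deriveM.
have l1 : in_L2 U (fun=> 1 : R) by exact: in_L2_cst.
have tD := test_D v tp.
have lc (h psi : pt3 R -> R) : continuous h -> test_function U psi -> in_L2 U (fun x => h x * psi x).
  move=> ch tpsi; have cpsi := test_continuous tpsi; case: tpsi => _ [K' [cK' _ h0]].
  apply: (in_L2_support mU cK'); last by move=> x /h0 ->; rewrite mulr0.
  by move=> x; apply: cvgM; [exact: ch|exact: cpsi].
rewrite ipC ipDl//; last 2 first.
- exact: lc.
- by have := lc _ _ cDf tp; apply: in_L2_eq => x _; rewrite mulrC.
have E (h psi : pt3 R -> R) : ip U (fun x => h x * psi x) (fun=> 1) = ip U h psi.
  by rewrite /ip; under eq_integral do rewrite mulr1.
rewrite E [X in _ + X](_ : _ = ip U ('D_v f) phi).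
  by move/eqP; rewrite addr_eq0 => /eqP.
by rewrite -(E ('D_v f) phi); apply: ip_eq => x _; rewrite mulrC.
Qed.

Lemma wderivB U v u1 g1 u2 g2 : measurable U ->
  is_wderiv U [:: v] u1 g1 -> is_wderiv U [:: v] u2 g2 ->
  is_wderiv U [:: v] (fun x => u1 x - u2 x) (fun x => g1 x - g2 x).
Proof.
move=> mU /(wderiv1P _ _ _ mU)[lu1 lg1 H1] /(wderiv1P _ _ _ mU)[lu2 lg2 H2].
apply/(wderiv1P _ _ _ mU); split; try exact: in_L2B.
move=> phi tp; have lp := test_L2 mU tp; have lD := test_L2 mU (test_D v tp).
by rewrite !ipBl// H1// H2//; ring.
Qed.

Lemma smooth_aff (p : affine) : smooth (aff p : pt3 R -> R).
Proof.
apply: (@smooth_coind _ _ (fun f => exists p : affine, f = aff p)); last by exists p.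
move=> _ [{}p ->].
have isd x v : is_derive x v (aff p) (dot p.1 v).
  apply/is_derive_epsP => e e0; exists 1 => // h h0 _.
  rewrite /aff dotDr dotZr.
  have -> : h^-1 * (dot p.1 x + h * dot p.1 v + p.2 - (dot p.1 x + p.2)) = dot p.1 v.
    by rewrite opprD addrACA subrr addr0 addrAC subrr add0r mulKf.
  by rewrite subrr normr0 ltW.
split.
- by move=> x; apply: cvgD; [exact: continuous_dot|exact: cvg_cst].
- by move=> x v; exact: (@ex_derive _ _ _ _ _ _ _ (isd x v)).
- move=> v; exists (0, dot p.1 v); apply/funext => x.
  by rewrite (@derive_val _ _ _ _ _ _ _ (isd x v)) /aff /dot /= !mul0r !addr0 add0r.
Qed.

Lemma derive_aff (p : affine) x v : 'D_v (aff p : pt3 R -> R) x = dot p.1 v.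
Proof.
have : is_derive x v (aff p) (dot p.1 v).
  apply/is_derive_epsP => e e0; exists 1 => // h h0 _.
  rewrite /aff dotDr dotZr.
  have -> : h^-1 * (dot p.1 x + h * dot p.1 v + p.2 - (dot p.1 x + p.2)) = dot p.1 v.
    by rewrite opprD addrACA subrr addr0 addrAC subrr add0r mulKf.
  by rewrite subrr normr0 ltW.
by move=> H; exact: (@derive_val _ _ _ _ _ _ _ H).
Qed.

End SmoothWeak.

(** * Affine approximation on star-shaped domains, and bounds for affine functions *)

Section DenyLions.
Variable R : realType.
Implicit Types (U V : set (pt3 R)) (x y z q : pt3 R).

(** Second derivatives appear as first weak derivatives of the [g i], so that first-order estimates
    can be applied twice. *)
Definition H2data U (v : pt3 R -> R) (g : 'I_3 -> pt3 R -> R)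
    (gg : 'I_3 -> 'I_3 -> pt3 R -> R) :=
  (forall i, is_wderiv U [:: basis3 i] v (g i)) /\
  (forall i j, is_wderiv U [:: basis3 j] (g i) (gg i j)).

Lemma H2data_sub U V v g gg : measurable U -> measurable V -> V `<=` U ->
  H2data U v g gg -> H2data V v g gg.
Proof. by move=> mU mV VU [H1 H2]; split=> *; exact: (wderiv_sub mU mV VU). Qed.

(** The Poincare inequality for the three [g i] at a common point [q] yields the gradient of [p];
    applied again to [v] minus the linear part, it yields the constant term. Hence the second
    constant is the square of the first. *)
Lemma deny_lions V z (rho L : R) v g gg :
  open V -> (exists M : R, V `<=` ball 0 M) -> 0 < rho -> 0 < L -> ball z rho `<=` V ->
  star_wrt V (ball z rho) ->
  (forall x q, V x -> ball z rho q -> `|q - x| < L) ->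
  H2data V v g gg ->
  exists p : affine,
    (\sum_i N2 V (fun x => g i x - dot p.1 (basis3 i))%R <=
     (3 * L ^+ 2 * (L / rho) ^+ 3)%:E * \sum_i \sum_j N2 V (gg i j))%E /\
    (N2 V (fun x => v x - aff p x)%R <=
     ((3 * L ^+ 2 * (L / rho) ^+ 3) ^+ 2)%:E * \sum_i \sum_j N2 V (gg i j))%E.
Proof.
move=> oV [M VM] rho0 L0 QV star dist [H1 H2].
have mV := open_measurable3 oV.
have fV : (mu3 V < +oo)%E.
  apply: (@le_lt_trans _ _ (mu3 (ball (0 : pt3 R) (`|M| + 1)))); last first.
    by rewrite mu3_ball ?ltry// addr_ge0.
  apply: le_measure; rewrite ?inE//; first exact: measurable_ball3.
  by move=> x /VM; apply: le_ball; rewrite (le_trans (ler_norm M))// lerDl.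
have [q Qq Hq] := poincare oV fV rho0 L0 QV star dist H2.
pose c : pt3 R := (g 0 q, g 1 q, g 2%:R q).
have cE i : dot c (basis3 i) = g i q.
  rewrite /c /dot /basis3 /=; case: i => -[|[|[|//]]] i3 /=;
    rewrite !(mulr0, mulr1, add0r, addr0); congr (g _ q); exact/val_inj.
have H3 (k : 'I_1) i : is_wderiv V [:: basis3 i] (fun x => v x - aff (c, 0) x) (fun x => g i x - dot c (basis3 i)).
  apply: wderivB => //.
  have := wderiv_smooth (basis3 i) mV fV (ex_intro _ M VM) (smooth_aff (c, 0)).
  by have -> : 'D_(basis3 i) (aff (c, 0)) = (fun=> dot c (basis3 i)) by apply/funext => x; exact: derive_aff.
have [q' Qq' Hq'] := @poincare _ 1 V z rho L (fun _ x => v x - aff (c, 0) x)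
   (fun _ i x => g i x - dot c (basis3 i)) oV fV rho0 L0 QV star dist H3.
have K0 : 0 <= 3 * L ^+ 2 * (L / rho) ^+ 3.
  by rewrite mulr_ge0// ?exprn_ge0 ?divr_ge0 ?ltW// mulr_gt0 ?exprn_gt0.
have E1 : (\sum_i N2 V (fun x => g i x - dot c (basis3 i))%R <=
     (3 * L ^+ 2 * (L / rho) ^+ 3)%:E * \sum_i \sum_j N2 V (gg i j))%E.
  by apply: le_trans Hq; apply: lee_sum => i _; rewrite cE.
exists (c, v q' - aff (c, 0) q'); split => //.
rewrite big_ord1 in Hq'; rewrite big_ord1 in Hq'.
rewrite expr2 EFinM -muleA.
apply: (@le_trans _ _ ((3 * L ^+ 2 * (L / rho) ^+ 3)%:E *
     \sum_i N2 V (fun x => g i x - dot c (basis3 i))%R)%E); last exact: lee_wpmul2l.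
apply: le_trans Hq'; rewrite (@N2_eq _ V _ (fun x => v x - aff (c, 0) x - (v q' - aff (c, 0) q')))//.
by move=> x _; rewrite /aff /=; ring.
Qed.

(** The dual of the sup norm carried by the product type: it bounds [dot w x] by [l1norm w] times
    the norm of [x]. *)
Definition l1norm (w : pt3 R) : R := `|w.1.1| + `|w.1.2| + `|w.2|.

Lemma l1norm_ge0 w : 0 <= l1norm w.
Proof. by rewrite /l1norm !addr_ge0. Qed.

Lemma pt3_norm_le x (r : R) : `|x| <= r <-> [/\ `|x.1.1| <= r, `|x.1.2| <= r & `|x.2| <= r].
Proof.
rewrite prod_normE ge_max prod_normE ge_max -andbA; split; first by move/and3P.
by move=> [-> -> ->].
Qed.

Lemma dot_le_l1norm w x : `|dot w x| <= l1norm w * `|x|.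
Proof.
have [h1 h2 h3] := (pt3_norm_le x `|x|).1 (lexx _).
rewrite /dot /l1norm !mulrDl.
apply: le_trans (ler_normD _ _) _; apply: lerD; last by rewrite normrM ler_wpM2l.
by apply: le_trans (ler_normD _ _) _; apply: lerD; rewrite normrM ler_wpM2l.
Qed.

Lemma affB (p : affine) x y : aff p x - aff p y = dot p.1 (x - y).
Proof. by rewrite /aff /dot /=; ring. Qed.

Lemma exists_small_N2 z (rho E : R) f : 0 < rho -> measurable_fun (ball z rho) f ->
  (N2 (ball z rho) f <= E%:E)%E ->
  exists2 x, ball z rho x & f x ^+ 2 <= E / (rho *+ 2) ^+ 3.
Proof.
move=> rho0 mf HE.
have vol : mu3 (ball z rho) = ((rho *+ 2) ^+ 3)%:E by rewrite mu3_ball// ltW.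
have r3 : 0 < (rho *+ 2) ^+ 3 by rewrite exprn_gt0// mulrn_wgt0.
have E0 : 0 <= E by rewrite -lee_fin; apply: le_trans HE; exact: N2_ge0.
have [x Qx hx] : exists2 x, ball z rho x & (((f x) ^+ 2)%:E <= (E / (rho *+ 2) ^+ 3)%:E)%E.
  apply: exists_le_average; first exact: measurable_ball3.
- by rewrite vol lte_fin.
- by rewrite vol ltry.
- by rewrite divr_ge0// ltW.
- exact: measurable_sq.
- by move=> q; rewrite lee_fin sqr_ge0.
- by rewrite vol -EFinM divfK// gt_eqF.
by exists x.
Qed.

Lemma continuous_aff (p : affine) : continuous (aff p : pt3 R -> R).
Proof. by case: (smoothP (smooth_aff p)). Qed.

Lemma measurable_aff (p : affine) (A : set (pt3 R)) : measurable_fun A (aff p).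
Proof.
apply: (measurable_funS measurableT) => //.
by apply: continuous_measurable3; exact: continuous_aff.
Qed.

(** In each ball of radius [rho / 12], of volume [rho^3 / 216], some value of [p] is at most [m].
    Sampling near [z - (rho/2) e_i] and [z + (rho/2) e_i] gives the i-th slope up to [1/6] of the
    full gradient; the sum over [i] loses half of it, which is absorbed, whence the 12. A sample
    near [z] then bounds the values. *)
Lemma affine_bound (p : affine) z (rho E : R) : 0 < rho ->
  (N2 (ball z rho) (aff p) <= E%:E)%E ->
  let m := Num.sqrt (216 * E / rho ^+ 3) in
  l1norm p.1 * rho <= 12 * m /\
  forall x, `|aff p x| * rho <= m * (13 * rho + 12 * `|x - z|).
Proof.
move=> rho0 HE m.
have E0 : 0 <= E by rewrite -lee_fin; apply: le_trans HE; exact: N2_ge0.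
have m0 : 0 <= m by exact: sqrtr_ge0.
have small w : (forall q, ball w (rho / 12) q -> ball z rho q) ->
    exists2 x, ball w (rho / 12) x & `|aff p x| <= m.
  move=> sub; have r12 : 0 < rho / 12 by exact: divr_gt0.
  have [||x Bx hx] := @exists_small_N2 w (rho / 12) E (aff p) r12.
  - exact: measurable_aff.
  - apply: le_trans HE; apply: N2_sub; [exact: measurable_ball3|exact: measurable_ball3|exact: sub|].
    exact: measurable_aff.
  exists x => //; rewrite -sqrtr_sqr /m ler_wsqrtr//.
  apply: le_trans hx _; rewrite le_eqVlt; apply/orP; left; apply/eqP.
  by rewrite -(mulr_natl (rho / 12) 2); field; rewrite gt_eqF.
have near w q : `|w - z| <= rho / 2 -> ball w (rho / 12) q -> ball z rho q.
  move=> wz; rewrite -!ball_normE/= => wq.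
  rewrite -(subrKA w); apply: le_lt_trans (ler_normD _ _) _.
  by rewrite distrC; lra.
pose half i : pt3 R := (rho / 2) *: basis3 i.
have nhalf i : `|half i| <= rho / 2.
  apply/pt3_norm_le; rewrite /half /basis3 /= /GRing.scale/=.
  have b (c : bool) : `|rho / 2 * c%:R| <= rho / 2.
    have r2 : 0 <= rho / 2 by rewrite divr_ge0// ltW.
    by case: c; rewrite ?mulr1 ?mulr0 ?normr0 ?ger0_norm.
  by split; exact: b.
have key i : `|dot p.1 (basis3 i)| * rho <= 2 * m + l1norm p.1 * (rho / 6).
  have [x1 B1 h1] : exists2 x, ball (z - half i) (rho / 12) x & `|aff p x| <= m.
    by apply: small => q; apply: near; rewrite addrAC subrr add0r normrN.
  have [x2 B2 h2] : exists2 x, ball (z + half i) (rho / 12) x & `|aff p x| <= m.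
    by apply: small => q; apply: near; rewrite addrAC subrr add0r.
  pose err := (x2 - (z + half i)) - (x1 - (z - half i)).
  have nerr : `|err| <= rho / 6.
    apply: le_trans (ler_normB _ _) _; rewrite distrC [X in _ + X]distrC.
    by move: B1 B2; rewrite -!ball_normE/=; lra.
  have E2 : dot p.1 (basis3 i) * rho = aff p x2 - aff p x1 - dot p.1 err.
    by rewrite affB /err /half /dot /= /GRing.scale/=; field.
  have -> : `|dot p.1 (basis3 i)| * rho = `|dot p.1 (basis3 i) * rho|.
    by rewrite normrM (ger0_norm (ltW rho0)).
  rewrite E2.
  apply: le_trans (ler_normB _ _) _; apply: lerD.
    by apply: le_trans (ler_normB _ _) _; lra.
  by apply: le_trans (dot_le_l1norm _ _) _; rewrite ler_wpM2l// l1norm_ge0.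
have S1 : l1norm p.1 * rho <= 12 * m.
  have := key 0; have := key 1; have := key 2%:R.
  rewrite /dot /basis3 /= !(mulr0, mulr1, add0r, addr0).
  have -> : l1norm p.1 * rho = `|p.1.1.1| * rho + `|p.1.1.2| * rho + `|p.1.2| * rho.
    by rewrite /l1norm; ring.
  have -> : l1norm p.1 * (rho / 6) = (`|p.1.1.1| * rho + `|p.1.1.2| * rho + `|p.1.2| * rho) / 6.
    by rewrite /l1norm; field.
  move: (`|p.1.1.1| * rho) (`|p.1.1.2| * rho) (`|p.1.2| * rho) => a b c; lra.
split=> // x.
have [x1 B1 h1] : exists2 x, ball z (rho / 12) x & `|aff p x| <= m.
  by apply: small => q; apply: near; rewrite subrr normr0 divr_ge0 ?ltW.
have E3 : aff p x = aff p x1 + dot p.1 (x - x1) by rewrite -affB addrC subrK.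
have n1 : `|x - x1| <= `|x - z| + rho / 12.
  rewrite -(subrKA z x (- x1)); apply: le_trans (ler_normD _ _) _.
  by rewrite lerD2l; move: B1; rewrite -ball_normE/= => /ltW.
have n2 : `|aff p x| <= m + l1norm p.1 * `|x - x1|.
  rewrite E3; apply: le_trans (ler_normD _ _) _; apply: lerD => //.
  exact: dot_le_l1norm.
have n3 : l1norm p.1 * `|x - x1| * rho <= 12 * m * (`|x - z| + rho / 12).
  rewrite mulrAC; apply: ler_pM => //; first by rewrite mulr_ge0 ?l1norm_ge0 ?ltW.
have n4 : `|aff p x| * rho <= (m + l1norm p.1 * `|x - x1|) * rho by rewrite ler_pM2r.
apply: le_trans n4 _; rewrite mulrDl.
have m1 : 0 <= m * rho by rewrite mulr_ge0// ltW.
move: n3 m1; move: (l1norm p.1 * `|x - x1| * rho) => A; move: (`|x - z|) => B n3 m1.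
have -> : m * (13 * rho + 12 * B) = m * rho + 12 * (m * rho) + 12 * m * B by ring.
have : 12 * m * (B + rho / 12) = 12 * m * B + m * rho by field.
lra.
Qed.

End DenyLions.

(** * Pointwise estimate at the vertex of a cone *)

Section Morrey.
Variable R : realType.
Implicit Types (U V : set (pt3 R)) (x y z q : pt3 R).

Lemma exp4_lt_eps (a e : R) : 0 <= a -> 0 < e -> exists k : nat, a * 2^-1 ^+ k <= e.
Proof.
move=> a0 e0; have [k hk] : exists k : nat, a / e <= k%:R.
  exists (Num.truncn (a / e)).+1; apply: ltW; exact: truncnS_gt.
exists k; have k2 : (k%:R : R) <= 2 ^+ k by rewrite -natrX ler_nat ltnW// ltn_expl.
rewrite exprVn ler_pdivrMr ?exprn_gt0// mulrC -ler_pdivrMr//.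
exact: le_trans hk k2.
Qed.

Lemma homothety_diff (x0 q y : pt3 R) (t : R) : t != 0 ->
  q - (x0 + t^-1 *: (y - x0)) = t^-1 *: (x0 + t *: (q - x0) - y).
Proof. by move=> t0; apply: pt3_eq; rewrite /= /GRing.scale/=; field. Qed.

Lemma homothetyK (x0 y : pt3 R) (t : R) : t != 0 ->
  x0 + t *: (x0 + t^-1 *: (y - x0) - x0) = y.
Proof. by move=> t0; apply: pt3_eq; rewrite /= /GRing.scale/=; field. Qed.

(** The union of the images of [Q] under the homotheties of centre [x0] and ratio in []0, r]]. The
    vertex is not put in, which keeps the cone of an open set open. *)
Definition cone (x0 : pt3 R) (Q : set (pt3 R)) (r : R) : set (pt3 R) :=
  [set x | exists t q, [/\ 0 < t <= r, Q q & x = x0 + t *: (q - x0)]].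

Lemma cone_open x0 Q r : open Q -> open (cone x0 Q r).
Proof.
move=> oQ; rewrite openE => x [t [q [/andP[t0 tr] Qq ->]]].
have /nbhs_ballP[e /= e0 he] : nbhs q Q by apply: open_nbhs_nbhs.
apply/nbhs_ballP; exists (t * e) => /=; first exact: mulr_gt0.
move=> y; rewrite -ball_normE/= => hy.
exists t, (x0 + t^-1 *: (y - x0)); split; rewrite ?t0//.
  apply: he; rewrite -ball_normE/=.
  rewrite homothety_diff ?gt_eqF//.
  by rewrite normrZ gtr0_norm ?invr_gt0// ltr_pdivrMl.
by rewrite homothetyK// gt_eqF.
Qed.

Lemma cone_ball x0 z (rho r : R) : 0 < r ->
  ball (x0 + r *: (z - x0)) (r * rho) `<=` cone x0 (ball z rho) r.
Proof.
move=> r0 y; rewrite -ball_normE/= => hy.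
exists r, (x0 + r^-1 *: (y - x0)); split; rewrite ?r0 ?lexx//.
  rewrite /= homothety_diff ?gt_eqF//.
  by rewrite normrZ gtr0_norm ?invr_gt0// ltr_pdivrMl.
by rewrite homothetyK// gt_eqF.
Qed.

Lemma ball_convex z (rho s t : R) p q : 0 <= s -> 0 <= t -> 0 < s + t ->
  ball z rho p -> ball z rho q -> ball z rho ((s + t)^-1 *: (s *: p + t *: q)).
Proof.
move=> s0 t0 st; rewrite -!ball_normE/= => hp hq.
have -> : z - (s + t)^-1 *: (s *: p + t *: q) = (s + t)^-1 *: (s *: (z - p) + t *: (z - q)).
  rewrite !scalerBr addrACA -scalerDl -opprD scalerBr scalerA mulVf ?scale1r//.
  by rewrite gt_eqF.
rewrite normrZ gtr0_norm ?invr_gt0// ltr_pdivrMl//.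
apply: le_lt_trans (ler_normD _ _) _; rewrite !normrZ (ger0_norm s0) (ger0_norm t0).
have [s1|s1] := eqVneq s 0.
  have t1 : 0 < t by move: st; rewrite s1 add0r.
  by rewrite s1 mul0r !add0r ltr_pM2l.
have s2 : 0 < s by rewrite lt_def s1.
by rewrite mulrDl; apply: ltr_leD; [rewrite ltr_pM2l|rewrite ler_wpM2l// ltW].
Qed.

(** A point between the copies of ratios [s] and [s'] lies in the copy whose ratio is the
    corresponding mean, over a weighted mean of the two base points, which convexity keeps in the
    ball. *)
Lemma cone_star x0 z (rho r : R) : star_wrt (cone x0 (ball z rho) r) (ball (x0 + r *: (z - x0)) (r * rho)).
Proof.
move=> x q t [s [p [/andP[s0 sr] Bp ->]]] Bq /andP[t0 t1].
have r0 : 0 < r by exact: lt_le_trans sr.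
have [s' [q' [/andP[s'0 s'r] Bq' ->]]] := cone_ball r0 Bq.
pose a := (1 - t) * s; pose b := t * s'.
have a0 : 0 <= a by rewrite mulr_ge0 ?subr_ge0// ltW.
have b0 : 0 <= b by rewrite mulr_ge0// ltW.
have ab : 0 < a + b.
  have [t2|tn] := eqVneq t 0; first by rewrite /a /b t2 subr0 mul1r mul0r addr0.
  by rewrite ltr_wpDl// /b mulr_gt0// lt_def tn.
exists (a + b), ((a + b)^-1 *: (a *: p + b *: q')); split.
- rewrite ab /=; apply: (@le_trans _ _ ((1 - t) * r + t * r)); last by rewrite -mulrDl subrK mul1r.
  by apply: lerD; apply: ler_wpM2l; rewrite ?subr_ge0.
- exact: ball_convex.
- have := gt_eqF ab; rewrite /a /b => /negbT ab0.
  by apply: pt3_eq; rewrite /= /GRing.scale/=; field.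
Qed.

Lemma cone_le x0 Q (r s : R) : r <= s -> cone x0 Q r `<=` cone x0 Q s.
Proof.
move=> rs x [t [q [/andP[t0 tr] Qq ->]]]; exists t, q; split => //.
by rewrite t0 (le_trans tr).
Qed.

Lemma cone_dist x0 Q (r L : R) x : (forall q, Q q -> `|q - x0| < L) -> 0 < L ->
  cone x0 Q r x -> `|x - x0| < r * L.
Proof.
move=> QL L0 [t [q [/andP[t0 tr] Qq ->]]].
rewrite addrAC subrr add0r normrZ (gtr0_norm t0).
apply: (@lt_le_trans _ _ (t * L)); first by rewrite ltr_pM2l// QL.
by rewrite ler_wpM2r// ltW.
Qed.

Lemma aff_sub (p p' : affine) x : aff (p - p') x = aff p x - aff p' x :> R.
Proof. by rewrite /aff /dot /=; ring. Qed.

Lemma affine_close (p p' : affine) Q (v : pt3 R -> R) (E1 E2 : R) : measurable Q -> measurable_fun Q v ->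
  (N2 Q (fun x => v x - aff p x)%R <= E1%:E)%E ->
  (N2 Q (fun x => v x - aff p' x)%R <= E2%:E)%E ->
  (N2 Q (aff (p - p')%R) <= (2 * (E1 + E2))%:E)%E.
Proof.
move=> mQ mv h1 h2.
have mB p1 : measurable_fun Q (fun x => v x - aff p1 x).
  by apply: measurable_funB => //; exact: measurable_aff.
rewrite (@N2_eq _ _ _ (fun x => (v x - aff p' x) + (-1) * (v x - aff p x))); last first.
  by move=> x _; rewrite aff_sub; ring.
have mN : measurable_fun Q (fun x => -1 * (v x - aff p x)).
  by apply: measurable_funM => //; exact: mB.
apply: le_trans (N2D mQ (mB p') mN) _.
rewrite (N2Z (-1) mQ (mB p)).
have -> : ((-1) ^+ 2 : R) = 1 by rewrite sqrrN expr1n.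
rewrite mul1e mulrDr [leRHS]EFinD addeC; apply: leeD.
  by rewrite EFinM lee_wpmul2l.
by rewrite EFinM lee_wpmul2l.
Qed.

Lemma morrey_scale_cst (r rho L E : R) : 0 < r -> 0 < rho ->
  (3 * (2 * L * r) ^+ 2 * (2 * L * r / (r * rho)) ^+ 3) ^+ 2 * E =
  (96 * (L / rho) ^+ 3) ^+ 2 * L ^+ 4 * E * r ^+ 4.
Proof. by move=> r0 rho0; field; rewrite !gt_eqF. Qed.

(** The cones are homothetic, so the shape ratio in the Deny-Lions constant is the same at every
    scale; only the fourth power of the ratio remains, two powers from each Poincare inequality. *)
Lemma morrey_scales U x0 z (rho L E : R) v g gg : open U -> (exists M : R, U `<=` ball 0 M) ->
  0 < rho -> 0 < L -> cone x0 (ball z rho) 1 `<=` U ->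
  (forall q, ball z rho q -> `|q - x0| < L) ->
  H2data U v g gg -> (\sum_i \sum_j N2 U (gg i j) <= E%:E)%E ->
  exists P : nat -> affine, forall k,
    (N2 (cone x0 (ball z rho) (4^-1 ^+ k)) (fun x => v x - aff (P k) x)%R <=
     ((96 * (L / rho) ^+ 3) ^+ 2 * L ^+ 4 * E * (4^-1 ^+ k) ^+ 4)%:E)%E.
Proof.
move=> oU [M UM] rho0 L0 CU QL Hv HE.
suff H k : exists p : affine,
    (N2 (cone x0 (ball z rho) (4^-1 ^+ k)) (fun x => v x - aff p x)%R <=
     ((96 * (L / rho) ^+ 3) ^+ 2 * L ^+ 4 * E * (4^-1 ^+ k) ^+ 4)%:E)%E.
  by have [P HP] := choice H; exists P.
set r := 4^-1 ^+ k; pose K := cone x0 (ball z rho) r.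
have r0 : 0 < r by rewrite exprn_gt0// invr_gt0.
have r1 : r <= 1 by rewrite exprn_ile1// ?invr_ge0// invf_le1// ler1n.
have KU : K `<=` U by apply: subset_trans CU; exact: cone_le.
have oK : open K by apply: cone_open; exact: ball_open.
have mU := open_measurable3 oU; have mK := open_measurable3 oK.
have [|||||||p [_ Hp]] := @deny_lions R K (x0 + r *: (z - x0)) (r * rho) (2 * L * r) v g gg oK.
- by exists M; exact: subset_trans UM.
- exact: mulr_gt0.
- by rewrite !mulr_gt0.
- exact: cone_ball.
- exact: cone_star.
- move=> x q Kx /(cone_ball r0) Kq; rewrite -(subrKA x0).
  apply: le_lt_trans (ler_normD _ _) _; rewrite [X in _ + X]distrC.
  have := cone_dist QL L0 Kx; have := cone_dist QL L0 Kq.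
  by move: (`|q - x0|) (`|x - x0|) => a b; lra.
- exact: (H2data_sub mU mK KU).
exists p; apply: le_trans Hp _; rewrite -morrey_scale_cst// [leRHS]EFinM.
apply: lee_wpmul2l; first by rewrite lee_fin sqr_ge0.
apply: le_trans HE; apply: lee_sum => i _; apply: lee_sum => j _.
apply: N2_sub => //.
by case: Hv => _ /(_ i j)/(wderiv1P _ _ _ mU)[_ /in_L2_measurable].
Qed.

Lemma sqrt_leM (x y r : R) : 0 <= r -> 0 <= y -> x <= y * r ^+ 2 ->
  Num.sqrt x <= Num.sqrt y * r.
Proof.
move=> r0 y0 h; have -> : Num.sqrt y * r = Num.sqrt (y * r ^+ 2).
  by rewrite sqrtrM// sqrtr_sqr ger0_norm.
exact: ler_wsqrtr.
Qed.

Lemma scale_compare (A rho r : R) : 0 <= A -> 0 < rho -> 0 < r ->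
  216 * (2 * (A * (r ^+ 2) ^+ 4 + A * (r ^+ 2 / 4) ^+ 4)) / (r ^+ 2 / 4 * rho) ^+ 3 <=
  216 * 256 * A / rho ^+ 3 * r ^+ 2.
Proof.
move=> A0 rho0 r0.
have -> : 216 * (2 * (A * (r ^+ 2) ^+ 4 + A * (r ^+ 2 / 4) ^+ 4)) / (r ^+ 2 / 4 * rho) ^+ 3 =
   (216 * 2 * 64 * (1 + 256^-1)) * (A / rho ^+ 3 * r ^+ 2) by field; rewrite !gt_eqF.
have -> : 216 * 256 * A / rho ^+ 3 * r ^+ 2 = (216 * 256) * (A / rho ^+ 3 * r ^+ 2) by ring.
apply: ler_wpM2r; last by lra.
by apply: mulr_ge0; [apply: divr_ge0 => //; apply: exprn_ge0; exact: ltW|exact: sqr_ge0].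
Qed.

Lemma scaled_ge0 (x A rho : R) : 0 <= x -> 0 <= A -> 0 < rho -> 0 <= x * A / rho ^+ 3.
Proof. by move=> x0 A0 r0; rewrite !mulr_ge0// invr_ge0 exprn_ge0// ltW. Qed.

Lemma l1norm_dist (a b : pt3 R) : l1norm b <= l1norm a + l1norm (a - b).
Proof.
rewrite /l1norm /=.
have := ler_distD 0 b.1.1 a.1.1.
have t (x y : R) : `|y| <= `|x| + `|x - y|.
  by rewrite -{1}(subrK x y) addrC distrC; exact: ler_normD.
have := t a.1.1 b.1.1; have := t a.1.2 b.1.2; have := t a.2 b.2; lra.
Qed.

(** Here [r] is the square root of the ratio of the cone. The squared error [r^8] on a volume of
    order [r^6] leaves a pointwise difference of order [r], and a gradient difference of order
    [r / r^2]. *)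
Lemma affine_step (p p' : affine) w (r rho A L c : R) x0 : 0 <= A -> 0 < rho -> 0 < r -> 0 <= c ->
  `|x0 - w| <= r ^+ 2 / 4 * L -> c = 13 + 12 * (L / rho) ->
  (N2 (ball w (r ^+ 2 / 4 * rho)) (aff (p - p')%R) <=
     (2 * (A * (r ^+ 2) ^+ 4 + A * (r ^+ 2 / 4) ^+ 4))%:E)%E ->
  let M0 := Num.sqrt (216 * 256 * A / rho ^+ 3) in
  `|aff (p - p') x0| <= M0 * c * r /\ l1norm (p - p').1 <= 48 * M0 / rho * r^-1.
Proof.
move=> A0 rho0 r0 c0 xw cE H M0.
have r2 : 0 < r ^+ 2 / 4 by rewrite divr_gt0// exprn_gt0.
have rr : 0 < r ^+ 2 / 4 * rho by rewrite mulr_gt0.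
have y0 : 0 <= 216 * 256 * A / rho ^+ 3.
  exact: scaled_ge0 (mulr_ge0 (ler0n _ _) (ler0n _ _)) A0 rho0.
have M00 : 0 <= M0 by exact: sqrtr_ge0.
have [h1 h2] := affine_bound rr H.
set m := Num.sqrt _ in h1 h2.
have mM : m <= M0 * r by apply: (sqrt_leM (ltW r0) y0); exact: scale_compare.
have m0 : 0 <= m by exact: sqrtr_ge0.
split.
  rewrite -(ler_pM2r rr); apply: le_trans (h2 x0) _.
  have -> : M0 * c * r * (r ^+ 2 / 4 * rho) = M0 * r * (13 * (r ^+ 2 / 4 * rho) + 12 * (r ^+ 2 / 4 * L)).
    by rewrite cE; field; rewrite gt_eqF.
  apply: ler_pM => //; first by rewrite addr_ge0// mulr_ge0// ltW.
  by rewrite lerD2l ler_wpM2l.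
rewrite -(ler_pM2r rr); apply: le_trans h1 _.
have -> : 48 * M0 / rho * r^-1 * (r ^+ 2 / 4 * rho) = 12 * (M0 * r).
  by field; rewrite !gt_eqF.
by rewrite ler_wpM2l.
Qed.

Lemma morrey_final (a M0 c m A E0 rho : R) : 0 < rho -> 0 <= A -> 0 <= E0 -> 0 <= c -> 0 <= a ->
  M0 ^+ 2 = 216 * 256 * A / rho ^+ 3 -> m ^+ 2 = 216 * (2 * (E0 + A)) / rho ^+ 3 ->
  0 <= M0 -> 0 <= m ->
  a <= 2 * M0 * c + m * c -> a ^+ 2 <= 10 ^+ 6 * c ^+ 2 * (E0 + A) / rho ^+ 3.
Proof.
move=> rho0 A0 E00 c0 a0 hM hm M00 m0 ha.
have h : a ^+ 2 <= (2 * M0 * c + m * c) ^+ 2 by rewrite ler_sqr// nnegrE ?addr_ge0// !mulr_ge0.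
apply: le_trans h _.
have h : (2 * M0 * c + m * c) ^+ 2 <= c ^+ 2 * (8 * M0 ^+ 2 + 2 * m ^+ 2).
  rewrite -subr_ge0; have -> : c ^+ 2 * (8 * M0 ^+ 2 + 2 * m ^+ 2) - (2 * M0 * c + m * c) ^+ 2 =
    (c * (2 * M0 - m)) ^+ 2 by ring.
  exact: sqr_ge0.
apply: le_trans h _; rewrite hM hm.
have p0 : 0 <= c ^+ 2 / rho ^+ 3 by rewrite divr_ge0 ?sqr_ge0// exprn_ge0// ltW.
have -> : c ^+ 2 * (8 * (216 * 256 * A / rho ^+ 3) + 2 * (216 * (2 * (E0 + A)) / rho ^+ 3)) =
  c ^+ 2 / rho ^+ 3 * (8 * (216 * 256) * A + 864 * (E0 + A)) by ring.
have -> : 10 ^+ 6 * c ^+ 2 * (E0 + A) / rho ^+ 3 = c ^+ 2 / rho ^+ 3 * (10 ^+ 6 * (E0 + A)) by ring.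
apply: ler_wpM2l => //; lra.
Qed.

(* The affine approximations of [v] on the cones of ratio [4^-k] with vertex
   [x0] converge at [x0], and by continuity their limit is [v x0]. *)
Lemma morrey_affine U x0 z (rho L E : R) v g gg :
  open U -> (exists M : R, U `<=` ball 0 M) ->
  0 < rho -> 0 < L -> cone x0 (ball z rho) 1 `<=` U ->
  (forall q, ball z rho q -> `|q - x0| < L) ->
  H2data U v g gg -> (\sum_i \sum_j N2 U (gg i j) <= E%:E)%E ->
  (forall e : R, 0 < e -> exists2 d : R, 0 < d & forall y, U y -> `|y - x0| < d -> `|v y - v x0| < e) ->
  let A := (96 * (L / rho) ^+ 3) ^+ 2 * L ^+ 4 * E in
  exists2 p : affine, (N2 (ball z rho) (fun x => v x - aff p x)%R <= A%:E)%E &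
  `|v x0 - aff p x0| <= 2 * Num.sqrt (216 * 256 * A / rho ^+ 3) * (13 + 12 * (L / rho)).
Proof.
move=> oU UM rho0 L0 CU QL Hv HE cv.
have [P HP] := morrey_scales oU UM rho0 L0 CU QL Hv HE.
have mU := open_measurable3 oU.
have mv : measurable_fun U v by case: Hv => /(_ 0)/(wderiv1P _ _ _ mU)[/in_L2_measurable].
have E1 : 0 <= E.
  by rewrite -lee_fin; apply: le_trans HE; apply: sume_ge0 => i _; apply: sume_ge0 => j _; exact: N2_ge0.
move=> A; rewrite -/A in HP.
have A0 : 0 <= A by rewrite /A; apply: mulr_ge0 => //; apply: mulr_ge0; [exact: sqr_ge0|rewrite exprn_ge0// ltW].
(* The ratios are powers of [1/4] so that their square roots, which are the pointwise errors, are
   the powers of [1/2]. *)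
pose h (k : nat) : R := 2^-1 ^+ k.
have h0 k : 0 < h k by rewrite exprn_gt0// invr_gt0.
have h1 k : h k <= 1 by rewrite /h exprVn invf_le1 ?exprn_gt0// exprn_ege1// ler1n.
have hS k : h k.+1 = h k / 2 by rewrite /h exprSr.
have r4 k : (4^-1 ^+ k : R) = h k ^+ 2.
  by rewrite /h exprAC; congr (_ ^+ k); field.
have rS k : 4^-1 ^+ k.+1 = h k ^+ 2 / 4 :> R by rewrite r4 hS; field.
have r0 k : 0 < (4^-1 ^+ k : R) by rewrite exprn_gt0// invr_gt0.
clearbody A.
set c := 13 + 12 * (L / rho).
have c0 : 0 <= c by rewrite addr_ge0// mulr_ge0// divr_ge0 ?ltW.
have CK k : cone x0 (ball z rho) (4^-1 ^+ k) `<=` U.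
  by apply: subset_trans CU; apply: cone_le; rewrite r4 expr_le1// ltW.
have sub k : ball (x0 + 4^-1 ^+ k *: (z - x0)) (4^-1 ^+ k * rho) `<=` cone x0 (ball z rho) (4^-1 ^+ k).
  by apply: cone_ball.
have oK k : open (cone x0 (ball z rho) (4^-1 ^+ k)) by apply: cone_open; exact: ball_open.
have mB p1 (V : set (pt3 R)) : V `<=` U -> measurable V -> measurable_fun V (fun x => v x - aff p1 x).
  move=> VU mV; apply: measurable_funB; first exact: measurable_funS mv.
  exact: measurable_aff.
have HQ (W : set (pt3 R)) k p1 E2 : measurable W -> W `<=` cone x0 (ball z rho) (4^-1 ^+ k) ->
    (N2 (cone x0 (ball z rho) (4^-1 ^+ k)) (fun x => v x - aff p1 x)%R <= E2%:E)%E ->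
    (N2 W (fun x => v x - aff p1 x)%R <= E2%:E)%E.
  move=> mW WK; apply: le_trans; apply: N2_sub => //; first exact: open_measurable3.
  by apply: mB; [exact: CK|exact: open_measurable3].
have zL : `|x0 - z| < L by rewrite distrC; apply: QL; exact: ballxx.
have wL k : `|x0 - (x0 + 4^-1 ^+ k *: (z - x0))| <= 4^-1 ^+ k * L.
  rewrite opprD addNKr normrN normrZ gtr0_norm// ler_wpM2l// ?ltW//.
  by rewrite distrC.
pose M0 := Num.sqrt (216 * 256 * A / rho ^+ 3).
have M00 : 0 <= M0 by exact: sqrtr_ge0.
have step k : `|aff (P k - P k.+1) x0| <= M0 * c * h k /\
    l1norm (P k - P k.+1).1 <= 48 * M0 / rho * (h k)^-1.
  apply: (@affine_step _ _ (x0 + 4^-1 ^+ k.+1 *: (z - x0)) (h k) rho A L) => //.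
    by rewrite -rS.
  rewrite -rS -r4; apply: affine_close.
  - exact: measurable_ball3.
  - by apply: measurable_funS mv => //; apply: subset_trans (CK k.+1); exact: sub.
  - apply: (HQ _ k) => //; first exact: measurable_ball3.
    apply: subset_trans (cone_le _); first exact: sub.
    by rewrite exprS ler_piMl ?invf_le1 ?ler1n// ltW.
  - by apply: (HQ _ k.+1) => //; exact: measurable_ball3.
have sumP k : `|aff (P 0%N - P k) x0| <= M0 * c * (2 - 2 * h k).
  elim: k => [|k IH].
    by rewrite subrr /aff /dot /= !mul0r !addr0 normr0 /h expr0 mulr1 subrr mulr0.
  have := (step k).1; rewrite !aff_sub hS in IH * => st.
  rewrite -(subrKA (aff (P k) x0)); apply: le_trans (ler_normD _ _) _.
  apply: le_trans (lerD IH st) _; rewrite -mulrDr; apply: ler_wpM2l; first exact: mulr_ge0.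
  by lra.
(* The gradients may blow up like [1 / h k]. They are used only at distance [O(h k ^+ 2)] of the
   vertex, where they contribute [O(h k)]. *)
have gradP k : l1norm (P k).1 <= l1norm (P 0%N).1 + 48 * M0 / rho * ((h k)^-1 - 1).
  elim: k => [|k IH]; first by rewrite /h expr0 invr1 subrr mulr0 addr0.
  apply: le_trans (l1norm_dist (P k).1 _) _.
  apply: le_trans (lerD IH (step k).2) _.
  rewrite -addrA lerD2l -mulrDr; apply: ler_wpM2l.
    by rewrite divr_ge0 ?mulr_ge0// ltW.
  by rewrite hS invf_div; move: (h0 k); move: (h k) => t t0; rewrite -[2 / t]/(2 * t^-1); lra.
set G0 := l1norm (P 0%N).1 in gradP.
have G00 : 0 <= G0 := l1norm_ge0 _.
(* The coefficient of [h k] in the error of [P k] at a sample point plus its variation from that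
   point to the vertex. *)
pose D := M0 + (G0 + 48 * M0 / rho) * L.
have D0 : 0 <= D.
  apply: addr_ge0 => //; apply: mulr_ge0; last exact: ltW.
  by apply: addr_ge0 => //; rewrite divr_ge0 ?mulr_ge0// ltW.
have lim : `|v x0 - aff (P 0%N) x0| <= 2 * M0 * c.
  apply/ler_addgt0Pr => e e0.
  have e2 : 0 < e / 2 by rewrite divr_gt0.
  have [d d0 hd] := cv _ e2.
  have a0 : 0 <= L / (d / 2) + D / (e / 2) by rewrite addr_ge0// divr_ge0// ltW// divr_gt0.
  have [k hk] := exp4_lt_eps a0 ltr01.
  rewrite -/(h k) mulrDl in hk.
  have hL : L * h k <= d / 2.
    have t : L / (d / 2) * h k <= 1.
      apply: le_trans hk; rewrite lerDl; apply: mulr_ge0; last exact: ltW.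
      by apply: divr_ge0 => //; exact: ltW.
    by move: t; rewrite mulrAC ler_pdivrMr ?mul1r// divr_gt0.
  have hD : D * h k <= e / 2.
    have t : D / (e / 2) * h k <= 1.
      apply: le_trans hk; rewrite lerDr; apply: mulr_ge0; last exact: ltW.
      by apply: divr_ge0; [exact: ltW|rewrite divr_ge0// ltW].
    by move: t; rewrite mulrAC ler_pdivrMr ?mul1r.
  have rr : 0 < 4^-1 ^+ k * rho by rewrite mulr_gt0.
  have [||x Bx hx] := @exists_small_N2 _ (x0 + 4^-1 ^+ k *: (z - x0)) _ (A * (4^-1 ^+ k) ^+ 4) (fun x => v x - aff (P k) x) rr.
  - by apply: mB; [apply: subset_trans (CK k); exact: sub|exact: measurable_ball3].
  - by apply: (HQ _ k) => //; exact: measurable_ball3.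
  have xk : `|x - x0| <= h k ^+ 2 * L by rewrite -r4; apply: ltW; apply: cone_dist (sub _ _ Bx).
  have hh : h k ^+ 2 <= h k by rewrite expr2 ler_piMl// ltW.
  have i1 : `|v x - v x0| < e / 2.
    apply: hd; first by apply: (CK k); exact: sub.
    apply: le_lt_trans xk _; apply: (@le_lt_trans _ _ (L * h k)); last by lra.
    by rewrite mulrC ler_wpM2l// ltW.
  have i2 : `|v x - aff (P k) x| <= M0 * h k.
    rewrite -sqrtr_sqr; apply: sqrt_leM; first exact: ltW.
      exact: scaled_ge0 (mulr_ge0 (ler0n _ _) (ler0n _ _)) _ _.
    apply: le_trans hx _; rewrite r4.
    have -> : A * (h k ^+ 2) ^+ 4 / (h k ^+ 2 * rho *+ 2) ^+ 3 = 8^-1 * (A / rho ^+ 3 * h k ^+ 2).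
      by field; rewrite !gt_eqF.
    have -> : 216 * 256 * A / rho ^+ 3 * h k ^+ 2 = (216 * 256) * (A / rho ^+ 3 * h k ^+ 2) by ring.
    apply: ler_wpM2r; last by lra.
    by apply: mulr_ge0; [apply: divr_ge0 => //; rewrite exprn_ge0// ltW|exact: sqr_ge0].
  have i3 : `|aff (P k) x - aff (P k) x0| <= (G0 + 48 * M0 / rho) * L * h k.
    rewrite affB; apply: le_trans (dot_le_l1norm _ _) _.
    have g1 : l1norm (P k).1 <= (G0 + 48 * M0 / rho) * (h k)^-1.
      apply: le_trans (gradP k) _; rewrite [leRHS]mulrDl; apply: lerD.
        by rewrite ler_peMr// invf_ge1// ?posrE.
      by apply: ler_wpM2l; [apply: divr_ge0; [exact: mulr_ge0|exact: ltW]|rewrite gerBl].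
    apply: le_trans (ler_pM (l1norm_ge0 _) (normr_ge0 _) g1 xk) _.
    rewrite le_eqVlt; apply/orP; left; apply/eqP; field; rewrite !gt_eqF//.
  have i4 : `|aff (P 0%N) x0 - aff (P k) x0| <= 2 * M0 * c.
    rewrite -aff_sub; apply: le_trans (sumP k) _.
    have : 0 <= M0 * c * h k by rewrite !mulr_ge0// ltW.
    by rewrite -[2 * M0 * c]mulrA mulrBr; lra.
  have -> : v x0 - aff (P 0%N) x0 = (v x - aff (P k) x) + (aff (P k) x - aff (P k) x0)
      - (v x - v x0) - (aff (P 0%N) x0 - aff (P k) x0) by ring.
  rewrite /D mulrDl in hD.
  apply: le_trans (ler_normB _ _) _; rewrite addrC; apply: lerD => //.
  apply: le_trans (ler_normB _ _) _.
  apply: (@le_trans _ _ (e / 2 + e / 2)); last by lra.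
  apply: lerD; last exact: ltW.
  apply: le_trans (ler_normD _ _) _; apply: le_trans (lerD i2 i3) _; exact: hD.
have QU : ball z rho `<=` cone x0 (ball z rho) (4^-1 ^+ 0).
  by have := sub 0%N; rewrite expr0 scale1r mul1r addrC subrK.
exists (P 0%N) => //.
have := HQ _ _ _ _ (measurable_ball3 z rho) QU (HP 0%N).
by rewrite expr0 expr1n mulr1.
Qed.

(** Replaces the approximation attached to the cone by any given [p]: both are close to [v] on the
    ball, so their difference is a small affine function. Thus one [p] serves at all the points [x0]
    that see the same ball. *)
Lemma morrey U x0 z (rho L E0 E : R) v g gg (p : affine) :
  open U -> (exists M : R, U `<=` ball 0 M) ->
  0 < rho -> 0 < L -> cone x0 (ball z rho) 1 `<=` U -> ball z rho `<=` U ->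
  (forall q, ball z rho q -> `|q - x0| < L) ->
  H2data U v g gg -> (\sum_i \sum_j N2 U (gg i j) <= E%:E)%E ->
  (forall e : R, 0 < e -> exists2 d : R, 0 < d & forall y, U y -> `|y - x0| < d -> `|v y - v x0| < e) ->
  (N2 (ball z rho) (fun x => v x - aff p x)%R <= E0%:E)%E ->
  (v x0 - aff p x0) ^+ 2 <=
    10 ^+ 6 * (13 + 12 * (L / rho)) ^+ 2 *
    (E0 + (96 * (L / rho) ^+ 3) ^+ 2 * L ^+ 4 * E) / rho ^+ 3.
Proof.
move=> oU UM rho0 L0 CU QU QL Hv HE cv Hp.
have [p0 H0 lim] := morrey_affine oU UM rho0 L0 CU QL Hv HE cv.
have mU := open_measurable3 oU.
have mv : measurable_fun U v by case: Hv => /(_ 0)/(wderiv1P _ _ _ mU)[/in_L2_measurable].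
have E1 : 0 <= E.
  by rewrite -lee_fin; apply: le_trans HE; apply: sume_ge0 => i _; apply: sume_ge0 => j _; exact: N2_ge0.
set A := (96 * (L / rho) ^+ 3) ^+ 2 * L ^+ 4 * E in lim H0 *.
have A0 : 0 <= A by rewrite /A; apply: mulr_ge0 => //; apply: mulr_ge0; [exact: sqr_ge0|rewrite exprn_ge0// ltW].
clearbody A; clear HE Hv cv.
have E00 : 0 <= E0 by rewrite -lee_fin; apply: le_trans Hp; exact: N2_ge0.
have zL : `|x0 - z| < L by rewrite distrC; apply: QL; exact: ballxx.
set c := 13 + 12 * (L / rho) in lim *.
have c0 : 0 <= c by apply: addr_ge0 => //; apply: mulr_ge0 => //; rewrite divr_ge0 ?ltW.
set M0 := Num.sqrt _ in lim.
have M00 : 0 <= M0 by exact: sqrtr_ge0.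
have mQ := measurable_ball3 z rho.
have mvQ : measurable_fun (ball z rho) v by exact: measurable_funS mv.
have cl := affine_close mQ mvQ H0 Hp.
rewrite (addrC A) in cl.
have [_ /(_ x0) b2] := affine_bound rho0 cl.
set m := Num.sqrt _ in b2.
have m0 : 0 <= m by exact: sqrtr_ge0.
rewrite -(real_normK (num_real (v x0 - aff p x0))).
apply: (@morrey_final _ M0 c m A E0 rho) => //.
- rewrite /M0 sqr_sqrtr; first by [].
  exact: scaled_ge0 (mulr_ge0 (ler0n _ _) (ler0n _ _)) A0 rho0.
- rewrite /m sqr_sqrtr; first by [].
  exact: scaled_ge0 (ler0n _ _) (mulr_ge0 (ler0n _ _) (addr_ge0 E00 A0)) rho0.
have -> : v x0 - aff p x0 = v x0 - aff p0 x0 + aff (p0 - p) x0 by rewrite aff_sub; ring.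
apply: le_trans (ler_normD _ _) _; apply: lerD => //.
rewrite -(ler_pM2r rho0); apply: le_trans b2 _.
rewrite -mulrA; apply: ler_wpM2l => //.
have -> : c * rho = 13 * rho + 12 * L by rewrite /c; field; rewrite gt_eqF.
by rewrite lerD2l ler_wpM2l// ltW.
Qed.

End Morrey.

(** * Sobolev seminorms *)

Section Seminorms.
Variable R : realType.
Implicit Types (U V : set (pt3 R)) (u v f g : pt3 R -> R).

Lemma mdirsE (a : 'I_3 -> nat) : @mdirs R a =
  nseq (a 0) (basis3 0) ++ nseq (a 1) (basis3 1) ++ nseq (a 2%:R) (basis3 2%:R).
Proof.
rewrite /mdirs !enum_ordSl enum_ord0 /= cats0.
have e1 : lift ord0 ord0 = 1 :> 'I_3 by exact/val_inj.
have e2 : lift ord0 (lift ord0 ord0) = 2%:R :> 'I_3 by exact/val_inj.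
by rewrite e1 e2.
Qed.

Lemma wderiv_unique U vs u g1 g2 : open U -> (mu3 U < +oo)%E ->
  is_wderiv U vs u g1 -> is_wderiv U vs u g2 -> N2 U (fun x => g1 x - g2 x) = 0%E.
Proof.
move=> oU fU [_ l1 h1] [_ l2 h2]; have mU := open_measurable3 oU.
apply: L2_dual0 => //; first exact: in_L2B.
move=> phi tp; have lp := test_L2 mU tp; rewrite ipBl//.
have := h1 _ tp; rewrite h2// leb3E !ipE// -!EFinM => -[].
by move/(mulfI (negbT (signr_eq0 _ _))) ->; rewrite subrr.
Qed.

Lemma N2_ae U f g : measurable U -> measurable_fun U f -> measurable_fun U g ->
  N2 U (fun x => f x - g x) = 0%E -> N2 U f = N2 U g.
Proof.
move=> mU mf mg h0.
have mfg : measurable_fun U (fun x => f x - g x) by exact: measurable_funB.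
have ae := (@ae_eq_integral_abs _ _ _ (@mu3 R) U mU (fun x => ((f x - g x) ^+ 2)%:E) (measurable_sq mfg)).1.
apply: ae_eq_integral => //; try exact: measurable_sq.
have /ae : (\int[@mu3 R]_(x in U) `|((f x - g x) ^+ 2)%:E| = 0)%E.
  rewrite -[RHS]h0; apply: eq_integral => x _.
  by rewrite gee0_abs// lee_fin sqr_ge0.
apply: filterS => x h Ux; have := h Ux; case=> /eqP.
by rewrite sqrf_eq0 subr_eq0 => /eqP ->.
Qed.

Lemma inf_wderiv U vs u g : open U -> (mu3 U < +oo)%E -> is_wderiv U vs u g ->
  ereal_inf [set (\int[@leb3 R]_(x in U) ((g' x) ^+ 2)%:E)%E | g' in is_wderiv U vs u] = N2 U g.
Proof.
move=> oU fU wg; have mU := open_measurable3 oU.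
apply/le_anti/andP; split; first by apply: ereal_inf_lbound; exists g.
apply: le_ereal_inf_tmp => _ [g' wg' <-].
have [_ /in_L2_measurable m' _] := wg'; have [_ /in_L2_measurable m _] := wg.
by rewrite (@N2_ae U g g' mU m m' (wderiv_unique oU fU wg wg')).
Qed.

(** The infimum over an empty set of weak derivatives is [+oo], so finiteness of the seminorm yields
    a derivative for each multi-index. *)
Lemma Hsemi2_wderiv k U u (a : {ffun 'I_3 -> 'I_k.+1}) : open U -> (mu3 U < +oo)%E ->
  (Hsemi2 k U u < +oo)%E -> (\sum_i (a i : nat) = k)%N ->
  exists2 g, is_wderiv U (mdirs (fun i => a i)) u g & (N2 U g <= Hsemi2 k U u)%E.
Proof.
move=> oU fU fin ak.
set F := fun a0 : {ffun 'I_3 -> 'I_k.+1} =>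
  ereal_inf [set (\int[@leb3 R]_(x in U) ((g' x) ^+ 2)%:E)%E | g' in is_wderiv U (mdirs (fun i => a0 i)) u].
have F0 a0 : (0 <= F a0)%E.
  by apply: le_ereal_inf_tmp => _ [g' _ <-]; exact: N2_ge0.
have Fle : (F a <= Hsemi2 k U u)%E.
  rewrite /Hsemi2 (bigD1 a)/=; last by apply/eqP.
  by apply: leeDl; apply: sume_ge0 => a0 _; exact: F0.
have [g wg] : exists g, is_wderiv U (mdirs (fun i => a i)) u g.
  apply: contrapT => no; move: (le_lt_trans Fle fin); rewrite /F.
  rewrite (_ : [set _ | _ in _] = set0) ?ereal_inf0 ?ltxx//.
  by rewrite -subset0 => y [g wg _]; apply: no; exists g.
by exists g => //; rewrite -(inf_wderiv oU fU wg).
Qed.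

Definition index1 (i : 'I_3) : {ffun 'I_3 -> 'I_2} := [ffun j => inord (i == j)].
Definition index2 (i j : 'I_3) : {ffun 'I_3 -> 'I_3} := [ffun l => inord ((i == l) + (j == l))].

Lemma index1E i j : index1 i j = (i == j) :> nat.
Proof. by rewrite ffunE inordK//; case: (i == j). Qed.

Lemma index2E i j l : index2 i j l = ((i == l) + (j == l))%N :> nat.
Proof. by rewrite ffunE inordK//; case: (i == l); case: (j == l). Qed.

Lemma ord3P (P : 'I_3 -> Prop) : P 0 -> P 1 -> P 2%:R -> forall i, P i.
Proof.
move=> p0 p1 p2 [[|[|[|//]]] i3].
- by rewrite (_ : Ordinal _ = 0)//; exact/val_inj.
- by rewrite (_ : Ordinal _ = 1)//; exact/val_inj.
- by rewrite (_ : Ordinal _ = 2%:R)//; exact/val_inj.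
Qed.

Lemma mdirs_index1 i : @mdirs R (fun l => index1 i l) = [:: basis3 i].
Proof. by rewrite mdirsE !index1E; move: i; apply: ord3P. Qed.

Lemma mdirs_index2 i j : @mdirs R (fun l => index2 i j l) = [:: basis3 i; basis3 j] \/
  @mdirs R (fun l => index2 i j l) = [:: basis3 j; basis3 i].
Proof. by rewrite mdirsE !index2E; move: i; apply: ord3P; move: j; apply: ord3P; by [left|right]. Qed.

Lemma sum_index1 i : (\sum_l (index1 i l : nat) = 1)%N.
Proof. by rewrite !big_ord_recr big_ord0 /= !index1E; move: i; apply: ord3P. Qed.

Lemma sum_index2 i j : (\sum_l (index2 i j l : nat) = 2)%N.
Proof. by rewrite !big_ord_recr big_ord0 /= !index2E; move: i; apply: ord3P; move: j; apply: ord3P. Qed.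

(** Multi-indices list their directions in increasing order, which may reverse the pair that is
    wanted; on test functions derivatives commute. *)
Lemma wderiv_swap U x y u h : is_wderiv U [:: x; y] u h -> is_wderiv U [:: y; x] u h.
Proof.
move=> -[lu lh H]; split; [exact: lu|exact: lh|] => phi tp.
have [_ _ Dp] := smoothP tp.1.
have -> : iter_deriv [:: y; x] phi = iter_deriv [:: x; y] phi.
  by apply/funext => z; apply: derive_comm; apply: smooth_C1; [exact: tp.1|exact: Dp|exact: Dp].
exact: H.
Qed.

(** Testing the first derivative against ['D_(basis3 j) phi] shows that a second weak derivative of
    [v] is a first weak derivative of [g i]. The [gg] are fixed before [g], which stays arbitrary
    because the flux condition comes with its own first derivatives. *)
Lemma H2_data U v : open U -> (mu3 U < +oo)%E -> in_H 2 U v ->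
  exists gg : 'I_3 -> 'I_3 -> pt3 R -> R, [/\ (N2 U v <= Hnorm2 2 U v)%E,
    forall i j, (N2 U (gg i j) <= Hnorm2 2 U v)%E &
    forall g : 'I_3 -> pt3 R -> R, (forall i, is_wderiv U [:: basis3 i] v (g i)) ->
      H2data U v g gg /\ forall i, (N2 U (g i) <= Hnorm2 2 U v)%E].
Proof.
move=> oU fU; rewrite /in_H; set H := Hnorm2 2 U v => fin; have mU := open_measurable3 oU.
have s0 k : (0 <= Hsemi2 k U v)%E.
  by apply: sume_ge0 => a _; apply: le_ereal_inf_tmp => _ [g' _ <-]; exact: N2_ge0.
have sk (k : 'I_3) : (Hsemi2 k U v <= H)%E.
  by rewrite /H /Hnorm2 (bigD1 k)//= leeDl// sume_ge0.
have D2 i j : exists h, is_wderiv U [:: basis3 i; basis3 j] v h /\ (N2 U h <= H)%E.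
  have [||h wh hh] := @Hsemi2_wderiv 2 U v (index2 i j) oU fU.
  - exact: le_lt_trans (sk 2%:R) fin.
  - exact: sum_index2.
  exists h; split; last exact: le_trans hh (sk 2%:R).
  by have [E|E] := mdirs_index2 i j; rewrite E in wh; [exact: wh|exact: wderiv_swap].
have D2' (ij : 'I_3 * 'I_3) := D2 ij.1 ij.2; have [gg0 Hgg] := choice D2'.
exists (fun i j => gg0 (i, j)); split.
- have [||h [lv _ _] _] := @Hsemi2_wderiv 0 U v [ffun=> ord0] oU fU.
  + exact: le_lt_trans (sk 0) fin.
  + by rewrite big1// => i _; rewrite ffunE.
  apply: le_trans (sk 0); rewrite /Hsemi2 (bigD1 [ffun=> ord0])/=; last first.
    by rewrite big1// => i _; rewrite ffunE.
  rewrite -(@inf_wderiv _ [::] v) //; last by split=> // phi _; rewrite expr0 mul1e.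
  rewrite mdirsE !ffunE /= leeDl//.
  by apply: sume_ge0 => a _; apply: le_ereal_inf_tmp => _ [g' _ <-]; exact: N2_ge0.
- by move=> i j; exact: (Hgg (i, j)).2.
move=> g wg; split; last first.
  move=> i; have [||h wh hh] := @Hsemi2_wderiv 1 U v (index1 i) oU fU.
  - exact: le_lt_trans (sk 1) fin.
  - exact: sum_index1.
  rewrite mdirs_index1 in wh.
  have [_ /in_L2_measurable m1 _] := wh; have [_ /in_L2_measurable m2 _] := wg i.
  by rewrite (N2_ae mU m2 m1 (wderiv_unique oU fU (wg i) wh)); exact: le_trans hh (sk 1).
split=> // i j; have [_ lg _] := wg i; have [[lv lh hh] _] := Hgg (i, j).
apply/(wderiv1P _ _ _ mU); split => // phi tp.
have /(wderiv1P _ _ _ mU)[_ _ H1] := wg i.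
have lD := test_L2 mU (test_D (basis3 i) (test_D (basis3 j) tp)).
have := hh _ tp; rewrite /= sqrrN expr1n mul1e leb3E (ipE mU lv lD) (ipE mU lh (test_L2 mU tp)).
by case=> E; have := H1 _ (test_D (basis3 j) tp); rewrite E => ->; rewrite opprK.
Qed.

Lemma sum_const_ffun k (c : \bar R) : (0 <= c)%E ->
  (\sum_(a : {ffun 'I_3 -> 'I_k.+1}) c = ((k.+1 ^ 3)%N%:R)%:E * c)%E.
Proof.
move=> c0; rewrite big_const card_ffun !card_ord.
elim: (_ ^ _)%N => [|m IH] /=; first by rewrite mul0e.
by rewrite IH -natr1 EFinD ge0_muleDl// mul1e addeC.
Qed.

Lemma Hsemi2_0_le U u : in_L2 U u -> (Hsemi2 0 U u <= N2 U u)%E.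
Proof.
move=> lu; apply: (@le_trans _ _ (\sum_(a : {ffun 'I_3 -> 'I_1}) N2 U u)%E); last first.
  by rewrite sum_const_ffun ?N2_ge0// exp1n mul1e.
rewrite [leRHS](bigID (fun a : {ffun 'I_3 -> 'I_1} => (\sum_i (a i : nat) == 0)%N))/=.
apply: (@le_trans _ _ (\sum_(a : {ffun 'I_3 -> 'I_1} | (\sum_i (a i : nat) == 0)%N) N2 U u)%E); last first.
  by rewrite leeDl// sume_ge0// => *; exact: N2_ge0.
apply: lee_sum => a _; apply: ereal_inf_lbound; exists u => //.
by rewrite mdirsE !ord1; split => // phi _; rewrite expr0 mul1e.
Qed.

(** Each multi-index of order one is bounded by the whole sum and their number by the [2^3]
    functions that index them; whence 8. *)
Lemma Hsemi2_1_le U u (d : 'I_3 -> pt3 R -> R) :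
  (forall i, is_wderiv U [:: basis3 i] u (d i)) ->
  (Hsemi2 1 U u <= 8%:E * \sum_i N2 U (d i))%E.
Proof.
move=> wd; have s0 : (0 <= \sum_i N2 U (d i))%E by apply: sume_ge0 => *; exact: N2_ge0.
apply: (@le_trans _ _ (\sum_(a : {ffun 'I_3 -> 'I_2}) \sum_i N2 U (d i))%E); last first.
  by rewrite sum_const_ffun.
rewrite [leRHS](bigID (fun a : {ffun 'I_3 -> 'I_2} => (\sum_i (a i : nat) == 1)%N))/=.
apply: (@le_trans _ _ (\sum_(a : {ffun 'I_3 -> 'I_2} | (\sum_i (a i : nat) == 1)%N) \sum_i N2 U (d i))%E); last first.
  by rewrite leeDl// sume_ge0.
apply: lee_sum => a /eqP a1.
have [i ai] : exists i, mdirs (fun l => a l) = [:: @basis3 R i].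
  move: a1; rewrite mdirsE !big_ord_recr big_ord0 /= add0n.
  have -> : widen_ord (leqnSn 2) (widen_ord (leqnSn 1) ord_max) = 0 :> 'I_3 by exact/val_inj.
  have -> : widen_ord (leqnSn 2) ord_max = 1 :> 'I_3 by exact/val_inj.
  have -> : ord_max = 2%:R :> 'I_3 by exact/val_inj.
  case: (a 0) => -[|[|//]] _ /=; case: (a 1) => -[|[|//]] _ /=; case: (a 2%:R) => -[|[|//]] _ //= _.
  - by exists 2%:R.
  - by exists 1.
  - by exists 0.
apply: (@le_trans _ _ (N2 U (d i))).
  by apply: ereal_inf_lbound; exists (d i) => //; rewrite ai.
by rewrite (bigD1 i)//= leeDl// sume_ge0// => *; exact: N2_ge0.
Qed.

End Seminorms.

(** * Local geometry of the interface *)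

Section Gradient.
Variable R : realType.
Implicit Types (G U : set (pt3 R)) (x y u v w : pt3 R) (psi : pt3 R -> R).

Lemma dotC x y : dot x y = dot y x.
Proof. by rewrite /dot; ring. Qed.

Lemma dotDl x y w : dot (x + y) w = dot x w + dot y w.
Proof. by rewrite dotC dotDr !(dotC w). Qed.

Lemma dotZl x w (t : R) : dot (t *: x) w = t * dot x w.
Proof. by rewrite dotC dotZr dotC. Qed.

Lemma dotNr x y : dot x (- y) = - dot x y.
Proof. by rewrite -scaleN1r dotZr mulN1r. Qed.

Lemma dotNl x y : dot (- x) y = - dot x y.
Proof. by rewrite dotC dotNr dotC. Qed.

Lemma dotBr w x y : dot w (x - y) = dot w x - dot w y.
Proof. by rewrite dotDr dotNr. Qed.

Lemma dotBl w x y : dot (x - y) w = dot x w - dot y w.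
Proof. by rewrite dotDl dotNl. Qed.

Lemma dot0r x : dot x 0 = 0.
Proof. by rewrite /dot !mulr0 !addr0. Qed.

Lemma dot_ge0 x : 0 <= dot x x.
Proof. by rewrite /dot !addr_ge0// -expr2 sqr_ge0. Qed.

Lemma dot_eq0 x : dot x x = 0 -> x = 0.
Proof.
rewrite /dot => h; have [a b c] : [/\ 0 <= x.1.1 * x.1.1, 0 <= x.1.2 * x.1.2 & 0 <= x.2 * x.2].
  by rewrite -!expr2 !sqr_ge0.
have z t : t * t = 0 -> t = 0 :> R by move/eqP; rewrite mulf_eq0 orbb => /eqP.
by apply: pt3_eq; apply: z => /=; lra.
Qed.

Lemma dot_gt0 x : x <> 0 -> 0 < dot x x.
Proof. by move=> x0; rewrite lt_def dot_ge0 andbT; apply/eqP => /dot_eq0. Qed.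

Lemma dot_CS x y : dot x y ^+ 2 <= dot x x * dot y y.
Proof.
rewrite -subr_ge0.
have -> : dot x x * dot y y - dot x y ^+ 2 = (x.1.1 * y.1.2 - x.1.2 * y.1.1) ^+ 2 +
   (x.1.1 * y.2 - x.2 * y.1.1) ^+ 2 + (x.1.2 * y.2 - x.2 * y.1.2) ^+ 2 by rewrite /dot; ring.
by rewrite !addr_ge0// sqr_ge0.
Qed.

Lemma dot_le3 x : dot x x <= 3 * `|x| ^+ 2.
Proof.
have [h1 h2 h3] := (pt3_norm_le x `|x|).1 (lexx _).
have sq (t : R) : `|t| <= `|x| -> t * t <= `|x| ^+ 2.
  by move=> h; rewrite -expr2 -(real_normK (num_real t)) ler_sqr// nnegrE.
by have := sq _ h1; have := sq _ h2; have := sq _ h3; rewrite /dot; lra.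
Qed.

Lemma norm_le_dot x (r : R) : 0 <= r -> dot x x <= r ^+ 2 -> `|x| <= r.
Proof.
move=> r0 h; apply/pt3_norm_le.
have [a b c] : [/\ 0 <= x.1.1 * x.1.1, 0 <= x.1.2 * x.1.2 & 0 <= x.2 * x.2].
  by rewrite -!expr2 !sqr_ge0.
have sq (t : R) : t * t <= dot x x -> `|t| <= r.
  move=> h'; rewrite -(ler_sqr (x := `|t|))// ?nnegrE// (real_normK (num_real t)).
  by rewrite expr2 (le_trans h').
by split; apply: sq; rewrite /dot; lra.
Qed.

Lemma dot_le_norm2 x y (a : R) : 0 <= a -> dot x x <= a ^+ 2 -> `|dot x y| <= 2 * a * `|y|.
Proof.
move=> a0 h; rewrite -ler_sqr ?nnegrE ?mulr_ge0// (real_normK (num_real _)).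
apply: le_trans (dot_CS _ _) _.
have h2 := dot_le3 y; have y0 := dot_ge0 y.
apply: (@le_trans _ _ (a ^+ 2 * (3 * `|y| ^+ 2))).
  by apply: ler_pM => //; exact: dot_ge0.
have -> : (2 * a * `|y|) ^+ 2 = a ^+ 2 * (4 * `|y| ^+ 2) by ring.
by apply: ler_wpM2l; [exact: sqr_ge0|have := sqr_ge0 `|y|; lra].
Qed.

Lemma unit_dot_le x y : dot x x = 1 -> `|dot x y| <= 2 * `|y|.
Proof.
move=> h; have := @dot_le_norm2 x y 1 ler01; rewrite mulr1 h expr1n; apply; exact: lexx.
Qed.

Lemma derive_dot_grad U psi x v : open U -> C1_at U psi -> U x ->
  'D_v psi x = dot (grad psi x) v.
Proof.
move=> oU C1 Ux.
have -> : v = 1 *: (v.1.1 *: basis3 0 + v.1.2 *: basis3 1) + v.2 *: basis3 2%:R.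
  by apply: pt3_eq; rewrite /= /GRing.scale/=; ring.
rewrite (derive_lin _ _ _ _ oU Ux C1) (derive_lin _ _ _ _ oU Ux C1).
rewrite /grad; move: ('D_(basis3 0) _ _) ('D_(basis3 1) _ _) ('D_(basis3 2%:R) _ _) => a b c.
by rewrite /dot /= /GRing.scale/=; ring.
Qed.

Lemma sum3_le (a b c S : R) : a <= S -> b <= S -> c <= S -> a + b + c <= 3 * S.
Proof. lra. Qed.

(* The segments in the mean value theorem extend past [x], hence the factor 3. *)
Lemma taylor2 U psi x0 : open U -> Ck_on 2 U psi -> U x0 ->
  exists r M : R, [/\ 0 < r, 0 < M, ball x0 r `<=` U &
    forall x y, ball x0 r x -> ball x0 r y ->
      `|psi y - psi x - dot (grad psi x) (y - x)| <= M * `|y - x| ^+ 2].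
Proof.
move=> oU C2 Ux0.
have C1 : C1_at U psi by exact: (@Ck1_C1 _ _ _ _ 2).
have C1i i : C1_at U ('D_(basis3 i) psi) by apply: (@Ck1_C1 _ _ _ _ 1) => //; exact: Ck_D.
have bnd (ij : 'I_3 * 'I_3) : exists M : R, \forall x \near x0, `|'D_(basis3 ij.2) ('D_(basis3 ij.1) psi) x| <= M.
  have [_ _ /(_ x0 (basis3 ij.2) Ux0) c] := C1i ij.1.
  exists (`|'D_(basis3 ij.2) ('D_(basis3 ij.1) psi) x0| + 1).
  have [d d0 hd] := continuous_ball c ltr01.
  apply/nbhs_ballP; exists d => //= y; rewrite -ball_normE/= distrC => /hd hy.
  by rewrite -lerBlDl; apply: le_trans (lerB_dist _ _) (ltW hy).
have [M HM] := choice bnd.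
have H : \forall x \near x0, forall ij, `|'D_(basis3 ij.2) ('D_(basis3 ij.1) psi) x| <= M ij.
  exact: (@filter_forall _ _ (fun (ij : 'I_3 * 'I_3) x => `|'D_(basis3 ij.2) ('D_(basis3 ij.1) psi) x| <= M ij) _ (nbhs_filter x0) HM).
have HU : \forall x \near x0, U x by exact: open_nbhs_nbhs.
have HH : nbhs x0 ([set x | forall ij : 'I_3 * 'I_3, `|'D_(basis3 ij.2) ('D_(basis3 ij.1) psi) x| <= M ij] `&` U).
  exact: filterI.
have [d /= d0 hd] := (nbhs_ballP _ _).1 HH.
pose S := \sum_ij `|M ij|.
have MS ij : M ij <= S.
  by rewrite /S (bigD1 ij)//= (le_trans (ler_norm _))// lerDl sumr_ge0.
have S0 : 0 <= S by exact: sumr_ge0.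
exists (d / 3), (9 * S + 1); split.
- by rewrite divr_gt0.
- by rewrite ltr_wpDl// mulr_ge0.
- by move=> x Bx; apply: (hd x _).2; apply: le_ball Bx; rewrite ler_pdivrMr// ler_peMr ?ler1n// ltW.
move=> x y; rewrite -!ball_normE/= => Bx By; pose v := y - x.
have inb (s : R) : `|s| <= 1 -> ball x0 d (x + s *: v).
  move=> s1; rewrite -ball_normE/= opprD addrA; apply: le_lt_trans (ler_normB _ _) _.
  have nv : `|v| <= `|x0 - x| + `|x0 - y|.
    by rewrite /v -(subrKA x0) [X in _ <= X]addrC (distrC x0 y); exact: ler_normD.
  have : `|s *: v| <= `|v| by rewrite normrZ ler_piMl.
  by lra.
have inU s : `|s| <= 1 -> U (x + s *: v) by move=> s1; exact: (hd _ (inb s s1)).2.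
have [|s] := @MVT_line _ _ psi x v 1.
  by move=> s; rewrite normr1 => s1; case: C1 => _ D _; apply: D; exact: inU.
rewrite normr1 scale1r mul1r => s1 E.
have yE : x + v = y by rewrite /v addrC subrK.
rewrite yE in E; rewrite E (derive_dot_grad v oU C1 (inU s s1)) -/v -dotBl.
have Dg i : `|'D_(basis3 i) psi (x + s *: v) - 'D_(basis3 i) psi x| <= 3 * S * `|v|.
  have [|s'] := @MVT_line _ _ ('D_(basis3 i) psi) x v s.
    move=> s'; move=> h; case: (C1i i) => _ D _; apply: D; apply: inU; exact: le_trans h s1.
  move=> s's ->.
  have s'1 := le_trans s's s1.
  rewrite normrM; apply: (@le_trans _ _ `|'D_v ('D_(basis3 i) psi) (x + s' *: v)|).
    by rewrite ler_piMl.
  rewrite (derive_dot_grad v oU (C1i i) (inU s' s'1)).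
  apply: le_trans (dot_le_l1norm _ _) _; apply: ler_wpM2r => //.
  have b j : `|'D_(basis3 j) ('D_(basis3 i) psi) (x + s' *: v)| <= S.
    exact: le_trans ((hd _ (inb s' s'1)).1 (i, j)) (MS _).
  by apply: sum3_le; exact: b.
apply: le_trans (dot_le_l1norm _ _) _; rewrite expr2 mulrA; apply: ler_wpM2r => //.
apply: (@le_trans _ _ (3 * (3 * S * `|v|))); first by apply: sum3_le; exact: Dg.
rewrite !mulrA; apply: ler_wpM2r => //.
by rewrite (_ : 3 * 3 = 9) ?lerDl//; clear; lra.
Qed.

(** The normal direction does not depend on the local equation. For [v] tangent according to [psi],
    the intermediate value theorem finds a point of [G] at [x + t v + s e] with [s = O(t^2)]; [psi']
    vanishes there too, so its slope along [v] is [O(t)] for all small [t]. *)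
Lemma local_equation_parallel G U psi U' psi' x v : G x -> U x -> U' x ->
  local_equation G U psi -> local_equation G U' psi' ->
  dot (grad psi x) v = 0 -> dot (grad psi' x) v = 0.
Proof.
move=> Gx Ux U'x [oU C2 g0 GU] [oU' C2' _ GU'] ev.
have [r [M [r0 M0 BU T]]] := taylor2 oU C2 Ux.
have [r' [M' [r'0 M'0 BU' T']]] := taylor2 oU' C2' U'x.
have px : psi x = 0 by have : (G `&` U) x by []; rewrite GU => -[].
have px' : psi' x = 0 by have : (G `&` U') x by []; rewrite GU' => -[].
set e := grad psi x in ev; set e' := grad psi' x.
have e0 : 0 < dot e e by apply: dot_gt0; exact: g0.
pose N := `|v| + 1.
have N0 : 0 < N by rewrite ltr_wpDl.
(* For [s = K t^2] the linear term [s * dot e e] is twice the Taylor remainder, so [psi] changes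
   sign between the two ends. *)
pose K := 2 * (M * N ^+ 2) / dot e e.
have K0 : 0 < K by rewrite divr_gt0// !mulr_gt0// exprn_gt0.
pose C := K * `|dot e' e| + M' * N ^+ 2.
have C0 : 0 <= C.
  apply: addr_ge0; first by apply: mulr_ge0 => //; exact: ltW.
  by apply: mulr_ge0; [exact: ltW|exact: sqr_ge0].
have small (t : R) : 0 < t -> t * N < r -> t * N < r' -> K * t * `|e| <= 1 -> `|dot e' v| <= t * C.
  move=> t0 tr tr' tK.
  pose z (s : R) := t *: v + s *: e.
  have nz s : `|s| <= K * t ^+ 2 -> `|z s| <= t * N.
    move=> hs; apply: le_trans (ler_normD _ _) _; rewrite !normrZ (gtr0_norm t0) /N mulrDr lerD2l.
    apply: (@le_trans _ _ (K * t ^+ 2 * `|e|)); first exact: ler_wpM2r.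
    have -> : K * t ^+ 2 * `|e| = t * (K * t * `|e|) by ring.
    by rewrite ler_pM2l.
  have inB s : `|s| <= K * t ^+ 2 -> ball x r (x + z s).
    move=> /nz h; rewrite -ball_normE/= opprD addNKr normrN; exact: le_lt_trans h tr.
  have inB' s : `|s| <= K * t ^+ 2 -> ball x r' (x + z s).
    move=> /nz h; rewrite -ball_normE/= opprD addNKr normrN; exact: le_lt_trans h tr'.
  have Kt : 0 < K * t ^+ 2 by rewrite mulr_gt0// exprn_gt0.
  have val s : `|s| <= K * t ^+ 2 -> `|psi (x + z s) - s * dot e e| <= M * (t * N) ^+ 2.
    move=> hs; have := T x (x + z s) (ballxx _ r0) (inB s hs).
    have xz : x + z s - x = z s by rewrite addrAC subrr add0r.
    rewrite px subr0 xz -/e {1}[in dot _ _]/z dotDr !dotZr ev mulr0 add0r => h.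
    apply: le_trans h _; rewrite ler_pM2l// ler_sqr ?nnegrE//; first exact: nz.
    by rewrite mulr_ge0// ltW.
  have KE : K * t ^+ 2 * dot e e = 2 * (M * (t * N) ^+ 2).
    by rewrite /K; field; rewrite gt_eqF.
  have q0 : 0 <= M * (t * N) ^+ 2 by rewrite mulr_ge0 ?sqr_ge0// ltW.
  have cz : continuous z.
    move=> s; apply: cvgD; first exact: cvg_cst.
    by apply: cvgZr_tmp; exact: cvg_id.
  have [|||s] := @IVT R (fun s => psi (x + z s)) (- (K * t ^+ 2)) (K * t ^+ 2) 0.
  - by rewrite (le_trans _ (ltW Kt))// oppr_le0 ltW.
  - apply: continuous_in_subspaceT => s; rewrite inE/= in_itv/= => hs.
    have hs' : `|s| <= K * t ^+ 2 by rewrite ler_norml.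
    apply: (@continuous_comp _ _ _ (fun s => x + z s) psi).
      by apply: cvgD; [exact: cvg_cst|exact: cz].
    by have [c _ _] := @Ck1_C1 _ _ _ _ 2 isT C2; apply: c; apply: BU; exact: inB.
  - have h1 := val (K * t ^+ 2); have h2 := val (- (K * t ^+ 2)).
    rewrite normrN (gtr0_norm Kt) in h1 h2.
    have {h1} := h1 (lexx _); have {h2} := h2 (lexx _); rewrite mulNr KE !ler_norml.
    move=> /andP[_ h2] /andP[h1 _]; apply/andP; split.
      by rewrite ge_min; apply/orP; left; lra.
    by rewrite le_max; apply/orP; right; lra.
  rewrite in_itv/= => hs; have {}hs : `|s| <= K * t ^+ 2 by rewrite ler_norml.
  move=> ps0.
  have Gy : G (x + z s).
    have : ([set y | psi y = 0] `&` U) (x + z s) by split => //; apply: BU; exact: inB.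
    by rewrite -GU => -[].
  have ps'0 : psi' (x + z s) = 0.
    have : (G `&` U') (x + z s) by split => //; apply: BU'; exact: inB'.
    by rewrite GU' => -[].
  have := T' x (x + z s) (ballxx _ r'0) (inB' s hs).
  have xz : x + z s - x = z s by rewrite addrAC subrr add0r.
  rewrite ps'0 px' subr0 sub0r normrN xz -/e' [in dot _ _]/z dotDr !dotZr => h.
  have {h}h : `|t * dot e' v + s * dot e' e| <= M' * (t * N) ^+ 2.
    apply: le_trans h _; rewrite ler_pM2l// ler_sqr ?nnegrE//; first exact: nz.
    by rewrite mulr_ge0// ltW.
  rewrite -(ler_pM2l t0) -{1}(gtr0_norm t0) -normrM.
  have -> : t * dot e' v = (t * dot e' v + s * dot e' e) - s * dot e' e by rewrite addrK.
  apply: le_trans (ler_normB _ _) _.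
  have h3 : `|s * dot e' e| <= K * t ^+ 2 * `|dot e' e| by rewrite normrM ler_wpM2r.
  apply: le_trans (lerD h h3) _; rewrite /C le_eqVlt; apply/orP; left; apply/eqP; ring.
apply/normr0_eq0; apply/eqP; rewrite -[_ == 0]orFb eq_sym -[_ == _]negbK; apply/negP => nz.
have p : 0 < `|dot e' v| by rewrite lt_def eq_sym nz normr_ge0.
pose t := Num.min (Num.min (r / (2 * N)) (r' / (2 * N))) (Num.min (K * `|e| + 1)^-1 (`|dot e' v| / (2 * (C + 1)))).
have C1 : 0 < 2 * (C + 1) by rewrite mulr_gt0// ltr_wpDl.
have Ke : 0 < K * `|e| + 1 by rewrite ltr_wpDl// mulr_ge0// ltW.
have N2 : 0 < 2 * N by rewrite mulr_gt0.
have t0 : 0 < t by rewrite !lt_min !divr_gt0// invr_gt0 Ke.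
have [t1 t2 t3 t4] : [/\ t <= r / (2 * N), t <= r' / (2 * N), t <= (K * `|e| + 1)^-1 & t <= `|dot e' v| / (2 * (C + 1))].
  by rewrite /t !ge_min !lexx !orbT.
have := small t t0; rewrite ler_pdivlMr// in t1; rewrite ler_pdivlMr// in t2; rewrite ler_pdivlMr// in t4.
rewrite -div1r ler_pdivlMr// in t3.
have tN : 0 < t * N by exact: mulr_gt0.
have e1 : t * (2 * N) = 2 * (t * N) by ring.
have e2 : t * (K * `|e| + 1) = K * t * `|e| + t by ring.
have e4 : t * (2 * (C + 1)) = 2 * (t * C) + 2 * t by ring.
have tC : 0 <= t * C by rewrite mulr_ge0// ltW.
rewrite e1 in t1 t2; rewrite e2 in t3; rewrite e4 in t4.
have h1 : t * N < r by lra.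
have h2 : t * N < r' by lra.
have h3 : K * t * `|e| <= 1 by lra.
have h5 : t * C < `|dot e' v| by lra.
by move=> /(_ h1 h2 h3); rewrite leNgt h5.
Qed.

End Gradient.

(** * The two sides near the interface: paraboloids, normals and cones *)

Section Sides.
Variable R : realType.
Implicit Types (G A B S Omega : set (pt3 R)) (x y u v w : pt3 R) (n : pt3 R -> pt3 R) (r C : R).

Lemma connected_side S A B : connected S -> open A -> open B -> A `&` B = set0 ->
  S `<=` A `|` B -> S `&` A !=set0 -> S `<=` A.
Proof.
move=> cS oA oB AB SAB SA; suff <- : S `&` A = S by exact: subIsetr.
apply: cS => //; first by exists A.
exists (~` B); first exact: open_closedC.
apply/seteqP; split => x [Sx h]; split => //.
  by move=> Bx; have : (A `&` B) x by []; rewrite AB.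
by have [] := SAB _ Sx.
Qed.

Lemma connected_segment (p q : pt3 R) : connected [set p + t *: (q - p) | t in `[0, 1 : R]].
Proof.
apply: connected_continuous_connected; first exact: segment_connected.
apply: continuous_subspaceT => t; apply: cvgD; first exact: cvg_cst.
by apply: cvgZr_tmp; exact: cvg_id.
Qed.

Lemma segment_side A B (p q : pt3 R) : open A -> open B -> A `&` B = set0 ->
  (forall t : R, 0 <= t <= 1 -> (A `|` B) (p + t *: (q - p))) -> A p -> A q.
Proof.
move=> oA oB AB H Ap.
have := connected_side (@connected_segment p q) oA oB AB; apply.
- by move=> _ [t + <-]; rewrite /= in_itv/= => /H.
- by exists p; split => //; exists 0; rewrite /= ?in_itv/= ?lexx ?ler01// scale0r addr0.
- by exists 1; rewrite /= ?in_itv/= ?lexx ?ler01// scale1r addrC subrK.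
Qed.

Lemma compact_uniform G (P : nat -> pt3 R -> pt3 R -> Prop) : compact G ->
  (forall x0, G x0 -> exists2 r : R, 0 < r & exists k0, forall k, (k0 <= k)%N ->
     forall x y, ball x0 r x -> ball x0 r y -> P k x y) ->
  exists2 r : R, 0 < r & exists k, forall x y, G x -> `|y - x| < r -> P k x y.
Proof.
move=> /compact_near_coveringP cG H.
have [|N _ HN] := cG nat \oo (fun k x => forall y, `|y - x| < k.+1%:R^-1 -> P k x y) _.
  move=> x0 /H[r r0 [k0 Hk]].
  have [m hm] : exists m : nat, (r / 2)^-1 <= m%:R.
    by exists (Num.truncn (r / 2)^-1).+1; apply: ltW; exact: truncnS_gt.
  exists (ball x0 (r / 2), [set k | (maxn k0 m <= k)%N]) => /=.
    by split; [apply/nbhs_ballP; exists (r / 2) => //=; rewrite divr_gt0|exists (maxn k0 m)].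
  move=> [x k] [/= Bx]; rewrite geq_max => /andP[kk mk] y xy.
  have hk : k.+1%:R^-1 <= r / 2.
    rewrite -[leRHS]invrK lef_pV2 ?posrE ?ltr0n ?invr_gt0 ?divr_gt0//.
    by apply: le_trans hm _; rewrite ler_nat (leq_trans mk).
  apply: Hk => //; first by apply: le_ball Bx; rewrite ler_pdivrMr// ler_peMr ?ler1n// ltW.
  apply: (@ball_split _ _ x) => //; rewrite -ball_normE/= distrC.
  exact: lt_le_trans xy hk.
exists (N.+1%:R^-1); first by rewrite invr_gt0.
by exists N => x y Gx xy; apply: (HN N) => //=.
Qed.

(* All that is used of the geometry of [G]; it is invariant under exchanging
   the two sides and reversing [n]. *)
Definition two_sided G A B n r C :=
  [/\ [/\ 0 < r, 0 < C & open A /\ open B],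
      [/\ A `&` B = set0, A `&` G = set0 & B `&` G = set0],
      forall x y, G x -> `|y - x| < r -> [\/ G y, A y | B y],
      forall x, G x -> dot (n x) (n x) = 1 /\
        exists2 d, 0 < d & forall t, 0 < t < d -> A (x + t *: n x) /\ B (x - t *: n x) &
      forall x y, G x -> G y -> `|y - x| < r ->
        `|dot (n x) (y - x)| <= C * dot (y - x) (y - x)].

Lemma two_sided_sym G A B n r C :
  two_sided G A B n r C -> two_sided G B A (fun x => - n x) r C.
Proof.
move=> [[r0 C0 [oA oB]] [AB AG BG] cov nG tan]; split => //.
- by rewrite setIC.
- by move=> x y Gx /(cov _ _ Gx)[]; [constructor 1|constructor 3|constructor 2].
- move=> x Gx; have [nn [d d0 hd]] := nG x Gx; split; first by rewrite dotNl dotNr opprK.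
  by exists d => // t /hd[h1 h2]; rewrite scalerN opprK.
- by move=> x y Gx Gy xy; rewrite dotNl normrN; exact: tan.
Qed.

Lemma dot_convex u v (s : R) : 0 <= s <= 1 ->
  dot ((1 - s) *: u + s *: v) ((1 - s) *: u + s *: v) <= (1 - s) * dot u u + s * dot v v.
Proof.
move=> /andP[s0 s1]; rewrite -subr_ge0.
have -> : (1 - s) * dot u u + s * dot v v -
    dot ((1 - s) *: u + s *: v) ((1 - s) *: u + s *: v) = s * (1 - s) * dot (u - v) (u - v).
  by rewrite /dot /= /GRing.scale/=; ring.
by rewrite !mulr_ge0 ?subr_ge0// dot_ge0.
Qed.

Lemma unit_norm_le x : dot x x = 1 -> `|x| <= 1.
Proof. by move=> h; apply: norm_le_dot => //; rewrite h expr1n. Qed.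

Lemma convex_lt (a b s r : R) : 0 <= s <= 1 -> a < r -> b < r -> (1 - s) * a + s * b < r.
Proof.
move=> /andP[s0 s1] ar br; have [->|sn] := eqVneq s 0; first by rewrite subr0 mul1r mul0r addr0.
have sp : 0 < s by rewrite lt_def sn.
have h1 : (1 - s) * a <= (1 - s) * r by rewrite ler_wpM2l ?subr_ge0// ltW.
have h2 : s * b < s * r by rewrite ltr_pM2l.
lra.
Qed.

(** The region above the paraboloid of curvature [C] is convex and, by the tangency estimate,
    contains no point of [G]. It contains [x + t n(x)] for small [t], which is in [A], and a segment
    inside the region cannot change sides. *)
Lemma two_sided_in G A B n r C x y : two_sided G A B n r C -> G x -> `|y| < r ->
  C * dot y y < dot (n x) y -> A (x + y).
Proof.
move=> [[r0 C0 [oA oB]] [AB AG BG] cov nG tan] Gx yr hy.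
have [nn [d d0 hd]] := nG x Gx.
(* The three bounds place the starting point in [A], within the radius [r] and above the
   paraboloid. *)
pose t := Num.min (d / 2) (Num.min (r / 2) (C^-1 / 2)).
have t0 : 0 < t by rewrite !lt_min !divr_gt0// invr_gt0.
have [t1 t2 t3] : [/\ t <= d / 2, t <= r / 2 & t <= C^-1 / 2].
  by rewrite /t !ge_min !lexx !orbT.
have td : t < d by lra.
have tC : C * (t * t) < t.
  have : C * t <= 1 / 2.
    by have := ler_wpM2l (ltW C0) t3; rewrite mulrA divff ?gt_eqF.
  by move=> h; have := ler_wpM2l (ltW t0) h; lra.
have ntr : `|t *: n x| < r.
  by rewrite normrZ gtr0_norm//; have := ler_wpM2l (ltW t0) (unit_norm_le nn); lra.
apply: (@segment_side A B (x + t *: n x)) => //; last by have [] := hd t; rewrite ?t0.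
move=> s s01; have /andP[s0 s1] := s01.
have -> : x + t *: n x + s *: (x + y - (x + t *: n x)) = x + ((1 - s) *: (t *: n x) + s *: y).
  by apply: pt3_eq; rewrite /= /GRing.scale/=; ring.
set z := (1 - s) *: (t *: n x) + s *: y.
have zr : `|z| < r.
  apply: le_lt_trans (ler_normD _ _) _; rewrite normrZ [X in _ + X]normrZ.
  by rewrite [`|s|]ger0_norm// [`|1 - s|]ger0_norm ?subr_ge0//; exact: convex_lt.
have zn : C * dot z z < dot (n x) z.
  have h1 := ler_wpM2l (ltW C0) (dot_convex (t *: n x) y s01).
  apply: le_lt_trans h1 _.
  rewrite /z dotDr !dotZr dotZl nn !mulr1 mulrDr.
  rewrite (mulrCA C (1 - s)) (mulrCA C s).
  have [->|sn] := eqVneq s 0; first by rewrite subr0 !mul1r !mul0r !addr0.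
  have sp : 0 < s by rewrite lt_def sn.
  by apply: ler_ltD; [rewrite ler_wpM2l ?subr_ge0// ltW|rewrite ltr_pM2l].
have xz : x + z - x = z by rewrite addrAC subrr add0r.
have := cov x (x + z) Gx; rewrite xz => /(_ zr)[Gz|Az|Bz]; [|by left|by right].
have := tan x _ Gx Gz; rewrite xz => /(_ zr) h; exfalso.
by have := le_lt_trans (le_trans (ler_norm _) h) zn; rewrite ltxx.
Qed.

Lemma two_sided_not G A B n r C x y : two_sided G A B n r C -> G x -> `|y| < r ->
  ~ B (x + y) -> - (C * dot y y) <= dot (n x) y.
Proof.
move=> H Gx yr nB; rewrite leNgt; apply/negP => h; apply: nB.
apply: (two_sided_in (two_sided_sym H)) => //.
by rewrite dotNl ltrNr.
Qed.

Lemma normal_lipschitz_alg (c W C d : R) : 0 < C -> 0 < d -> 32 * C * d < 1 ->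
  W ^+ 2 = 1 - c ^+ 2 -> 0 <= W -> W <= 16 * C * d -> - (13 * C * d) <= c ->
  2 - 2 * c <= (32 * C * d) ^+ 2.
Proof.
move=> C0 d0 h hW W0 W1 c1.
have c2 : - 2^-1 <= c by lra.
have Cd : 0 < C * d by exact: mulr_gt0.
have W2 : W ^+ 2 <= (16 * C * d) ^+ 2 by rewrite ler_sqr// nnegrE; lra.
nra.
Qed.

(** Only the position of the sides is used: a displacement that clears the paraboloid at [x] leads
    into [A], and so cannot point far below the tangent plane at [y]. Two such displacements bound
    the cosine [c] of the angle from below and the tangential part [W] of [n y] from above. *)
Lemma normal_lipschitz G A B n r C x y : two_sided G A B n r C -> G x -> G y ->
  4 * `|y - x| < r -> 32 * C * `|y - x| < 1 ->
  dot (n y - n x) (n y - n x) <= (32 * C * `|y - x|) ^+ 2.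
Proof.
move=> H Gx Gy dr dC.
have [->|xy] := eqVneq y x.
  by rewrite !subrr /dot /= !mulr0 !addr0 sqr_ge0.
have [[r0 C0 [oA oB]] [AB AG BG] cov nG tan] := H.
have [nx _] := nG x Gx; have [ny _] := nG y Gy.
set d := `|y - x| in dr dC *.
have d0 : 0 < d by rewrite normr_gt0 subr_eq0.
have Cd : 0 < C * d by exact: mulr_gt0.
pose c := dot (n x) (n y).
(* The 13 is 10 from the paraboloid at [y], for [x + u - y], plus 3 from the tangency estimate for
   [x - y]. *)
have key u : `|u| <= 2 * d -> dot u u <= 2 * d ^+ 2 -> 2 * C * d ^+ 2 < dot (n x) u ->
    - (13 * C * d ^+ 2) <= dot (n y) u.
  move=> ud uu nu.
  have Au : A (x + u).
    apply: (two_sided_in H) => //; first by lra.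
    by apply: le_lt_trans nu; rewrite [2 * C]mulrC -mulrA ler_pM2l.
  have yE : x + u = y + (x + u - y) by rewrite [RHS]addrC subrK.
  have := @two_sided_not G A B n r C y (x + u - y) H Gy.
  have n3 : `|x + u - y| <= 3 * d.
    have -> : x + u - y = u - (y - x) by rewrite opprB addrAC addrC.
    by apply: le_trans (ler_normB _ _) _; rewrite -/d; lra.
  rewrite -yE => /(_ ltac:(lra)) h.
  have {}h : - (C * dot (x + u - y) (x + u - y)) <= dot (n y) (x + u - y).
    by apply: h => Bu; have : (A `&` B) (x + u) by []; rewrite AB.
  have s1 : dot (x + u - y) (x + u - y) <= 10 * d ^+ 2.
    have s2 := dot_le3 (y - x); rewrite -/d in s2.
    have -> : dot (x + u - y) (x + u - y) = 2 * dot u u + 2 * dot (y - x) (y - x) - dot (u + (y - x)) (u + (y - x)).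
      by rewrite /dot /=; ring.
    by have := dot_ge0 (u + (y - x)); lra.
  have t1 : `|dot (n y) (x - y)| <= C * (3 * d ^+ 2).
    apply: le_trans (tan y x Gy Gx _) _; first by rewrite distrC -/d; lra.
    by rewrite ler_pM2l// (le_trans (dot_le3 _))// distrC -/d.
  have := ler_wpM2l (ltW C0) s1.
  have -> : dot (n y) u = dot (n y) (x + u - y) - dot (n y) (x - y) by rewrite -dotBr; congr dot; rewrite opprB addrA subrK addrAC subrr add0r.
  by move: t1; rewrite ler_norml => /andP[_ t1]; lra.
have c1 : - (13 * C * d) <= c.
  have := key (d *: n x); rewrite normrZ (gtr0_norm d0) dotZl !dotZr nx !mulr1.
  rewrite (dotC (n y)) -/c.
  have h1 := ler_wpM2l (ltW d0) (unit_norm_le nx).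
  have d2 : 0 < d * d by exact: mulr_gt0.
  move=> /(_ ltac:(lra) ltac:(by rewrite expr2; lra)) h.
  have {}h : - (13 * C * d ^+ 2) <= d * c.
    apply: h; have -> : 2 * C * d ^+ 2 = d * (2 * C * d) by ring.
    by rewrite -[ltRHS]mulr1 ltr_pM2l//; lra.
  by rewrite -(ler_pM2l d0); apply: le_trans h; rewrite le_eqVlt; apply/orP; left; apply/eqP; ring.
have cl1 : c <= 1.
  have := dot_ge0 (n x - n y).
  have -> : dot (n x - n y) (n x - n y) = dot (n x) (n x) + dot (n y) (n y) - 2 * c by rewrite /c /dot /=; ring.
  by rewrite nx ny; lra.
have -> : dot (n y - n x) (n y - n x) = 2 - 2 * c.
  by have -> : dot (n y - n x) (n y - n x) = dot (n x) (n x) + dot (n y) (n y) - 2 * c;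
    [rewrite /c /dot /=; ring|rewrite nx ny].
pose w := n y - c *: n x.
have ww : dot w w = 1 - c ^+ 2.
  have -> : dot w w = dot (n y) (n y) - 2 * c * dot (n x) (n y) + c ^+ 2 * dot (n x) (n x).
    by rewrite /w /dot /= /GRing.scale/=; ring.
  by rewrite nx ny -/c; ring.
have nw : dot (n y) w = dot w w.
  by rewrite ww /w dotBr dotZr ny (dotC (n y)) -/c; ring.
have xw : dot (n x) w = 0 by rewrite /w dotBr dotZr nx -/c; ring.
pose W := Num.sqrt (dot w w).
have W0 : 0 <= W by exact: sqrtr_ge0.
have W2 : W ^+ 2 = dot w w by rewrite sqr_sqrtr ?dot_ge0.
apply: (@normal_lipschitz_alg c W C d) => //; first by rewrite W2.
have [WE|WE] := eqVneq W 0; first by rewrite WE; lra.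
have Wp : 0 < W by rewrite lt_def WE.
(* It rises just enough at [x] to enter [A], and otherwise points against the tangential part of
   [n y]. *)
pose u := d *: ((3 * C * d) *: n x - W^-1 *: w).
have uu : dot u u = d ^+ 2 * ((3 * C * d) ^+ 2 + 1).
  have -> : dot u u = d ^+ 2 * ((3 * C * d) ^+ 2 * dot (n x) (n x) - 2 * (3 * C * d) * W^-1 * dot (n x) w + W^-1 ^+ 2 * dot w w).
    by rewrite /u /dot /= /GRing.scale/=; ring.
  by rewrite nx xw -W2 mulr1 mulr0 subr0 -exprMn mulVf// expr1n.
have sq1 : (3 * C * d) ^+ 2 <= 1 by rewrite expr_le1//; lra.
have d2 : 0 < d ^+ 2 by rewrite exprn_gt0.
have := key u; have uu2 : dot u u <= 2 * d ^+ 2.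
  by rewrite uu [2 * _]mulrC ler_pM2l//; lra.
move=> /(_ _ uu2) h.
have {}h : 2 * C * d ^+ 2 < dot (n x) u -> - (13 * C * d ^+ 2) <= dot (n y) u.
  apply: h; apply: norm_le_dot; first by rewrite mulr_ge0// ltW.
  by apply: le_trans uu2 _; rewrite exprMn; lra.
have nxu : dot (n x) u = 3 * C * d ^+ 2.
  by rewrite /u dotZr dotBr !dotZr nx xw; ring.
have nyu : dot (n y) u = d * (3 * C * d * c - W).
  by rewrite /u dotZr dotBr !dotZr nw -W2 (dotC (n y)) -/c; field.
rewrite nxu nyu in h.
have {}h : - (13 * C * d ^+ 2) <= d * (3 * C * d * c - W).
  by apply: h; have : 0 < C * d ^+ 2 by [exact: mulr_gt0]; lra.
have {}h : - (13 * C * d) <= 3 * C * d * c - W.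
  by rewrite -(ler_pM2l d0); apply: le_trans h; rewrite le_eqVlt; apply/orP; left; apply/eqP; ring.
have := ler_wpM2l (ltW Cd) cl1; lra.
Qed.

Lemma open_line A y v : open A -> A y ->
  exists2 d : R, 0 < d & forall s : R, `|s| < d -> A (y + s *: v).
Proof.
move=> oA Ay; have /nbhs_ballP[e /= e0 he] : nbhs y A by apply: open_nbhs_nbhs.
exists (e / (`|v| + 1)); first by rewrite divr_gt0// ltr_wpDl.
move=> s; rewrite ltr_pdivlMr ?ltr_wpDl// => hs; apply: he.
rewrite -ball_normE/= opprD addNKr normrN normrZ; apply: le_lt_trans hs.
by rewrite ler_wpM2l// lerDl.
Qed.

Lemma small_quadratic (C a b r m : R) : 0 < C -> 0 < a -> 0 <= b -> 0 < r -> 0 <= m ->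
  exists2 d : R, 0 < d & forall t, 0 < t < d -> t * m < r /\ C * (t * (t * b)) < t * a.
Proof.
move=> C0 a0 b0 r0 m0.
have Cb : 0 <= C * b by rewrite mulr_ge0// ltW.
exists (Num.min (r / (m + 1)) (a / (C * b + 1))).
  by rewrite lt_min !divr_gt0// ltr_wpDl.
move=> t /andP[t0]; rewrite lt_min => /andP[]; rewrite !ltr_pdivlMr ?ltr_wpDl// => t1 t2.
split; first by lra.
have -> : C * (t * (t * b)) = t * (t * (C * b)) by ring.
by rewrite ltr_pM2l//; lra.
Qed.

(** Follow the segment to the first parameter at which it is not in [A]. As both sides are open,
    this exit point lies on [G]; its normal is close to [n xs], so [y] points into [A] there and the
    points just before the exit lie in [B], a contradiction. *)
Lemma two_sided_cone G A B n r C xs x y (rho k : R) : two_sided G A B n r C -> G xs ->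
  0 < k -> 16 * rho < r -> 512 * C * rho < k -> k <= 1 ->
  A x \/ G x -> `|x - xs| <= rho -> `|y| <= rho -> 0 < `|y| -> k * `|y| <= dot (n xs) y ->
  A (x + y).
Proof.
move=> H Gs k0 rr rC k1 AGx xr yr y0 ny; apply: contrapT => nA.
have [[r0 C0 [oA oB]] [AB AG BG] cov nG tan] := H.
have rho0 : 0 < rho by exact: lt_le_trans yr.
have normal_pos g : G g -> `|g - xs| <= 2 * rho -> 0 < dot (n g) y.
  move=> Gg gr.
  have g0 : 0 <= `|g - xs| by [].
  have Cg := ler_wpM2l (ltW C0) gr.
  have := @normal_lipschitz G A B n r C xs g H Gs Gg.
  move=> /(_ ltac:(lra) ltac:(lra)) h.
  have h2 : 32 * C * `|g - xs| <= k / 8 by lra.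
  have {}h : dot (n g - n xs) (n g - n xs) <= (k / 8) ^+ 2.
    by apply: le_trans h _; rewrite ler_sqr// nnegrE; [rewrite !mulr_ge0// ltW|lra].
  have := @dot_le_norm2 _ _ y (k / 8) ltac:(lra) h; rewrite ler_norml dotBl => /andP[h3 _].
  have : 0 < k * `|y| by exact: mulr_gt0.
  by lra.
have start : exists2 d : R, 0 < d & forall t, 0 < t < d -> A (x + t *: y).
  case: AGx => [Ax|Gx].
    have [d d0 hd] := open_line y oA Ax; exists d => // t /andP[t0 td]; apply: hd.
    by rewrite gtr0_norm.
  have np := normal_pos x Gx ltac:(lra).
  have [d d0 hd] := small_quadratic C0 np (dot_ge0 y) r0 (normr_ge0 y).
  exists d => // t tt; have [h1 h2] := hd t tt; case/andP: tt => t0 _.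
  by apply: (two_sided_in H) => //; rewrite ?normrZ ?gtr0_norm// dotZl !dotZr.
have [d0 d00 hd0] := start.
(* Its infimum is the exit parameter; it is positive because the segment starts inside [A], even
   from a point of [G]. *)
pose T := [set t : R | 0 < t <= 1 /\ ~ A (x + t *: y)].
have T1 : T 1 by split; rewrite ?ltr01 ?lexx// scale1r.
have lT : lbound T d0.
  move=> t [/andP[t0 _] nAt]; rewrite leNgt; apply/negP => td; apply: nAt; apply: hd0.
  by rewrite t0.
have hT : has_inf T by split; [exists 1|exists d0].
pose t0 := inf T.
have t0d : d0 <= t0 by apply: lb_le_inf => //; exists 1.
have t0p : 0 < t0 by exact: lt_le_trans t0d.
have t01 : t0 <= 1 by apply: ge_inf => //; exists d0.
have before s : 0 < s < t0 -> A (x + s *: y).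
  move=> /andP[s0 st]; apply: contrapT => nAs.
  have : t0 <= s by apply: ge_inf; [exists d0|split => //; rewrite s0 (le_trans (ltW st))].
  by rewrite leNgt st.
pose g := x + t0 *: y.
have gE s : g + s *: y = x + (t0 + s) *: y by rewrite /g -addrA -scalerDl.
have nAg : ~ A g.
  move=> Ag; have [d d1 hd] := open_line y oA Ag.
  have [t [Tt1 nAt] tt] : exists2 t, T t & t < t0 + d.
    apply: contrapT => no; have : t0 + d <= t0.
      apply: lb_le_inf; first by exists 1.
      by move=> t Tt; rewrite leNgt; apply/negP => tt; apply: no; exists t.
    by lra.
  have t0t : t0 <= t by apply: ge_inf; [exists d0|split].
  apply: nAt; have := hd (t - t0); rewrite gE (addrC t0) subrK; apply.
  by rewrite ger0_norm ?subr_ge0//; lra.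
have gx : `|g - xs| <= 2 * rho.
  have -> : g - xs = (x - xs) + t0 *: y by rewrite /g addrAC.
  apply: le_trans (ler_normD _ _) _; rewrite normrZ gtr0_norm//.
  have : t0 * `|y| <= 1 * `|y| by rewrite ler_wpM2r.
  by lra.
have nBg : ~ B g.
  move=> Bg; have [d d1 hd] := open_line y oB Bg.
  pose s := Num.min (d / 2) (t0 / 2).
  have [s1 s2] : s <= d / 2 /\ s <= t0 / 2 by rewrite /s !ge_min !lexx !orbT.
  have sp : 0 < s by rewrite lt_min !divr_gt0.
  have Bs : B (g + (- s) *: y) by apply: hd; rewrite normrN gtr0_norm//; lra.
  have As : A (g + (- s) *: y) by rewrite gE; apply: before; apply/andP; split; lra.
  by have : (A `&` B) (g + (- s) *: y) by []; rewrite AB.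
have Gg : G g by have [] := cov xs g Gs ltac:(lra).
have np := normal_pos g Gg gx.
have [d d1 hd] := small_quadratic C0 np (dot_ge0 y) r0 (normr_ge0 y).
pose s := Num.min (d / 2) (t0 / 2).
have [s1 s2] : s <= d / 2 /\ s <= t0 / 2 by rewrite /s !ge_min !lexx !orbT.
have sp : 0 < s by rewrite lt_min !divr_gt0.
have [h1 h2] := hd s ltac:(apply/andP; split; lra).
have As : A (g + (- s) *: y) by rewrite gE; apply: before; apply/andP; split; lra.
have Bs : B (g + (- s) *: y).
  apply: (two_sided_in (two_sided_sym H)) => //.
    by rewrite normrZ normrN gtr0_norm.
  by rewrite dotNl !dotZr dotZl !mulNr !mulrN !opprK.
by have : (A `&` B) (g + (- s) *: y) by []; rewrite AB.
Qed.

End Sides.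

Section InterfaceGeometry.
Variable R : realType.
Implicit Types (G A B S Omega : set (pt3 R)) (x y u v w : pt3 R) (n : pt3 R -> pt3 R) (r C : R).

Lemma sqr_norm_le_dot w : `|w| ^+ 2 <= dot w w.
Proof.
rewrite -[leRHS]sqr_sqrtr ?dot_ge0// ler_sqr ?nnegrE//.
by apply: norm_le_dot; rewrite // sqr_sqrtr ?dot_ge0.
Qed.

Lemma polyhedral_open Omega : convex_polyhedral_domain Omega -> open Omega.
Proof.
move=> [_ _ [k [a [b ->]]]]; rewrite openE => x /= ax.
apply: (@filter_forall _ _ (fun i => [set y | dot (a i) y < b i]) _ (nbhs_filter x)) => i.
exact: (cvgr_lt (dot (a i) x) (@continuous_dot R (a i) x)).
Qed.

(** At points of [G] both values of [psi] vanish, so Taylor leaves a quadratic bound for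
    [dot (grad psi x) (y - x)]. The field [n] comes from possibly different local equations, but is
    parallel to [grad psi], whose length is bounded below near [x0]. *)
Lemma interface_tangent G n x0 : C2_surface G ->
  (forall x, G x -> normal_to G x (n x) /\ dot (n x) (n x) = 1) -> G x0 ->
  exists r C, [/\ 0 < r, 0 < C & forall x y, ball x0 r x -> ball x0 r y -> G x -> G y ->
    `|dot (n x) (y - x)| <= C * dot (y - x) (y - x)].
Proof.
move=> C2G nG Gx0; have [U [psi [Ux0 le]]] := C2G x0 Gx0.
have [oU C2 g0 GU] := le.
have [r [M [r0 M0 BU T]]] := taylor2 oU C2 Ux0.
pose gg x := dot (grad psi x) (grad psi x).
have gg0 : 0 < gg x0 by apply: dot_gt0; exact: g0.
have cgg : {for x0, continuous gg}.
  have [_ _ c] := @Ck1_C1 _ _ _ _ 2 isT C2.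
  have ci i := c x0 (basis3 i) Ux0.
  by apply: cvgD; [apply: cvgD|]; apply: cvgM; exact: ci.
have [d d0 hd] := continuous_ball cgg (divr_gt0 gg0 (ltr0n R 2)).
pose m := gg x0 / 2; have m0 : 0 < m by rewrite divr_gt0.
exists (Num.min r d), (M / Num.sqrt m); split.
- by rewrite lt_min r0.
- by rewrite divr_gt0// sqrtr_gt0.
move=> x y Bx By Gx Gy.
have mr : Num.min r d <= r /\ Num.min r d <= d by rewrite !ge_min !lexx orbT.
have Bxr := le_ball mr.1 Bx; have Byr := le_ball mr.1 By; have Bxd := le_ball mr.2 Bx.
have zero z : G z -> U z -> psi z = 0.
  by move=> Gz Uz; have : (G `&` U) z by []; rewrite GU => -[].
have := T x y Bxr Byr; rewrite !zero//; [|exact: BU|exact: BU].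
rewrite subrr sub0r normrN; set w := y - x; set g := grad psi x => gw.
have gm : m <= dot g g.
  move: Bxd; rewrite -ball_normE/= distrC => /hd; rewrite /gg -/g -/(gg x0) ltr_norml => /andP[+ _].
  by rewrite /m; lra.
have gp : 0 < dot g g by exact: lt_le_trans gm.
have [[U' [psi' [U'x le' [c nE]]]] nn] := nG x Gx.
have par v : dot g v = 0 -> dot (n x) v = 0.
  move=> gv; rewrite nE dotZl.
  by rewrite (local_equation_parallel Gx (BU _ Bxr) U'x le le' gv) mulr0.
have nw : dot (n x) w = dot g w / dot g g * dot (n x) g.
  have := par (w - (dot g w / dot g g) *: g).
  rewrite !dotBr !dotZr divfK ?gt_eqF// subrr => /(_ erefl)/eqP.
  by rewrite subr_eq0 => /eqP.
have ng := dot_CS (n x) g; rewrite nn mul1r in ng.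
have sm : 0 < Num.sqrt m by rewrite sqrtr_gt0.
have h1 : `|dot (n x) w| <= `|dot g w| / Num.sqrt m.
  rewrite -ler_sqr ?nnegrE// ?divr_ge0 ?sqrtr_ge0//.
  rewrite exprMn exprVn (sqr_sqrtr (ltW m0)) !(real_normK (num_real _)) nw.
  have -> : (dot g w / dot g g * dot (n x) g) ^+ 2 = dot g w ^+ 2 * ((dot (n x) g) ^+ 2 / dot g g ^+ 2).
    by rewrite !exprMn exprVn; ring.
  apply: ler_wpM2l; first exact: sqr_ge0.
  apply: (@le_trans _ _ (dot g g)^-1); last by rewrite lef_pV2.
  rewrite ler_pdivrMr ?exprn_gt0// expr2 mulrA mulVf ?gt_eqF// mul1r.
  exact: ng.
apply: le_trans h1 _; rewrite mulrAC; apply: ler_wpM2r; first by rewrite invr_ge0 sqrtr_ge0.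
by apply: le_trans gw _; rewrite ler_pM2l//; exact: sqr_norm_le_dot.
Qed.

Lemma interface_two_sided Omega G Op Om n : interface_geometry Omega G Op Om n ->
  exists r C, two_sided G Op Om n r C.
Proof.
move=> [pO [cG C2G GO] [[_ oOp _ OpO] [_ oOm _ OmO] OpOm OE] _ nG].
have oO := polyhedral_open pO.
have nG' x : G x -> normal_to G x (n x) /\ dot (n x) (n x) = 1.
  move=> /nG[h1 h2 _]; split => //.
  by rewrite -[LHS]sqr_sqrtr ?dot_ge0// -/(enorm _) h2 expr1n.
(* The curvature bound and a neighbourhood of [G] inside [Omega] are made uniform together; within
   [Omega] every point off [G] belongs to one of the sides. *)
pose P (k : nat) x y := (G x -> G y -> `|dot (n x) (y - x)| <= k%:R * dot (y - x) (y - x)) /\ Omega y.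
have [|r r0 [k HP]] := @compact_uniform R G P cG.
  move=> x0 Gx0; have [r [C [r0 C0 H]]] := interface_tangent C2G nG' Gx0.
  have /nbhs_ballP[d /= d0 hd] : nbhs x0 Omega by apply: open_nbhs_nbhs; split => //; exact: GO.
  have mr : Num.min r d <= r /\ Num.min r d <= d by rewrite !ge_min !lexx orbT.
  exists (Num.min r d); first by rewrite lt_min r0.
  exists (Num.truncn C).+1 => k kC x y Bx By; split; last by apply: hd; exact: (le_ball mr.2 By).
  move=> Gx Gy; apply: le_trans (H x y (le_ball mr.1 Bx) (le_ball mr.1 By) Gx Gy) _.
  apply: ler_wpM2r; first exact: dot_ge0.
  by apply: le_trans (ltW (truncnS_gt C)) _; rewrite ler_nat.
have OG x : Op x \/ Om x -> G x -> False.
  by move=> h Gx; have : (Omega `\` G) x by [rewrite OE]; case.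
exists r, k.+1%:R; split.
- by split.
- split => //; rewrite -subset0 => x [h1 h2]; apply: (OG x) => //; by [left|right].
- move=> x y Gx xy; have [_ Oy] := HP x y Gx xy.
  have [Gy|nGy] := pselect (G y); first by constructor 1.
  have : (Omega `\` G) y by []; rewrite OE => -[h|h]; by [constructor 2|constructor 3].
- move=> x Gx; split; first exact: (nG' x Gx).2.
  by have [_ _] := nG x Gx.
- move=> x y Gx Gy xy; apply: le_trans ((HP x y Gx xy).1 Gx Gy) _.
  by apply: ler_wpM2r; rewrite ?dot_ge0// ler_nat.
Qed.

End InterfaceGeometry.

(** * Affine approximation of a function on one side of the interface *)

Section LocalApproximation.
Variable R : realType.
Implicit Types (G A B S Q : set (pt3 R)) (x y u w : pt3 R) (n : pt3 R -> pt3 R) (r C : R).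

Definition star_hull S Q : set (pt3 R) :=
  [set x | exists a q (t : R), [/\ S a, Q q, 0 <= t <= 1 & x = a + t *: (q - a)]].

(** A perturbation of [a + t (q - a)] is absorbed by the endpoint in [S] when [t < 1], and by the
    endpoint in [Q] when [t = 1]. *)
Lemma star_hull_open S Q : open S -> open Q -> open (star_hull S Q).
Proof.
have key (O : set (pt3 R)) y (s : R) : open O -> O y -> 0 < s ->
    exists2 e : R, 0 < e & forall u, `|u| < e -> O (y + s^-1 *: u).
  move=> oO Oy s0; have /nbhs_ballP[e /= e0 he] : nbhs y O by apply: open_nbhs_nbhs.
  exists (s * e); first exact: mulr_gt0.
  move=> u hu; apply: he; rewrite -ball_normE/= opprD addNKr normrN normrZ gtr0_norm ?invr_gt0//.
  by rewrite ltr_pdivrMl.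
move=> oS oQ; rewrite openE => x [a [q [t [Sa Qq /andP[t0 t1] ->]]]].
have [t2|t2] := ltP t 1.
  have s0 : 0 < 1 - t by rewrite subr_gt0.
  have [e e0 he] := key S a (1 - t) oS Sa s0.
  apply/nbhs_ballP; exists e => //= y; rewrite -ball_normE/= distrC => /he Sy.
  exists (a + (1 - t)^-1 *: (y - (a + t *: (q - a)))), q, t; split; rewrite ?t0//.
  have sn : 1 - t != 0 by rewrite gt_eqF.
  by apply: pt3_eq; rewrite /= /GRing.scale/=; field.
have t3 : t = 1 by apply/le_anti/andP.
have [e e0 he] := key Q q 1 oQ Qq ltr01.
apply/nbhs_ballP; exists e => //= y; rewrite -ball_normE/= distrC t3 => /he Qy.
exists a, (q + 1^-1 *: (y - (a + 1 *: (q - a)))), 1; split; rewrite ?ler01 ?lexx//.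
by apply: pt3_eq; rewrite /= /GRing.scale/=; field.
Qed.

Lemma star_hull_star S z (rho : R) : star_wrt (star_hull S (ball z rho)) (ball z rho).
Proof.
move=> x q s [a [q1 [t [Sa Qq1 /andP[t0 t1] ->]]]] Qq /andP[s0 s1].
have a0 : 0 <= (1 - s) * t by rewrite mulr_ge0 ?subr_ge0.
have [st|st] := eqVneq ((1 - s) * t + s) 0.
  have sE : s = 0 by lra.
  exists a, q1, t; rewrite sE scale0r addr0 t0 t1; split => //.
have st0 : 0 < (1 - s) * t + s by rewrite lt_def st addr_ge0.
exists a, (((1 - s) * t + s)^-1 *: (((1 - s) * t) *: q1 + s *: q)), ((1 - s) * t + s); split => //.
- exact: ball_convex.
- rewrite addr_ge0//=; have : 0 <= (1 - s) * (1 - t) by rewrite mulr_ge0 ?subr_ge0.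
  by lra.
- by apply: pt3_eq; rewrite /= /GRing.scale/=; field.
Qed.

(** Explains the distance [20 h]. The normal component of [q - x] is at least
    [20 h - 2 h - 6 h = 12 h], where the factor 2 compares Euclidean and sup norm, while its norm is
    at most [24 h]: a slope of at least one half. *)
Lemma unit_offset_cone nu xs x q (h : R) : dot nu nu = 1 -> 0 < h -> `|x - xs| <= 3 * h ->
  ball (xs + (20 * h) *: nu) h q ->
  [/\ `|q - x| <= 24 * h, 0 < `|q - x|, 2^-1 * `|q - x| <= dot nu (q - x) & `|q - xs| < 21 * h].
Proof.
move=> nn h0 xh; rewrite -ball_normE/= distrC => qh.
have nu1 := unit_norm_le nn.
have E : q - x = (q - (xs + (20 * h) *: nu)) - (x - xs) + (20 * h) *: nu.
  by apply: pt3_eq; rewrite /= /GRing.scale/=; ring.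
have n20 : `|(20 * h) *: nu| <= 20 * h.
  have h20 : 0 <= 20 * h by rewrite mulr_ge0// ltW.
  by rewrite normrZ (ger0_norm h20) ler_piMr.
have d1 : `|q - x| <= 24 * h.
  rewrite E; apply: le_trans (ler_normD _ _) _.
  have := ler_normB (q - (xs + (20 * h) *: nu)) (x - xs); lra.
have b1 := unit_dot_le (q - (xs + (20 * h) *: nu)) nn.
have b2 := unit_dot_le (x - xs) nn.
have dn : 12 * h <= dot nu (q - x).
  rewrite E dotDr dotBr dotZr nn mulr1.
  by move: b1 b2; rewrite !ler_norml => /andP[b1 _] /andP[_ b2]; lra.
have b3 := unit_dot_le (q - x) nn.
split => //.
- by have := le_trans (ler_norm _) b3; lra.
- lra.
- have -> : q - xs = (q - (xs + (20 * h) *: nu)) + (20 * h) *: nu by rewrite opprD addrA subrK.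
  by apply: le_lt_trans (ler_normD _ _) _; lra.
Qed.

Lemma morrey_constant (K E h : R) : 0 < h ->
  10 ^+ 6 * (13 + 12 * (42 * h / h)) ^+ 2 *
    (K * h ^+ 4 * E + (96 * (42 * h / h) ^+ 3) ^+ 2 * (42 * h) ^+ 4 * E) / h ^+ 3 =
  10 ^+ 6 * (13 + 12 * 42) ^+ 2 * (K + (96 * 42 ^+ 3) ^+ 2 * 42 ^+ 4) * h * E.
Proof. by move=> h0; rewrite !mulfK ?gt_eqF//; field; rewrite gt_eqF. Qed.

Lemma lee_EFinM (c E : R) (S : \bar R) : 0 <= c -> (S <= E%:E)%E -> (c%:E * S <= (c * E)%:E)%E.
Proof. by move=> c0 h; rewrite EFinM; exact: lee_wpmul2l. Qed.

Lemma deny_constant (h : R) : 0 < h ->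
  3 * (42 * h) ^+ 2 * (42 * h / h) ^+ 3 = 3 * 42 ^+ 2 * 42 ^+ 3 * h ^+ 2.
Proof. by move=> h0; rewrite mulfK ?gt_eqF//; ring. Qed.

(** On the ball the constant slope of [p] is [g i] minus the approximation error, and the square of
    a constant is recovered from its integral. *)
Lemma gradient_bound (p : affine) (z : pt3 R) (h F E : R) (g : 'I_3 -> pt3 R -> R) : 0 < h ->
  (forall i, measurable_fun (ball z h) (g i)) ->
  (forall i, N2 (ball z h) (g i) <= F%:E)%E ->
  (forall i, N2 (ball z h) (fun x => g i x - dot p.1 (basis3 i))%R <= E%:E)%E ->
  l1norm p.1 ^+ 2 * h ^+ 3 <= 3 * (F + E).
Proof.
move=> h0 mg HF HE; have mQ := measurable_ball3 z h.
have b i : dot p.1 (basis3 i) ^+ 2 * (h *+ 2) ^+ 3 <= 2 * (F + E).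
  rewrite -lee_fin.
  have -> : ((dot p.1 (basis3 i) ^+ 2 * (h *+ 2) ^+ 3)%:E = N2 (ball z h) (fun=> dot p.1 (basis3 i)))%E.
    transitivity ((dot p.1 (basis3 i) ^+ 2)%:E * mu3 (ball z h))%E.
      by rewrite mu3_ball ?ltW// -EFinM.
    by rewrite /N2 integral_cst.
  rewrite (@N2_eq _ _ _ (fun x => g i x + (-1) * (g i x - dot p.1 (basis3 i)))); last first.
    by move=> x _; ring.
  have m1 : measurable_fun (ball z h) (fun x => g i x - dot p.1 (basis3 i)).
    by apply: measurable_funB => //; exact: measurable_cst.
  have mN : measurable_fun (ball z h) (fun x => -1 * (g i x - dot p.1 (basis3 i))).
    by apply: measurable_funM => //; exact: measurable_cst.
  apply: le_trans (N2D mQ (mg i) mN) _.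
  rewrite (N2Z (-1) mQ m1); have -> : ((-1) ^+ 2 : R) = 1 by rewrite sqrrN expr1n.
  rewrite mul1e mulrDr [leRHS]EFinD; apply: leeD; rewrite EFinM; apply: lee_wpmul2l => //.
have e (c : R) : c * (h *+ 2) ^+ 3 = 8 * (c * h ^+ 3) by rewrite -mulr_natl; ring.
have := b 0; have := b 1; have := b 2%:R; rewrite !e.
rewrite /dot /basis3 /= !(mulr0, mulr1, add0r, addr0).
have := sqr_ge0 (`|p.1.1.1| - `|p.1.1.2|); have := sqr_ge0 (`|p.1.1.1| - `|p.1.2|).
have := sqr_ge0 (`|p.1.1.2| - `|p.1.2|).
have h3 : 0 <= h ^+ 3 by rewrite exprn_ge0// ltW.
rewrite /l1norm -(real_normK (num_real p.1.1.1)) -(real_normK (num_real p.1.1.2)) -(real_normK (num_real p.1.2)).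
move: (`|p.1.1.1|) (`|p.1.1.2|) (`|p.1.2|) => x y w h4 h5 h6 b1 b2 b3.
have : (x + y + w) ^+ 2 <= 3 * (x ^+ 2 + y ^+ 2 + w ^+ 2).
  have -> : (x + y + w) ^+ 2 = 3 * (x ^+ 2 + y ^+ 2 + w ^+ 2) - (x - y) ^+ 2 - (x - w) ^+ 2 - (y - w) ^+ 2 by ring.
  lra.
move/(ler_wpM2r h3).
have w0 : 0 <= w ^+ 2 * h ^+ 3 by rewrite mulr_ge0// sqr_ge0.
have -> : 3 * (x ^+ 2 + y ^+ 2 + w ^+ 2) * h ^+ 3 = 3 * (x ^+ 2 * h ^+ 3 + y ^+ 2 * h ^+ 3 + w ^+ 2 * h ^+ 3) by ring.
lra.
Qed.

(* The ball of radius [h] around [xs + 20 h n] is seen from every point of the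
   side [A] within [3 h] of [xs], so [W] contains a domain which is star-shaped
   with respect to it. *)
Lemma side_approximation : exists2 K : R, 0 < K & forall G A B n r C xs (h E : R) v g gg,
  two_sided G A B n r C -> G xs -> 0 < h -> 400 * h < r -> 10 ^+ 5 * C * h < 1 ->
  H2data A v g gg ->
  let W := A `&` ball xs (21 * h) in
  (\sum_i \sum_j N2 W (gg i j) <= E%:E)%E ->
  exists p : affine,
    [/\ forall x, A x \/ G x -> `|x - xs| <= 3 * h ->
          (forall e : R, 0 < e -> exists2 d : R, 0 < d & forall y, A y -> `|y - x| < d -> `|v y - v x| < e) ->
          (v x - aff p x) ^+ 2 <= K * h * E,
        (N2 (A `&` ball xs (3 * h)) (fun x => v x - aff p x)%R <= (K * h ^+ 4 * E)%:E)%E,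
        (forall i, N2 (A `&` ball xs (3 * h)) (fun x => g i x - dot p.1 (basis3 i))%R <= (K * h ^+ 2 * E)%:E)%E &
        forall F : R, (\sum_i N2 W (g i) <= F%:E)%E -> l1norm p.1 ^+ 2 * h ^+ 3 <= K * (F + h ^+ 2 * E)].
Proof.
pose K1 : R := 3 * 42 ^+ 2 * 42 ^+ 3.
pose KM : R := 10 ^+ 6 * (13 + 12 * 42) ^+ 2 * (K1 ^+ 2 + (96 * 42 ^+ 3) ^+ 2 * 42 ^+ 4).
have K10 : 0 <= K1 by rewrite !mulr_ge0// exprn_ge0.
have KM0 : 0 <= KM by rewrite mulr_ge0 ?addr_ge0 ?sqr_ge0// mulr_ge0 ?sqr_ge0// ?exprn_ge0.
exists (3 + 3 * K1 + K1 ^+ 2 + KM).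
  by have := sqr_ge0 K1; lra.
move=> G A B n r C xs h E v g gg H Gs h0 hr hC Hv W HE.
have [[r0 C0 [oA oB]] _ _ nG _] := H; have [nn _] := nG xs Gs.
pose z := xs + (20 * h) *: n xs; pose Q := ball z h.
have E0 : 0 <= E.
  by rewrite -lee_fin; apply: le_trans HE; apply: sume_ge0 => i _; apply: sume_ge0 => j _; exact: N2_ge0.
have oW : open W by apply: openI => //; exact: ball_open.
have Ch : 0 < C * h by exact: mulr_gt0.
have coneA x q (t : R) : A x \/ G x -> `|x - xs| <= 3 * h -> Q q -> 0 < t <= 1 -> W (x + t *: (q - x)).
  move=> AGx xh Qq /andP[t0 t1].
  have [d1 d2 d3 d4] := unit_offset_cone nn h0 xh Qq.
  split.
    (* The displacement bound [24 h] and the slope [1/2] are the origin of [400 * h < r] and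
       [10 ^+ 5 * C * h < 1]. *)
    apply: (@two_sided_cone _ G A B n r C xs x _ (24 * h) 2^-1 H) => //.
    - by lra.
    - have -> : 512 * C * (24 * h) = 512 * 24 * (C * h) by ring.
      lra.
    - by lra.
    - by lra.
    - by rewrite normrZ gtr0_norm//; apply: le_trans d1; rewrite ler_piMl.
    - by rewrite normrZ gtr0_norm// mulr_gt0.
    - by rewrite normrZ gtr0_norm// dotZr mulrCA ler_pM2l.
  rewrite -ball_normE/= distrC.
  have -> : x + t *: (q - x) - xs = (1 - t) *: (x - xs) + t *: (q - xs).
    by apply: pt3_eq; rewrite /= /GRing.scale/=; ring.
  apply: le_lt_trans (ler_normD _ _) _; rewrite !normrZ (gtr0_norm t0).
  rewrite ger0_norm ?subr_ge0//; apply: convex_lt => //; first by rewrite ltW.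
  by lra.
have QW : Q `<=` W.
  move=> q Qq; have qE : xs + (q - xs) = q by rewrite addrC subrK.
  have := coneA xs q 1 (or_intror Gs); rewrite scale1r qE; apply => //.
    by rewrite subrr normr0 mulr_ge0// ltW.
  by rewrite ltr01 lexx.
pose S := A `&` ball xs (3 * h); pose V := star_hull S Q.
have oS : open S by apply: openI => //; exact: ball_open.
have oV : open V by apply: star_hull_open => //; exact: ball_open.
have Qz : Q z by exact: ballxx.
have Sd x : S x -> `|x - xs| <= 3 * h by move=> [_]; rewrite -ball_normE/= distrC => /ltW.
have VW : V `<=` W.
  move=> _ [a [q [t [Sa Qq /andP[t0 t1] ->]]]].
  have [tE|tn] := eqVneq t 0.
    rewrite tE scale0r addr0; case: Sa => Aa Ba; split => //; apply: (le_ball _ Ba).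
    by rewrite ler_pM2r//; lra.
  by apply: coneA => //; [left; case: Sa|exact: Sd|rewrite lt_def tn t0].
have SV : S `<=` V.
  move=> x Sx; exists x, z, 0; split; rewrite ?lexx ?ler01// ?scale0r ?addr0//.
have QV : Q `<=` V.
  have [_ [d d0 hd]] := nG xs Gs.
  (* A point of [Q] belongs to the hull as the endpoint of a segment that starts in [S], so a point
     of [S] has to be exhibited: one slightly above [xs] along the normal. *)
  pose t := Num.min (d / 2) h.
  have [t1 t2] : t <= d / 2 /\ t <= h by rewrite /t !ge_min !lexx orbT.
  have t0 : 0 < t by rewrite lt_min h0 divr_gt0.
  move=> q Qq; exists (xs + t *: n xs), q, 1; split; rewrite ?ler01 ?lexx//.
    split; first by have [] := hd t _; rewrite ?t0//=; lra.
    rewrite -ball_normE/= opprD addNKr normrN normrZ gtr0_norm//.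
    by have := ler_wpM2l (ltW t0) (unit_norm_le nn); lra.
  by rewrite scale1r [RHS]addrC subrK.
have bW : exists M : R, W `<=` ball 0 M.
  exists (`|xs| + 21 * h) => x [_]; rewrite -!ball_normE/= sub0r normrN distrC => hx.
  by rewrite -(subrK xs x); apply: le_lt_trans (ler_normD _ _) _; rewrite addrC ltrD2l.
have bV : exists M : R, V `<=` ball 0 M by case: bW => M WM; exists M; exact: subset_trans WM.
have dV x q : V x -> ball z h q -> `|q - x| < 42 * h.
  move=> /VW[_ Bx] /QW[_]; move: Bx; rewrite -!ball_normE/= => h1 h2.
  rewrite -(subrKA xs); apply: le_lt_trans (ler_normD _ _) _.
  by rewrite distrC; lra.
have mA := open_measurable3 oA; have mW := open_measurable3 oW.
have mV := open_measurable3 oV; have mS := open_measurable3 oS; have mQ := measurable_ball3 z h.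
have AW : W `<=` A by move=> x [].
have HW := H2data_sub mA mW AW Hv.
have HV := H2data_sub mW mV VW HW.
have lv : in_L2 W v by case: HW => /(_ 0)/(wderiv1P _ _ _ mW)[].
have lg i : in_L2 W (g i) by case: HW => /(_ i)/(wderiv1P _ _ _ mW)[].
have lgg i j : in_L2 W (gg i j) by case: HW => _ /(_ i j)/(wderiv1P _ _ _ mW)[].
have HEV : (\sum_i \sum_j N2 V (gg i j) <= E%:E)%E.
  apply: le_trans HE; apply: lee_sum => i _; apply: lee_sum => j _; apply: N2_sub => //.
  exact: in_L2_measurable.
have h42 : 0 < 42 * h by rewrite mulr_gt0.
have [p [Hp1 Hp2]] := deny_lions oV bV h0 h42 QV (@star_hull_star _ _ _) dV HV.
rewrite deny_constant// -/K1 in Hp1 Hp2.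
have K1h : 0 <= K1 * h ^+ 2 by rewrite mulr_ge0 ?sqr_ge0.
have {}Hp1 i : (N2 V (fun x => g i x - dot p.1 (basis3 i))%R <= (K1 * h ^+ 2 * E)%:E)%E.
  apply: (@le_trans _ _ (\sum_i N2 V (fun x => g i x - dot p.1 (basis3 i))%R)%E).
    by rewrite (bigD1 i)//= leeDl// sume_ge0// => *; exact: N2_ge0.
  by apply: le_trans Hp1 _; exact: lee_EFinM.
have {}Hp2 : (N2 V (fun x => v x - aff p x)%R <= (K1 ^+ 2 * h ^+ 4 * E)%:E)%E.
  apply: le_trans Hp2 _.
  have -> : K1 ^+ 2 * h ^+ 4 * E = (K1 * h ^+ 2) ^+ 2 * E by ring.
  by apply: lee_EFinM => //; exact: sqr_ge0.
have mvV : measurable_fun V (fun x => v x - aff p x).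
  apply: measurable_funB; last exact: measurable_aff.
  by apply: measurable_funS (in_L2_measurable lv).
have mgV i : measurable_fun V (fun x => g i x - dot p.1 (basis3 i)).
  apply: measurable_funB; last exact: measurable_cst.
  by apply: measurable_funS (in_L2_measurable (lg i)).
have le_K (a b c : R) : 0 <= b -> 0 <= c -> a <= 3 + 3 * K1 + K1 ^+ 2 + KM ->
    a * b * c <= (3 + 3 * K1 + K1 ^+ 2 + KM) * b * c.
  by move=> b0 c0 ab; apply: ler_wpM2r => //; exact: ler_wpM2r.
have K12 : 0 <= K1 ^+ 2 by exact: sqr_ge0.
have hh k : 0 <= h ^+ k by rewrite exprn_ge0// ltW.
exists p; split.
- move=> x AGx xh cv.
  have HQ : (N2 Q (fun x => v x - aff p x)%R <= (K1 ^+ 2 * h ^+ 4 * E)%:E)%E.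
    by apply: le_trans Hp2; exact: N2_sub.
  have := @morrey R W x z h (42 * h) (K1 ^+ 2 * h ^+ 4 * E) E v g gg p oW bW h0 h42.
  rewrite morrey_constant// -/KM => M.
  apply: (@le_trans _ _ (KM * h * E)); last first.
    by apply: le_K => //; [exact: ltW|lra].
  apply: M => //.
  + move=> _ [t [q [t01 Qq ->]]]; exact: coneA.
  + move=> q Qq; have [d1 _ _ _] := unit_offset_cone nn h0 xh Qq; lra.
  + by move=> e /cv[d d0 hd]; exists d => // y /AW; exact: hd.
- apply: (@le_trans _ _ (K1 ^+ 2 * h ^+ 4 * E)%:E).
    by apply: le_trans Hp2; exact: N2_sub.
  by rewrite lee_fin; apply: le_K => //; lra.
- move=> i; apply: (@le_trans _ _ (K1 * h ^+ 2 * E)%:E).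
    by apply: le_trans (Hp1 i); exact: N2_sub.
  by rewrite lee_fin; apply: le_K => //; lra.
- move=> F HF.
  have F0 : 0 <= F.
    by rewrite -lee_fin; apply: le_trans HF; apply: sume_ge0 => i _; exact: N2_ge0.
  apply: (@le_trans _ _ (3 * (F + K1 * h ^+ 2 * E))).
    apply: (@gradient_bound p z h F (K1 * h ^+ 2 * E) g) => //.
    + by move=> i; apply: measurable_funS (in_L2_measurable (lg i)).
    + move=> i; apply: (@le_trans _ _ (N2 W (g i))).
        by apply: N2_sub => //; exact: in_L2_measurable.
      apply: le_trans HF.
      by rewrite (bigD1 i)//= leeDl// sume_ge0// => *; exact: N2_ge0.
    + by move=> i; apply: le_trans (Hp1 i); exact: N2_sub.
  have a4 := mulr_ge0 (hh 2%N) E0; have a1 := mulr_ge0 K10 a4.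
  have a2 := mulr_ge0 K12 a4; have a3 := mulr_ge0 KM0 a4.
  have b1 := mulr_ge0 K10 F0; have b2 := mulr_ge0 K12 F0; have b3 := mulr_ge0 KM0 F0.
  rewrite -(mulrA K1); clearbody K1 KM; clear -F0 a4 a1 a2 a3 b1 b2 b3.
  lra.
Qed.

End LocalApproximation.

(** * Traces on the interface *)

Section DirectionalFubini.
Variable R : realType.
Local Notation R' := (measurableTypeR R).
Local Notation leb := (@lebesgue_measure R).

Definition place (j : 'I_3) (s : pt2 R) (t : R) : pt3 R :=
  if j == 0 then (t, s.1, s.2) else if j == 1 then (s.1, t, s.2) else (s.1, s.2, t).

Lemma measurable_place j : measurable_fun setT (fun p : R' * R' * R' => place j p.1 p.2 : R' * R' * R').
Proof.
have m1 : measurable_fun setT (fun p : R' * R' * R' => p.1.1) by apply: measurableT_comp; [exact: measurable_fst|exact: measurable_fst].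
have m2 : measurable_fun setT (fun p : R' * R' * R' => p.1.2) by apply: measurableT_comp; [exact: measurable_snd|exact: measurable_fst].
have m3 : measurable_fun setT (fun p : R' * R' * R' => p.2) by exact: measurable_snd.
have pr (f g h : R' * R' * R' -> R') : measurable_fun setT f -> measurable_fun setT g ->
    measurable_fun setT h -> measurable_fun setT (fun p => (f p, g p, h p) : R' * R' * R').
  by move=> mf mg mh; apply/measurable_fun_pairP; split => //; apply/measurable_fun_pairP; split.
by move: j; apply: ord3P; rewrite /place /=; apply: pr.
Qed.

Lemma measurable_inner (F : R' * R' * R' -> \bar R) : measurable_fun setT F -> (forall x, 0 <= F x)%E ->
  measurable_fun setT (fun s : R' * R' => \int[leb]_t F (s, t))%E.
Proof. by move=> mF F0; exact: (measurable_fun_fubini_tonelli_F (m2 := leb)). Qed.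

(** The measure is an iterated product in a fixed order; at most two coordinates have to be
    exchanged to integrate along the j-th axis first. *)
Lemma fubini_place j (F : pt3 R -> \bar R) : measurable_fun setT F -> (forall x, 0 <= F x)%E ->
  (\int[@mu3 R]_x F x = \int[@mu2 R]_s \int[leb]_t F (place j s t))%E.
Proof.
move=> mF F0.
have swap (g : R' * R' -> \bar R) : measurable_fun setT g -> (forall x, 0 <= g x)%E ->
    (\int[leb]_a \int[leb]_b g (a, b) = \int[leb]_b \int[leb]_a g (a, b))%E.
  by move=> mg g0; exact: (fubini_tonelli (m1 := leb) (m2 := leb)).
have mFj : measurable_fun setT (fun p : R' * R' * R' => F (place j p.1 p.2)).
  by apply: measurableT_comp; [exact: mF|exact: measurable_place].
have H0 (s : R' * R') : (0 <= \int[leb]_t F (place j s t))%E by exact: integral_ge0.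
have L0 (s : R' * R') : (0 <= \int[leb]_t F (s, t))%E by exact: integral_ge0.
have mH := measurable_inner mFj (fun p => F0 _).
have mL := measurable_inner mF F0.
rewrite (mu3_fubini mF F0) (mu2_fubini mL L0) (mu2_fubini mH H0) /=.
have slice (a : R') : measurable_fun setT (fun p : R' * R' => F (place j (a, p.1) p.2)).
  apply: (@measurableT_comp _ _ _ _ _ _ (fun p : R' * R' * R' => F (place j p.1 p.2)) _ (fun p : R' * R' => ((a, p.1), p.2) : R' * R' * R')) => //.
  apply/measurable_fun_pairP; split; last exact: measurable_snd.
  by apply/measurable_fun_pairP; split; [exact: measurable_cst|exact: measurable_fst].
have inner (a : R') : (\int[leb]_b \int[leb]_t F (place j (a, b) t) = \int[leb]_t \int[leb]_b F (place j (a, b) t))%E.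
  by rewrite (swap _ (slice a)).
move: j {mFj H0 mH slice} inner; apply: ord3P => inner; rewrite /place /= in inner *.
- under [RHS]eq_integral do rewrite inner.
  exact: (swap _ mL).
- by under [RHS]eq_integral do rewrite inner.
- by [].
Qed.

Lemma placeD j (s s' : pt2 R) (t t' : R) : place j s t + place j s' t' = place j (s + s') (t + t').
Proof. by move: j; apply: ord3P. Qed.

Lemma placeZ j (s : pt2 R) (t c : R) : c *: place j s t = place j (c *: s) (c * t).
Proof. by move: j; apply: ord3P. Qed.

Lemma placeB j (s s' : pt2 R) (t t' : R) : place j s t - place j s' t' = place j (s - s') (t - t').
Proof. by rewrite -scaleN1r placeZ placeD scaleN1r mulN1r. Qed.

Lemma place_basis j : place j 0 1 = basis3 j.
Proof. by move: j; apply: ord3P. Qed.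

Lemma place_line j s (t u : R) : place j s t + u *: basis3 j = place j s (t + u).
Proof. by rewrite -place_basis placeZ placeD scaler0 addr0 mulr1. Qed.

Definition others (j : 'I_3) (x : pt3 R) : pt2 R :=
  if j == 0 then (x.1.2, x.2) else if j == 1 then (x.1.1, x.2) else x.1.

Lemma place_others j x : place j (others j x) (dot x (basis3 j)) = x.
Proof.
by case: x => -[a b] c; move: j; apply: ord3P;
  rewrite /place /others /dot /basis3 /= !(mulr0, mulr1, add0r, addr0).
Qed.

Lemma dot_place j s t s' t' : dot (place j s t) (place j s' t') = s.1 * s'.1 + s.2 * s'.2 + t * t'.
Proof. by move: j; apply: ord3P; rewrite /dot /place /=; ring. Qed.

Lemma norm_place j s (t r : R) : `|place j s t| <= r <-> `|s| <= r /\ `|t| <= r.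
Proof.
rewrite pt3_norm_le prod_normE ge_max.
by move: j; apply: ord3P; rewrite /place /=; split=> [[-> -> ->]//|[/andP[-> ->] ->]].
Qed.

End DirectionalFubini.

Section Endpoint.
Variable R : realType.
Local Notation leb := (@lebesgue_measure R).

Lemma young (h w a b : R) : 0 < h -> `|w| <= 1 ->
  a ^+ 2 / h + 2 * w * (a * b) <= 2 / h * a ^+ 2 + h * b ^+ 2.
Proof.
move=> h0 w1.
have -> : 2 / h * a ^+ 2 + h * b ^+ 2 = a ^+ 2 / h + (a ^+ 2 / h + h * b ^+ 2) by ring.
rewrite lerD2l.
have w2 : 0 <= h * b ^+ 2 * (1 - w ^+ 2).
  apply: mulr_ge0; first by apply: mulr_ge0; [exact: ltW|exact: sqr_ge0].
  by rewrite subr_ge0 -(real_normK (num_real w)) expr_le1.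
rewrite -subr_ge0.
have -> : a ^+ 2 / h + h * b ^+ 2 - 2 * w * (a * b) = (a - h * w * b) ^+ 2 / h + h * b ^+ 2 * (1 - w ^+ 2).
  by field; rewrite gt_eqF.
by rewrite addr_ge0// divr_ge0 ?sqr_ge0// ltW.
Qed.

(* [F t = ((t - k) / h) a(t)^2], where [k] is the endpoint opposite to [e]. *)
Lemma endpoint_bound (a a' : R -> R) (c d e : R) : c < d -> continuous a' ->
  (forall t : R, is_derive t (1 : R) a (a' t)) -> e = c \/ e = d ->
  ((a e ^+ 2)%:E <= \int[leb]_(t in `]c, d[) (2 / (d - c) * a t ^+ 2 + (d - c) * a' t ^+ 2)%:E)%E.
Proof.
move=> cd ca' da ecd.
have da' t : derivable a t 1 by exact: (@ex_derive _ _ _ _ _ _ _ (da t)).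
have ca : continuous a.
  by move=> t; apply: differentiable_continuous; apply/derivable1_diffP.
set h := d - c; have h0 : 0 < h by rewrite subr_gt0.
pose k := c + d - e.
have kcd : (k = d /\ e = c) \/ (k = c /\ e = d).
  by rewrite /k; case: ecd => ->; [left|right]; split => //; ring.
pose w t := (t - k) / h.
pose F t := w t * a t ^+ 2.
pose f t := a t ^+ 2 / h + 2 * w t * (a t * a' t).
have dw (t : R) : is_derive t (1 : R) w h^-1.
  have -> : w = (fun s : R => (s - k) * h^-1) by [].
  by apply: is_derive_eq; rewrite subr0 scaler0 add0r /GRing.scale/= mulr1.
have dF (t : R) : is_derive t (1 : R) F (f t).
  have D := da t; have W := dw t.
  rewrite /F; apply: is_derive_eq; rewrite /f /GRing.scale/=; ring.
have cw : continuous w.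
  move=> t; apply: cvgM; last exact: cvg_cst.
  by apply: cvgB; [exact: cvg_id|exact: cvg_cst].
have ca2 : continuous (fun t => a t ^+ 2).
  by move=> t; apply: (@continuous_comp _ _ _ a (fun x => x ^+ 2)); [exact: ca|exact: exprn_continuous].
have cf : continuous f.
  move=> t; apply: cvgD; first by apply: cvgM; [exact: ca2|exact: cvg_cst].
  apply: cvgM; first by apply: cvgM; [exact: cvg_cst|exact: cw].
  by apply: cvgM; [exact: ca|exact: ca'].
pose g t := 2 / h * a t ^+ 2 + h * a' t ^+ 2.
have cg : continuous g.
  move=> t; apply: cvgD; (apply: cvgM; first exact: cvg_cst); first exact: ca2.
  by apply: (@continuous_comp _ _ _ a' (fun x => x ^+ 2)); [exact: ca'|exact: exprn_continuous].
have cF : continuous F by move=> t; apply: cvgM; [exact: cw|exact: ca2].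
have := @continuous_FTC2 R f F c d cd (continuous_subspaceT cf) _ _.
have -> : ((F d)%:E - (F c)%:E = (a e ^+ 2)%:E)%E.
  have hn : d - c != 0 by rewrite gt_eqF.
  rewrite -EFinB; congr EFin; rewrite /F /w /h.
  by case: kcd => -[-> ->]; field.
move=> <-; last 2 first.
- split; first by move=> t _; exact: (@ex_derive _ _ _ _ _ _ _ (dF t)).
    by apply: cvg_at_right_filter; exact: cF.
  by apply: cvg_at_left_filter; exact: cF.
- by move=> t _; rewrite derive1E (@derive_val _ _ _ _ _ _ _ (dF t)).
have mg (D : set R) : measurable D -> measurable_fun D (fun t => (g t)%:E).
  move=> mD; apply/measurable_EFinP; apply: (measurable_funS measurableT) => //.
  exact: continuous_measurable_fun.
rewrite [leRHS](_ : _ = \int[leb]_(t in `[c, d]) (g t)%:E)%E; last first.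
  by rewrite -integral_itv_obnd_cbnd ?integral_itv_bndo_bndc//; exact: mg.
apply: le_integral => //.
- by apply: continuous_compact_integrable; [exact: segment_compact|exact: continuous_subspaceT].
- by apply: continuous_compact_integrable; [exact: segment_compact|exact: continuous_subspaceT].
move=> t; rewrite inE/= in_itv/= => /andP[ct td]; rewrite lee_fin; apply: young => //.
rewrite /w normrM (gtr0_norm (x := h^-1)) ?invr_gt0// ler_pdivrMr// mul1r ler_norml /h.
by case: kcd => -[-> _]; apply/andP; split; lra.
Qed.

End Endpoint.

(** * The interface near one of its points as the graph of a C^1 function *)

Section Patch.
Variable R : realType.
Implicit Types (G A B : set (pt3 R)) (x y u : pt3 R) (n : pt3 R -> pt3 R) (r C : R).

Lemma is_derive_epsV (V W : normedModType R) (f : V -> W) (x v : V) (l : W) :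
  (forall e : R, 0 < e -> exists2 d : R, 0 < d & forall h : R, h != 0 -> `|h| < d ->
    `|h^-1 *: (f (x + h *: v) - f x) - l| <= e) -> is_derive x v f l.
Proof.
move=> H.
have cl : (fun h => h^-1 *: ((f \o shift x) (h *: v) - f x)) @ 0^' --> l.
  apply/cvgrPdist_le => e e0; have [d d0 hd] := H e e0.
  exists d => //= h hlt h0; have {}hlt : `|h| < d by move: hlt; rewrite /ball_ /= sub0r normrN.
  by rewrite distrC [h *: v + x]addrC; exact: hd.
split; first by apply/cvg_ex; exists l.
by rewrite /derive; apply: cvg_lim.
Qed.

Lemma continuous_epsV (V W : normedModType R) (f : V -> W) (x : V) :
  (forall e : R, 0 < e -> exists2 d : R, 0 < d & forall y : V, `|y - x| < d -> `|f y - f x| <= e) ->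
  {for x, continuous f}.
Proof.
move=> H; apply/cvgrPdist_le => e /H[d d0 hd]; apply/nbhs_ballP; exists d => // y.
by rewrite -ball_normE/= distrC => /hd; rewrite distrC.
Qed.

Lemma continuous_eq_on (V W : normedModType R) (D : set V) (f g : V -> W) (x : V) :
  open D -> D x -> (forall y : V, D y -> f y = g y) -> {for x, continuous g} -> {for x, continuous f}.
Proof.
move=> oD Dx fg cg; rewrite /prop_for /continuous_at (fg x Dx).
have E : {near x, g =1 f}.
  by have Dn : nbhs x D by [exact: open_nbhs_nbhs]; apply: filterS Dn => y /fg.
exact: cvg_trans (near_eq_cvg E) cg.
Qed.

(** Three squares below [1/4] cannot add up to 1. The axis found here is the one over which the
    surface is a graph. *)
Lemma large_component u : dot u u = 1 -> exists j, 2^-1 <= `|dot u (basis3 j)|.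
Proof.
move=> h; apply: contrapT => no.
have s j : dot u (basis3 j) ^+ 2 < 4^-1.
  have : `|dot u (basis3 j)| < 2^-1 by rewrite ltNge; apply/negP => hj; apply: no; exists j.
  move=> hj; rewrite -(real_normK (num_real _)).
  have -> : 4^-1 = 2^-1 ^+ 2 :> R by field.
  by rewrite ltr_sqr// nnegrE// invr_ge0.
have := dot_basis_sum u; rewrite h !big_ord_recr big_ord0 /= add0r.
by have := s (widen_ord (leqnSn 2) (widen_ord (leqnSn 1) ord_max)); have := s (widen_ord (leqnSn 2) ord_max); have := s ord_max; lra.
Qed.

Lemma dot_place_split j u (s : pt2 R) (t : R) :
  dot u (place j s t) = dot u (place j s 0) + t * dot u (basis3 j).
Proof. by rewrite -dotZr -dotDr place_line add0r. Qed.

Lemma norm_place0 j (s : pt2 R) : `|place j s 0 : pt3 R| <= `|s|.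
Proof. by apply/norm_place; rewrite normr0. Qed.

Lemma lipschitz_alg (a N b s Cd : R) : 4^-1 <= `|a| -> `|N| <= 2 * s ->
  `|N + b * a| <= Cd -> Cd <= (s + `|b|) / 16 -> 0 <= s -> `|b| <= 11 * s.
Proof.
move=> a4 N2 h1 h2 s0.
have : `|b * a| <= 2 * s + (s + `|b|) / 16.
  have -> : b * a = (N + b * a) - N by ring.
  by apply: le_trans (ler_normB _ _) _; lra.
rewrite normrM; have : `|b| * 4^-1 <= `|b| * `|a| by rewrite ler_wpM2l.
lra.
Qed.

(** With [d = h / 4], on each line over the base square the points [5 d] up and down lie on opposite
    sides of [G]: they gain [5 d / 2] along the normal, against [2 d] lost tangentially and less
    than [d / 2] by curvature. So the segment meets [G], and [f] chooses a point; its regularity is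
    derived afterwards. *)
Lemma graph_exists G A B n r C xs (h : R) j : two_sided G A B n r C -> G xs -> 0 < h ->
  400 * h < r -> 10 ^+ 5 * C * h < 1 -> 2^-1 <= `|dot (n xs) (basis3 j)| ->
  exists f : pt2 R -> R, forall s, ball (others j xs) (h / 4) s ->
    G (place j s (f s)) /\ `|f s - dot xs (basis3 j)| <= 5 * (h / 4).
Proof.
move=> H Gs h0 hr hC nj.
have [[r0 C0 [oA oB]] [AB AG BG] cov nG tan] := H; have [nn _] := nG xs Gs.
have Ch : 0 < C * h by exact: mulr_gt0.
have hC' : C * h < (10 ^+ 5)^-1 by rewrite -div1r ltr_pdivlMr ?exprn_gt0//; lra.
pose d := h / 4; have d0 : 0 < d by rewrite divr_gt0.
have dE : h = 4 * d by rewrite /d; field.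
rewrite dE in Ch hC hC' hr.
have Cd : 0 < C * d by exact: mulr_gt0.
pose s0 := others j xs; pose t0 := dot xs (basis3 j).
have xsE : xs = place j s0 t0 by rewrite place_others.
pose D := ball s0 d.
have ex s : D s -> exists t, G (place j s t) /\ `|t - t0| <= 5 * d.
  rewrite /D -ball_normE/= distrC => sd.
  pose sg := Num.sg (dot (n xs) (basis3 j)).
  have nj0 : dot (n xs) (basis3 j) != 0.
    by rewrite -normr_eq0; apply/eqP => E; move: nj; rewrite E; lra.
  have sgE : sg * dot (n xs) (basis3 j) = `|dot (n xs) (basis3 j)| by rewrite normrEsg.
  have sgn : `|sg| = 1 by rewrite normr_sg nj0.
  have E v : place j s (t0 + v) = xs + place j (s - s0) v.
    by rewrite {1}xsE placeD; congr place; rewrite addrC subrK.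
  have nv v : `|v| <= 5 * d -> `|place j (s - s0) v| <= 5 * d.
    by move=> hv; apply/norm_place; split => //; lra.
  have q v : `|v| <= 5 * d -> C * dot (place j (s - s0) v) (place j (s - s0) v) < d / 2.
    move=> /nv hv; have := dot_le3 (place j (s - s0) v).
    have hv2 : `|place j (s - s0) v| ^+ 2 <= (5 * d) ^+ 2 by rewrite ler_sqr ?nnegrE// mulr_ge0// ltW.
    move=> h3; apply: (@le_lt_trans _ _ (C * (3 * (5 * d) ^+ 2))).
      by rewrite ler_pM2l//; lra.
    have -> : C * (3 * (5 * d) ^+ 2) = d * (75 * (C * d)) by ring.
    by rewrite ltr_pM2l//; lra.
  have N2 := unit_dot_le (place j (s - s0) 0) nn.
  have {}N2 : `|dot (n xs) (place j (s - s0) 0)| <= 2 * d.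
    by apply: le_trans N2 _; have := norm_place0 j (s - s0); lra.
  rewrite ler_norml in N2; case/andP: N2 => N1 N2.
  have v5 : `|5 * d * sg| <= 5 * d by rewrite normrM sgn mulr1 gtr0_norm// mulr_gt0.
  have v5' : `|- (5 * d * sg)| <= 5 * d by rewrite normrN.
  have dn : d * 2^-1 <= d * `|dot (n xs) (basis3 j)| by rewrite ler_pM2l.
  have e5 : 5 * d * sg * dot (n xs) (basis3 j) = 5 * (d * `|dot (n xs) (basis3 j)|) by rewrite -sgE; ring.
  have Ap : A (place j s (t0 + 5 * d * sg)).
    rewrite E; apply: (two_sided_in H) => //; first by have := nv _ v5; lra.
    by have := q _ v5; rewrite (dot_place_split j (n xs)) e5; lra.
  have Bm : B (place j s (t0 - 5 * d * sg)).
    rewrite E; apply: (two_sided_in (two_sided_sym H)) => //; first by have := nv _ v5'; lra.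
    by have := q _ v5'; rewrite dotNl (dot_place_split j (n xs)) mulNr e5; lra.
  apply: contrapT => no.
  have Am : A (place j s (t0 - 5 * d * sg)).
    apply: (segment_side oA oB AB _ Ap) => l /andP[l0 l1].
    have -> : place j s (t0 + 5 * d * sg) + l *: (place j s (t0 - 5 * d * sg) - place j s (t0 + 5 * d * sg)) =
        place j s (t0 + (1 - 2 * l) * (5 * d * sg)).
      by rewrite placeB placeZ placeD subrr scaler0 addr0; congr place; ring.
    have hl : `|(1 - 2 * l) * (5 * d * sg)| <= 5 * d.
      by rewrite normrM; apply: le_trans v5; rewrite ler_piMl// ler_norml; apply/andP; split; lra.
    have := cov xs (place j s (t0 + (1 - 2 * l) * (5 * d * sg))) Gs.
    rewrite E addrAC subrr add0r => hc.
    have [Gy|Ay|By] := hc ltac:(have := nv _ hl; lra); [|by left|by right].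
    exfalso; apply: no; exists (t0 + (1 - 2 * l) * (5 * d * sg)); rewrite E; split => //.
    by rewrite addrAC subrr add0r.
  by have : (A `&` B) (place j s (t0 - 5 * d * sg)) by []; rewrite AB.
rewrite -/s0 -/t0 -/d -/D.
have [f Hf] : exists f : pt2 R -> R, forall s, D s -> G (place j s (f s)) /\ `|f s - t0| <= 5 * d.
  have ex' s : exists t, D s -> G (place j s t) /\ `|t - t0| <= 5 * d.
    have [Ds|nD] := pselect (D s); last by exists 0.
    by have [t ht] := ex s Ds; exists t.
  by have [f Hf] := choice ex'; exists f.
by exists f.
Qed.

Lemma graph_derivable_alg (K a b df t v e : R) : 0 <= K -> t != 0 -> 4^-1 <= `|a| ->
  `|t * b + df * a| <= K * (`|t| * v) ^+ 2 -> `|t| * (4 * K * v ^+ 2 + 1) < e ->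
  `|t^-1 * df + b / a| <= e.
Proof.
move=> K0 t0 a4 h te.
have ap : 0 < `|a| by apply: lt_le_trans a4; rewrite invr_gt0.
have tp : 0 < `|t| by rewrite normr_gt0.
have -> : t^-1 * df + b / a = (t * b + df * a) / (t * a).
  by field; rewrite t0 -normr_gt0 ap.
rewrite normrM normfV normrM ler_pdivrMr ?mulr_gt0//.
apply: le_trans h _.
have -> : K * (`|t| * v) ^+ 2 = (`|t| * 4^-1) * (`|t| * (4 * K * v ^+ 2)) by field.
rewrite mulrC; apply: ler_pM.
- by rewrite mulr_ge0// mulr_ge0 ?sqr_ge0// mulr_ge0.
- by rewrite mulr_ge0.
- by apply: le_trans (ltW te); rewrite ler_wpM2l// lerDl.
- by rewrite ler_pM2l.
Qed.

(** An increment of the graph is orthogonal to [N] up to a quadratic error, and the j-th component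
    of [N] stays away from 0; solving for the increment of [f] gives its derivatives as quotients of
    components of [N], which are continuous. The area element is [sqrt (1 + a^2 + b^2)] with [a],
    [b] the slopes. *)
Lemma graph_C1 j (D : set (pt2 R)) (f : pt2 R -> R) (N : pt2 R -> pt3 R) (K : R) : open D -> 0 <= K ->
  (forall s, D s -> 4^-1 <= `|dot (N s) (basis3 j)|) ->
  (forall s, D s -> {for s, continuous N}) ->
  (forall s, D s -> {for s, continuous (fun s => place j s (f s))}) ->
  (forall s s', D s -> D s' ->
    `|dot (N s) (place j (s' - s) 0) + (f s' - f s) * dot (N s) (basis3 j)| <= K * `|s' - s| ^+ 2) ->
  Ck_on 1 D (fun s => place j s (f s)) /\
  forall s, D s -> 1 <= area_element (fun s => place j s (f s)) s.
Proof.
move=> oD K0 N4 cN cX tan; pose X s := place j s (f s).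
pose g v s := dot (N s) (place j v 0) / dot (N s) (basis3 j).
have n0 s : D s -> dot (N s) (basis3 j) != 0.
  by move=> Ds; rewrite -normr_gt0; apply: lt_le_trans (N4 s Ds); rewrite invr_gt0.
have dX s v : D s -> is_derive s v X (place j v (- g v s)).
  move=> Ds; apply: is_derive_epsV => e e0.
  have /nbhs_ballP[e1 /= e10 he] : nbhs s D by apply: open_nbhs_nbhs.
  have v0 : 0 < `|v| + 1 by rewrite ltr_wpDl.
  have M0 : 0 < 4 * K * `|v| ^+ 2 + 1 by rewrite ltr_wpDl// mulr_ge0 ?sqr_ge0// mulr_ge0.
  exists (Num.min (e1 / (`|v| + 1)) (e / (4 * K * `|v| ^+ 2 + 1))); first by rewrite lt_min !divr_gt0.
  move=> t tn0; rewrite lt_min !ltr_pdivlMr// => /andP[t1 t2].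
  have tv : s + t *: v - s = t *: v by rewrite addrAC subrr add0r.
  have Ds' : D (s + t *: v).
    apply: he; rewrite -ball_normE/= opprD addNKr normrN normrZ; apply: le_lt_trans t1.
    by rewrite ler_wpM2l// lerDl.
  rewrite /X placeB tv placeZ placeB scalerA mulVf// scale1r subrr opprK.
  apply/norm_place; rewrite normr0; split; first exact: ltW.
  have := tan s _ Ds Ds'; rewrite tv normrZ.
  have -> : dot (N s) (place j (t *: v) 0) = t * dot (N s) (place j v 0).
    by rewrite -dotZr placeZ mulr0.
  by move=> h; apply: (graph_derivable_alg K0 tn0 (N4 s Ds) h).
have DX s v : D s -> 'D_v X s = place j v (- g v s).
  by move=> Ds; exact: (@derive_val _ _ _ _ _ _ _ (dX s v Ds)).
have cdot u s : D s -> {for s, continuous (fun s => dot (N s) u)}.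
  move=> Ds; have c := cN s Ds.
  have -> : (fun s => dot (N s) u) = (dot u \o N) by apply/funext => s' /=; rewrite dotC.
  by apply: continuous_comp; [exact: c|exact: continuous_dot].
have cg v s : D s -> {for s, continuous (g v)}.
  move=> Ds; apply: cvgM; first exact: cdot.
  by apply: cvgV; [exact: n0|exact: cdot].
have cDX s v : D s -> {for s, continuous ('D_v X)}.
  move=> Ds; apply: (continuous_eq_on oD Ds (fun s' => DX s' v)).
  have P (u : R) : place j v u = place j v 0 + u *: basis3 j by rewrite place_line add0r.
  rewrite /prop_for /continuous_at P; under eq_fun do rewrite P.
  apply: cvgD; first exact: cvg_cst.
  by apply: cvgZr_tmp; apply: cvgN; exact: cg.
split.
  case=> [|v [|//]] _ s Ds /=; split => //; try exact: cX; try exact: cDX.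
  by move=> _ v; exact: (@ex_derive _ _ _ _ _ _ _ (dX s v Ds)).
move=> s Ds; rewrite /area_element -/X (DX s (1, 0) Ds) (DX s (0, 1) Ds) !dot_place /=.
move: (- g (1, 0) s) (- g (0, 1) s) => a b.
rewrite -{1}sqrtr1; apply: ler_wsqrtr.
have := sqr_ge0 a; have := sqr_ge0 b; rewrite !expr2; clear; lra.
Qed.

(** The heights were merely chosen line by line, yet any two points of the graph satisfy the
    tangency estimate. At this scale its quadratic term is a small multiple of the increment and is
    absorbed, which forces the chosen [f] to be Lipschitz. *)
Lemma graph_lipschitz G A B n r C xs (h : R) j (f : pt2 R -> R) : two_sided G A B n r C -> G xs -> 0 < h ->
  400 * h < r -> 10 ^+ 5 * C * h < 1 -> 2^-1 <= `|dot (n xs) (basis3 j)| ->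
  (forall s, ball (others j xs) (h / 4) s ->
    G (place j s (f s)) /\ `|f s - dot xs (basis3 j)| <= 5 * (h / 4)) ->
  let X s := place j s (f s) in let D := ball (others j xs) (h / 4) in
  [/\ forall s, D s -> 4^-1 <= `|dot (n (X s)) (basis3 j)|,
      forall s, D s -> `|X s - xs| <= 5 * (h / 4),
      forall s s', D s -> D s' -> `|X s' - X s| <= 11 * `|s' - s| &
      forall s s', D s -> D s' ->
        `|dot (n (X s)) (place j (s' - s) 0) + (f s' - f s) * dot (n (X s)) (basis3 j)| <=
        3 * C * `|X s' - X s| ^+ 2].
Proof.
move=> H Gs h0 hr hC nj Hf X D.
have [[r0 C0 _] _ _ nG tan] := H; have [nn _] := nG xs Gs.
pose d := h / 4; have d0 : 0 < d by rewrite divr_gt0.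
have dE : h = 4 * d by rewrite /d; field.
rewrite -/d in Hf *; rewrite dE in hC hr.
have Cd : 0 < C * d by exact: mulr_gt0.
have dr : 40 * d < r by move: hr d0; clear; lra.
have CdE2 : 10 ^+ 3 * (C * d) < 8^-1.
  by move: hC Cd; clear; lra.
have xsE : xs = place j (others j xs) (dot xs (basis3 j)) by rewrite place_others.
have GX s : D s -> G (X s) by move=> /Hf[].
have Xd s : D s -> `|X s - xs| <= 5 * d.
  move=> Ds; rewrite xsE placeB; apply/norm_place; split; last by case: (Hf s Ds).
  move: Ds; rewrite /D -ball_normE/= distrC -/d => h1; apply: le_trans (ltW h1) _.
  by rewrite ler_peMl ?ler1n// ltW.
have Xd2 s s' : D s -> D s' -> `|X s' - X s| <= 10 * d.
  move=> /Xd h1 /Xd h2; rewrite -(subrKA xs); apply: le_trans (ler_normD _ _) _.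
  by rewrite (distrC xs); move: h1 h2; clear; lra.
have CX m : m <= 10 * d -> C * m <= 10 * (C * d).
  by move=> h1; apply: le_trans (ler_wpM2l (ltW C0) h1) _; rewrite mulrCA.
have nX s : D s -> 4^-1 <= `|dot (n (X s)) (basis3 j)|.
  move=> Ds; have X5 := Xd s Ds.
  have Cx : C * `|X s - xs| <= 10 * (C * d).
    by apply: CX; apply: le_trans X5 _; rewrite ler_pM2r// ler_nat.
  have h4 : 4 * `|X s - xs| < r by move: X5 dr d0; clear; lra.
  have h5 : 32 * C * `|X s - xs| <= 8^-1 by move: Cx CdE2 Cd; clear; lra.
  have h6 : 32 * C * `|X s - xs| < 1 by move: h5; clear; lra.
  have nl := normal_lipschitz H Gs (GX s Ds) h4 h6.
  have {}nl : dot (n (X s) - n xs) (n (X s) - n xs) <= (8^-1) ^+ 2.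
    apply: le_trans nl _; rewrite ler_sqr ?nnegrE ?invr_ge0//.
    by rewrite mulr_ge0// mulr_ge0// ltW.
  have b1 : `|basis3 j| <= 1 :> R.
    by rewrite -place_basis; apply/norm_place; rewrite normr0 normr1.
  have e8 : 0 <= 8^-1 :> R by rewrite invr_ge0.
  have := dot_le_norm2 (basis3 j) e8 nl; rewrite dotBl => b2.
  have := lerB_dist (dot (n xs) (basis3 j)) (dot (n (X s)) (basis3 j)).
  by rewrite distrC; move: nj b1 b2; clear; lra.
have tanX s s' : D s -> D s' ->
    `|dot (n (X s)) (place j (s' - s) 0) + (f s' - f s) * dot (n (X s)) (basis3 j)| <= 3 * C * `|X s' - X s| ^+ 2.
  move=> Ds Ds'; rewrite -dot_place_split -placeB.
  apply: le_trans (tan _ _ (GX s Ds) (GX s' Ds') _) _.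
    by have := Xd2 s s' Ds Ds'; move: dr d0; clear; rewrite -/(X s) -/(X s'); lra.
  have -> : 3 * C * `|X s' - X s| ^+ 2 = C * (3 * `|X s' - X s| ^+ 2) by ring.
  by rewrite ler_pM2l//; exact: dot_le3.
have fL s s' : D s -> D s' -> `|f s' - f s| <= 11 * `|s' - s|.
  move=> Ds Ds'; apply: (lipschitz_alg (nX s Ds) _ (tanX s s' Ds Ds')) => //.
    apply: le_trans (unit_dot_le _ (nG _ (GX s Ds)).1) _.
    by rewrite ler_pM2l//; exact: norm_place0.
  have n1 := CX _ (Xd2 s s' Ds Ds').
  have n2 : `|X s' - X s| <= `|s' - s| + `|f s' - f s|.
    by rewrite placeB; apply/norm_place; split; rewrite ?lerDl ?lerDr.
  have n3 : 3 * C * `|X s' - X s| <= 16^-1 by move: n1 CdE2; clear; lra.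
  rewrite expr2 mulrA; apply: (@le_trans _ _ (16^-1 * `|X s' - X s|)); first exact: ler_wpM2r.
  by move: n2; clear; lra.
split=> // s s' Ds Ds'; rewrite placeB; apply/norm_place; split; last exact: fL.
by rewrite ler_peMl// ler1n.
Qed.

Lemma graph_patch G A B n r C xs (h : R) j : two_sided G A B n r C -> G xs -> 0 < h ->
  400 * h < r -> 10 ^+ 5 * C * h < 1 -> 2^-1 <= `|dot (n xs) (basis3 j)| ->
  exists f : pt2 R -> R, let X s := place j s (f s) in let D := ball (others j xs) (h / 4) in
    [/\ regular_patch G D X, forall s, D s -> 1 <= area_element X s,
        forall s, D s -> `|X s - xs| <= 5 * (h / 4) &
        forall s, D s -> {for s, continuous (fun s => n (X s))}].
Proof.
move=> H Gs h0 hr hC nj.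
have [f Hf] := graph_exists H Gs h0 hr hC nj.
have := graph_lipschitz H Gs h0 hr hC nj Hf; set D := ball _ _.
move=> [nX Xd XL tanX]; exists f => X; rewrite -/X in nX Xd XL tanX.
have [[r0 C0 _] _ _ nG tan] := H.
have GX s : D s -> G (X s) by move=> /Hf[].
have oD : open D by exact: ball_open.
have near_D s : D s -> exists2 e : R, 0 < e & forall s', `|s' - s| < e -> D s'.
  move=> Ds; have /nbhs_ballP[e /= e0 he] : nbhs s D by apply: open_nbhs_nbhs.
  by exists e => // s' hs'; apply: he; rewrite -ball_normE/= distrC.
have cX s : D s -> {for s, continuous X}.
  move=> Ds; apply: continuous_epsV => e e0; have [e1 e10 he1] := near_D s Ds.
  exists (Num.min e1 (e / 11)); first by rewrite lt_min e10 divr_gt0.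
  move=> s'; rewrite lt_min => /andP[h1 h2].
  apply: le_trans (XL s s' Ds (he1 _ h1)) _.
  by move: h2; rewrite ltr_pdivlMr// mulrC => /ltW.
have cn s : D s -> {for s, continuous (fun s => n (X s))}.
  move=> Ds; apply: continuous_epsV => e e0; have [e1 e10 he1] := near_D s Ds.
  pose M := 32 * 11 * C.
  have M0 : 0 < M by rewrite mulr_gt0.
  exists (Num.min e1 (Num.min (r / (4 * 11)) (Num.min M^-1 (e / M)))).
    by rewrite !lt_min e10 invr_gt0 M0 !divr_gt0// mulr_gt0.
  move=> s'; rewrite !lt_min => /and4P[h1 h2 h3 h4]; have Ds' := he1 _ h1.
  have l := XL s s' Ds Ds'.
  rewrite ltr_pdivlMr ?mulr_gt0// in h2; rewrite -div1r ltr_pdivlMr// in h3; rewrite ltr_pdivlMr// in h4.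
  have k1 : 32 * C * `|X s' - X s| <= `|s' - s| * M.
    have -> : `|s' - s| * M = 32 * C * (11 * `|s' - s|) by rewrite /M; ring.
    by rewrite ler_wpM2l// mulr_ge0// ltW.
  have k2 : 4 * `|X s' - X s| < r by move: l h2; clear; lra.
  have nl := normal_lipschitz H (GX s Ds) (GX s' Ds') k2 (le_lt_trans k1 h3).
  apply: le_trans (le_trans k1 (ltW h4)); apply: norm_le_dot => //.
  by rewrite mulr_ge0// mulr_ge0// ltW.
have tanX' s s' : D s -> D s' ->
    `|dot (n (X s)) (place j (s' - s) 0) + (f s' - f s) * dot (n (X s)) (basis3 j)| <=
    3 * C * 11 ^+ 2 * `|s' - s| ^+ 2.
  move=> Ds Ds'; apply: le_trans (tanX s s' Ds Ds') _.
  have -> : 3 * C * 11 ^+ 2 * `|s' - s| ^+ 2 = 3 * C * (11 * `|s' - s|) ^+ 2 by ring.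
  apply: ler_wpM2l; first by rewrite mulr_ge0// ltW.
  by rewrite ler_sqr ?nnegrE ?mulr_ge0//; exact: XL.
have K0 : 0 <= 3 * C * 11 ^+ 2 by rewrite mulr_ge0 ?exprn_ge0// mulr_ge0// ltW.
have [CkX area] := graph_C1 oD K0 nX cn cX tanX'.
have Xinj s s' : X s = X s' -> s = s'.
  move=> /eqP; rewrite -subr_eq0 placeB => /eqP E.
  have : `|place j (s - s') (f s - f s')| <= 0 by rewrite E normr0.
  by move=> /norm_place[+ _]; rewrite normr_le0 subr_eq0 => /eqP.
split=> //; split=> //.
- by move=> s s' _ _; exact: Xinj.
- by move=> _ [s Ds <-]; exact: GX.
- by move=> s /area h1; exact: lt_le_trans h1.
Qed.

End Patch.

(** * Trace inequality on a graph, for smooth functions and then for traces *)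

Section Trace.
Variable R : realType.
Local Notation leb := (@lebesgue_measure R).
Local Notation R' := (measurableTypeR R).
Implicit Types (G A B W : set (pt3 R)) (D : set (pt2 R)).

Lemma open_measurable2 D : open D -> measurable D.
Proof.
move=> oD; pose E : set (pt3 R) := D `*` setT.
have oE : open E.
  rewrite openE => -[s t] [/= Ds _]; have nD : nbhs s D by apply: open_nbhs_nbhs.
  by exists (D, setT) => //=; split => //; exact: filterT.
have mE := open_measurable3 oE.
have mi : measurable_fun setT (fun s : R' * R' => (s, 0) : R' * R' * R').
  by apply/measurable_fun_pairP; split; [exact: measurable_id|exact: measurable_cst].
have := mi measurableT _ mE; rewrite setTI.
by have -> : (fun s : R' * R' => (s, 0)) @^-1` E = D by apply/seteqP; split => s /=; [case|].
Qed.

Lemma open_continuous_measurable2 D (f : pt2 R -> R) : open D ->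
  (forall s, D s -> {for s, continuous f}) -> measurable_fun D f.
Proof.
move=> oD cf; have mD := open_measurable2 oD; pose E : set (pt3 R) := D `*` setT.
have oE : open E.
  rewrite openE => -[s t] [/= Ds _]; have nD : nbhs s D by apply: open_nbhs_nbhs.
  by exists (D, setT) => //=; split => //; exact: filterT.
have mE := open_measurable3 oE.
have mi : measurable_fun setT (fun s : R' * R' => (s, 0) : R' * R' * R').
  by apply/measurable_fun_pairP; split; [exact: measurable_id|exact: measurable_cst].
have mf : measurable_fun E (fun p : pt3 R => f p.1).
  apply: open_continuous_measurable3 => // -[s t]; rewrite inE => -[/= Ds _].
  apply: (@continuous_comp _ _ _ fst f); first exact: cvg_fst.
  exact: cf.
apply: (@measurable_comp _ _ _ _ _ _ E (fun p : R' * R' * R' => f p.1) D (fun s : R' * R' => (s, 0) : R' * R' * R')) => //.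
  by move=> _ [s Ds <-].
exact: measurable_funS mi.
Qed.

Lemma smooth_line (w : pt3 R -> R) j s (k t : R) : smooth w ->
  is_derive t (1 : R) (fun t => w (place j s t) - k) ('D_(basis3 j) w (place j s t)).
Proof.
move=> sw; have [_ dw _] := smoothP sw.
have E (u : R) : place j s u = place j s 0 + u *: basis3 j by rewrite place_line add0r.
have H : is_derive t (1 : R) (fun u : R => w (place j s 0 + u *: basis3 j)) ('D_(basis3 j) w (place j s t)).
  by rewrite (E t); apply: is_derive_line; apply: derivableP.
have -> : (fun t => w (place j s t) - k) = (fun u : R => w (place j s 0 + u *: basis3 j) - k).
  by apply/funext => u; rewrite E.
by apply: is_derive_eq; rewrite subr0.
Qed.

Lemma continuous_place j (s : pt2 R) : continuous (fun t => place j s t).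
Proof.
have -> : (fun t => place j s t) = (fun t => place j s 0 + t *: basis3 j).
  by apply/funext => t; rewrite place_line add0r.
move=> t; apply: cvgD; first exact: cvg_cst.
by apply: cvgZr_tmp; exact: cvg_id.
Qed.

(** Over each base point a vertical segment of length [h] ends on the graph and otherwise runs in
    [W]; the one-dimensional endpoint bound on it is integrated over [D], and Fubini along the j-th
    axis collects the segments. *)
Lemma smooth_trace_bound j (w : pt3 R -> R) W D (f : pt2 R -> R) (k h : R) : smooth w -> open W -> 0 < h ->
  measurable D -> measurable_fun D (fun s => w (place j s (f s))) ->
  (forall s, D s -> exists c d, [/\ d - c = h, f s = c \/ f s = d &
     forall t, c < t < d -> W (place j s t)]) ->
  (\int[@mu2 R]_(s in D) ((w (place j s (f s)) - k) ^+ 2)%:E <=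
   (2 / h)%:E * N2 W (fun x => w x - k)%R + h%:E * N2 W ('D_(basis3 j) w))%E.
Proof.
move=> sw oW h0 mD mw HD.
have [cw _ Dw] := smoothP sw; have [cDw _ _] := smoothP (Dw (basis3 j)).
have mW := open_measurable3 oW.
pose g x := 2 / h * (w x - k) ^+ 2 + h * ('D_(basis3 j) w x) ^+ 2.
have g0 x : 0 <= g x.
  by rewrite addr_ge0// mulr_ge0 ?sqr_ge0// ltW// divr_gt0.
have mwk : measurable_fun setT (fun x : R' * R' * R' => w x - k).
  by apply: measurable_funB; [exact: continuous_measurable3|exact: measurable_cst].
have mDw : measurable_fun setT ('D_(basis3 j) w : R' * R' * R' -> R) by exact: continuous_measurable3.
have mg : measurable_fun setT (fun x : R' * R' * R' => (g x)%:E).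
  apply/measurable_EFinP; apply: measurable_funD; apply: measurable_funM; try exact: measurable_cst;
    exact: measurable_funX.
pose F := (fun x : R' * R' * R' => (g x)%:E) \_ W.
have F0 x : (0 <= F x)%E by rewrite /F patchE; case: ifP => // _; rewrite lee_fin.
have mF : measurable_fun setT F.
  by apply/(measurable_restrictT _ mW); exact: measurable_funS mg.
have mFj : measurable_fun setT (fun p : R' * R' * R' => F (place j p.1 p.2)).
  by apply: measurableT_comp; [exact: mF|exact: measurable_place].
have mI := measurable_inner mFj (fun p => F0 _).
have I0 s : (0 <= \int[leb]_t F (place j s t))%E by exact: integral_ge0.
have step s : D s -> (((w (place j s (f s)) - k) ^+ 2)%:E <= \int[leb]_t F (place j s t))%E.
  move=> Ds; have [c [d [cdh fcd Wcd]]] := HD s Ds.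
  have cd : c < d by rewrite -subr_gt0 cdh.
  have cD' : continuous (fun t => 'D_(basis3 j) w (place j s t)).
    move=> t; apply: (@continuous_comp _ _ _ (fun t => place j s t) ('D_(basis3 j) w)).
      exact: continuous_place.
    exact: cDw.
  have := endpoint_bound cd cD' (fun t => smooth_line j s k t sw) fcd.
  rewrite cdh => hb; apply: le_trans hb _.
  have mFs : measurable_fun setT (fun t : R' => F (place j s t)).
    apply: (@measurableT_comp _ _ _ _ _ _ (fun p : R' * R' * R' => F (place j p.1 p.2)) _ (fun t : R' => (s, t) : R' * R' * R')) => //.
    by apply/measurable_fun_pairP; split; [exact: measurable_cst|exact: measurable_id].
  rewrite (_ : (\int[leb]_(t in `]c, d[) _)%E = (\int[leb]_(t in `]c, d[) F (place j s t))%E); last first.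
    apply: eq_integral => t; rewrite inE/= in_itv/= => tcd.
    by rewrite /F patchE mem_set//; exact: Wcd.
  apply: ge0_subset_integral => //; exact: measurable_itv.
apply: (@le_trans _ _ (\int[@mu2 R]_(s in D) \int[leb]_t F (place j s t))%E).
  apply: ge0_le_integral => //.
  - by move=> s _; rewrite lee_fin sqr_ge0.
  - apply/measurable_EFinP; apply: measurable_funX; apply: measurable_funB => //; exact: measurable_cst.
  - exact: measurable_funS mI.
apply: (@le_trans _ _ (\int[@mu2 R]_s \int[leb]_t F (place j s t))%E).
  exact: ge0_subset_integral.
rewrite -(fubini_place j mF F0) /F -integral_mkcond.
have mwk' : measurable_fun W (fun x : R' * R' * R' => w x - k) by exact: measurable_funS mwk.
have mDw' : measurable_fun W ('D_(basis3 j) w : R' * R' * R' -> R) by exact: measurable_funS mDw.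
rewrite (_ : (\int[@mu3 R]_(x in W) (g x)%:E)%E =
  (\int[@mu3 R]_(x in W) ((2 / h)%:E * ((w x - k) ^+ 2)%:E + h%:E * ('D_(basis3 j) w x ^+ 2)%:E))%E)//.
have h2 : 0 <= 2 / h by rewrite divr_ge0// ltW.
rewrite ge0_integralD//.
- rewrite !ge0_integralZl//; try exact: measurable_sq; try (by move=> x _; rewrite lee_fin sqr_ge0).
  by rewrite lee_fin ltW.
- by move=> x _; rewrite mule_ge0// lee_fin// sqr_ge0.
- by apply: measurable_funeM; exact: measurable_sq.
- by move=> x _; rewrite mule_ge0// lee_fin ?sqr_ge0// ltW.
- by apply: measurable_funeM; exact: measurable_sq.
Qed.

Lemma Hsemi2_ge k U u g (a : {ffun 'I_3 -> 'I_k.+1}) : open U -> (@mu3 R U < +oo)%E ->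
  (\sum_i (a i : nat) = k)%N -> is_wderiv U (mdirs (fun i => a i)) u g -> (N2 U g <= Hsemi2 k U u)%E.
Proof.
move=> oU fU ak wg; rewrite -(inf_wderiv oU fU wg) /Hsemi2 (bigD1 a)/=; last by apply/eqP.
apply: leeDl; apply: sume_ge0 => b _; apply: le_ereal_inf_tmp => _ [g' _ <-]; exact: N2_ge0.
Qed.

Lemma Hnorm2_1_ge U u g j : open U -> (@mu3 R U < +oo)%E -> is_wderiv U [:: basis3 j] u g ->
  (N2 U u <= Hnorm2 1 U u)%E /\ (N2 U g <= Hnorm2 1 U u)%E.
Proof.
move=> oU fU wg; have [lu lg _] := wg.
have s0 k : (0 <= Hsemi2 k U u)%E.
  by apply: sume_ge0 => a _; apply: le_ereal_inf_tmp => _ [g' _ <-]; exact: N2_ge0.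
rewrite /Hnorm2 !big_ord_recr big_ord0 /= add0e; split.
  apply: (@le_trans _ _ (Hsemi2 0 U u)); last by rewrite leeDl.
  apply: (@Hsemi2_ge 0 U u u [ffun=> ord0]) => //; first by rewrite big1// => i _; rewrite ffunE.
  by rewrite mdirsE !ffunE; split => // phi _; rewrite expr0 mul1e.
apply: (@le_trans _ _ (Hsemi2 1 U u)); last by rewrite leeDr.
by apply: (@Hsemi2_ge 1 U u g (index1 j)); rewrite ?sum_index1 ?mdirs_index1.
Qed.

Lemma N2_shift (U : set (pt3 R)) (f g : pt3 R -> R) : measurable U -> measurable_fun U f -> measurable_fun U g ->
  (N2 U f <= 2%:E * N2 U g + 2%:E * N2 U (fun x => f x - g x)%R)%E.
Proof.
move=> mU mf mg; have mB : measurable_fun U (fun x : pt3 R => f x - g x) by exact: measurable_funB.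
rewrite (@N2_eq _ U f (fun x => g x + (f x - g x))); last by move=> x _; rewrite addrC subrK.
exact: N2D.
Qed.

Definition N2s (D : set (pt2 R)) (f : pt2 R -> R) : \bar R := (\int[@mu2 R]_(s in D) (f s ^+ 2)%:E)%E.

Lemma N2s_add D (f g : pt2 R -> R) : measurable D -> measurable_fun D f -> measurable_fun D g ->
  (N2s D (fun s => f s + g s)%R <= 2%:E * N2s D f + 2%:E * N2s D g)%E.
Proof.
move=> mD mf mg.
have msq (u : pt2 R -> R) : measurable_fun D u -> measurable_fun D (fun s => (u s ^+ 2)%:E).
  by move=> mu; apply/measurable_EFinP; exact: measurable_funX.
have p2 (u : pt2 R -> R) s : D s -> (0 <= (u s ^+ 2)%:E)%E by move=> _; rewrite lee_fin sqr_ge0.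
rewrite -!ge0_integralZl//; try exact: msq; try exact: p2.
rewrite -ge0_integralD//; try (by move=> s _; rewrite mule_ge0// lee_fin sqr_ge0);
  try (by apply: measurable_funeM; exact: msq).
apply: ge0_le_integral => //; first exact: p2.
- by apply: msq; exact: measurable_funD.
- by apply: emeasurable_funD; apply: measurable_funeM; exact: msq.
move=> s _; rewrite -!EFinM -EFinD lee_fin -subr_ge0.
have -> : 2 * f s ^+ 2 + 2 * g s ^+ 2 - (f s + g s) ^+ 2 = (f s - g s) ^+ 2 by ring.
exact: sqr_ge0.
Qed.

Lemma continuous_dot_comp (a b : pt2 R -> pt3 R) s : {for s, continuous a} -> {for s, continuous b} ->
  {for s, continuous (fun s => dot (a s) (b s))}.
Proof.
move=> ca cb.
have c (x : pt2 R -> pt3 R) w : {for s, continuous x} -> {for s, continuous (dot w \o x)}.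
  by move=> cx; apply: continuous_comp; [exact: cx|exact: continuous_dot].
have E (x y : pt3 R) : dot x y = dot (basis3 0) x * dot (basis3 0) y + dot (basis3 1) x * dot (basis3 1) y +
    dot (basis3 2%:R) x * dot (basis3 2%:R) y.
  by rewrite /dot /basis3 /= !(mul0r, mul1r, add0r, addr0).
rewrite (_ : (fun s => dot (a s) (b s)) = fun s => (dot (basis3 0) \o a) s * (dot (basis3 0) \o b) s +
  (dot (basis3 1) \o a) s * (dot (basis3 1) \o b) s +
  (dot (basis3 2%:R) \o a) s * (dot (basis3 2%:R) \o b) s); last by apply/funext => s'; rewrite E.
have m w : {for s, continuous (fun s => (dot w \o a) s * (dot w \o b) s)}.
  by apply: cvgM; exact: c.
exact: (cvgD (cvgD (m _) (m _)) (m _)).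
Qed.

Lemma measurable_area_element D X : open D -> Ck_on 1 D (X : pt2 R -> pt3 R) ->
  measurable_fun D (area_element X).
Proof.
move=> oD CkX; apply: open_continuous_measurable2 => // s Ds.
have c v : {for s, continuous ('D_v X)} by have [] := CkX [:: v] isT s Ds.
have cd u v : {for s, continuous (fun s => dot ('D_u X s) ('D_v X s))}.
  by apply: continuous_dot_comp; exact: c.
apply: (@continuous_comp _ _ _ (fun s => dot ('D_(1, 0) X s) ('D_(1, 0) X s) * dot ('D_(0, 1) X s) ('D_(0, 1) X s) -
  dot ('D_(1, 0) X s) ('D_(0, 1) X s) * dot ('D_(1, 0) X s) ('D_(0, 1) X s)) Num.sqrt); last exact: sqrt_continuous.
exact: (cvgB (cvgM (cd _ _) (cd _ _)) (cvgM (cd _ _) (cd _ _))).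
Qed.

(* The constants come from using [(a + b)^2 <= 2 a^2 + 2 b^2] twice. *)
Lemma trace_bound j A W G D (f : pt2 R -> R) u d tr (k h a b : R) :
  let X s := place j s (f s) in
  open A -> (@mu3 R A < +oo)%E -> (exists M : R, A `<=` ball 0 M) -> open W -> W `<=` A -> 0 < h ->
  regular_patch G D X -> (forall s, D s -> 1 <= area_element X s) ->
  (forall s, D s -> exists c d, [/\ d - c = h, f s = c \/ f s = d &
     forall t, c < t < d -> W (place j s t)]) ->
  is_wderiv A [:: basis3 j] u d -> is_trace A G u tr ->
  (N2 W (fun x => u x - k)%R <= a%:E)%E -> (N2 W d <= b%:E)%E ->
  measurable_fun D (fun s => tr (X s)) /\
  (N2s D (fun s => tr (X s) - k)%R <= (8 / h * a + 4 * h * b)%:E)%E.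
Proof.
move=> X oA fA bA oW WA h0 reg area HD wd [mtr _ [w [sw wu wt]]] Ha Hb.
have [oD CkX _ XG _] := reg.
have mD := open_measurable2 oD; have mA := open_measurable3 oA; have mW := open_measurable3 oW.
have cX s : D s -> {for s, continuous X} by move=> Ds; have [] := CkX [::] isT s Ds.
have fE s : f s = dot (X s) (basis3 j) by rewrite -place_basis dot_place !mulr0 !add0r mulr1.
have mf : measurable_fun D f.
  apply: open_continuous_measurable2 => // s Ds.
  have -> : f = dot (basis3 j) \o X by apply/funext => s' /=; rewrite fE dotC.
  by apply: (@continuous_comp _ _ _ X (dot (basis3 j))); [exact: cX|exact: continuous_dot].
have mX : measurable_fun setT (fun s : R' * R' => place j s ((f \_ D) s) : R' * R' * R').
  apply: (@measurableT_comp _ _ _ _ _ _ (fun p : R' * R' * R' => place j p.1 p.2 : R' * R' * R') _ (fun s : R' * R' => (s, (f \_ D) s) : R' * R' * R')).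
    exact: measurable_place.
  apply/measurable_fun_pairP; split; first exact: measurable_id.
  exact/(measurable_restrictT _ mD).
have mtX : measurable_fun D (fun s => tr (X s)).
  apply: (@eq_measurable_fun _ _ _ _ D (fun s => tr (place j s ((f \_ D) s)))).
    by move=> s Ds; rewrite /X patchE Ds.
  apply: (measurable_funS measurableT) => //.
  exact: (@measurableT_comp _ _ _ _ _ _ (tr : R' * R' * R' -> R) _ (fun s : R' * R' => place j s ((f \_ D) s) : R' * R' * R')).
split => //; apply/lee_addgt0Pr => e e0.
(* The denominator is the total coefficient with which [e1] enters the final bound. *)
pose e1 := e / (2 + 8 / h + 4 * h).
have den : 0 < 2 + 8 / h + 4 * h by rewrite !addr_gt0// ?divr_gt0// mulr_gt0.
have e10 : 0 < e1 by rewrite divr_gt0.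
have nb : nbhs (0 : \bar R) [set y | (y < e1%:E)%E] by apply: open_ereal_lt'; rewrite lte_fin.
have [m [Hm1 Hm2]] : exists m, (Hnorm2 1 A (fun x => w m x - u x)%R <= e1%:E)%E /\
    (surf_int G (fun x => (w m x - tr x) ^+ 2)%R <= e1%:E)%E.
  have n1 : \forall m \near \oo, (Hnorm2 1 A (fun x => w m x - u x)%R < e1%:E)%E.
    exact: (wu _ nb).
  have n2 : \forall m \near \oo, (surf_int G (fun x => (w m x - tr x) ^+ 2)%R < e1%:E)%E.
    exact: (wt _ nb).
  have [m [h1 h2]] := @filter_ex _ \oo _ _ (filterI n1 n2).
  by exists m; split; exact: ltW.
have [cw _ Dw] := smoothP (sw m); have [cDw _ _] := smoothP (Dw (basis3 j)).
have mwX : measurable_fun D (fun s => w m (X s)).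
  by apply: open_continuous_measurable2 => // s Ds; apply: (@continuous_comp _ _ _ X (w m)); [exact: cX|exact: cw].
(* Since the area element is at least 1, the integral over the parameters is below that of the
   patch, which is one of the terms of the supremum [surf_int]. *)
have sD : (N2s D (fun s => tr (X s) - w m (X s))%R <= e1%:E)%E.
  apply: le_trans Hm2; apply: le_trans; last first.
    by apply: ereal_sup_ubound; exists D, X; split; [exact: reg|reflexivity].
  rewrite leb2E; apply: ge0_le_integral => //.
  - by move=> s _; rewrite lee_fin sqr_ge0.
  - by apply/measurable_EFinP; apply: measurable_funX; exact: measurable_funB.
  - apply/measurable_EFinP; apply: measurable_funM; last exact: measurable_area_element.
    by apply: measurable_funX; exact: measurable_funB.
  move=> s Ds; rewrite lee_fin -(sqrrN (tr (X s) - w m (X s))) opprB ler_peMr ?sqr_ge0//; exact: area.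
have lub : is_wderiv A [:: basis3 j] (fun x => w m x - u x) (fun x => 'D_(basis3 j) (w m) x - d x).
  by apply: wderivB => //; exact: wderiv_smooth.
have [b1 b2] := Hnorm2_1_ge oA fA lub.
have [/in_L2_measurable mu1 /in_L2_measurable md1 _] := wd.
have mwA (g : pt3 R -> R) (U : set (pt3 R)) : continuous g -> measurable_fun U g.
  by move=> cg; apply: (measurable_funS measurableT) => //; exact: continuous_measurable3.
have sW (g : pt3 R -> R) : measurable_fun A g -> (N2 A g <= Hnorm2 1 A (fun x => w m x - u x)%R)%E -> (N2 W g <= e1%:E)%E.
  by move=> mg hg; apply: le_trans (N2_sub mW mA WA mg) _; exact: le_trans hg Hm1.
have s1 : (N2 W (fun x => w m x - u x)%R <= e1%:E)%E.
  by apply: sW => //; apply: measurable_funB => //; exact: mwA.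
have s2 : (N2 W (fun x => 'D_(basis3 j) (w m) x - d x)%R <= e1%:E)%E.
  by apply: sW => //; apply: measurable_funB => //; exact: mwA.
have muk : measurable_fun W (fun x => u x - k).
  by apply: measurable_funB; [exact: measurable_funS mu1|exact: measurable_cst].
have mdW : measurable_fun W d by exact: measurable_funS md1.
have mcst (U : set (pt3 R)) : measurable_fun U (fun=> k) by exact: measurable_cst.
have t1 : (N2 W (fun x => w m x - k)%R <= (2 * a + 2 * e1)%:E)%E.
  apply: le_trans (N2_shift mW _ muk) _; first by apply: measurable_funB; [exact: mwA|exact: mcst].
  rewrite [leRHS]EFinD; apply: leeD; first exact: lee_EFinM.
  apply: lee_EFinM => //; rewrite (@N2_eq _ W _ (fun x => w m x - u x))//.
  by move=> x _; rewrite opprB addrA subrK.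
have t2 : (N2 W ('D_(basis3 j) (w m)) <= (2 * b + 2 * e1)%:E)%E.
  apply: le_trans (N2_shift mW _ mdW) _; first exact: mwA.
  by rewrite [leRHS]EFinD; apply: leeD; exact: lee_EFinM.
have tb := smooth_trace_bound k (sw m) oW h0 mD mwX HD.
have {tb}t3 : (N2s D (fun s => w m (X s) - k)%R <= (2 / h * (2 * a + 2 * e1) + h * (2 * b + 2 * e1))%:E)%E.
  by apply: le_trans tb _; rewrite [leRHS]EFinD; apply: leeD; apply: lee_EFinM => //; rewrite ?divr_ge0// ltW.
have mk : measurable_fun D (fun=> k) by exact: measurable_cst.
have -> : (fun s => tr (X s) - k) = (fun s => (tr (X s) - w m (X s)) + (w m (X s) - k)).
  by apply/funext => s; rewrite addrA subrK.
apply: le_trans (N2s_add mD _ _) _; [exact: measurable_funB|exact: measurable_funB|].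
rewrite -EFinD.
have -> : 8 / h * a + 4 * h * b + e = 2 * e1 + 2 * (2 / h * (2 * a + 2 * e1) + h * (2 * b + 2 * e1)).
  have eE : e = e1 * (2 + 8 / h + 4 * h) by rewrite /e1 divfK// gt_eqF.
  by rewrite {1}eE; ring.
by rewrite [leRHS]EFinD; apply: leeD; exact: lee_EFinM.
Qed.

End Trace.

(** * The flux jump of the two affine approximations *)

Section Flux.
Variable R : realType.
Local Notation R' := (measurableTypeR R).
Implicit Types (G A B : set (pt3 R)) (D : set (pt2 R)) (n : pt3 R -> pt3 R) (r C h : R).

(** The axis makes a slope of at least [1/2] with the tangent plane, so one of its two directions
    enters [A] by the cone property; the sign of the normal component decides whether the graph
    point is the lower or the upper end. *)
Lemma vertical_side G A B n r C xs h j s (fs : R) : two_sided G A B n r C -> G xs -> 0 < h ->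
  400 * h < r -> 10 ^+ 5 * C * h < 1 -> 2^-1 <= `|dot (n xs) (basis3 j)| ->
  G (place j s fs) -> `|place j s fs - xs| <= 5 * (h / 4) ->
  exists c d, [/\ d - c = h, fs = c \/ fs = d &
    forall t, c < t < d -> (A `&` ball xs (3 * h)) (place j s t)].
Proof.
move=> H Gs h0 hr hC nj Gx xd.
have [[r0 C0 _] _ _ nG _] := H; have [nn _] := nG xs Gs.
have Ch : 0 < C * h by exact: mulr_gt0.
have inA (t : R) : t != fs -> `|t - fs| < h -> 0 <= (t - fs) * dot (n xs) (basis3 j) ->
    (A `&` ball xs (3 * h)) (place j s t).
  move=> tf th pos.
  have E : place j s t = place j s fs + (t - fs) *: basis3 j by rewrite place_line addrC subrK.
  have b1 : `|(basis3 j : pt3 R)| <= 1.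
    by rewrite -place_basis; apply/norm_place; rewrite normr0 normr1.
  have ny : `|(t - fs) *: (basis3 j : pt3 R)| <= `|t - fs|.
    by rewrite normrZ ler_piMr.
  have dE : dot (n xs) ((t - fs) *: basis3 j) = `|t - fs| * `|dot (n xs) (basis3 j)|.
    by rewrite dotZr -normrM ger0_norm.
  have tp : 0 < `|t - fs| by rewrite normr_gt0 subr_eq0.
  have key : 2^-1 * `|t - fs| <= dot (n xs) ((t - fs) *: basis3 j).
    by rewrite dE mulrC ler_pM2l.
  split.
    rewrite E; apply: (@two_sided_cone _ G A B n r C xs _ _ (2 * h) 2^-1 H) => //.
    - by move: hr h0; clear; lra.
    - by move: hC Ch; clear; lra.
    - by clear; lra.
    - by right.
    - by move: xd h0; clear; lra.
    - by move: ny th h0; clear; lra.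
    - rewrite normr_gt0; apply: contraTneq key => ->; rewrite dot0r -ltNge.
      by rewrite mulr_gt0// invr_gt0.
    - by apply: le_trans key; rewrite ler_wpM2l// invr_ge0.
  rewrite -ball_normE/= distrC E addrAC; apply: le_lt_trans (ler_normD _ _) _.
  by move: xd ny th h0; clear; lra.
have [pos|neg] := leP 0 (dot (n xs) (basis3 j)).
  exists fs, (fs + h); split; [by rewrite addrAC subrr add0r|by left|].
  move=> t /andP[t1 t2]; apply: inA; first by rewrite gt_eqF.
    by rewrite gtr0_norm ?subr_gt0// ltrBlDl.
  by rewrite mulr_ge0// subr_ge0 ltW.
exists (fs - h), fs; split; [by rewrite opprB addrCA subrr addr0|by right|].
move=> t /andP[t1 t2]; apply: inA; first by rewrite lt_eqF.
  by rewrite ltr0_norm ?subr_lt0// opprB ltrBlDl -ltrBlDr.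
by rewrite mulr_le0 ?subr_le0// ltW.
Qed.

Lemma flux_square (T P M Q S bp bm : R) :
  (T - bp * P + bm * M - bp * Q + bm * S) ^+ 2 <=
  5 * (T ^+ 2 + (bp ^+ 2 * P ^+ 2 + bm ^+ 2 * M ^+ 2) + (bp ^+ 2 * Q ^+ 2 + bm ^+ 2 * S ^+ 2)).
Proof.
have H (a b c d e : R) : (a + b + c + d + e) ^+ 2 <=
    5 * (a ^+ 2 + (b ^+ 2 + c ^+ 2) + (d ^+ 2 + e ^+ 2)).
  rewrite -subr_ge0.
  have -> : 5 * (a ^+ 2 + (b ^+ 2 + c ^+ 2) + (d ^+ 2 + e ^+ 2)) - (a + b + c + d + e) ^+ 2 =
    (a - b) ^+ 2 + (a - c) ^+ 2 + (a - d) ^+ 2 + (a - e) ^+ 2 + (b - c) ^+ 2 + (b - d) ^+ 2 +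
    (b - e) ^+ 2 + (c - d) ^+ 2 + (c - e) ^+ 2 + (d - e) ^+ 2 by ring.
  by rewrite !addr_ge0// sqr_ge0.
have := H T (- (bp * P)) (bm * M) (- (bp * Q)) (bm * S).
by rewrite !sqrrN !exprMn.
Qed.

Lemma sum_dot_bound (x : 'I_3 -> R) (u : pt3 R) : dot u u = 1 ->
  (\sum_i x i * dot (basis3 i) u) ^+ 2 <= \sum_i x i ^+ 2.
Proof.
move=> uu; apply: le_trans (sum_CS _ _) _.
by under [X in _ * X]eq_bigr do rewrite dotC; rewrite dot_basis_sum uu mulr1.
Qed.

Lemma dot_sum_basis (c u : pt3 R) : dot c u = \sum_i dot c (basis3 i) * dot (basis3 i) u.
Proof.
rewrite !big_ord_recr big_ord0 /= add0r /dot /basis3 /=.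
by rewrite !(mulr0, mulr1, add0r, addr0, mul0r, mul1r).
Qed.

Lemma integral_const_le (D : set (pt2 R)) (S : pt2 R -> R) (c M m : R) : measurable D ->
  @mu2 R D = m%:E -> (forall s, D s -> c <= S s) -> (forall s, 0 <= S s) ->
  measurable_fun D S -> (\int[@mu2 R]_(s in D) (S s)%:E <= M%:E)%E -> 0 <= m -> c * m <= M.
Proof.
move=> mD vol cS S0 mS SM m0.
have [c0|c0] := leP 0 c; last first.
  have : 0 <= M by rewrite -lee_fin; apply: le_trans SM; apply: integral_ge0 => s _; rewrite lee_fin.
  by apply: le_trans; rewrite mulr_le0_ge0// ltW.
rewrite -lee_fin; apply: le_trans SM.
have -> : ((c * m)%:E = \int[@mu2 R]_(s in D) (cst c%:E) s)%E.
  by rewrite integral_cst// EFinM -vol.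
apply: ge0_le_integral => //; exact/measurable_EFinP.
Qed.

Lemma integral_three (D : set (pt2 R)) (T : pt2 R -> R) (P M : 'I_3 -> pt2 R -> R) (x y e : R) :
  measurable D -> measurable_fun D T -> (forall i, measurable_fun D (P i)) ->
  (forall i, measurable_fun D (M i)) -> 0 <= x -> 0 <= y ->
  (N2s D T <= 0)%E -> (forall i, N2s D (P i) <= e%:E)%E -> (forall i, N2s D (M i) <= e%:E)%E ->
  (\int[@mu2 R]_(s in D) (T s ^+ 2 + (x * (\sum_i P i s ^+ 2) + y * (\sum_i M i s ^+ 2)))%:E <=
   (3 * (x + y) * e)%:E)%E.
Proof.
move=> mD mT mP mM x0 y0 HT HP HM.
have msq (u : pt2 R -> R) : measurable_fun D u -> measurable_fun D (fun s => (u s ^+ 2)%:E).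
  by move=> mu; apply/measurable_EFinP; exact: measurable_funX.
have part (c : R) (F : 'I_3 -> pt2 R -> R) : 0 <= c -> (forall i, measurable_fun D (F i)) ->
    (forall i, N2s D (F i) <= e%:E)%E ->
    measurable_fun D (fun s => (c * (\sum_i F i s ^+ 2))%:E) /\
    (\int[@mu2 R]_(s in D) (c * (\sum_i F i s ^+ 2))%:E <= (c * (3 * e))%:E)%E.
  move=> c0 mF HF; split.
    apply/measurable_EFinP; apply: measurable_funM; first exact: measurable_cst.
    by apply: measurable_sum => i; exact: measurable_funX.
  under eq_integral do rewrite EFinM -sumEFin.
  rewrite ge0_integralZl//; first last.
  - by move=> s _; apply: sume_ge0 => i _; rewrite lee_fin sqr_ge0.
  - by apply: emeasurable_sum => i; exact: msq.
  apply: lee_EFinM => //; rewrite ge0_integral_sum//.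
  - rewrite !big_ord_recr big_ord0 /= add0e (_ : 3 * e = e + e + e); last by ring.
    by rewrite !EFinD; apply: leeD; [apply: leeD|]; exact: HF.
  - by move=> i; exact: msq.
  - by move=> i s _; rewrite lee_fin sqr_ge0.
have [m1 h1] := part x P x0 mP HP; have [m2 h2] := part y M y0 mM HM.
have p0 (c : R) (F : 'I_3 -> pt2 R -> R) s : 0 <= c -> (0 <= (c * (\sum_i F i s ^+ 2))%:E)%E.
  by move=> c0; rewrite lee_fin mulr_ge0// sumr_ge0// => i _; exact: sqr_ge0.
under eq_integral do rewrite EFinD (EFinD (x * _)).
rewrite ge0_integralD//; first last.
- by apply: emeasurable_funD.
- by move=> s _; rewrite adde_ge0// p0.
- exact: msq.
- by move=> s _; rewrite lee_fin sqr_ge0.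
rewrite ge0_integralD//; [|by move=> s _; exact: p0|by move=> s _; exact: p0].
have -> : 3 * (x + y) * e = 0 + (x * (3 * e) + y * (3 * e)) by ring.
by rewrite !EFinD; apply: leeD => //; exact: leeD.
Qed.

(** At every point of the patch the constant jump [K0] is a combination of five terms: the flux jump
    of the traces, which has zero integral, the deviations of the traces from [cp] and [cm],
    controlled by the trace inequality, and the effect of replacing the normal at the point by
    [n xs], of order [C h]. Squaring and integrating over the patch gives the bound. *)
Lemma flux_bound G Op Om n r C xs h v (gp gm : 'I_3 -> pt3 R -> R) ggp ggm tp tm (cp cm : pt3 R) (bp bm a b : R) :
  two_sided G Op Om n r C -> G xs -> 0 < h -> 400 * h < r -> 10 ^+ 5 * C * h < 1 ->
  (exists M : R, Op `<=` ball 0 M) -> (exists M : R, Om `<=` ball 0 M) ->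
  (@mu3 R Op < +oo)%E -> (@mu3 R Om < +oo)%E ->
  H2data Op v gp ggp -> H2data Om v gm ggm ->
  (forall i, is_trace Op G (gp i) (tp i)) -> (forall i, is_trace Om G (gm i) (tm i)) ->
  surf_int G (fun x => (bp * (\sum_i tp i x * dot (basis3 i) (n x)) -
                        bm * (\sum_i tm i x * dot (basis3 i) (n x))) ^+ 2) = 0%E ->
  (forall i, N2 (Op `&` ball xs (3 * h)) (fun x => gp i x - dot cp (basis3 i))%R <= a%:E)%E ->
  (forall i, N2 (Om `&` ball xs (3 * h)) (fun x => gm i x - dot cm (basis3 i))%R <= a%:E)%E ->
  (forall i j, N2 (Op `&` ball xs (3 * h)) (ggp i j) <= b%:E)%E ->
  (forall i j, N2 (Om `&` ball xs (3 * h)) (ggm i j) <= b%:E)%E ->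
  (bp * dot cp (n xs) - bm * dot cm (n xs)) ^+ 2 * h ^+ 2 <=
    60 * (bp ^+ 2 + bm ^+ 2) * (8 / h * a + 4 * h * b) +
    5 * (bp ^+ 2 * dot cp cp + bm ^+ 2 * dot cm cm) * (40 * C * h) ^+ 2 * h ^+ 2.
Proof.
move=> H Gs h0 hr hC bOp bOm fOp fOm [wp1 wp2] [wm1 wm2] trp trm flux Hap Ham Hbp Hbm.
have [[r0 C0 [oOp oOm]] _ _ nG _] := H; have [nn _] := nG xs Gs.
have [j nj] := large_component nn.
have [f] := graph_patch H Gs h0 hr hC nj.
set X := fun s => place j s (f s); set D := ball _ _ => -[reg area Xd cnX].
have [oD CkX _ XG _] := reg; have mD := open_measurable2 oD.
have GX s : D s -> G (X s) by move=> Ds; apply: XG; exists s.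
pose Wp := Op `&` ball xs (3 * h); pose Wm := Om `&` ball xs (3 * h).
have oWp : open Wp by apply: openI => //; exact: ball_open.
have oWm : open Wm by apply: openI => //; exact: ball_open.
have WpO : Wp `<=` Op by move=> x [].
have WmO : Wm `<=` Om by move=> x [].
have HDp s : D s -> exists c d, [/\ d - c = h, f s = c \/ f s = d & forall t, c < t < d -> Wp (place j s t)].
  by move=> Ds; apply: (vertical_side H) => //; [exact: GX|exact: Xd].
have HDm s : D s -> exists c d, [/\ d - c = h, f s = c \/ f s = d & forall t, c < t < d -> Wm (place j s t)].
  move=> Ds; apply: (vertical_side (two_sided_sym H)) => //; [|exact: GX|exact: Xd].
  by rewrite dotNl normrN.
have Tp i := trace_bound oOp fOp bOp oWp WpO h0 reg area HDp (wp2 i j) (trp i) (Hap i) (Hbp i j).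
have Tm i := trace_bound oOm fOm bOm oWm WmO h0 reg area HDm (wm2 i j) (trm i) (Ham i) (Hbm i j).
set e := 8 / h * a + 4 * h * b in Tp Tm *.
pose T s := bp * (\sum_i tp i (X s) * dot (basis3 i) (n (X s))) - bm * (\sum_i tm i (X s) * dot (basis3 i) (n (X s))).
pose kappa := (bp ^+ 2 * dot cp cp + bm ^+ 2 * dot cm cm) * (40 * C * h) ^+ 2.
pose S s := T s ^+ 2 + (bp ^+ 2 * (\sum_i (tp i (X s) - dot cp (basis3 i)) ^+ 2) +
   bm ^+ 2 * (\sum_i (tm i (X s) - dot cm (basis3 i)) ^+ 2)).
pose K0 := bp * dot cp (n xs) - bm * dot cm (n xs).
have mn i : measurable_fun D (fun s => dot (basis3 i) (n (X s))).
  apply: open_continuous_measurable2 => // s Ds.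
  by apply: (@continuous_comp _ _ _ (fun s => n (X s)) (dot (basis3 i))); [exact: cnX|exact: continuous_dot].
have mT : measurable_fun D T.
  apply: measurable_funB; apply: measurable_funM; try exact: measurable_cst;
    apply: measurable_sum => i; apply: measurable_funM => //; [exact: (Tp i).1|exact: (Tm i).1].
have mp i : measurable_fun D (fun s => (tp i (X s) - dot cp (basis3 i)) ^+ 2).
  by apply: measurable_funX; apply: measurable_funB; [exact: (Tp i).1|exact: measurable_cst].
have mm i : measurable_fun D (fun s => (tm i (X s) - dot cm (basis3 i)) ^+ 2).
  by apply: measurable_funX; apply: measurable_funB; [exact: (Tm i).1|exact: measurable_cst].
have S0 s : 0 <= S s.
  by rewrite !addr_ge0 ?sqr_ge0// mulr_ge0 ?sqr_ge0// sumr_ge0// => i _; exact: sqr_ge0.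
have k0 : 0 <= bp ^+ 2 by exact: sqr_ge0.
have k1 : 0 <= bm ^+ 2 by exact: sqr_ge0.
have pt s : D s -> K0 ^+ 2 / 5 - kappa <= S s.
  move=> Ds; have [nX _] := nG _ (GX s Ds).
  pose P := \sum_i (tp i (X s) - dot cp (basis3 i)) * dot (basis3 i) (n (X s)).
  pose M := \sum_i (tm i (X s) - dot cm (basis3 i)) * dot (basis3 i) (n (X s)).
  pose Q := dot cp (n (X s) - n xs); pose V := dot cm (n (X s) - n xs).
  have PE : P = \sum_i tp i (X s) * dot (basis3 i) (n (X s)) - dot cp (n (X s)).
    by rewrite /P (dot_sum_basis cp) -sumrB; apply: eq_bigr => i _; rewrite mulrBl.
  have ME : M = \sum_i tm i (X s) * dot (basis3 i) (n (X s)) - dot cm (n (X s)).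
    by rewrite /M (dot_sum_basis cm) -sumrB; apply: eq_bigr => i _; rewrite mulrBl.
  have KE : K0 = T s - bp * P + bm * M - bp * Q + bm * V.
    by rewrite PE ME /Q /V !dotBr /T /K0; ring.
  have := flux_square (T s) P M Q V bp bm; rewrite -KE => fs.
  have P2 : P ^+ 2 <= \sum_i (tp i (X s) - dot cp (basis3 i)) ^+ 2 by exact: sum_dot_bound.
  have M2 : M ^+ 2 <= \sum_i (tm i (X s) - dot cm (basis3 i)) ^+ 2 by exact: sum_dot_bound.
  have Ch : 0 < C * h by exact: mulr_gt0.
  have xd := Xd s Ds; have Cx := ler_wpM2l (ltW C0) xd.
  have d1 : 4 * `|X s - xs| < r by move: xd hr h0; clear; lra.
  have d2 : 32 * C * `|X s - xs| <= 40 * C * h by move: Cx; clear; lra.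
  have d3 : 40 * C * h < 1 by move: hC Ch; clear; lra.
  have nl := normal_lipschitz H Gs (GX s Ds) d1 (le_lt_trans d2 d3).
  have {}nl : dot (n (X s) - n xs) (n (X s) - n xs) <= (40 * C * h) ^+ 2.
    apply: le_trans nl _; rewrite ler_sqr// nnegrE; last by rewrite -mulrA mulr_ge0// ltW.
    by rewrite mulr_ge0// mulr_ge0// ltW.
  have qb c : dot c (n (X s) - n xs) ^+ 2 <= dot c c * (40 * C * h) ^+ 2.
    by apply: le_trans (dot_CS _ _) _; rewrite ler_wpM2l// dot_ge0.
  have Q2 := ler_wpM2l k0 (qb cp); have V2 := ler_wpM2l k1 (qb cm).
  have := ler_wpM2l k0 P2; have := ler_wpM2l k1 M2.
  move=> w1 w2; rewrite lerBlDr ler_pdivrMr// [leRHS]mulrC.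
  apply: le_trans fs _; rewrite ler_pM2l// /S /kappa mulrDl -!(mulrA (_ ^+ 2)).
  by apply: lerD; [rewrite lerD2l|]; exact: lerD.
have e0 : (N2s D T <= 0)%E.
  rewrite -[leRHS]flux; apply: le_trans; last first.
    by apply: ereal_sup_ubound; exists D, X; split; [exact: reg|reflexivity].
  rewrite leb2E; apply: ge0_le_integral => //.
  - by move=> s _; rewrite lee_fin sqr_ge0.
  - by apply/measurable_EFinP; exact: measurable_funX.
  - apply/measurable_EFinP; apply: measurable_funM; last exact: measurable_area_element.
    exact: measurable_funX.
  by move=> s Ds; rewrite lee_fin ler_peMr ?sqr_ge0//; exact: area.
have mp' i : measurable_fun D (fun s => tp i (X s) - dot cp (basis3 i)).
  by apply: measurable_funB; [exact: (Tp i).1|exact: measurable_cst].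
have mm' i : measurable_fun D (fun s => tm i (X s) - dot cm (basis3 i)).
  by apply: measurable_funB; [exact: (Tm i).1|exact: measurable_cst].
have SI := integral_three mD mT mp' mm' k0 k1 e0 (fun i => (Tp i).2) (fun i => (Tm i).2).
have mS : measurable_fun D S.
  apply: measurable_funD; first exact: measurable_funX.
  by apply: measurable_funD; apply: measurable_funM; try exact: measurable_cst; exact: measurable_sum.
have h4 : 0 <= h / 4 by rewrite divr_ge0// ltW.
have := integral_const_le mD (mu2_ball _ h4) pt S0 mS SI (exprn_ge0 2 (mulrn_wge0 2 h4)).
rewrite -/K0 -[_ *+ 2]mulr_natl.
(* The base of the patch has area [h^2 / 4]; the 5 counts the terms of the decomposition. *)
have -> : (K0 ^+ 2 / 5 - kappa) * (2 * (h / 4)) ^+ 2 = (K0 ^+ 2 * h ^+ 2 - 5 * kappa * h ^+ 2) / 20 by field.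
have -> : 5 * (bp ^+ 2 * dot cp cp + bm ^+ 2 * dot cm cm) * (40 * C * h) ^+ 2 * h ^+ 2 = 5 * kappa * h ^+ 2.
  by rewrite /kappa; ring.
rewrite ler_pdivrMr// lerBlDr => fin; apply: le_trans fin _.
by rewrite lerD2r le_eqVlt; apply/orP; left; apply/eqP; ring.
Qed.

End Flux.

(** * Tetrahedra *)

Section Barycentric.
Variable R : realType.
Implicit Types (a : 'I_4 -> pt3 R) (x y u w : pt3 R) (p q : affine (R := R)).

Definition homogeneous x (c : 'I_4) : R := [:: x.1.1; x.1.2; x.2; 1]`_c.

(** In homogeneous coordinates affine independence becomes invertibility, and the columns of the
    inverse are the coefficients of the barycentric coordinates. *)
Definition vertex_mx a : 'M[R]_4 := \matrix_(k, c) homogeneous (a k) c.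

Lemma vertex_mx_unit a : affinely_independent a -> vertex_mx a \in unitmx.
Proof.
move=> ai; rewrite -row_free_unit; apply: inj_row_free => v vA.
have E c : \sum_k v 0 k * homogeneous (a k) c = 0.
  have := congr1 (fun m : 'rV[R]_4 => m 0 c) vA; rewrite !mxE => E; rewrite -[RHS]E.
  by apply: eq_bigr => k _; rewrite mxE.
apply/rowP => k; rewrite mxE; apply: (ai (fun k => v 0 k)).
  by rewrite -[RHS](E 3%:R); apply: eq_bigr => i _; rewrite /homogeneous /= mulr1.
have s1 (F : 'I_4 -> pt3 R) : (\sum_k F k).1.1 = \sum_k (F k).1.1.
  by apply: (big_morph (fun x : pt3 R => x.1.1)).
have s2 (F : 'I_4 -> pt3 R) : (\sum_k F k).1.2 = \sum_k (F k).1.2.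
  by apply: (big_morph (fun x : pt3 R => x.1.2)).
have s3 (F : 'I_4 -> pt3 R) : (\sum_k F k).2 = \sum_k (F k).2.
  by apply: (big_morph (fun x : pt3 R => x.2)).
apply: pt3_eq; rewrite ?s1 ?s2 ?s3 /=.
- by rewrite -[RHS](E 0).
- by rewrite -[RHS](E 1).
- by rewrite -[RHS](E 2%:R).
Qed.

Definition of_column (c : 'I_4 -> R) : affine (R := R) := ((c 0, c 1, c 2%:R), c 3%:R).

Lemma aff_of_column (c : 'I_4 -> R) x : aff (of_column c) x = \sum_i homogeneous x i * c i.
Proof.
have e0 : widen_ord (leqnSn 3) (widen_ord (leqnSn 2) (widen_ord (leqnSn 1) ord_max)) = 0 :> 'I_4 by exact/val_inj.
have e1 : widen_ord (leqnSn 3) (widen_ord (leqnSn 2) ord_max) = 1 :> 'I_4 by exact/val_inj.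
have e2 : widen_ord (leqnSn 3) ord_max = 2%:R :> 'I_4 by exact/val_inj.
have e3 : ord_max = 3%:R :> 'I_4 by exact/val_inj.
rewrite !big_ord_recr big_ord0 /= add0r e0 e1 e2 e3 /homogeneous /= /aff /dot /=; ring.
Qed.

Lemma barycentric_exists a : affinely_independent a ->
  exists lam : 'I_4 -> affine (R := R), forall k l, aff (lam k) (a l) = (k == l)%:R.
Proof.
move=> /vertex_mx_unit uA; exists (fun k => of_column (fun i => invmx (vertex_mx a) i k)) => k l.
rewrite aff_of_column.
have := congr1 (fun m : 'M[R]_4 => m l k) (mulmxV uA); rewrite !mxE eq_sym => <-.
by apply: eq_bigr => i _; rewrite mxE.
Qed.

Lemma aff_vertices_eq0 a p : affinely_independent a -> (forall k, aff p (a k) = 0) -> p = 0.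
Proof.
move=> /vertex_mx_unit uA H.
pose c (i : 'I_4) := [:: p.1.1.1; p.1.1.2; p.1.2; p.2]`_i.
have pE : p = of_column c by rewrite /of_column /c /=; case: (p) => -[[? ?] ?] ?.
have : vertex_mx a *m (\col_i c i) = 0.
  apply/matrixP => k l; rewrite !mxE -[RHS](H k) pE aff_of_column.
  by apply: eq_bigr => i _; rewrite !mxE.
move=> /(congr1 (mulmx (invmx (vertex_mx a)))); rewrite mulKmx// mulmx0 => c0.
have ci i : c i = 0 by have := congr1 (fun m : 'cV[R]_4 => m i 0) c0; rewrite !mxE.
by rewrite pE /of_column !ci.
Qed.

Lemma affD p q x : aff (p + q) x = aff p x + aff q x.
Proof. by rewrite /aff /dot /=; ring. Qed.

Lemma affZ (t : R) p x : aff (t *: p) x = t * aff p x.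
Proof. by rewrite /aff /dot /= /GRing.scale/=; ring. Qed.

Lemma aff_sum (I : finType) (F : I -> affine (R := R)) x : aff (\sum_i F i) x = \sum_i aff (F i) x.
Proof.
apply: (big_morph (fun p => aff p x)) => [p q|]; first exact: affD.
by rewrite /aff /dot /= !mul0r !addr0.
Qed.

Lemma dot_sumr (I : finType) u (F : I -> pt3 R) : dot u (\sum_i F i) = \sum_i dot u (F i).
Proof. by apply: (big_morph (dot u)) => [x y|]; [exact: dotDr|exact: dot0r]. Qed.

Lemma grad_sum (I : finType) (F : I -> affine (R := R)) : (\sum_i F i).1 = \sum_i (F i).1.
Proof. exact: (big_morph (fun p : affine => p.1)). Qed.

Lemma aff_convex (I : finType) (l : I -> R) (y : I -> pt3 R) p : \sum_i l i = 1 ->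
  aff p (\sum_i l i *: y i) = \sum_i l i * aff p (y i).
Proof.
move=> l1; rewrite /aff dot_sumr.
under [RHS]eq_bigr do rewrite mulrDr.
have lp : \sum_i l i * p.2 = p.2 by rewrite -mulr_suml l1 mul1r.
rewrite [RHS]big_split /= lp; congr (_ + _).
by apply: eq_bigr => i _; rewrite dotZr.
Qed.

Variables (a : 'I_4 -> pt3 R) (lam : 'I_4 -> affine (R := R)).
Hypothesis ai : affinely_independent a.
Hypothesis lamE : forall k l, aff (lam k) (a l) = (k == l)%:R.

Lemma aff_reconstruct p : p = \sum_k aff p (a k) *: lam k.
Proof.
apply/eqP; rewrite -subr_eq0; apply/eqP; apply: (aff_vertices_eq0 ai) => l.
rewrite aff_sub aff_sum (bigD1 l)//= affZ lamE eqxx mulr1 big1 ?addr0 ?subrr// => k kl.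
by rewrite affZ lamE (negbTE kl) mulr0.
Qed.

Lemma bary_sum x : \sum_k aff (lam k) x = 1.
Proof.
have := congr1 (fun p => aff p x) (aff_reconstruct ((0, 1) : affine)).
have E y : aff ((0, 1) : affine) y = 1 :> R by rewrite /aff /dot /= !mul0r !add0r.
by rewrite aff_sum E => ->; apply: eq_bigr => k _; rewrite affZ E mul1r.
Qed.

Lemma bary_point x : x = \sum_k aff (lam k) x *: a k.
Proof.
have E p : aff p x = aff p (\sum_k aff (lam k) x *: a k).
  rewrite (aff_convex _ _ (bary_sum x)) {1}(aff_reconstruct p) aff_sum.
  by apply: eq_bigr => k _; rewrite affZ mulrC.
by apply: pt3_eq; [have := E ((1, 0, 0), 0)|have := E ((0, 1, 0), 0)|have := E ((0, 0, 1), 0)];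
  rewrite /aff /dot /= !(mul0r, mul1r, add0r, addr0).
Qed.

Lemma tetP x : tet a x <-> forall k, 0 < aff (lam k) x.
Proof.
split; last by move=> H; exists (fun k => aff (lam k) x); split; [exact: H|exact: bary_sum|exact: bary_point].
move=> [l [l0 l1 ->]] k; rewrite (aff_convex _ _ l1) (bigD1 k)//= lamE eqxx mulr1 big1 ?addr0// => i ik.
by rewrite lamE eq_sym (negbTE ik) mulr0.
Qed.

Lemma tet_open : open (tet a).
Proof.
rewrite openE => x /tetP H.
have : \forall y \near x, forall k, 0 < aff (lam k) y.
  apply: (@filter_forall _ _ (fun k => [set y | 0 < aff (lam k) y]) _ (nbhs_filter x)) => k.
  exact: (cvgr_gt (aff (lam k) x) (@continuous_aff R (lam k) x)).
by apply: filterS => y /tetP.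
Qed.

Lemma tet_convex x y (t : R) : tet a x -> tet a y -> 0 <= t <= 1 -> tet a (x + t *: (y - x)).
Proof.
move=> /tetP hx /tetP hy /andP[t0 t1]; apply/tetP => k.
have -> : aff (lam k) (x + t *: (y - x)) = (1 - t) * aff (lam k) x + t * aff (lam k) y.
  by rewrite /aff /dot /= /GRing.scale/=; ring.
have [->|tn] := eqVneq t 0; first by rewrite subr0 mul1r mul0r addr0.
apply: ltr_wpDl; first by rewrite mulr_ge0 ?subr_ge0// ltW.
by rewrite mulr_gt0// lt_def tn.
Qed.

Lemma grad_lam_vertices k l i : dot (lam k).1 (a l - a i) = (k == l)%:R - (k == i)%:R.
Proof. by rewrite -affB !lamE. Qed.

(* [p = (w.w) u - (u.w) w] is a multiple of the gradient of the [k]-th barycentric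
   coordinate, since both are orthogonal to the edge and to [w]. *)
Lemma dihedral_grad i j k l : uniq [:: i; j; k; l] ->
  0 <= dot (orth_part (a j - a i) (a k - a i)) (orth_part (a j - a i) (a l - a i)) ->
  dot (lam k).1 (lam l).1 <= 0.
Proof.
rewrite /= !inE !negb_or => /and4P[/and3P[ij ik il] /andP[jk jl] kl _].
set e := a j - a i; set u := orth_part e (a k - a i); set w := orth_part e (a l - a i).
move=> uw0; set g := (lam k).1; set g' := (lam l).1.
have ge : dot g e = 0 by rewrite /g /e grad_lam_vertices eq_sym (negbTE jk) eq_sym (negbTE ik) subrr.
have g'e : dot g' e = 0 by rewrite /g' /e grad_lam_vertices eq_sym (negbTE jl) eq_sym (negbTE il) subrr.
have orth x y : dot x e = 0 -> dot x (orth_part e y) = dot x y.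
  by move=> xe; rewrite /orth_part dotBr dotZr xe mulr0 subr0.
have gu : dot g u = 1 by rewrite orth// /g grad_lam_vertices eqxx eq_sym (negbTE ik) subr0.
have gw : dot g w = 0 by rewrite orth// /g grad_lam_vertices (negbTE kl) eq_sym (negbTE ik) subrr.
have g'u : dot g' u = 0 by rewrite orth// /g' grad_lam_vertices eq_sym (negbTE kl) eq_sym (negbTE il) subrr.
have g'w : dot g' w = 1 by rewrite orth// /g' grad_lam_vertices eqxx eq_sym (negbTE il) subr0.
have e0 : dot e e != 0.
  apply/eqP => /dot_eq0 E; have := grad_lam_vertices j j i; rewrite -/e E dot0r eqxx eq_sym (negbTE ij).
  by move/eqP; rewrite subr0 eq_sym oner_eq0.
have oe y : dot (orth_part e y) e = 0 by rewrite /orth_part (dotBl e y) dotZl divfK// subrr.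
have ue : dot u e = 0 by exact: oe.
have we : dot w e = 0 by exact: oe.
set U := dot u u; set V := dot w w; set c := dot u w in uw0.
pose p := V *: u - c *: w; pose D := U * V - c ^+ 2.
have pe : dot p e = 0 by rewrite /p dotBl !dotZl ue we !mulr0 subrr.
have pu : dot p u = D by rewrite /p dotBl !dotZl (dotC w u) -/c -/U /D; ring.
have pw : dot p w = 0 by rewrite /p dotBl !dotZl -/c -/V; ring.
have pg' : dot p g' = - c by rewrite /p dotBl !dotZl (dotC u) (dotC w) g'u g'w; ring.
have pD : p = D *: g.
  apply/eqP; rewrite -subr_eq0; apply/eqP; set q := p - D *: g.
  have qe : dot q e = 0 by rewrite /q dotBl dotZl pe ge mulr0 subrr.
  have qm m : dot q (a m - a i) = 0.
    have H y : dot q (orth_part e y) = 0 -> dot q y = 0 by rewrite orth.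
    have [->|mi] := eqVneq m i; first by rewrite subrr dot0r.
    have [->|mj] := eqVneq m j; first exact: qe.
    have [->|mk] := eqVneq m k; first by apply: H; rewrite -/u /q dotBl dotZl pu gu mulr1 subrr.
    have -> : m = l.
      apply: contraTeq isT => ml; have := max_card (mem [:: m; i; j; k; l]).
      rewrite card_ord (card_uniqP _)//= !inE !negb_or mi mj mk ml ij ik il jk jl kl.
      by [].
    by apply: H; rewrite -/w /q dotBl dotZl pw gw mulr0 subrr.
  have := @aff_vertices_eq0 a (q, - dot q (a i)) ai; rewrite /aff /= => Q.
  have {Q} : (q, - dot q (a i)) = 0 :> affine by apply: Q => m; rewrite -dotBr qm.
  exact: (congr1 (fun z : affine => z.1)).
have key : D * dot g g' = - c by rewrite -dotZl -pD.
have D0 : 0 <= D by rewrite /D subr_ge0; exact: dot_CS.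
(* If [D] vanished then so would [c], hence [U * V], and [u] or [w] would be zero against
   [dot g u = 1] and [dot g' w = 1]. *)
have Dn : D != 0.
  apply/eqP => DE; move: key pu; rewrite DE mul0r => /esym/eqP; rewrite oppr_eq0 => /eqP cE.
  move: DE; rewrite /D cE expr0n /= subr0 => /eqP; rewrite mulf_eq0 => /orP[|] /eqP /dot_eq0 E _.
    by move: gu; rewrite E dot0r => /esym/eqP; rewrite oner_eq0.
  by move: g'w; rewrite E dot0r => /esym/eqP; rewrite oner_eq0.
have Dp : 0 < D by rewrite lt_def Dn.
by rewrite -(pmulr_rle0 _ Dp) key oppr_le0.
Qed.

End Barycentric.

Lemma angle_le_pihalf (R : realType) (u w : pt3 R) : angle u w <= pi / 2 -> 0 <= dot u w.
Proof.
rewrite /angle; set x := dot u w / _ => ax.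
have N0 : 0 <= enorm u * enorm w by rewrite mulr_ge0// sqrtr_ge0.
have x1 : `|x| <= 1.
  have [NE|Nn] := eqVneq (enorm u * enorm w) 0; first by rewrite /x NE invr0 mulr0 normr0.
  have Np : 0 < enorm u * enorm w by rewrite lt_def Nn.
  rewrite /x normrM normfV (gtr0_norm Np) ler_pdivrMr// mul1r.
  rewrite -ler_sqr ?nnegrE// (real_normK (num_real _)) exprMn /enorm !sqr_sqrtr ?dot_ge0//.
  exact: dot_CS.
have xin : x \in `[-1, 1] by rewrite in_itv /= -ler_norml.
have x0 : 0 <= x.
  rewrite -(acosK xin); apply: cos_ge0_pihalf; rewrite ax andbT.
  have : 0 <= acos x by apply: acos_ge0; rewrite -ler_norml.
  by apply: le_trans; rewrite oppr_le0 divr_ge0// pi_ge0.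
(* With a zero vector the quotient in [angle] is 0 by the convention for division, and the inner
   product vanishes by Cauchy-Schwarz. *)
have [NE|Nn] := eqVneq (enorm u * enorm w) 0.
  have := dot_CS u w.
  have -> : dot u u * dot w w = (enorm u * enorm w) ^+ 2 by rewrite exprMn /enorm !sqr_sqrtr ?dot_ge0.
  by rewrite NE expr0n /= => h; have : dot u w ^+ 2 == 0 by [rewrite eq_le h sqr_ge0]; rewrite sqrf_eq0 => /eqP ->.
by have -> : dot u w = x * (enorm u * enorm w) by [rewrite /x divfK]; exact: mulr_ge0.
Qed.

Lemma sum_const4 (R : pzRingType) (c : R) : \sum_(k < 4) c = 4 * c.
Proof. by rewrite sumr_const card_ord mulr_natl. Qed.

Section TetShape.
Variable R : realType.
Implicit Types (a : 'I_4 -> pt3 R) (x y u w : pt3 R).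

Lemma enorm_ge0 x : 0 <= enorm x.
Proof. exact: sqrtr_ge0. Qed.

Lemma enorm_sq x : enorm x ^+ 2 = dot x x.
Proof. by rewrite sqr_sqrtr// dot_ge0. Qed.

Lemma norm_le_enorm x : `|x| <= enorm x.
Proof. by apply: norm_le_dot; [exact: enorm_ge0|rewrite enorm_sq]. Qed.

Lemma enorm_le_norm x : enorm x <= 2 * `|x|.
Proof.
rewrite -ler_sqr ?nnegrE ?enorm_ge0 ?mulr_ge0// enorm_sq exprMn.
by apply: le_trans (dot_le3 x) _; apply: ler_wpM2r; [exact: sqr_ge0|clear; lra].
Qed.

Lemma tet_bounded a x : tet a x -> `|x| <= \sum_k `|a k|.
Proof.
move=> [l [l0 l1 ->]]; apply: le_trans (ler_norm_sum _ _ _) _; apply: ler_sum => k _.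
have lk1 : l k <= 1 by rewrite -l1 (bigD1 k)//= lerDl sumr_ge0// => i _; exact: ltW.
by rewrite normrZ gtr0_norm//; exact: ler_piMl.
Qed.

Lemma enorm_le_diam a x y : tet a x -> tet a y -> enorm (x - y) <= diam (tet a).
Proof.
move=> Tx Ty; apply: sup_ubound; last by exists x, y.
exists (2 * (\sum_k `|a k| + \sum_k `|a k|)) => _ [u [w [Tu Tw ->]]].
apply: le_trans (enorm_le_norm _) _; rewrite ler_pM2l//.
by apply: le_trans (ler_normB _ _) _; apply: lerD; exact: tet_bounded.
Qed.

Lemma norm_le_diam a x y : closure (tet a) x -> closure (tet a) y -> `|x - y| <= diam (tet a).
Proof.
move=> cx cy; apply/ler_addgt0Pr => e e0.
have e2 : 0 < e / 2 by rewrite divr_gt0.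
have [x' [Tx' Bx]] := cx _ (nbhsx_ballx x _ e2).
have [y' [Ty' By]] := cy _ (nbhsx_ballx y _ e2).
have -> : x - y = (x - x') + (x' - y') - (y - y') by apply: pt3_eq; rewrite /=; ring.
have h1 := le_trans (norm_le_enorm _) (enorm_le_diam Tx' Ty').
move: Bx By; rewrite -!ball_normE/= => Bx By.
apply: le_trans (ler_normB _ _) _; have := ler_normD (x - x') (x' - y').
by move: Bx By h1; clear; lra.
Qed.

Variables (a : 'I_4 -> pt3 R) (lam : 'I_4 -> affine (R := R)).
Hypothesis ai : affinely_independent a.
Hypothesis lamE : forall k l, aff (lam k) (a l) = (k == l)%:R.

Lemma tet_vertex_closure k : closure (tet a) (a k).
Proof.
pose m : pt3 R := \sum_l 4^-1 *: a l.
have s4 : \sum_(l < 4) (4^-1 : R) = 1.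
  by rewrite sum_const4 mulfV// pnatr_eq0.
have Em l : aff (lam l) m = 4^-1.
  rewrite /m (aff_convex _ _ s4) (bigD1 l)//= lamE eqxx mulr1 big1 ?addr0// => i il.
  by rewrite lamE eq_sym (negbTE il) mulr0.
move=> B /nbhs_ballP[e /= e0 he].
pose t := Num.min 1 (e / (`|m - a k| + 1)).
have n1 : 0 < `|m - a k| + 1 by rewrite ltr_wpDl.
have t0 : 0 < t by rewrite lt_min ltr01 divr_gt0.
have t1 : t <= 1 by rewrite /t ge_min lexx.
have te : t * (`|m - a k| + 1) <= e by rewrite -ler_pdivlMr// /t ge_min lexx orbT.
exists (a k + t *: (m - a k)); split; last first.
  apply: he; rewrite -ball_normE/= opprD addNKr normrN normrZ gtr0_norm//.
  by apply: lt_le_trans te; rewrite ltr_pM2l// ltrDl.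
apply/(tetP ai lamE) => l.
have -> : aff (lam l) (a k + t *: (m - a k)) = (1 - t) * aff (lam l) (a k) + t * aff (lam l) m.
  by rewrite /aff /dot /= /GRing.scale/=; ring.
rewrite Em lamE; apply: ltr_wpDl; last by rewrite mulr_gt0// invr_gt0.
by rewrite mulr_ge0 ?subr_ge0//; case: (l == k).
Qed.

Lemma tet_neq0 : tet a !=set0.
Proof.
by have [x [Tx _]] := @tet_vertex_closure 0 _ filterT; exists x.
Qed.

Lemma diam_gt0 : 0 < diam (tet a).
Proof.
have [x Tx] := tet_neq0.
have /nbhs_ballP[e /= e0 he] : nbhs x (tet a) by apply: open_nbhs_nbhs; split=> //; exact: tet_open.
pose y := x + (e / 2) *: (basis3 0 : pt3 R).
have E : x - y = - ((e / 2) *: basis3 0) by rewrite /y opprD addNKr.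
have b1 : `|(basis3 0 : pt3 R)| <= 1 by rewrite -place_basis; apply/norm_place; rewrite normr0 normr1.
have Ty : tet a y.
  apply: he; rewrite -ball_normE/= E normrN normrZ gtr0_norm ?divr_gt0//.
  by apply: (@le_lt_trans _ _ (e / 2)); [rewrite ler_piMr// divr_ge0// ltW|rewrite ltr_pdivrMr// ltr_pMr// ltr1n].
apply: lt_le_trans (enorm_le_diam Tx Ty); rewrite sqrtr_gt0 E dotNl dotNr opprK dotZl dotZr.
by rewrite !mulr_gt0 ?divr_gt0// /dot /basis3 /= !mulr1 !mulr0 !addr0.
Qed.

(** Between two opposite points at distance [d] in an inscribed ball the barycentric coordinate
    varies by [d] times the length of its gradient, while it stays between 0 and 1. The strict
    inequality selects an actual ball below the supremum. *)
Lemma grad_lam_bound (d : R) k : 0 < d -> d < inball_diam (tet a) ->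
  dot (lam k).1 (lam k).1 <= d^-1 ^+ 2.
Proof.
move=> d0 hd.
have [_ [c [r [r0 BT ->]]] dr] : exists2 y, [set d | exists c r,
    [/\ 0 < r, [set x | enorm (x - c) < r] `<=` tet a & d = r *+ 2]] y & d < y.
  apply: sup_gt => //; apply/set0P/eqP => E.
  by move: hd; rewrite /inball_diam E sup0 ltNge ltW.
set g := (lam k).1; pose N := enorm g.
have [NE|Nn] := eqVneq N 0.
  by rewrite -enorm_sq -/N NE expr0n /= sqr_ge0.
have Np : 0 < N by rewrite lt_def Nn enorm_ge0.
pose t := d / 2; have t0 : 0 < t by rewrite divr_gt0.
have tr : t < r by rewrite /t ltr_pdivrMr// mulr_natr.
have inT (s : R) : `|s| = t -> tet a (c + (s / N) *: g).
  move=> st; apply: BT => /=; rewrite addrAC subrr add0r.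
  have -> : enorm ((s / N) *: g) = t; last exact: tr.
  apply/eqP; rewrite -(eqrXn2 (n := 2)) ?enorm_ge0// ?ltW//; apply/eqP.
  by rewrite enorm_sq dotZl dotZr -enorm_sq -/N -st (real_normK (num_real s)); field.
have val (s : R) : aff (lam k) (c + (s / N) *: g) = aff (lam k) c + s * N.
  have -> : aff (lam k) (c + (s / N) *: g) = aff (lam k) c + s / N * dot g g.
    by rewrite /aff dotDr dotZr addrAC.
  by rewrite -enorm_sq -/N; field.
have hp : aff (lam k) (c + (t / N) *: g) <= 1.
  have /(tetP ai lamE) H := inT t (gtr0_norm t0).
  by rewrite -(bary_sum ai lamE (c + (t / N) *: g)) (bigD1 k)//= lerDl sumr_ge0// => i _; exact: ltW.
have hm : 0 < aff (lam k) (c + (- t / N) *: g).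
  by have /(tetP ai lamE) := inT (- t) (etrans (normrN _) (gtr0_norm t0)); apply.
rewrite val in hp; rewrite val in hm.
have dN : d * N <= 1 by move: hp hm; rewrite /t; lra.
rewrite -enorm_sq -/N ler_sqr ?nnegrE ?enorm_ge0 ?invr_ge0 ?(ltW d0)//.
by rewrite -div1r ler_pdivlMr// mulrC.
Qed.

End TetShape.

(** * Shape functions on one element: the scalar equation for the normal slope *)

Section IFEAlgebra.
Variable R : realType.
Variables (a : 'I_4 -> pt3 R) (lam : 'I_4 -> affine (R := R)).
Hypothesis ai : affinely_independent a.
Hypothesis lamE : forall k l, aff (lam k) (a l) = (k == l)%:R.
Variables (nu xs : pt3 R) (side : 'I_4 -> bool) (h g eps bp bm c0 : R).
Hypotheses (nn : dot nu nu = 1) (h0 : 0 < h) (g0 : 0 <= g) (eps0 : 0 <= eps) (bp0 : 0 < bp) (c00 : 0 < c0).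
Local Notation d k := (dot nu (a k - xs)).
Hypothesis dh : forall k, `|d k| <= 2 * h.
Hypothesis dp : forall k, side k -> - eps <= d k.
Hypothesis dm : forall k, ~~ side k -> d k <= eps.
Hypothesis gb : forall k, dot (lam k).1 (lam k).1 <= g ^+ 2.
Hypothesis nonobtuse : forall k l, k != l -> dot (lam k).1 (lam l).1 <= 0.
Let mu := bm / bp.
Let dd : affine (R := R) := (nu, - dot nu xs).
(** [w] and [w'] are the gradients of the Lagrange interpolants of the signed distance to the
    tangent plane, restricted to the vertices of one side and of the other. Their sum is [nu], as
    affine functions are reproduced. *)
Let w := \sum_(k | side k) d k *: (lam k).1.
Let w' := \sum_(k | ~~ side k) d k *: (lam k).1.
Let theta := dot w nu.

Let ddE x : aff dd x = dot nu (x - xs).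
Proof. by rewrite /aff /dd /= dotBr. Qed.

Lemma dot_sum_filter (I : finType) (P : pred I) u (F : I -> pt3 R) :
  dot u (\sum_(i | P i) F i) = \sum_(i | P i) dot u (F i).
Proof. by apply: (big_morph (dot u)) => [x y|]; [exact: dotDr|exact: dot0r]. Qed.

Let nuE : nu = w + w'.
Proof.
have := congr1 (fun p : affine => p.1) (aff_reconstruct ai lamE dd).
rewrite grad_sum /= => {1}->; rewrite (bigID side) /=.
by congr (_ + _); apply: eq_bigr => k _; rewrite ddE.
Qed.

(* A side-[+] vertex has [d >= - eps] and a side-[-] vertex has [d <= eps], so up
   to [eps] each product [d k * d l] is nonpositive, as is the inner product of
   the gradients when no dihedral angle is obtuse. *)
Let cross : - (16 * (2 * h * eps * g ^+ 2)) <= dot w w'.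
Proof.
set m := 2 * h * eps * g ^+ 2.
have m0 : 0 <= m by rewrite !mulr_ge0// ?sqr_ge0// ltW.
have -> : dot w w' = \sum_(l | ~~ side l) \sum_(k | side k) d k * d l * dot (lam k).1 (lam l).1.
  rewrite /w' dot_sum_filter; apply: eq_bigr => l _.
  rewrite dotZr (dotC w) /w dot_sum_filter mulr_sumr; apply: eq_bigr => k _.
  by rewrite dotZr (dotC (lam l).1); ring.
have term k l : side k -> ~~ side l -> - m <= d k * d l * dot (lam k).1 (lam l).1.
  move=> sk sl; have kl : k != l by apply: contraTneq sk => ->.
  have G0 := nonobtuse kl; set G := dot _ _ in G0 *.
  have G1 : - g ^+ 2 <= G.
    have : `|G| <= g ^+ 2.
      rewrite -ler_sqr ?nnegrE ?sqr_ge0// (real_normK (num_real _)); apply: le_trans (dot_CS _ _) _.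
      by rewrite (expr2 (g ^+ 2)); apply: ler_pM; rewrite ?dot_ge0.
    by rewrite ler_norml => /andP[].
  have := dp sk; have := dm sl; have := dh k; have := dh l; rewrite !ler_norml.
  move: (d k) (d l) => x y /andP[y1 y2] /andP[x1 x2] ye xe.
  have xy : x * y <= 2 * h * eps.
    have [x0|x0] := leP 0 x.
      have [y0|y0] := leP 0 y; first by apply: ler_pM.
      by apply: (@le_trans _ _ 0); [rewrite mulr_ge0_le0// ltW|rewrite !mulr_ge0// ltW].
    have [y0|y0] := leP 0 y.
      by apply: (@le_trans _ _ 0); [rewrite mulr_le0_ge0// ltW|rewrite !mulr_ge0// ltW].
    by rewrite -mulrNN mulrC; apply: ler_pM; rewrite ?oppr_ge0 ?(ltW x0) ?(ltW y0)//; lra.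
  have gg : 0 <= g ^+ 2 by exact: sqr_ge0.
  apply: (@le_trans _ _ (2 * h * eps * G)).
    by rewrite /m -mulrN ler_wpM2l// !mulr_ge0// ltW.
  by rewrite ler_wnM2r.
have card (P : pred 'I_4) (F : 'I_4 -> R) (c : R) : 0 <= c -> (forall k, P k -> - c <= F k) ->
    - (4 * c) <= \sum_(k | P k) F k.
  move=> c1 HF; rewrite big_mkcond /=.
  have -> : - (4 * c) = \sum_(k < 4) - c by rewrite sum_const4 mulrN.
  by apply: ler_sum => k _; case: ifP => [/HF//|_]; rewrite oppr_le0.
have -> : 16 * m = 4 * (4 * m) by ring.
apply: (card); first exact: mulr_ge0.
by move=> l sl; apply: (card) => // k sk; exact: term.
Qed.

(** As [nu = w + w'] is a unit vector, [theta = w.w + w.w'] and [1 - theta = w'.w' + w.w'], so the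
    lower bound for the cross product gives both inequalities. *)
Lemma theta_bounds : - (32 * h * eps * g ^+ 2) <= theta <= 1 + 32 * h * eps * g ^+ 2.
Proof.
have c := cross; have e : 16 * (2 * h * eps * g ^+ 2) = 32 * h * eps * g ^+ 2 by ring.
have t1 : theta = dot w w + dot w w' by rewrite /theta {1}nuE dotDr.
have t2 : 1 - theta = dot w' w' + dot w w'.
  have e1 : dot nu nu = theta + dot w' nu by rewrite {1}nuE dotDl.
  have e2 : dot w' nu = dot w' w + dot w' w' by rewrite {1}nuE dotDr.
  by rewrite -nn e1 e2 (dotC w' w); ring.
have := dot_ge0 w; have := dot_ge0 w'; rewrite e in c; move: c t1 t2.
by move: (dot w w) (dot w w') (dot w' w') theta (32 * _) => *; apply/andP; split; lra.
Qed.

Let mu_ne : bp * mu = bm. Proof. by rewrite /mu mulrC divfK// gt_eqF. Qed.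

Definition nodal (p : piece (R := R)) k := if side k then aff p.1 (a k) else aff p.2 (a k).

Definition is_piece (p : piece (R := R)) :=
  (forall x, dot nu (x - xs) = 0 -> aff p.1 x = aff p.2 x) /\
  bp * dot p.1.1 nu = bm * dot p.2.1 nu.

(** The difference of the two pieces vanishes on the tangent plane, hence is a multiple of the
    signed distance, and the flux condition determines the factor. *)
Lemma piece_structure p : is_piece p -> p.1 = p.2 + ((mu - 1) * dot p.2.1 nu) *: dd.
Proof.
move=> [H1 H2]; set gam := (mu - 1) * _.
have gE : dot (p.1.1 - p.2.1) nu = gam.
  have : bp * dot p.1.1 nu = bp * (mu * dot p.2.1 nu) by rewrite mulrA mu_ne.
  by move/(mulfI (lt0r_neq0 bp0)) => E; rewrite dotBl E /gam; ring.
apply/eqP; rewrite -subr_eq0; apply/eqP; apply: (aff_vertices_eq0 ai) => k.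
set x := a k; pose x' := x - dot nu (x - xs) *: nu.
have x'0 : dot nu (x' - xs) = 0.
  have -> : x' - xs = (x - xs) - dot nu (x - xs) *: nu by rewrite /x' addrAC.
  by rewrite (dotBr _ (x - xs)) dotZr nn mulr1 subrr.
have := H1 x' x'0 => E.
have E' : aff (p.1 - p.2) x' = 0 by rewrite aff_sub E subrr.
rewrite aff_sub affD affZ ddE opprD addrA -aff_sub.
have -> : aff (p.1 - p.2) x = aff (p.1 - p.2) x' + dot nu (x - xs) * dot (p.1.1 - p.2.1) nu.
  by rewrite /x' /aff (dotBr _ _ (_ *: _)) dotZr /=; ring.
by rewrite E' gE; ring.
Qed.

Let W : affine (R := R) := \sum_k (if side k then d k else 0) *: lam k.

Let W1 : W.1 = w.
Proof.
rewrite /W grad_sum /w [RHS]big_mkcond /=; apply: eq_bigr => k _.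
by case: ifP => //= _; rewrite scale0r.
Qed.

Let WA k : aff W (a k) = if side k then d k else 0.
Proof.
rewrite /W aff_sum (bigD1 k)//= affZ lamE eqxx mulr1 big1 ?addr0// => l lk.
by rewrite affZ lamE (negbTE lk) mulr0.
Qed.

Hypothesis den : c0 <= 1 + (mu - 1) * theta.

(** By [piece_structure] the minus piece must be [Z - (mu - 1) psi W], with [Z] the Lagrange
    interpolant of the data and [psi] its own normal slope. Taking normal slopes gives
    [psi (1 + (mu - 1) theta) = dot Z.1 nu], which is solvable. *)
Lemma piece_exists (z : 'I_4 -> R) : exists p, is_piece p /\ forall k, nodal p k = z k.
Proof.
pose Z : affine (R := R) := \sum_k z k *: lam k.
have ZA k : aff Z (a k) = z k.
  rewrite /Z aff_sum (bigD1 k)//= affZ lamE eqxx mulr1 big1 ?addr0// => l lk.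
  by rewrite affZ lamE (negbTE lk) mulr0.
have dn : 1 + (mu - 1) * theta != 0 by rewrite gt_eqF// (lt_le_trans c00).
pose psi := dot Z.1 nu / (1 + (mu - 1) * theta).
pose pm : affine := Z - ((mu - 1) * psi) *: W.
pose pp : affine := pm + ((mu - 1) * psi) *: dd.
have pmn : dot pm.1 nu = psi.
  by rewrite /pm /= dotBl dotZl W1 -/theta /psi; field.
exists (pp, pm); split; [split|] => /=.
- by move=> x x0; rewrite /pp affD affZ ddE x0 mulr0 addr0.
- rewrite /pp /= dotDl dotZl nn mulr1 pmn.
  by transitivity (bp * mu * psi); [ring|rewrite mu_ne].
move=> k; rewrite /nodal /= /pp; case: ifP => sk.
  by rewrite affD affZ ddE /pm aff_sub affZ WA sk ZA; ring.
by rewrite /pm aff_sub affZ WA sk ZA mulr0 subr0.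
Qed.

(** The scalar equation of [piece_exists], read as a bound: [psi] is at most the slope of [Z] over
    [c0], and both pieces are [Z] corrected by [(mu - 1) psi] times functions of size [2 h]. *)
Lemma piece_stable p e : is_piece p -> 0 <= e -> (forall k, `|nodal p k| <= e) ->
  let m := `|mu - 1| * (4 * e * g / c0) in
  [/\ forall b, dot b b = 1 -> `|dot p.2.1 b| <= 4 * e * g + m * (8 * h * g),
      forall b, dot b b = 1 -> `|dot p.1.1 b| <= 4 * e * g + m * (8 * h * g) + m,
      forall x, (forall k, 0 <= aff (lam k) x) -> `|aff p.2 x| <= e + m * (2 * h) &
      forall x, (forall k, 0 <= aff (lam k) x) -> `|aff p.1 x| <= e + m * (2 * h) + m * (2 * h)].
Proof.
move=> pS e0 pe m.
pose Z : affine (R := R) := \sum_k nodal p k *: lam k.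
set psi := dot p.2.1 nu.
have p1E := piece_structure pS; rewrite -/psi in p1E.
have p2E : p.2 = Z - ((mu - 1) * psi) *: W.
  rewrite (aff_reconstruct ai lamE p.2) /Z /W scaler_sumr -sumrB; apply: eq_bigr => k _.
  rewrite scalerA -scalerBl; congr (_ *: _); rewrite /nodal; case: ifP => sk; last by rewrite mulr0 subr0.
  by rewrite p1E affD affZ ddE; ring.
have lb b k : dot b b = 1 -> `|dot (lam k).1 b| <= g.
  move=> bb; rewrite -ler_sqr ?nnegrE// (real_normK (num_real _)).
  by apply: le_trans (dot_CS _ _) _; rewrite bb mulr1.
have sum4 (F : 'I_4 -> R) (c : R) : (forall k, `|F k| <= c) -> `|\sum_k F k| <= 4 * c.
  move=> HF; apply: le_trans (ler_norm_sum _ _ _) _.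
  have -> : 4 * c = \sum_(k < 4) c by rewrite sum_const4.
  by apply: ler_sum.
have gsum (c : 'I_4 -> R) b : dot (\sum_k c k *: lam k).1 b = \sum_k c k * dot (lam k).1 b.
  by rewrite grad_sum dotC dot_sumr; apply: eq_bigr => k _; rewrite dotZr dotC.
have Zb b : dot b b = 1 -> `|dot Z.1 b| <= 4 * e * g.
  move=> bb; rewrite /Z gsum -mulrA; apply: sum4 => k.
  by rewrite normrM; apply: ler_pM => //; exact: lb.
have Wb b : dot b b = 1 -> `|dot W.1 b| <= 8 * h * g.
  move=> bb; rewrite /W gsum (_ : 8 * h * g = 4 * (2 * h * g)); last by ring.
  apply: sum4 => k; rewrite normrM; apply: ler_pM => //; last exact: lb.
  by case: ifP => // _; rewrite normr0 mulr_ge0// ltW.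
have psiE : psi * (1 + (mu - 1) * theta) = dot Z.1 nu.
  have : psi = dot Z.1 nu - (mu - 1) * psi * theta.
    by rewrite {1}/psi p2E /= dotBl dotZl W1.
  by move=> E; rewrite -[dot Z.1 nu](subrK ((mu - 1) * psi * theta)) -E; ring.
have psib : `|psi| <= 4 * e * g / c0.
  rewrite ler_pdivlMr//; apply: le_trans (Zb nu nn); rewrite -psiE normrM.
  by apply: ler_wpM2l => //; apply: le_trans den (ler_norm _).
have mb : `|(mu - 1) * psi| <= m by rewrite normrM ler_wpM2l.
have b2 b : dot b b = 1 -> `|dot p.2.1 b| <= 4 * e * g + m * (8 * h * g).
  move=> bb; rewrite p2E /= dotBl dotZl; apply: le_trans (ler_normB _ _) _.
  apply: lerD; first exact: Zb.
  by rewrite normrM; apply: ler_pM => //; exact: Wb.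
have vsum (c : 'I_4 -> R) x (C : R) : (forall k, 0 <= aff (lam k) x) -> (forall k, `|c k| <= C) ->
    `|aff (\sum_k c k *: lam k) x| <= C.
  move=> x0 cC; rewrite aff_sum; apply: le_trans (ler_norm_sum _ _ _) _.
  apply: (@le_trans _ _ (\sum_k C * aff (lam k) x)).
    by apply: ler_sum => k _; rewrite affZ normrM (ger0_norm (x0 k)) ler_wpM2r.
  by rewrite -mulr_sumr (bary_sum ai lamE) mulr1.
have v2 x : (forall k, 0 <= aff (lam k) x) -> `|aff p.2 x| <= e + m * (2 * h).
  move=> x0; rewrite p2E aff_sub affZ; apply: le_trans (ler_normB _ _) _.
  apply: lerD; first exact: vsum.
  rewrite normrM; apply: ler_pM => //; apply: vsum => // k.
  by case: ifP => // _; rewrite normr0 mulr_ge0// ltW.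
split=> // [b bb|x x0].
  rewrite p1E /= dotDl dotZl; apply: le_trans (ler_normD _ _) _; apply: lerD; first exact: b2.
  rewrite normrM -[leRHS]mulr1; apply: ler_pM => //.
  rewrite -ler_sqr ?nnegrE// (real_normK (num_real _)) expr1n.
  by apply: le_trans (dot_CS _ _) _; rewrite nn bb mulr1.
rewrite p1E affD affZ; apply: le_trans (ler_normD _ _) _; apply: lerD; first exact: v2.
rewrite normrM; apply: ler_pM => //.
by rewrite (aff_reconstruct ai lamE dd); apply: vsum => // k; rewrite ddE.
Qed.

End IFEAlgebra.

(** * Interface elements *)

Section Transmission.
Variable R : realType.
Implicit Types (G A B : set (pt3 R)) (n : pt3 R -> pt3 R) (p q : affine (R := R)).

Lemma dot_le_enorm (x y : pt3 R) : `|dot x y| <= enorm x * enorm y.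
Proof.
rewrite -ler_sqr ?nnegrE ?mulr_ge0 ?enorm_ge0// (real_normK (num_real _)) exprMn !enorm_sq.
exact: dot_CS.
Qed.

Lemma offset_sq (b nu : pt3 R) (h s : R) : dot b b = 1 -> dot nu nu = 1 -> dot nu b = 0 ->
  dot (h *: b + s *: nu) (h *: b + s *: nu) = h ^+ 2 + s ^+ 2.
Proof.
move=> bb nn nb; rewrite !(dotDl, dotDr, dotZl, dotZr) bb nn nb (dotC b) nb; ring.
Qed.

Lemma offset_alg (C h t : R) : 0 < C -> 0 < h -> 10 * C * h < 1 -> t = 2 * C * h ^+ 2 ->
  [/\ 0 < t, t <= h & C * (h ^+ 2 + t ^+ 2) < t].
Proof.
move=> C0 h0 hC ->; have Ch : 0 < C * h by exact: mulr_gt0.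
split; first by rewrite !mulr_gt0 ?exprn_gt0.
- by rewrite expr2 mulrA ler_piMl ?ltW//; lra.
- have -> : C * (h ^+ 2 + (2 * C * h ^+ 2) ^+ 2) = C * h * h * (1 + 4 * (C * h) ^+ 2) by ring.
  have -> : 2 * C * h ^+ 2 = C * h * h * 2 by ring.
  rewrite ltr_pM2l ?mulr_gt0//; have : (C * h) ^+ 2 < 1 / 10 by nra.
  lra.
Qed.

(** At the heights [2 C h^2] and [-2 C h^2] above [xs + h b] the points have left the two
    paraboloids and lie on opposite sides, so the segment between them meets [G]. *)
Lemma interface_offset G A B n r C xs b (h : R) : two_sided G A B n r C -> G xs ->
  dot b b = 1 -> dot (n xs) b = 0 -> 0 < h -> 4 * h < r -> 10 * C * h < 1 ->
  exists2 s : R, `|s| <= 2 * C * h ^+ 2 & G (xs + (h *: b + s *: n xs)).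
Proof.
move=> H Gs bb nb h0 hr hC.
have [[r0 C0 [oA oB]] [AB AG BG] cov nG _] := H; have [nn _] := nG xs Gs.
pose w (s : R) := h *: b + s *: n xs.
set t := 2 * C * h ^+ 2; have [t0 th tC] := offset_alg C0 h0 hC (erefl t).
have ww s : dot (w s) (w s) = h ^+ 2 + s ^+ 2 by exact: offset_sq.
have nw s : dot (n xs) (w s) = s by rewrite /w dotDr !dotZr nb nn; ring.
have wr (s : R) : `|s| <= t -> `|w s| < r.
  move=> st; apply: (@le_lt_trans _ _ (2 * h)); last by move: hr h0; clear; lra.
  apply: norm_le_dot; first by rewrite mulr_ge0// ltW.
  have : s ^+ 2 <= h ^+ 2.
    by rewrite -(real_normK (num_real s)) ler_sqr ?nnegrE ?(ltW h0)//; exact: le_trans th.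
  by rewrite ww exprMn; have := sqr_ge0 h; lra.
have Ap : A (xs + w t).
  by apply: (two_sided_in H) => //; rewrite ?wr ?gtr0_norm// ww nw.
have Bm : B (xs + w (- t)).
  apply: (two_sided_in (two_sided_sym H)) => //; first by rewrite wr// normrN gtr0_norm.
  by rewrite ww dotNl nw opprK sqrrN.
apply: contrapT => N.
have NG (s : R) : `|s| <= t -> ~ G (xs + w s) by move=> st Gx; apply: N; exists s.
have : A (xs + w (- t)).
  apply: (segment_side oA oB AB) Ap => u /andP[u0 u1].
  have -> : xs + w t + u *: (xs + w (- t) - (xs + w t)) = xs + w (t - 2 * u * t).
    by apply: pt3_eq; rewrite /= /GRing.scale/=; ring.
  have su : `|t - 2 * u * t| <= t.
    have a0 : 0 <= u * t by rewrite mulr_ge0// ltW.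
    have a1 : u * t <= t by rewrite ler_piMl// ltW.
    by rewrite ler_norml; apply/andP; split; lra.
  have xr : `|xs + w (t - 2 * u * t) - xs| < r by rewrite addrAC subrr add0r wr.
  have [||] := cov _ _ Gs xr.
  - by move/(NG _ su).
  - by left.
  - by right.
by move=> Am; have : (A `&` B) (xs + w (- t)) by []; rewrite AB.
Qed.

(** The tangential slope is read off two points of [G], namely [xs] and the one at offset about
    [h b]; the height of the latter above the tangent plane costs the second term. *)
Lemma tangential_bound G A B n r C xs b (h m : R) q : two_sided G A B n r C -> G xs ->
  dot b b = 1 -> dot (n xs) b = 0 -> 0 < h -> 4 * h < r -> 10 * C * h < 1 ->
  (forall x, G x -> `|x - xs| <= 3 * h -> `|aff q x| <= m) ->
  `|dot q.1 b| * h <= 2 * m + 2 * C * (h ^+ 2 * `|dot q.1 (n xs)|).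
Proof.
move=> H Gs bb nb h0 hr hC Hq; have [s sb Gx] := interface_offset H Gs bb nb h0 hr hC.
have [[r0 C0 _] _ _ nG _] := H; have [nn _] := nG xs Gs.
set w := h *: b + s *: n xs in Gx.
have [t0 th _] := offset_alg C0 h0 hC (erefl _).
have w3 : `|w| <= 3 * h.
  apply: norm_le_dot; first by rewrite mulr_ge0// ltW.
  have : s ^+ 2 <= h ^+ 2.
    by rewrite -(real_normK (num_real s)) ler_sqr ?nnegrE ?(ltW h0)//; exact: le_trans th.
  by rewrite /w offset_sq// exprMn; have := sqr_ge0 h; lra.
have h1 : `|aff q (xs + w)| <= m by apply: Hq => //; rewrite addrAC subrr add0r.
have h2 : `|aff q xs| <= m by apply: Hq => //; rewrite subrr normr0 mulr_ge0// ltW.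
have E : h * dot q.1 b = aff q (xs + w) - aff q xs - s * dot q.1 (n xs).
  by rewrite affB (addrAC xs w) subrr add0r /w dotDr !dotZr; ring.
rewrite mulrC -{1}(gtr0_norm h0) -normrM E.
apply: le_trans (ler_normB _ _) _; apply: lerD.
  by apply: le_trans (ler_normB _ _) _; lra.
by rewrite normrM mulrA ler_wpM2r.
Qed.

Lemma affine_growth (u nu : pt3 R) (h M1 M2 : R) : dot nu nu = 1 -> 0 <= h -> 0 <= M2 ->
  `|dot u nu| * h <= M1 -> (forall b, dot b b = 1 -> dot nu b = 0 -> `|dot u b| * h <= M2) ->
  forall y, `|dot u y| * h <= (M1 + M2) * enorm y.
Proof.
move=> nn h0 M20 H1 H2 y; set al := dot u nu in H1; pose t := u - al *: nu.
have nt : dot nu t = 0 by rewrite /t dotBr dotZr nn (dotC nu) -/al mulr1 subrr.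
have uE : u = al *: nu + t by rewrite /t addrC subrK.
have tt : enorm t * h <= M2.
  have [E|tn] := eqVneq (enorm t) 0; first by rewrite E mul0r.
  have tp : 0 < enorm t by rewrite lt_def tn enorm_ge0.
  have tE : dot t t = enorm t * enorm t by rewrite -enorm_sq.
  have ut : dot u t = enorm t * enorm t by rewrite {1}uE dotDl dotZl nt mulr0 add0r.
  have := H2 ((enorm t)^-1 *: t); rewrite !dotZr dotZl nt mulr0 ut tE.
  by rewrite mulKf// mulVf// (gtr0_norm tp); apply.
have en : enorm nu = 1 by rewrite /enorm nn sqrtr1.
have y0 := enorm_ge0 y.
have h1 : `|al * dot nu y| * h <= M1 * enorm y.
  have := dot_le_enorm nu y; rewrite en mul1r normrM => nb.
  by rewrite mulrAC; apply: ler_pM => //; rewrite mulr_ge0.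
have h2 : `|dot t y| * h <= M2 * enorm y.
  apply: le_trans (ler_wpM2r h0 (dot_le_enorm t y)) _.
  by rewrite mulrAC ler_wpM2r.
rewrite uE dotDl dotZl [leRHS]mulrDl; apply: le_trans (lerD h1 h2).
by rewrite -mulrDl ler_wpM2r// ler_normD.
Qed.

Lemma is_pieceB (nu xs : pt3 R) (bp bm : R) (p q : piece (R := R)) :
  is_piece nu xs bp bm p -> is_piece nu xs bp bm q ->
  is_piece nu xs bp bm (p.1 - q.1, p.2 - q.2).
Proof.
move=> [p1 p2] [q1 q2]; split => [x x0|] /=; first by rewrite !aff_sub p1// q1.
by rewrite !(dotBl nu) !mulrBr p2 q2.
Qed.

(** [q] is the plus piece that matches [pm] exactly, and remains close to [pp]: in the normal
    direction the difference of slopes is the flux jump divided by [bp], and in tangential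
    directions both pieces approximate the same values of [v] on [G]. *)
Lemma transmission G A B n r C xs (pp pm : affine (R := R)) (v : pt3 R -> R) (bp bm h K e : R) :
  two_sided G A B n r C -> G xs -> 0 < bp -> 0 <= K -> 0 <= e ->
  0 < h -> 4 * h < r -> 10 * C * h < 1 ->
  (forall x, G x -> `|x - xs| <= 3 * h -> `|v x - aff pp x| <= K * e) ->
  (forall x, G x -> `|x - xs| <= 3 * h -> `|v x - aff pm x| <= K * e) ->
  l1norm pp.1 * h ^+ 2 <= K * e -> l1norm pm.1 * h ^+ 2 <= K * e ->
  `|bp * dot pp.1 (n xs) - bm * dot pm.1 (n xs)| * h <= K * e ->
  let M := K / bp + (4 * K + 4 * C * K) in
  exists q : affine, [/\ is_piece (n xs) xs bp bm (q, pm),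
    forall y, `|dot (pp - q).1 y| * h <= M * e * enorm y &
    forall x, `|x - xs| <= 3 * h -> `|aff (pp - q) x| <= (2 * K + 6 * M) * e].
Proof.
move=> H Gs bp0 K0 e0 h0 hr hC Hp Hm lp lm flux M.
have [[r0 C0 _] _ _ nG _] := H; have [nn _] := nG xs Gs.
set nu := n xs in flux nn *; set mu := bm / bp.
have bmu : bp * mu = bm by rewrite /mu mulrC divfK// gt_eqF.
pose dd : affine (R := R) := (nu, - dot nu xs).
have ddE x : aff dd x = dot nu (x - xs) by rewrite /aff /dd /= dotBr.
(* The factor found in [piece_structure]. *)
pose c := (mu - 1) * dot pm.1 nu.
exists (pm + c *: dd); set q := pm + c *: dd.
have qE x : aff (pp - q) x = aff (pp - pm) x - c * dot nu (x - xs).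
  by rewrite !aff_sub /q affD affZ ddE; ring.
have q1E : (pp - q).1 = (pp - pm).1 - c *: nu by rewrite /= opprD addrA.
have small x : G x -> `|x - xs| <= 3 * h -> `|aff (pp - pm) x| <= 2 * (K * e).
  move=> Gx xh; have -> : aff (pp - pm) x = (v x - aff pm x) - (v x - aff pp x) by rewrite aff_sub; ring.
  by apply: le_trans (ler_normB _ _) _; have := Hp x Gx xh; have := Hm x Gx xh; lra.
have lb (p : affine (R := R)) : l1norm p.1 * h ^+ 2 <= K * e -> h ^+ 2 * `|dot p.1 nu| <= K * e.
  move=> lp1; apply: le_trans lp1; rewrite mulrC ler_wpM2r ?sqr_ge0//.
  apply: le_trans (dot_le_l1norm _ _) _; rewrite ler_piMr ?l1norm_ge0//.
  by apply: norm_le_dot => //; rewrite nn expr1n.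
have nb : h ^+ 2 * `|dot (pp - pm).1 nu| <= 2 * (K * e).
  rewrite dotBl; apply: (@le_trans _ _ (h ^+ 2 * (`|dot pp.1 nu| + `|dot pm.1 nu|))).
    by rewrite ler_wpM2l ?sqr_ge0// ler_normB.
  by rewrite mulrDr; have := lb _ lp; have := lb _ lm; lra.
have growth y : `|dot (pp - q).1 y| * h <= M * e * enorm y.
  have -> : M * e = K / bp * e + (4 * K + 4 * C * K) * e by rewrite /M; ring.
  apply: (affine_growth nn (ltW h0)).
  - by rewrite mulr_ge0// addr_ge0// !mulr_ge0// ltW.
  - have -> : dot (pp - q).1 nu = (bp * dot pp.1 nu - bm * dot pm.1 nu) / bp.
      by rewrite q1E (dotBl nu (pp - pm).1) dotZl nn /= dotBl /c /mu; field; rewrite gt_eqF.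
    rewrite normrM normfV (gtr0_norm bp0) mulrAC [leRHS]mulrAC ler_wpM2r// ?invr_ge0; exact: ltW.
  move=> b bb nub; rewrite q1E (dotBl b (pp - pm).1) dotZl nub mulr0 subr0.
  apply: le_trans (tangential_bound H Gs bb nub h0 hr hC small) _.
  have -> : (4 * K + 4 * C * K) * e = 2 * (2 * (K * e)) + 2 * C * (2 * (K * e)) by ring.
  by rewrite lerD2l ler_wpM2l// mulr_ge0// ltW.
split => //.
  split => /=; first by move=> x x0; rewrite /q affD affZ ddE x0 mulr0 addr0.
  rewrite dotDl dotZl nn mulr1 /c; transitivity (bp * mu * dot pm.1 nu); [ring|by rewrite bmu].
move=> x xh.
have -> : aff (pp - q) x = aff (pp - q) xs + dot (pp - q).1 (x - xs) by rewrite -affB [RHS]addrC subrK.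
have M0 : 0 <= M * e.
  by rewrite mulr_ge0// /M !addr_ge0 ?mulr_ge0 ?invr_ge0//; apply: ltW.
have b1 : `|aff (pp - q) xs| <= 2 * (K * e).
  by rewrite qE subrr dot0r mulr0 subr0; apply: small => //; rewrite subrr normr0 mulr_ge0// ltW.
have b2 : `|dot (pp - q).1 (x - xs)| <= 6 * (M * e).
  rewrite -(ler_pM2r h0); apply: le_trans (growth _) _.
  rewrite [leRHS]mulrAC [leRHS]mulrC ler_wpM2l//.
  by apply: le_trans (enorm_le_norm _) _; move: xh; clear; lra.
apply: le_trans (ler_normD _ _) _; apply: le_trans (lerD b1 b2) _.
by rewrite [leRHS]mulrDl !mulrA.
Qed.

Lemma piece_stability (a : 'I_4 -> pt3 R) (lam : 'I_4 -> affine (R := R)) nu xs side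
    (h kap bp bm c0 e : R) (p : piece (R := R)) :
  affinely_independent a -> (forall k l, aff (lam k) (a l) = (k == l)%:R) ->
  dot nu nu = 1 -> 0 < h -> 0 < kap -> 0 < bp -> 0 < c0 -> 0 <= e ->
  (forall k, `|dot nu (a k - xs)| <= 2 * h) ->
  (forall k, dot (lam k).1 (lam k).1 <= ((kap * h)^-1) ^+ 2) ->
  c0 <= 1 + (bm / bp - 1) * dot (\sum_(k | side k) dot nu (a k - xs) *: (lam k).1) nu ->
  is_piece nu xs bp bm p -> (forall k, `|nodal a side p k| <= e) ->
  let t := `|bm / bp - 1| * (4 * kap^-1 / c0) in
  let N := 1 + 4 * t + 4 * kap^-1 + 8 * kap^-1 * t + t in
  (forall b, dot b b = 1 -> `|dot p.1.1 b| * h <= N * e /\ `|dot p.2.1 b| * h <= N * e) /\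
  (forall x, (forall k, 0 <= aff (lam k) x) -> `|aff p.1 x| <= N * e /\ `|aff p.2 x| <= N * e).
Proof.
move=> ai lamE nn h0 kap0 bp0 c00 e0 dh gb den pP pe t N.
have g0 : 0 <= (kap * h)^-1 by rewrite invr_ge0 mulr_ge0// ltW.
have [/=] := piece_stable ai lamE nn h0 g0 bp0 c00 dh gb den pP e0 pe.
set m := `|bm / bp - 1| * _ => H1 H2 H3 H4.
have k0 : 0 <= kap^-1 by rewrite invr_ge0 ltW.
have t0 : 0 <= t * e by rewrite !mulr_ge0// ?invr_ge0 ltW.
have mh : m * h = t * e.
  by rewrite /m /t; field; rewrite !gt_eqF.
have gh : (kap * h)^-1 * h = kap^-1 by field; rewrite !gt_eqF.
have ke : 0 <= kap^-1 * e by rewrite mulr_ge0.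
have kt : 0 <= kap^-1 * (t * e) by rewrite mulr_ge0.
have NE : N * e = e + 4 * (t * e) + 4 * (kap^-1 * e) + 8 * (kap^-1 * (t * e)) + t * e by rewrite /N; ring.
split=> [b bb|x x0].
  have b2 : `|dot p.2.1 b| * h <= 4 * (kap^-1 * e) + 8 * (kap^-1 * (t * e)).
    apply: le_trans (ler_wpM2r (ltW h0) (H1 b bb)) _.
    have -> : (4 * e * (kap * h)^-1 + m * (8 * h * (kap * h)^-1)) * h =
      4 * (((kap * h)^-1 * h) * e) + 8 * (((kap * h)^-1 * h) * (m * h)) by ring.
    by rewrite gh mh.
  have b1 : `|dot p.1.1 b| * h <= 4 * (kap^-1 * e) + 8 * (kap^-1 * (t * e)) + t * e.
    apply: le_trans (ler_wpM2r (ltW h0) (H2 b bb)) _.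
    have -> : (4 * e * (kap * h)^-1 + m * (8 * h * (kap * h)^-1) + m) * h =
      4 * (((kap * h)^-1 * h) * e) + 8 * (((kap * h)^-1 * h) * (m * h)) + m * h by ring.
    by rewrite gh mh.
  by rewrite NE; move: b1 b2 e0 t0 ke kt; clear; split; lra.
have v2 : `|aff p.2 x| <= e + 2 * (t * e) by rewrite -mh; apply: le_trans (H3 x x0) _; rewrite mulrCA.
have v1 : `|aff p.1 x| <= e + 2 * (t * e) + 2 * (t * e).
  by rewrite -mh; apply: le_trans (H4 x x0) _; rewrite [2 * (m * h)]mulrCA.
by rewrite NE; move: v1 v2 e0 t0 ke kt; clear; split; lra.
Qed.

Lemma N2_bounded (U : set (pt3 R)) (f : pt3 R -> R) (m V : R) : measurable U -> measurable_fun U f ->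
  (forall x, U x -> `|f x| <= m) -> (mu3 U <= V%:E)%E -> (N2 U f <= (m ^+ 2 * V)%:E)%E.
Proof.
move=> mU mf fm UV.
apply: (@le_trans _ _ (\int3_(x in U) (m ^+ 2)%:E)%E); last first.
  by rewrite integral_cst//; apply: lee_EFinM => //; exact: sqr_ge0.
apply: ge0_le_integral => //.
- by move=> x _; rewrite lee_fin sqr_ge0.
- exact: measurable_sq.
- move=> x Ux; rewrite lee_fin -(real_normK (num_real (f x))).
  by rewrite lerXn2r ?nnegrE ?(le_trans _ (fm x Ux))// fm.
Qed.

Lemma N2_perturb (U : set (pt3 R)) (f g : pt3 R -> R) (X m V : R) : measurable U ->
  measurable_fun U f -> measurable_fun U g -> (N2 U f <= X%:E)%E ->
  (forall x, U x -> `|g x - f x| <= m) -> (mu3 U <= V%:E)%E ->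
  (N2 U g <= (2 * X + 2 * (m ^+ 2 * V))%:E)%E.
Proof.
move=> mU mf mg Hf Hm UV.
have mgf : measurable_fun U (fun x => g x - f x) by exact: measurable_funB.
have -> : N2 U g = N2 U (fun x => f x + (g x - f x)).
  by apply: N2_eq => x _; rewrite addrC subrK.
apply: le_trans (N2D mU mf mgf) _; rewrite [leRHS]EFinD.
by apply: leeD; apply: lee_EFinM => //; exact: N2_bounded.
Qed.

End Transmission.

Section InterfaceElement.
Variable R : realType.
Implicit Types (G Op Om A T : set (pt3 R)) (n : pt3 R -> pt3 R).

Lemma dot_basis3 (i : 'I_3) : dot (basis3 i) (basis3 i) = 1 :> R.
Proof. by move: i; apply: ord3P; rewrite /dot /basis3 /= !(mulr0, mulr1, addr0, add0r). Qed.

Definition plus_side G Om (s : bool) (x : pt3 R) := ~~ (`[< Om x >] || (`[< G x >] && ~~ s)).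

Lemma nodal_valueE G Om s (a : 'I_4 -> pt3 R) (p : piece (R := R)) k :
  nodal_value G Om s p (a k) = nodal a (fun k => plus_side G Om s (a k)) p k.
Proof. by rewrite /nodal_value /nodal /plus_side; case: (_ || _). Qed.

Lemma plus_sideP G Op Om n r C s xs x : two_sided G Op Om n r C -> G xs -> `|x - xs| < r ->
  if plus_side G Om s x then (Op x \/ G x) /\ ~ Om x else (Om x \/ G x) /\ ~ Op x.
Proof.
move=> [_ [AB AG BG] cov _ _] Gs xr; rewrite /plus_side.
have xor P Q : P `&` Q = set0 -> P x -> ~ Q x.
  by move=> PQ Px Qx; have : (P `&` Q) x by []; rewrite PQ.
case: asboolP => [mx|nmx] /=.
  by split; [left|move/(xor _ _ AB); apply].
case: asboolP => [gx|ngx] /=.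
  by case: s => /=; split=> //; [right|right|move/(xor _ _ AG)].
have [/ngx//|ox|/nmx//] := cov xs x Gs xr.
by split; [left|].
Qed.

(** For [theta] in [[0, 1]] the denominator lies between 1 and [mu]; half of their minimum leaves
    room for the perturbation [d]. *)
Lemma denominator_bound (mu theta d c0 : R) : 0 < mu -> 0 <= d -> - d <= theta <= 1 + d ->
  c0 = Num.min 1 mu / 2 -> d * (1 + mu) <= c0 -> c0 <= 1 + (mu - 1) * theta.
Proof.
move=> mu0 d0 /andP[t1 t2] -> hd.
have md : 0 <= mu * d by rewrite mulr_ge0// ltW.
have [m1|m1] := leP 1 mu.
  rewrite min_l// in hd.
  have : (mu - 1) * - d <= (mu - 1) * theta by rewrite ler_wpM2l// subr_ge0.
  lra.
rewrite min_r ?(ltW m1)// in hd.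
have : (1 - mu) * theta <= (1 - mu) * (1 + d) by rewrite ler_wpM2l// subr_ge0 ltW.
lra.
Qed.

Lemma interface_denominator G Op Om n r C s (a : 'I_4 -> pt3 R) (lam : 'I_4 -> affine (R := R)) xs
    (h kap mu c0 : R) :
  two_sided G Op Om n r C -> G xs -> 0 < h -> h < r -> 0 < kap -> 0 < mu ->
  affinely_independent a -> (forall k l, aff (lam k) (a l) = (k == l)%:R) ->
  (forall k, `|a k - xs| <= h) ->
  (forall k, dot (lam k).1 (lam k).1 <= ((kap * h)^-1) ^+ 2) ->
  (forall k l, k != l -> dot (lam k).1 (lam l).1 <= 0) ->
  c0 = Num.min 1 mu / 2 -> 96 * C * h / kap ^+ 2 * (1 + mu) <= c0 ->
  (forall k, `|dot (n xs) (a k - xs)| <= 2 * h) /\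
  c0 <= 1 + (mu - 1) *
    dot (\sum_(k | plus_side G Om s (a k)) dot (n xs) (a k - xs) *: (lam k).1) (n xs).
Proof.
move=> H Gs h0 hr kap0 mu0 ai lamE ah gb no c0E hd.
have [[r0 C0 _] _ _ nG _] := H; have [nn _] := nG xs Gs.
have dh k : `|dot (n xs) (a k - xs)| <= 2 * h.
  by apply: le_trans (unit_dot_le _ nn) _; rewrite ler_wpM2l.
(* The height by which a vertex can lie on the wrong side of the tangent plane; the 3 compares the
   squares of Euclidean and sup norm. *)
split=> //; pose eps := C * (3 * h ^+ 2).
have eps0 : 0 <= eps by rewrite !mulr_ge0 ?sqr_ge0// ltW.
have g0 : 0 <= (kap * h)^-1 by rewrite invr_ge0 mulr_ge0// ltW.
have ar k : `|a k - xs| < r by exact: le_lt_trans hr.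
have aE k : a k = xs + (a k - xs) by rewrite addrC subrK.
have ce k : C * dot (a k - xs) (a k - xs) <= eps.
  rewrite ler_pM2l//; apply: le_trans (dot_le3 _) _; rewrite ler_wpM2l//.
  by rewrite ler_sqr ?nnegrE// ltW.
have dp k : plus_side G Om s (a k) -> - eps <= dot (n xs) (a k - xs).
  move=> sk; have := plus_sideP s H Gs (ar k); rewrite sk => -[_ nO].
  apply: le_trans (_ : - (C * dot (a k - xs) (a k - xs)) <= _); first by rewrite lerN2.
  by apply: (two_sided_not H) => //; rewrite -aE.
have dm k : ~~ plus_side G Om s (a k) -> dot (n xs) (a k - xs) <= eps.
  move=> sk; have := plus_sideP s H Gs (ar k); rewrite (negbTE sk) => -[_ nO].
  apply: le_trans (ce k); rewrite -lerN2 -dotNl.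
  by apply: (two_sided_not (two_sided_sym H)) => //; rewrite -aE.
have := theta_bounds ai lamE nn h0 g0 eps0 dh dp dm gb no.
have -> : 32 * h * eps * (kap * h)^-1 ^+ 2 = 96 * C * h / kap ^+ 2.
  by rewrite /eps; field; rewrite !gt_eqF.
move=> tb; apply: (denominator_bound mu0 _ tb c0E hd).
by rewrite divr_ge0 ?sqr_ge0// !mulr_ge0// ltW.
Qed.

(** Passes from the approximation [q] to the interpolant piece [p]. Their difference is affine,
    hence bounded pointwise, and only the volume of a cube of radius [2 h] around the element,
    [64 h^3], is used, however thin its part in [A] is. *)
Lemma element_side A T xs (h e E K0 M : R) (v : pt3 R -> R) (g : 'I_3 -> pt3 R -> R) (q p : affine (R := R)) :
  open A -> open T -> 0 < h -> T `<=` ball xs (2 * h) -> e ^+ 2 = h * E ->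
  measurable_fun A v -> (forall i, measurable_fun A (g i)) ->
  (N2 (A `&` ball xs (3 * h)) (fun x => v x - aff q x)%R <= (K0 * h ^+ 4 * E)%:E)%E ->
  (forall i, N2 (A `&` ball xs (3 * h)) (fun x => g i x - dot q.1 (basis3 i))%R <= (K0 * h ^+ 2 * E)%:E)%E ->
  (forall x, T x -> `|aff (q - p) x| <= M * e) ->
  (forall b, dot b b = 1 -> `|dot (q - p).1 b| * h <= M * e) ->
  (N2 (T `&` A) (fun x => v x - aff p x)%R <= ((2 * K0 + 128 * M ^+ 2) * h ^+ 4 * E)%:E)%E /\
  forall i, (N2 (T `&` A) (fun x => g i x - dot p.1 (basis3 i))%R <=
    ((2 * K0 + 128 * M ^+ 2) * h ^+ 2 * E)%:E)%E.
Proof.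
move=> oA oT h0 Tb eE mv mg H1 H2 D1 D2.
have mA := open_measurable3 oA; have mT := open_measurable3 oT.
have mTA : measurable (T `&` A) by exact: measurableI.
have mAb : measurable (A `&` ball xs (3 * h)) by apply: measurableI => //; exact: measurable_ball3.
have sub : T `&` A `<=` A `&` ball xs (3 * h).
  by move=> x [Tx Ax]; split=> //; apply: (@le_ball _ _ xs (2 * h)); [move: h0; clear; lra|exact: Tb].
have V : (mu3 (T `&` A) <= (64 * h ^+ 3)%:E)%E.
  apply: (@le_trans _ _ (mu3 (ball xs (2 * h)))).
    by apply: le_measure; rewrite ?inE//; [exact: measurable_ball3|move=> x [/Tb]].
  have h2 : 0 <= 2 * h by rewrite mulr_ge0// ltW.
  by rewrite mu3_ball// lee_fin -mulr_natl; rewrite [leLHS](_ : _ = 64 * h ^+ 3)//; ring.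
have mTv : measurable_fun (T `&` A) v by apply: (measurable_funS mA) => // x [].
have mTg i : measurable_fun (T `&` A) (g i) by apply: (measurable_funS mA) => // x [].
split=> [|i].
  apply: le_trans (N2_perturb (f := fun x => v x - aff q x) (X := K0 * h ^+ 4 * E) (m := M * e) mTA _ _ _ _ V) _ => //.
  - by apply: measurable_funB => //; exact: measurable_aff.
  - by apply: measurable_funB => //; exact: measurable_aff.
  - apply: le_trans H1; apply: N2_sub => //; apply: measurable_funB; last exact: measurable_aff.
    by apply: (measurable_funS mA) => // x [].
  - move=> x [Tx _]; have -> : v x - aff p x - (v x - aff q x) = aff (q - p) x by rewrite aff_sub; ring.
    exact: D1.
  - rewrite lee_fin exprMn eE le_eqVlt; apply/orP; left; apply/eqP; ring.
apply: le_trans (N2_perturb (f := fun x => g i x - dot q.1 (basis3 i)) (X := K0 * h ^+ 2 * E) (m := M * e / h) mTA _ _ _ _ V) _ => //.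
- exact: measurable_funB.
- exact: measurable_funB.
- apply: le_trans (H2 i); apply: N2_sub => //; apply: measurable_funB => //.
  by apply: (measurable_funS mA) => // x [].
- move=> x _.
  have -> : g i x - dot p.1 (basis3 i) - (g i x - dot q.1 (basis3 i)) = dot (q - p).1 (basis3 i).
    by rewrite /= dotBl; ring.
  rewrite ler_pdivlMr//; apply: D2.
  by rewrite dot_basis3.
- rewrite lee_fin !exprMn exprVn eE le_eqVlt; apply/orP; left; apply/eqP.
  by field; rewrite gt_eqF.
Qed.

Lemma sqrt_bound (c k z X : R) : 0 <= c -> c <= k -> 0 <= z -> X ^+ 2 <= c * z ->
  `|X| <= Num.sqrt k * Num.sqrt z.
Proof.
move=> c0 ck z0 hX; have k0 : 0 <= k by exact: le_trans ck.
rewrite -sqrtrM// -sqrtr_sqr ler_sqrt ?mulr_ge0//.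
by apply: le_trans hX _; rewrite ler_wpM2r.
Qed.

Lemma dot_le_l1norm_sq (w : pt3 R) : dot w w <= l1norm w ^+ 2.
Proof.
rewrite /dot /l1norm -!expr2 -(real_normK (num_real w.1.1)) -(real_normK (num_real w.1.2)) -(real_normK (num_real w.2)).
have := normr_ge0 w.1.1; have := normr_ge0 w.1.2; have := normr_ge0 w.2.
move: `|_| `|_| `|_| => x y z x0 y0 z0.
have := mulr_ge0 x0 y0; have := mulr_ge0 x0 z0; have := mulr_ge0 y0 z0; nra.
Qed.

(** The variation of the normal contributes [h^4] times the squared gradients. These are
    [O(E / h^3)] provided [E] also bounds the first derivatives, so the contribution is [O(h E)]
    like the rest. *)
Lemma flux_cst (bp bm C h E K0 Cp Cm lp lm : R) : 0 < h -> h <= 1 -> 0 <= E -> 0 < K0 ->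
  Cp <= lp -> Cm <= lm -> lp * h ^+ 3 <= K0 * (E + h ^+ 2 * E) -> lm * h ^+ 3 <= K0 * (E + h ^+ 2 * E) ->
  60 * (bp ^+ 2 + bm ^+ 2) * (8 / h * (K0 * h ^+ 2 * E) + 4 * h * E) +
    5 * (bp ^+ 2 * Cp + bm ^+ 2 * Cm) * (40 * C * h) ^+ 2 * h ^+ 2 <=
  (bp ^+ 2 + bm ^+ 2) * (480 * K0 + 240 + 10 * K0 * (40 * C) ^+ 2) * (h * E).
Proof.
move=> h0 h1 E0 K00 Cp1 Cm1 Hp Hm.
have hE : h ^+ 2 * E <= E by rewrite ler_piMl// expr_le1// ltW.
have h3 : 0 <= h ^+ 3 by rewrite exprn_ge0// ltW.
have up : Cp * h ^+ 3 <= 2 * K0 * E.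
  apply: le_trans (ler_wpM2r h3 Cp1) _; apply: le_trans Hp _.
  by rewrite [2 * K0]mulrC -[leRHS]mulrA ler_pM2l//; move: hE; clear; lra.
have um : Cm * h ^+ 3 <= 2 * K0 * E.
  apply: le_trans (ler_wpM2r h3 Cm1) _; apply: le_trans Hm _.
  by rewrite [2 * K0]mulrC -[leRHS]mulrA ler_pM2l//; move: hE; clear; lra.
have -> : 60 * (bp ^+ 2 + bm ^+ 2) * (8 / h * (K0 * h ^+ 2 * E) + 4 * h * E) =
  (bp ^+ 2 + bm ^+ 2) * (480 * K0 + 240) * (h * E) by field; rewrite gt_eqF.
have -> : 5 * (bp ^+ 2 * Cp + bm ^+ 2 * Cm) * (40 * C * h) ^+ 2 * h ^+ 2 =
  5 * (40 * C) ^+ 2 * h * (bp ^+ 2 * (Cp * h ^+ 3) + bm ^+ 2 * (Cm * h ^+ 3)) by ring.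
have -> : (bp ^+ 2 + bm ^+ 2) * (480 * K0 + 240 + 10 * K0 * (40 * C) ^+ 2) * (h * E) =
  (bp ^+ 2 + bm ^+ 2) * (480 * K0 + 240) * (h * E) +
  5 * (40 * C) ^+ 2 * h * (bp ^+ 2 * (2 * K0 * E) + bm ^+ 2 * (2 * K0 * E)) by ring.
rewrite lerD2l; apply: ler_wpM2l.
  by apply: mulr_ge0; [rewrite mulr_ge0 ?sqr_ge0|exact: ltW].
by apply: lerD; apply: ler_wpM2l => //; exact: sqr_ge0.
Qed.

Lemma small_step (C kap mu : R) : 0 < C -> 0 < kap -> 0 < mu ->
  exists2 h1 : R, 0 < h1 & forall h, 0 < h -> h <= h1 ->
    [/\ h <= 1, 10 ^+ 5 * C * h < 1 & 96 * C * h / kap ^+ 2 * (1 + mu) <= Num.min 1 mu / 2].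
Proof.
move=> C0 kap0 mu0; pose c0 := Num.min 1 mu / 2; pose D := 96 * C / kap ^+ 2 * (1 + mu).
have c00 : 0 < c0 by rewrite divr_gt0// lt_min ltr01.
have D0 : 0 < D by rewrite mulr_gt0 ?divr_gt0 ?exprn_gt0 ?mulr_gt0// addr_gt0.
have T0 : 0 < 10 ^+ 5 * C by rewrite mulr_gt0// exprn_gt0.
exists (Num.min 1 (Num.min ((10 ^+ 5 * C)^-1 / 2) (c0 / D))).
  by rewrite !lt_min ltr01 (divr_gt0 c00 D0) andbT divr_gt0// invr_gt0.
move=> h h0; rewrite !le_min => /and3P[h1 h2 h3]; split=> //.
  apply: (@le_lt_trans _ _ (10 ^+ 5 * C * ((10 ^+ 5 * C)^-1 / 2))); first by rewrite ler_pM2l.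
  by rewrite mulrA divff ?gt_eqF//; clear; lra.
have -> : 96 * C * h / kap ^+ 2 * (1 + mu) = h * D by rewrite /D; ring.
by rewrite -ler_pdivlMr.
Qed.

(** The interpolant [p] minus the shape function [(q, pm)] near the two approximations is again a
    shape function, and its nodal values are approximation errors of [v] at the vertices. Stability
    bounds it, and the triangle inequality through [pp] and [pm] concludes. *)
Lemma interface_estimate (bp bm C kap : R) : 0 < bp -> 0 < bm -> 0 < C -> 0 < kap ->
  exists2 K : R, 0 < K & forall G Op Om n r s (a : 'I_4 -> pt3 R) (lam : 'I_4 -> affine (R := R)) xs h
    v (gp gm : 'I_3 -> pt3 R -> R) ggp ggm tp tm (E : R) (p : piece (R := R)),
  two_sided G Op Om n r C -> G xs -> 0 < h -> 400 * h < r ->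
  [/\ h <= 1, 10 ^+ 5 * C * h < 1 & 96 * C * h / kap ^+ 2 * (1 + bm / bp) <= Num.min 1 (bm / bp) / 2] ->
  [/\ exists M : R, Op `<=` ball 0 M, exists M : R, Om `<=` ball 0 M,
      (@mu3 R Op < +oo)%E & (@mu3 R Om < +oo)%E] ->
  affinely_independent a -> (forall k l, aff (lam k) (a l) = (k == l)%:R) ->
  (forall x, closure (tet a) x -> `|x - xs| <= h) ->
  (forall k, dot (lam k).1 (lam k).1 <= ((kap * h)^-1) ^+ 2) ->
  (forall k l, k != l -> dot (lam k).1 (lam l).1 <= 0) ->
  H2data Op v gp ggp -> H2data Om v gm ggm ->
  (forall i, is_trace Op G (gp i) (tp i)) -> (forall i, is_trace Om G (gm i) (tm i)) ->
  surf_int G (fun x => (bp * (\sum_i tp i x * dot (basis3 i) (n x)) -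
                        bm * (\sum_i tm i x * dot (basis3 i) (n x))) ^+ 2) = 0%E ->
  let Wp := Op `&` ball xs (21 * h) in let Wm := Om `&` ball xs (21 * h) in
  (\sum_i \sum_j N2 Wp (ggp i j) <= E%:E)%E -> (\sum_i \sum_j N2 Wm (ggm i j) <= E%:E)%E ->
  (\sum_i N2 Wp (gp i) <= E%:E)%E -> (\sum_i N2 Wm (gm i) <= E%:E)%E ->
  (forall x, Op x \/ Om x \/ G x -> forall e : R, 0 < e ->
     exists2 d : R, 0 < d & forall y, Op y \/ Om y -> `|y - x| < d -> `|v y - v x| < e) ->
  in_Sh n bp bm xs p -> (forall k, nodal_value G Om s p (a k) = v (a k)) ->
  [/\ (N2 (tet a `&` Op) (fun x => v x - aff p.1 x)%R <= (K * h ^+ 4 * E)%:E)%E,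
      (N2 (tet a `&` Om) (fun x => v x - aff p.2 x)%R <= (K * h ^+ 4 * E)%:E)%E,
      forall i, (N2 (tet a `&` Op) (fun x => gp i x - dot p.1.1 (basis3 i))%R <= (K * h ^+ 2 * E)%:E)%E &
      forall i, (N2 (tet a `&` Om) (fun x => gm i x - dot p.2.1 (basis3 i))%R <= (K * h ^+ 2 * E)%:E)%E].
Proof.
move=> bp0 bm0 C0 kap0; have [K0 K00 HK0] := side_approximation R.
have mu0 : 0 < bm / bp by rewrite divr_gt0.
pose S := bp ^+ 2 + bm ^+ 2; have S0 : 0 <= S by rewrite addr_ge0 ?sqr_ge0.
pose kf := S * (480 * K0 + 240 + 10 * K0 * (40 * C) ^+ 2).
have kf0 : 0 <= kf.
  apply: mulr_ge0; first exact: S0.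
  apply: addr_ge0; last by apply: mulr_ge0; [apply: mulr_ge0; [exact: ler0n|exact: ltW]|exact: sqr_ge0].
  by apply: addr_ge0; [apply: mulr_ge0; [exact: ler0n|exact: ltW]|exact: ler0n].
(* One constant for three squared bounds: point values with [K0], gradients with [2 * K0], the flux
   with [kf]. *)
pose kk := 2 * K0 + kf; pose K1 := Num.sqrt kk.
have K10 : 0 <= K1 by exact: sqrtr_ge0.
pose M := K1 / bp + (4 * K1 + 4 * C * K1).
have M0 : 0 <= M by rewrite !addr_ge0 ?mulr_ge0 ?invr_ge0//; exact: ltW.
pose c0 := Num.min 1 (bm / bp) / 2; have c00 : 0 < c0 by rewrite divr_gt0// lt_min ltr01.
pose t := `|bm / bp - 1| * (4 * kap^-1 / c0).
pose N := 1 + 4 * t + 4 * kap^-1 + 8 * kap^-1 * t + t.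
have ki0 : 0 <= kap^-1 by rewrite invr_ge0 ltW.
have t0 : 0 <= t by rewrite !mulr_ge0// invr_ge0 ltW.
have Nx (x y : R) : 0 <= x -> 0 <= y -> 0 <= 1 + 4 * x + 4 * y + 8 * y * x + x.
  by move=> x0 y0; rewrite !addr_ge0 ?mulr_ge0.
have N0 : 0 <= N by exact: Nx.
(* Nodal values of the difference: [K1] for [v - pp] plus [2 * K1 + 6 * M] for [pp - q]. *)
pose F := 3 * K1 + 6 * M; have F0 : 0 <= F by rewrite addr_ge0 ?mulr_ge0.
pose D := 2 * K1 + 6 * M + M + N * F.
exists (2 * K0 + 128 * D ^+ 2); first by apply: ltr_pwDl; [exact: mulr_gt0|apply: mulr_ge0; [exact: ler0n|exact: sqr_ge0]].
move=> G Op Om n r s a lam xs h v gp gm ggp ggm tp tm E p H Gs h0 hr [h1 hC hd] [bOp bOm fOp fOm].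
move=> ai lamE Ta gb no dp dm trp trm flux Wp Wm Ep Em Fp Fm cont pS pv.
have [[r0 _ [oOp oOm]] _ cov nG _] := H; have [nn _] := nG xs Gs.
have E0 : 0 <= E by rewrite -lee_fin; apply: le_trans Fp; apply: sume_ge0 => i _; exact: N2_ge0.
set e := Num.sqrt (h * E); have e0 : 0 <= e by exact: sqrtr_ge0.
have hE0 : 0 <= h * E by rewrite mulr_ge0// ltW.
have eE : e ^+ 2 = h * E by rewrite sqr_sqrtr.
have Ch0 : 0 < C * h by rewrite mulr_gt0.
have [pp [pp1 pp2 pp3 pp4]] := HK0 G Op Om n r C xs h E v gp ggp H Gs h0 hr hC dp Ep.
have [pm [pm1 pm2 pm3 pm4]] := HK0 G Om Op _ r C xs h E v gm ggm (two_sided_sym H) Gs h0 hr hC dm Em.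
have vp x : Op x \/ G x -> `|x - xs| <= 3 * h -> `|v x - aff pp x| <= K1 * e.
  move=> ox xh; apply: (sqrt_bound (c := K0)) => //; first exact: ltW.
    by rewrite /kk; move: K00 kf0; clear; lra.
  rewrite mulrA; apply: pp1 => // e' e'0.
  have [|d d0 hd'] := cont x _ e' e'0; first by case: ox; auto.
  by exists d => // y Oy; apply: hd'; left.
have vm x : Om x \/ G x -> `|x - xs| <= 3 * h -> `|v x - aff pm x| <= K1 * e.
  move=> ox xh; apply: (sqrt_bound (c := K0)) => //; first exact: ltW.
    by rewrite /kk; move: K00 kf0; clear; lra.
  rewrite mulrA; apply: pm1 => // e' e'0.
  have [|d d0 hd'] := cont x _ e' e'0; first by case: ox; auto.
  by exists d => // y Oy; apply: hd'; right.
have lb (q : affine (R := R)) : l1norm q.1 ^+ 2 * h ^+ 3 <= K0 * (E + h ^+ 2 * E) ->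
    l1norm q.1 * h ^+ 2 <= K1 * e.
  move=> hq; have q0 : 0 <= l1norm q.1 * h ^+ 2 by rewrite mulr_ge0 ?l1norm_ge0 ?sqr_ge0.
  rewrite -(ger0_norm q0); apply: (sqrt_bound (c := 2 * K0)) => //; first by rewrite mulr_ge0// ltW.
    by rewrite /kk lerDl.
  have -> : (l1norm q.1 * h ^+ 2) ^+ 2 = h * (l1norm q.1 ^+ 2 * h ^+ 3) by ring.
  rewrite [leRHS]mulrCA ler_pM2l//; apply: le_trans hq _.
  have hE : h ^+ 2 * E <= E by rewrite ler_piMl// expr_le1// ltW.
  by rewrite [2 * K0]mulrC -[leRHS]mulrA ler_pM2l//; move: hE; clear; lra.
have lpp := pp4 _ Fp; have lpm := pm4 _ Fm.
have sub3 A : A `&` ball xs (3 * h) `<=` A `&` ball xs (21 * h).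
  by move=> x [Ax Bx]; split=> //; apply: (le_ball _ Bx); move: h0; clear; lra.
have b3 A (gg : 'I_3 -> 'I_3 -> pt3 R -> R) : open A ->
    (forall i j, measurable_fun A (gg i j)) ->
    (\sum_i \sum_j N2 (A `&` ball xs (21 * h)) (gg i j) <= E%:E)%E ->
    forall i j, (N2 (A `&` ball xs (3 * h)) (gg i j) <= E%:E)%E.
  move=> oA mgg hE i j; apply: le_trans hE; have mA := open_measurable3 oA.
  apply: (@le_trans _ _ (N2 (A `&` ball xs (21 * h)) (gg i j))).
    apply: N2_sub => //; try by apply: measurableI => //; exact: measurable_ball3.
    by apply: (measurable_funS mA) => // x [].
  rewrite (bigD1 i)//= (bigD1 j)//= -addeA leeDl// adde_ge0//; first by apply: sume_ge0 => *; exact: N2_ge0.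
  by apply: sume_ge0 => *; apply: sume_ge0 => *; exact: N2_ge0.
have mOp := open_measurable3 oOp; have mOm := open_measurable3 oOm.
have mgp i : measurable_fun Op (gp i) by case: dp => /(_ i)/(wderiv1P _ _ _ mOp)[_ /in_L2_measurable].
have mgm i : measurable_fun Om (gm i) by case: dm => /(_ i)/(wderiv1P _ _ _ mOm)[_ /in_L2_measurable].
have mvp : measurable_fun Op v by case: dp => /(_ 0)/(wderiv1P _ _ _ mOp)[/in_L2_measurable].
have mvm : measurable_fun Om v by case: dm => /(_ 0)/(wderiv1P _ _ _ mOm)[/in_L2_measurable].
have mggp i j : measurable_fun Op (ggp i j) by case: dp => _ /(_ i j)/(wderiv1P _ _ _ mOp)[_ /in_L2_measurable].
have mggm i j : measurable_fun Om (ggm i j) by case: dm => _ /(_ i j)/(wderiv1P _ _ _ mOm)[_ /in_L2_measurable].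
have fb : `|bp * dot pp.1 (n xs) - bm * dot pm.1 (n xs)| * h <= K1 * e.
  rewrite -[X in _ * X <= _](gtr0_norm h0) -normrM; apply: (sqrt_bound (c := kf)) => //; first by rewrite /kk lerDr mulr_ge0// ltW.
  rewrite exprMn; apply: le_trans (flux_cst bp bm C h0 h1 E0 K00 (dot_le_l1norm_sq _) (dot_le_l1norm_sq _) lpp lpm).
  exact: (flux_bound H Gs h0 hr hC bOp bOm fOp fOm dp dm trp trm flux pp3 pm3 (b3 _ _ oOp mggp Ep) (b3 _ _ oOm mggm Em)).
have h4r : 4 * h < r by move: hr h0; clear; lra.
have hC10 : 10 * C * h < 1 by rewrite -mulrA in hC *; move: hC Ch0; clear; nra.
have hr1 : h < r by move: hr h0; clear; lra.
have [q [qS qg qv]] := transmission H Gs bp0 K10 e0 h0 h4r hC10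
  (fun x Gx => vp x (or_intror Gx)) (fun x Gx => vm x (or_intror Gx)) (lb _ lpp) (lb _ lpm) fb.
pose side k := plus_side G Om s (a k).
have ah k : `|a k - xs| <= h by apply: Ta; exact: (tet_vertex_closure ai lamE).
have [dh den] := interface_denominator s H Gs h0 hr1 kap0 mu0 ai lamE ah gb no (erefl c0) hd.
have dS := is_pieceB pS qS; rewrite /= in dS.
have h3h x : `|x - xs| <= h -> `|x - xs| <= 3 * h by move=> xh; apply: le_trans xh _; move: h0; clear; lra.
have Fe0 : 0 <= F * e by exact: mulr_ge0.
have nb k : `|nodal a side (p.1 - q, p.2 - pm) k| <= F * e.
  have := pv k; rewrite nodal_valueE /nodal /= -/(side k).
  have := plus_sideP s H Gs (le_lt_trans (ah k) hr1); rewrite -/(side k).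
  have xh := h3h _ (ah k).
  case: (side k) => -[ok _] pE; rewrite aff_sub pE.
    have -> : v (a k) - aff q (a k) = (v (a k) - aff pp (a k)) + aff (pp - q) (a k) by rewrite aff_sub; ring.
    apply: le_trans (ler_normD _ _) _; apply: le_trans (lerD (vp _ ok xh) (qv _ xh)) _.
    by rewrite le_eqVlt; apply/orP; left; apply/eqP; rewrite /F /M; ring.
  apply: le_trans (vm _ ok xh) _; rewrite ler_wpM2r// /F.
  apply: (@le_trans _ _ (3 * K1)); first by rewrite ler_peMl// ler1n.
  by rewrite lerDl; apply: mulr_ge0.
have [sg sv] := piece_stability ai lamE nn h0 kap0 bp0 c00 Fe0 dh gb den dS nb.
rewrite -/t -/N /= in sg sv.
have De : D * e = (2 * K1 + 6 * M) * e + M * e + N * (F * e) by rewrite /D [LHS]mulrDl [in LHS]mulrDl mulrA.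
have Me0 : 0 <= M * e by exact: mulr_ge0.
have Ke0 : 0 <= (2 * K1 + 6 * M) * e by rewrite mulr_ge0// addr_ge0// mulr_ge0.
have Ne0 : 0 <= N * (F * e) by exact: mulr_ge0.
have Tx x : tet a x -> (forall k, 0 <= aff (lam k) x) /\ `|x - xs| <= h.
  by move=> tx; split; [move=> k; apply: ltW; exact: (tetP ai lamE x).1|apply: Ta; exact: subset_closure].
have Tb : tet a `<=` ball xs (2 * h).
  move=> x /Tx[_ xh]; rewrite -ball_normE /= distrC; apply: le_lt_trans xh _.
  by move: h0; clear; lra.
have oT := tet_open ai lamE.
have en (b : pt3 R) : dot b b = 1 -> enorm b = 1 by move=> bb; rewrite /enorm bb sqrtr1.
have [||r1 r2] := element_side (q := pp) (p := p.1) (M := D) oOp oT h0 Tb eE mvp mgp pp2 pp3.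
- move=> x /Tx[lx xh]; have -> : aff (pp - p.1) x = aff (pp - q) x - aff (p.1 - q) x by rewrite !aff_sub; ring.
  have [w1 _] := sv x lx; have w2 := qv x (h3h _ xh); rewrite -/M in w2.
  apply: le_trans (ler_normB _ _) _; rewrite De.
  by apply: le_trans (lerD w2 w1) _; rewrite lerD2r lerDl.
- move=> b bb; have -> : dot (pp - p.1).1 b = dot (pp - q).1 b - dot (p.1 - q).1 b by rewrite /= !(dotBl b); ring.
  have [w1 _] := sg b bb; have w2 := qg b; rewrite -/M en// mulr1 in w2.
  apply: le_trans (ler_wpM2r (ltW h0) (ler_normB _ _)) _; rewrite mulrDl De.
  by apply: le_trans (lerD w2 w1) _; rewrite lerD2r lerDr.
have [||r3 r4] := element_side (q := pm) (p := p.2) (M := D) oOm oT h0 Tb eE mvm mgm pm2 pm3.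
- move=> x /Tx[lx xh]; have -> : aff (pm - p.2) x = - aff (p.2 - pm) x by rewrite !aff_sub; ring.
  have [_ w1] := sv x lx; rewrite normrN De.
  by apply: le_trans w1 _; rewrite lerDr addr_ge0.
- move=> b bb; have -> : dot (pm - p.2).1 b = - dot (p.2 - pm).1 b by rewrite /= !(dotBl b); ring.
  have [_ w1] := sg b bb; rewrite normrN De.
  by apply: le_trans w1 _; rewrite lerDr addr_ge0.
by split.
Qed.

End InterfaceElement.

(** * Elements away from the interface *)

Section PlainElement.
Variable R : realType.
Variables (a : 'I_4 -> pt3 R) (lam : 'I_4 -> affine (R := R)).
Hypothesis ai : affinely_independent a.
Hypothesis lamE : forall k l, aff (lam k) (a l) = (k == l)%:R.

(** One factor 2 turns the diameter into a radius, the other the Euclidean ball into a sup norm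
    ball. *)
Lemma inscribed_ball (d : R) : 0 < d -> d < inball_diam (tet a) ->
  exists z, ball z (d / 4) `<=` tet a.
Proof.
move=> d0 hd.
have [_ [c [r [r0 BT ->]]] dr] : exists2 y, [set d | exists c r,
    [/\ 0 < r, [set x | enorm (x - c) < r] `<=` tet a & d = r *+ 2]] y & d < y.
  apply: sup_gt => //; apply/set0P/eqP => E.
  by move: hd; rewrite /inball_diam E sup0 ltNge ltW.
exists c => x; rewrite -ball_normE /= distrC => xc; apply: BT => /=.
by apply: le_lt_trans (enorm_le_norm _) _; move: xc dr; rewrite -mulr_natl; lra.
Qed.

Lemma tet_cone k q (t : R) : tet a q -> 0 < t <= 1 -> tet a (a k + t *: (q - a k)).
Proof.
move=> Tq /andP[t0 t1]; apply/(tetP ai lamE) => l.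
have -> : aff (lam l) (a k + t *: (q - a k)) = (1 - t) * aff (lam l) (a k) + t * aff (lam l) q.
  by rewrite /aff /dot /= /GRing.scale/=; ring.
rewrite lamE; apply: ltr_wpDl; first by rewrite mulr_ge0 ?subr_ge0.
by rewrite mulr_gt0//; exact: (tetP ai lamE q).1.
Qed.

Lemma vertex_stability (p : affine (R := R)) (g m : R) : 0 <= g ->
  (forall k, dot (lam k).1 (lam k).1 <= g ^+ 2) -> (forall k, `|aff p (a k)| <= m) ->
  (forall b, dot b b = 1 -> `|dot p.1 b| <= 4 * (m * g)) /\
  (forall x, tet a x -> `|aff p x| <= m).
Proof.
move=> g0 gb pm; have pE := aff_reconstruct ai lamE p; split=> [b bb|x Tx].
  rewrite pE grad_sum dotC dot_sumr; apply: le_trans (ler_norm_sum _ _ _) _.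
  rewrite -sum_const4; apply: ler_sum => k _; rewrite dotZr normrM; apply: ler_pM => //.
  rewrite -ler_sqr ?nnegrE// (real_normK (num_real _)); apply: le_trans (dot_CS _ _) _.
  by rewrite bb mul1r.
rewrite pE aff_sum; apply: le_trans (ler_norm_sum _ _ _) _.
apply: (@le_trans _ _ (\sum_k m * aff (lam k) x)); last by rewrite -mulr_sumr (bary_sum ai lamE) mulr1.
apply: ler_sum => k _; have l0 := (tetP ai lamE x).1 Tx k.
by rewrite affZ normrM (gtr0_norm l0) ler_wpM2r// ltW.
Qed.

End PlainElement.

Lemma plain_cst (R : realType) (h kap E : R) : 0 < h -> 0 < kap ->
  let K1 := 12 * (8 / kap) ^+ 3 in
  3 * (2 * h) ^+ 2 * (2 * h / (kap * h / 4)) ^+ 3 = K1 * h ^+ 2 /\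
  10 ^+ 6 * (13 + 12 * (2 * h / (kap * h / 4))) ^+ 2 *
    (K1 ^+ 2 * h ^+ 4 * E + (96 * (2 * h / (kap * h / 4)) ^+ 3) ^+ 2 * (2 * h) ^+ 4 * E) / (kap * h / 4) ^+ 3 =
  (10 ^+ 6 * (13 + 12 * (8 / kap)) ^+ 2 * (K1 ^+ 2 + (96 * (8 / kap) ^+ 3) ^+ 2 * 2 ^+ 4) / (kap / 4) ^+ 3) *
    (h * E).
Proof.
move=> h0 k0 K1; have -> : 2 * h / (kap * h / 4) = 8 / kap by field; rewrite !gt_eqF.
split; first by rewrite /K1; ring.
have -> : (kap * h / 4) ^+ 3 = (kap / 4) ^+ 3 * h ^+ 3 by ring.
move: (10 ^+ 6 * _) (96 * _) => x y; rewrite /K1; move: (12 * _) => z.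
have : (kap / 4) ^+ 3 != 0 by rewrite expf_neq0// gt_eqF// divr_gt0.
move: ((kap / 4) ^+ 3) => w w0; field.
by rewrite w0 gt_eqF.
Qed.

(** Here the element itself is star-shaped with respect to its inscribed ball, and by convexity
    contains the cone over that ball from each vertex. The pointwise bound at the vertices and the
    stability of Lagrange interpolation finish as on interface elements. *)
Lemma plain_estimate (R : realType) (kap : R) : 0 < kap ->
  exists2 K : R, 0 < K & forall (a : 'I_4 -> pt3 R) (lam : 'I_4 -> affine (R := R)) h
    (v : pt3 R -> R) (g : 'I_3 -> pt3 R -> R) gg (E : R) (p : affine (R := R)),
  affinely_independent a -> (forall k l, aff (lam k) (a l) = (k == l)%:R) ->
  0 < h -> diam (tet a) <= h -> kap * h < inball_diam (tet a) ->
  H2data (tet a) v g gg -> (\sum_i \sum_j N2 (tet a) (gg i j) <= E%:E)%E ->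
  (forall k (e : R), 0 < e ->
     exists2 d : R, 0 < d & forall y, tet a y -> `|y - a k| < d -> `|v y - v (a k)| < e) ->
  (forall k, aff p (a k) = v (a k)) ->
  (N2 (tet a) (fun x => v x - aff p x)%R <= (K * h ^+ 4 * E)%:E)%E /\
  forall i, (N2 (tet a) (fun x => g i x - dot p.1 (basis3 i))%R <= (K * h ^+ 2 * E)%:E)%E.
Proof.
move=> kap0; pose K1 := 12 * (8 / kap) ^+ 3.
have K10 : 0 <= K1 by rewrite mulr_ge0// exprn_ge0// divr_ge0// ltW.
pose KM := 10 ^+ 6 * (13 + 12 * (8 / kap)) ^+ 2 * (K1 ^+ 2 + (96 * (8 / kap) ^+ 3) ^+ 2 * 2 ^+ 4) / (kap / 4) ^+ 3.
have KM0 : 0 <= KM.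
  apply: divr_ge0; last by rewrite exprn_ge0// divr_ge0// ltW.
  apply: mulr_ge0; first by apply: mulr_ge0; [exact: exprn_ge0|exact: sqr_ge0].
  by apply: addr_ge0; [exact: sqr_ge0|apply: mulr_ge0; [exact: sqr_ge0|exact: exprn_ge0]].
pose D := Num.sqrt KM * (1 + 4 / kap); pose K0 := K1 ^+ 2 + K1 + 1.
exists (2 * K0 + 128 * D ^+ 2).
  apply: ltr_pwDl; last by apply: mulr_ge0; [exact: ler0n|exact: sqr_ge0].
  by apply: mulr_gt0 => //; apply: ltr_wpDl => //; apply: addr_ge0 => //; exact: sqr_ge0.
move=> a lam h v g gg E p ai lamE h0 dh hin Hv HE cont pv.
have E0 : 0 <= E.
  by rewrite -lee_fin; apply: le_trans HE; apply: sume_ge0 => i _; apply: sume_ge0 => j _; exact: N2_ge0.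
have kh0 : 0 < kap * h by exact: mulr_gt0.
have [z BT] := inscribed_ball kh0 hin.
have oT := tet_open ai lamE; have mT := open_measurable3 oT.
have bT : exists M : R, tet a `<=` ball 0 M.
  exists (\sum_k `|a k| + 1) => x /tet_bounded xb.
  by rewrite -ball_normE /= sub0r normrN; apply: le_lt_trans xb _; rewrite ltrDl.
have rho0 : 0 < kap * h / 4 by exact: divr_gt0.
have L0 : 0 < 2 * h by exact: mulr_gt0.
have dT x y : closure (tet a) x -> closure (tet a) y -> `|x - y| < 2 * h.
  by move=> cx cy; apply: le_lt_trans (norm_le_diam cx cy) _; move: dh h0; clear; lra.
have cT x : tet a x -> closure (tet a) x by exact: subset_closure.
have cv k : closure (tet a) (a k) by exact: (tet_vertex_closure ai lamE).
have [e1 e2] := plain_cst E h0 kap0.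
rewrite -/K1 -/KM in e1 e2.
have star : star_wrt (tet a) (ball z (kap * h / 4)).
  by move=> x q t Tx Qq t01; apply: (tet_convex ai lamE) => //; exact: BT.
have [|p0 [H1 H2]] := @deny_lions R (tet a) z (kap * h / 4) (2 * h) v g gg oT bT rho0 L0 BT star _ Hv.
  by move=> x q Tx /BT Tq; apply: dT; exact: cT.
rewrite e1 in H1 H2.
have KE : (N2 (tet a) (fun x => v x - aff p0 x)%R <= (K1 ^+ 2 * h ^+ 4 * E)%:E)%E.
  apply: le_trans H2 _; have -> : (K1 * h ^+ 2) ^+ 2 = K1 ^+ 2 * h ^+ 4 by ring.
  by apply: lee_EFinM => //; apply: mulr_ge0; [exact: sqr_ge0|apply: exprn_ge0; exact: ltW].
have mv : measurable_fun (tet a) v by case: Hv => /(_ 0)/(wderiv1P _ _ _ mT)[/in_L2_measurable].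
have mg i : measurable_fun (tet a) (g i) by case: Hv => /(_ i)/(wderiv1P _ _ _ mT)[_ /in_L2_measurable].
set e := Num.sqrt (h * E).
have hE0 : 0 <= h * E by rewrite mulr_ge0// ltW.
have eE : e ^+ 2 = h * E by rewrite sqr_sqrtr.
have vk k : `|v (a k) - aff p0 (a k)| <= Num.sqrt KM * e.
  apply: (sqrt_bound (c := KM)) => //.
  rewrite -e2; apply: (morrey oT bT rho0 L0 _ BT _ Hv HE (cont k)).
  - by move=> y [t [q [t01 /BT Tq ->]]]; exact: (tet_cone ai lamE).
  - by move=> q /BT Tq; apply: dT; [exact: cT|exact: cv].
  - apply: le_trans KE; apply: N2_sub => //; first exact: measurable_ball3.
    by apply: measurable_funB => //; exact: measurable_aff.
pose m := Num.sqrt KM * e; have m0 : 0 <= m by rewrite mulr_ge0 ?sqrtr_ge0.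
have g0 : 0 <= (kap * h)^-1 by rewrite invr_ge0 ltW.
have [||s1 s2] := @vertex_stability R a lam ai lamE (p0 - p) (kap * h)^-1 m g0.
- by move=> k; exact: (grad_lam_bound ai lamE).
- by move=> k; rewrite aff_sub pv distrC; exact: vk.
(* Lets [element_side] be reused with the whole element as its own side and a vertex as centre. *)
have sub3 : tet a `&` ball (a 0) (3 * h) = tet a.
  apply: setIidl => x Tx; rewrite -ball_normE /= distrC; apply: lt_le_trans (dT _ _ (cT _ Tx) (cv 0)) _.
  by move: h0; clear; lra.
have T2 : tet a `<=` ball (a 0) (2 * h).
  by move=> x Tx; rewrite -ball_normE /= distrC; apply: dT; [exact: cT|exact: cv].
have hq2 : 0 <= h ^+ 2 by exact: sqr_ge0.
have [||||r1 r2] := element_side (q := p0) (p := p) (M := D) (K0 := K0) oT oT h0 T2 eE mv mg.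
- rewrite sub3; apply: le_trans KE _; rewrite lee_fin; apply: ler_wpM2r => //.
  by apply: ler_wpM2r; [apply: exprn_ge0; exact: ltW|rewrite /K0 -addrA lerDl addr_ge0].
- move=> i; rewrite sub3.
  apply: (@le_trans _ _ (\sum_i N2 (tet a) (fun x => g i x - dot p0.1 (basis3 i))%R)%E).
    by rewrite (bigD1 i)//= leeDl// sume_ge0// => *; exact: N2_ge0.
  apply: le_trans H1 _; apply: le_trans (lee_EFinM _ HE) _.
    by apply: mulr_ge0.
  rewrite lee_fin; apply: ler_wpM2r => //; apply: ler_wpM2r => //.
  by rewrite /K0 addrAC lerDr addr_ge0// sqr_ge0.
- move=> x Tx; apply: le_trans (s2 x Tx) _; rewrite /m /D mulrAC ler_peMr//.
  by rewrite lerDl divr_ge0// ltW.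
- move=> b bb; apply: le_trans (ler_wpM2r (ltW h0) (s1 b bb)) _.
  have -> : 4 * (m * (kap * h)^-1) * h = m * (4 / kap) by field; rewrite !gt_eqF.
  have -> : D * e = m * (1 + 4 / kap) by rewrite /m /D mulrAC.
  by apply: ler_wpM2l; [exact: m0|rewrite lerDr].
by rewrite setIid in r1 r2.
Qed.

(** * Summation over the mesh *)

Section Assembly.
Variable R : realType.
Implicit Types (U A T B : set (pt3 R)) (f g u v w : pt3 R -> R).

Lemma within_continuous_eps A f : {within A, continuous f} ->
  forall x, A x -> forall e : R, 0 < e ->
  exists2 d : R, 0 < d & forall y, A y -> `|y - x| < d -> `|f y - f x| < e.
Proof.
move=> /subspace_continuousP cf x Ax e e0.
have := cf x Ax; move/cvgrPdist_lt => /(_ e e0).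
rewrite near_withinE => /nbhs_ballP[d /= d0 hd]; exists d => // y Ay yx.
by rewrite distrC; apply: hd => //; rewrite -ball_normE /= distrC.
Qed.

(** The mesh only places elements in the closure. At a point of an open element on a bounding plane,
    a small move along the outer normal would violate the weak inequality that holds on the
    closure. *)
Lemma open_in_polyhedron (Omega T : set (pt3 R)) : convex_polyhedral_domain Omega ->
  open T -> T `<=` closure Omega -> T `<=` Omega.
Proof.
move=> [[x0 O0] _ [k [a [b OE]]]] oT TO.
have clO x i : closure Omega x -> dot (a i) x <= b i.
  move=> cx; have : closed [set y | dot (a i) y <= b i].
    have -> : [set y | dot (a i) y <= b i] = (dot (a i)) @^-1` [set z | z <= b i] by [].
    by apply: closed_comp; [move=> y _; exact: continuous_dot|exact: closed_le].
  move=> /closure_id E; suff : closure [set y | dot (a i) y <= b i] x by rewrite -E.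
  by apply: closure_subset cx; rewrite OE => y /= Hy; exact: ltW.
move=> x Tx; rewrite OE /= => i.
have /nbhs_ballP[d /= d0 hd] : nbhs x T by apply: open_nbhs_nbhs.
have [a0|an] := eqVneq (a i) 0.
  by move: O0; rewrite OE /= => /(_ i); rewrite a0 !(dotC 0) !dot0r.
have an' : a i <> 0 by apply/eqP.
pose t := d / 2 / (`|a i| + 1).
have n1 : 0 < `|a i| + 1 by rewrite ltr_wpDl.
have t0 : 0 < t by rewrite !divr_gt0.
have : T (x + t *: a i).
  apply: hd; rewrite -ball_normE /= opprD addNKr normrN normrZ gtr0_norm//.
  apply: (@le_lt_trans _ _ (t * (`|a i| + 1))); first by rewrite ler_pM2l// lerDl.
  by rewrite /t divfK ?gt_eqF//; move: d0; clear; lra.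
move/TO/(clO _ i); rewrite dotDr dotZr; apply: lt_le_trans.
by rewrite ltrDl mulr_gt0// dot_gt0.
Qed.

(* The balls [ball (z i) rho] with [y i] near [x] are disjoint and lie in a ball
   around [x]: compare the volumes. *)
Lemma overlap (N : nat) (y z : 'I_N -> pt3 R) (r s rho : R) x : 0 < rho -> 0 <= r -> 0 <= s ->
  (forall i j, i != j -> ball (z i) rho `&` ball (z j) rho = set0) ->
  (forall i, `|z i - y i| <= s) ->
  (\sum_i \1_(ball (y i) r) x) * (rho *+ 2) ^+ 3 <= ((r + s + rho) *+ 2) ^+ 3.
Proof.
move=> rho0 r0 s0 disj zy.
pose F i := if `[< ball (y i) r x >] then ball (z i) rho else set0.
have mF i : measurable (F i) by rewrite /F; case: ifP => _ //; exact: measurable_ball3.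
have FE i : mu3 (F i) = (\1_(ball (y i) r) x * (rho *+ 2) ^+ 3)%:E.
  rewrite /F indicE; case: asboolP => Bx; first by rewrite mem_set// mul1r mu3_ball// ltW.
  by rewrite memNset// mul0r measure0.
have rs0 : 0 <= r + s + rho by rewrite !addr_ge0// ltW.
rewrite -lee_fin -(mu3_ball x rs0) mulr_suml -sumEFin.
under eq_bigr do rewrite -FE.
have I A : measurable A -> mu3 A = \int3_x (\1_A x)%:E.
  by move=> mA; rewrite integral_indic// setIT.
under eq_bigr do rewrite I//.
rewrite (I (ball x _)); last exact: measurable_ball3.
have mI i : measurable_fun setT (fun q => (\1_(F i) q)%:E : \bar R).
  by apply/measurable_EFinP; apply: measurable_indic; exact: mF.
rewrite -ge0_integral_sum//.
apply: ge0_le_integral => //.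
- by move=> q _; apply: sume_ge0.
- exact: emeasurable_sum.
- by apply/measurable_EFinP; apply: measurable_indic; exact: measurable_ball3.
move=> q _; rewrite sumEFin lee_fin.
have [[i Fi]|nF] := pselect (exists i, F i q); last first.
  rewrite big1 ?indicE ?ler0n// => i _; rewrite indicE memNset// => Fi; apply: nF; by exists i.
rewrite (bigD1 i)//= big1 ?addr0; last first.
  move=> j ji; rewrite indicE memNset// => Fj; move: Fi Fj; rewrite /F.
  case: ifP => // _ Bi; case: ifP => // _ Bj.
  by have : (ball (z j) rho `&` ball (z i) rho) q by []; rewrite disj.
have Fx : ball x (r + s + rho) q.
  move: Fi; rewrite /F; case: asboolP => // + Bz; rewrite -!ball_normE /= in Bz * => xy.
  have -> : x - q = (z i - q) - (z i - y i) - (y i - x) by apply: pt3_eq; rewrite /=; ring.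
  apply: le_lt_trans (ler_normB _ _) _; have := ler_normB (z i - q) (z i - y i).
  by move: (zy i) Bz xy; lra.
by rewrite !indicE !mem_set.
Qed.

Lemma N2_overlap (N : nat) U f (B : 'I_N -> set (pt3 R)) (c : R) : measurable U ->
  measurable_fun U f -> (forall i, measurable (B i)) -> 0 <= c ->
  (forall x, \sum_i \1_(B i) x <= c) ->
  (\sum_i N2 (U `&` B i) f <= c%:E * N2 U f)%E.
Proof.
move=> mU mf mB c0 Bc.
have E i : N2 (U `&` B i) f = \int3_(x in U) (\1_(B i) x * f x ^+ 2)%:E.
  rewrite /N2 integral_mkcondr; apply: eq_integral => x _; rewrite patchE indicE.
  by case: ifP => _; rewrite ?mul1r ?mul0r.
have mB' i : measurable_fun U (fun x => (\1_(B i) x * f x ^+ 2)%:E).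
  apply/measurable_EFinP; apply: measurable_funM; last exact: measurable_funX.
  exact: measurable_indic.
under eq_bigr do rewrite E.
rewrite -ge0_integral_sum//; last by move=> i x _; rewrite lee_fin mulr_ge0// sqr_ge0.
rewrite /N2 -ge0_integralZl//; last 2 first.
- exact: measurable_sq.
- by move=> x _; rewrite lee_fin sqr_ge0.
apply: ge0_le_integral => //.
- by move=> x _; apply: sume_ge0 => i _; rewrite lee_fin mulr_ge0// sqr_ge0.
- exact: emeasurable_sum.
- by apply: measurable_funeM; exact: measurable_sq.
- by move=> x _; rewrite sumEFin -EFinM lee_fin -mulr_suml ler_wpM2r// sqr_ge0.
Qed.

Lemma wderiv_eq U vs u w g : {in U, u =1 w} -> is_wderiv U vs u g -> is_wderiv U vs w g.
Proof.
move=> uw [lu lg H]; split=> //; first exact: in_L2_eq lu.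
by move=> phi /H <-; apply: eq_integral => x xU; rewrite uw.
Qed.

Lemma Hsemi2_affine U v w (g : 'I_3 -> pt3 R -> R) (p : affine (R := R)) (X Y : R) :
  open U -> (mu3 U < +oo)%E -> (exists M : R, U `<=` ball 0 M) ->
  (forall i, is_wderiv U [:: basis3 i] v (g i)) -> {in U, w =1 aff p} ->
  (N2 U (fun x => v x - aff p x)%R <= X%:E)%E ->
  (forall i, N2 U (fun x => g i x - dot p.1 (basis3 i))%R <= Y%:E)%E ->
  (Hsemi2 0 U (fun x => v x - w x)%R <= X%:E)%E /\ (Hsemi2 1 U (fun x => v x - w x)%R <= (24 * Y)%:E)%E.
Proof.
move=> oU fU bU wg wp HX HY; have mU := open_measurable3 oU.
have wd i : is_wderiv U [:: basis3 i] (fun x => v x - aff p x) (fun x => g i x - dot p.1 (basis3 i)).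
  have -> : (fun x => g i x - dot p.1 (basis3 i)) = (fun x => g i x - 'D_(basis3 i) (aff p) x).
    by apply/funext => x; rewrite derive_aff.
  exact: wderivB mU (wg i) (wderiv_smooth (basis3 i) mU fU bU (smooth_aff p)).
have eqw : {in U, (fun x => v x - aff p x) =1 (fun x => v x - w x)} by move=> x xU; rewrite wp.
split.
  apply: le_trans (Hsemi2_0_le _) _; first by case: (wd 0) => + _ _; exact: in_L2_eq.
  by apply: le_trans HX; rewrite (N2_eq eqw).
apply: le_trans (Hsemi2_1_le (fun i => wderiv_eq eqw (wd i))) _.
apply: (@le_trans _ _ (8%:E * \sum_(i < 3) Y%:E)%E).
  by apply: lee_wpmul2l => //; apply: lee_sum => i _; exact: HY.
rewrite sumEFin -EFinM lee_fin sumr_const card_ord -[Y *+ 3]mulr_natl mulrA.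
by rewrite (_ : 8 * 3 = 24 :> R)//; ring.
Qed.

Lemma other_vertices (k l : 'I_4) : k != l -> exists i j, uniq [:: i; j; k; l].
Proof.
move=> kl; have : (1 < #|~: [set k; l]|)%N.
  by have := cardsC [set k; l]; rewrite cards2 kl card_ord; lia.
move=> /card_gt1P[i [j [+ + ij]]]; rewrite !inE !negb_or => /andP[ik il] /andP[jk jl].
by exists i, j; rewrite /= !inE !negb_or ij ik il jk jl kl.
Qed.

Lemma dihedral_nonobtuse (a : 'I_4 -> pt3 R) (lam : 'I_4 -> affine (R := R)) :
  affinely_independent a -> (forall k l, aff (lam k) (a l) = (k == l)%:R) ->
  dihedral_angles_le_right a -> forall k l, k != l -> dot (lam k).1 (lam l).1 <= 0.
Proof.
move=> ai lamE ra k l kl; have [i [j u]] := other_vertices kl.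
by apply: (dihedral_grad ai lamE u); apply: angle_le_pihalf; exact: ra.
Qed.

End Assembly.

Section Main.
Variable R : realType.
Implicit Types (Omega G Op Om U T : set (pt3 R)) (n : pt3 R -> pt3 R) (v w : pt3 R -> R).

Lemma affine_interpolation (a : 'I_4 -> pt3 R) (z : 'I_4 -> R) : affinely_independent a ->
  exists p : affine, forall k, aff p (a k) = z k.
Proof.
move=> /barycentric_exists[lam lamE]; exists (\sum_k z k *: lam k) => k.
rewrite aff_sum (bigD1 k)//= affZ lamE eqxx mulr1 big1 ?addr0// => l lk.
by rewrite affZ lamE (negbTE lk) mulr0.
Qed.

(** Elements and sides are disjoint, so local pieces glue without conflict, and single values at
    shared vertices follow from interpolating the same [v]. The value 0 off the elements is
    arbitrary. *)
Lemma interpolant_exists G Op Om n (bp bm : R) s (N : nat) (a : 'I_N -> 'I_4 -> pt3 R) xs v :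
  (forall i j, i != j -> tet (a i) `&` tet (a j) = set0) -> Op `&` Om = set0 ->
  (forall i, exists p, [/\ interface_element G (a i) -> in_Sh n bp bm (xs i) p,
     ~ interface_element G (a i) -> p.1 = p.2 &
     forall k, nodal_value G Om s p (a i k) = v (a i k)]) ->
  exists w, is_IFE_interpolant G Op Om n bp bm s a xs v w.
Proof.
move=> disj OO /choice[p Hp].
have piece x i : tet (a i) x -> [pick i | `[< tet (a i) x >]] = Some i.
  move=> Tx; case: pickP => [j /asboolP Tj|/(_ i)]; last by rewrite asboolT.
  congr Some; apply/eqP/negPn/negP => /disj d.
  by have : (tet (a j) `&` tet (a i)) x by []; rewrite d.
exists (fun x => if [pick i | `[< tet (a i) x >]] is Some i then
  (if `[< Op x >] then aff (p i).1 x else aff (p i).2 x) else 0).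
exists p; last by move=> i; have [] := Hp i.
split.
- by move=> i; have [] := Hp i.
- by move=> i; have [] := Hp i.
- by move=> i x; rewrite inE => -[/piece -> Ox]; rewrite asboolT.
- move=> i x; rewrite inE => -[/piece -> Ox]; rewrite asboolF// => Px.
  by have : (Op `&` Om) x by []; rewrite OO.
- by move=> i j k l E; have [_ _ ->] := Hp i; have [_ _ ->] := Hp j; rewrite E.
Qed.

(** First derivatives are included to pay for the curvature of the interface, as in [flux_cst]. *)
Definition energy U (g : 'I_3 -> pt3 R -> R) (gg : 'I_3 -> 'I_3 -> pt3 R -> R) : \bar R :=
  (\sum_i \sum_j N2 U (gg i j) + \sum_i N2 U (g i))%E.

Lemma energy_ge0 U g gg : (0 <= energy U g gg)%E.
Proof.
apply: adde_ge0; last by apply: sume_ge0 => *; exact: N2_ge0.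
by apply: sume_ge0 => *; apply: sume_ge0 => *; exact: N2_ge0.
Qed.

Lemma energy_le U g gg (E : R) : (energy U g gg <= E%:E)%E ->
  (\sum_i \sum_j N2 U (gg i j) <= E%:E)%E /\ (\sum_i N2 U (g i) <= E%:E)%E.
Proof.
have s1 : (0 <= \sum_i \sum_j N2 U (gg i j))%E.
  by apply: sume_ge0 => *; apply: sume_ge0 => *; exact: N2_ge0.
have s2 : (0 <= \sum_i N2 U (g i))%E by apply: sume_ge0 => *; exact: N2_ge0.
by move=> h; split; apply: le_trans h; rewrite /energy; [rewrite leeDl|rewrite leeDr].
Qed.

Lemma H2data_measurable U v g gg : measurable U -> H2data U v g gg ->
  [/\ measurable_fun U v, forall i, measurable_fun U (g i) & forall i j, measurable_fun U (gg i j)].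
Proof.
move=> mU [H1 H2]; split=> [|i|i j].
- by have /(wderiv1P _ _ _ mU)[/in_L2_measurable] := H1 0.
- by have /(wderiv1P _ _ _ mU)[_ /in_L2_measurable] := H1 i.
- by have /(wderiv1P _ _ _ mU)[_ /in_L2_measurable] := H2 i j.
Qed.

Lemma energy_sub A U v g gg (E : R) : open A -> open U -> A `<=` U -> H2data U v g gg ->
  (energy U g gg <= E%:E)%E -> (energy A g gg <= E%:E)%E.
Proof.
move=> oA oU AU Hv; have mA := open_measurable3 oA; have mU := open_measurable3 oU.
have [_ mg mgg] := H2data_measurable mU Hv.
apply: le_trans; apply: leeD; apply: lee_sum => i _; last exact: N2_sub.
by apply: lee_sum => j _; exact: N2_sub.
Qed.

(** The 12 counts nine second and three first derivatives, each bounded by [H] and covered at most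
    [c] times. *)
Lemma energy_overlap (N : nat) U v g gg (B : 'I_N -> set (pt3 R)) (c H : R) : measurable U ->
  H2data U v g gg -> (forall i, measurable (B i)) -> 0 <= c -> (forall x, \sum_i \1_(B i) x <= c) ->
  (forall i, N2 U (g i) <= H%:E)%E -> (forall i j, N2 U (gg i j) <= H%:E)%E ->
  (\sum_i energy (U `&` B i) g gg <= (12 * (c * H))%:E)%E.
Proof.
move=> mU Hv mB c0 Bc Hg Hgg; have [_ mg mgg] := H2data_measurable mU Hv.
have one f : measurable_fun U f -> (N2 U f <= H%:E)%E -> (\sum_i N2 (U `&` B i) f <= (c * H)%:E)%E.
  by move=> mf fH; apply: le_trans (N2_overlap mU mf mB c0 Bc) _; exact: lee_EFinM.
rewrite /energy big_split /= exchange_big /= [X in (_ + X <= _)%E]exchange_big /=.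
apply: (@le_trans _ _ (\sum_(i < 3) \sum_(j < 3) (c * H)%:E + \sum_(i < 3) (c * H)%:E)%E).
  apply: leeD; apply: lee_sum => i _; last exact: one.
  by rewrite exchange_big; apply: lee_sum => j _; exact: one.
have s3 (z : R) : (\sum_(i < 3) z%:E = (3 * z)%:E)%E.
  by rewrite sumEFin sumr_const card_ord -[z *+ 3]mulr_natl.
by under eq_bigr do rewrite s3; rewrite !s3 -EFinD lee_fin; move: (c * H) => z; clear; lra.
Qed.

(** Both kinds of elements in one statement. The energy is taken on a ball around the vertex [a 0],
    since [xs] is meaningful only on interface elements; radius [22 h] contains the ball of radius
    [21 h] around [xs]. An element missing [G] lies in one side by convexity, and the other
    intersection is empty. *)
Lemma local_estimate (bp bm C kap : R) : 0 < bp -> 0 < bm -> 0 < C -> 0 < kap ->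
  exists2 K : R, 0 < K & forall Omega G Op Om n r s (a : 'I_4 -> pt3 R) xs h
    v (gp gm : 'I_3 -> pt3 R -> R) ggp ggm tp tm (E : R) (p : piece (R := R)),
  two_sided G Op Om n r C -> Omega `\` G = Op `|` Om -> G `<=` Omega -> 0 < h -> 400 * h < r ->
  [/\ h <= 1, 10 ^+ 5 * C * h < 1 & 96 * C * h / kap ^+ 2 * (1 + bm / bp) <= Num.min 1 (bm / bp) / 2] ->
  [/\ exists M : R, Op `<=` ball 0 M, exists M : R, Om `<=` ball 0 M,
      (@mu3 R Op < +oo)%E & (@mu3 R Om < +oo)%E] ->
  affinely_independent a -> tet a `<=` Omega -> diam (tet a) <= h -> kap * h < inball_diam (tet a) ->
  (interface_element G a -> [/\ dihedral_angles_le_right a, G xs & closure (tet a) xs]) ->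
  H2data Op v gp ggp -> H2data Om v gm ggm ->
  (forall i, is_trace Op G (gp i) (tp i)) -> (forall i, is_trace Om G (gm i) (tm i)) ->
  surf_int G (fun x => (bp * (\sum_i tp i x * dot (basis3 i) (n x)) -
                        bm * (\sum_i tm i x * dot (basis3 i) (n x))) ^+ 2) = 0%E ->
  (energy (Op `&` ball (a 0%R) (22 * h)%R) gp ggp <= E%:E)%E ->
  (energy (Om `&` ball (a 0%R) (22 * h)%R) gm ggm <= E%:E)%E ->
  (forall x, closure Omega x -> forall e : R, 0 < e ->
     exists2 d : R, 0 < d & forall y, closure Omega y -> `|y - x| < d -> `|v y - v x| < e) ->
  (interface_element G a -> in_Sh n bp bm xs p) -> (~ interface_element G a -> p.1 = p.2) ->
  (forall k, nodal_value G Om s p (a k) = v (a k)) ->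
  [/\ (N2 (tet a `&` Op) (fun x => v x - aff p.1 x)%R <= (K * h ^+ 4 * E)%:E)%E,
      (N2 (tet a `&` Om) (fun x => v x - aff p.2 x)%R <= (K * h ^+ 4 * E)%:E)%E,
      forall i, (N2 (tet a `&` Op) (fun x => gp i x - dot p.1.1 (basis3 i))%R <= (K * h ^+ 2 * E)%:E)%E &
      forall i, (N2 (tet a `&` Om) (fun x => gm i x - dot p.2.1 (basis3 i))%R <= (K * h ^+ 2 * E)%:E)%E].
Proof.
move=> bp0 bm0 C0 kap0.
have [K1 K10 H1] := interface_estimate bp0 bm0 C0 kap0; have [K2 K20 H2] := plain_estimate kap0.
exists (K1 + K2); first exact: addr_gt0.
move=> Omega G Op Om n r s a xs h v gp gm ggp ggm tp tm E p H OE GO h0 hr hs bd ai TO dh hin ie dp dm trp trm flux.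
move=> Ep Em cont pI pP pv.
have [[r0 _ [oOp oOm]] [OO OpG OmG] cov nG _] := H.
have mOp := open_measurable3 oOp; have mOm := open_measurable3 oOm.
have OpO : Op `<=` Omega by move=> x Ox; have [] : (Omega `\` G) x by [rewrite OE; left].
have OmO : Om `<=` Omega by move=> x Ox; have [] : (Omega `\` G) x by [rewrite OE; right].
have cl x : Omega x -> closure Omega x by exact: subset_closure.
have [lam lamE] := barycentric_exists ai.
have oT := tet_open ai lamE; have mT := open_measurable3 oT.
have E0 : 0 <= E by rewrite -lee_fin; apply: le_trans Ep; exact: energy_ge0.
have kh0 : 0 < kap * h by exact: mulr_gt0.
have cT x : tet a x -> closure (tet a) x by exact: subset_closure.
have cv k : closure (tet a) (a k) by exact: (tet_vertex_closure ai lamE).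
have oB (z : pt3 R) (t : R) : open (ball z t) by exact: ball_open.
have mono (K : R) (q : nat) (S : \bar R) : K <= K1 + K2 ->
    (S <= (K * h ^+ q * E)%:E)%E -> (S <= ((K1 + K2) * h ^+ q * E)%:E)%E.
  move=> KK /le_trans; apply; rewrite lee_fin; apply: ler_wpM2r => //.
  by apply: ler_wpM2r => //; apply: exprn_ge0; exact: ltW.
have m1 q S : (S <= (K1 * h ^+ q * E)%:E)%E -> (S <= ((K1 + K2) * h ^+ q * E)%:E)%E.
  by apply: mono; rewrite lerDl ltW.
have m2 q S : (S <= (K2 * h ^+ q * E)%:E)%E -> (S <= ((K1 + K2) * h ^+ q * E)%:E)%E.
  by apply: mono; rewrite lerDr ltW.
have [IE|NI] := pselect (interface_element G a).
  have [ra Gs cs] := ie IE.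
  have Ta x : closure (tet a) x -> `|x - xs| <= h by move=> cx; apply: le_trans (norm_le_diam cx cs) dh.
  have BB : ball xs (21 * h) `<=` ball (a 0) (22 * h).
    move=> x; rewrite -!ball_normE /= => Bx; have -> : a 0 - x = (a 0 - xs) + (xs - x) by apply: pt3_eq; rewrite /=; ring.
    by apply: le_lt_trans (ler_normD _ _) _; have := Ta _ (cv 0); move: Bx; clear; lra.
  have sub A : A `&` ball xs (21 * h) `<=` A `&` ball (a 0) (22 * h) by move=> x [Ax /BB].
  have Ep' : (energy (Op `&` ball xs (21 * h)%R) gp ggp <= E%:E)%E.
    apply: (energy_sub (v := v) (U := Op `&` ball (a 0) (22 * h))) => //; try exact: openI.
    by apply: H2data_sub dp => //; apply: open_measurable3; exact: openI.
  have Em' : (energy (Om `&` ball xs (21 * h)%R) gm ggm <= E%:E)%E.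
    apply: (energy_sub (v := v) (U := Om `&` ball (a 0) (22 * h))) => //; try exact: openI.
    by apply: H2data_sub dm => //; apply: open_measurable3; exact: openI.
  have [Ep1 Ep2] := energy_le Ep'; have [Em1 Em2] := energy_le Em'.
  have [|||c1 c2 c3 c4] := H1 G Op Om n r s a lam xs h v gp gm ggp ggm tp tm E p H Gs h0 hr hs bd ai lamE Ta
    _ _ dp dm trp trm flux Ep1 Em1 Ep2 Em2 _ (pI IE) pv.
  - by move=> k; exact: (grad_lam_bound ai lamE).
  - exact: (dihedral_nonobtuse ai lamE ra).
  - move=> x Ox e e0; have [|d d0 hd] := cont x _ e e0; first by apply: cl; case: Ox => [/OpO//|[/OmO//|/GO]].
    by exists d => // y Oy; apply: hd; apply: cl; case: Oy => [/OpO|/OmO].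
  - by split=> [||i|i]; apply: m1.
have pE := pP NI.
have pk k : aff p.1 (a k) = v (a k) by have := pv k; rewrite /nodal_value -pE; case: ifP.
have Tside x : tet a x -> (Op `|` Om) x.
  by move=> Tx; rewrite -OE; split; [exact: TO|move=> Gx; apply: NI; exists x].
have one A B (g : 'I_3 -> pt3 R -> R) gg x0 : open A -> open B -> A `&` B = set0 -> Op `|` Om `<=` A `|` B ->
    tet a x0 -> A x0 -> H2data A v g gg -> (energy (A `&` ball (a 0%R) (22 * h)%R) g gg <= E%:E)%E ->
    tet a `&` A = tet a /\
    (N2 (tet a) (fun x => v x - aff p.1 x)%R <= (K2 * h ^+ 4 * E)%:E)%E /\
    forall i, (N2 (tet a) (fun x => g i x - dot p.1.1 (basis3 i))%R <= (K2 * h ^+ 2 * E)%:E)%E.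
  move=> oA oB' AB AOB Tx0 Ax0 Hv HE; have mA := open_measurable3 oA.
  have TA : tet a `<=` A.
    move=> x Tx; apply: (segment_side oA oB' AB _ Ax0) => t t01.
    by apply: AOB; apply: Tside; exact: (tet_convex ai lamE).
  split; first exact: setIidl.
  have TB : tet a `<=` A `&` ball (a 0) (22 * h).
    move=> x Tx; split; first exact: TA.
    rewrite -ball_normE /= distrC; apply: le_lt_trans (norm_le_diam (cT _ Tx) (cv 0)) _.
    by apply: le_lt_trans dh _; move: h0; clear; lra.
  have HT : H2data (tet a) v g gg by exact: H2data_sub Hv.
  have HE' : (energy (tet a) g gg <= E%:E)%E.
    apply: (energy_sub (v := v) (U := A `&` ball (a 0) (22 * h))) HE => //; first exact: openI.
    by apply: H2data_sub Hv => //; apply: open_measurable3; exact: openI.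
  have [HE1 _] := energy_le HE'.
  apply: (H2 a lam h v g gg E p.1 ai lamE h0 dh hin HT HE1) => // k e e0.
  have cO : closure Omega (a k) by apply: closure_subset (cv k).
  by have [d d0 hd] := cont _ cO e e0; exists d => // y Ty; apply: hd; apply: cl; exact: TO.
have null A f q : tet a `&` A = set0 -> (N2 (tet a `&` A) f <= ((K1 + K2) * h ^+ q * E)%:E)%E.
  move=> ->; rewrite /N2 integral_set0 lee_fin; apply: mulr_ge0 => //.
  by apply: mulr_ge0; [rewrite addr_ge0 ?ltW|apply: exprn_ge0; exact: ltW].
have [x0 Tx0] := tet_neq0 ai lamE.
have dis A B : A `&` B = set0 -> tet a `&` A = tet a -> tet a `&` B = set0.
  by move=> AB <-; rewrite -setIA AB setI0.
have [Ox0|Mx0] := Tside _ Tx0.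
  have [|TA [e1 e2]] := one Op Om gp ggp x0 oOp oOm OO _ Tx0 Ox0 dp Ep; first by [].
  have TM := dis _ _ OO TA; split; rewrite ?TA; [exact: m2|exact: null|by move=> i; apply: m2|by move=> i; exact: null].
have MO : Om `&` Op = set0 by rewrite setIC.
have [|TA [e1 e2]] := one Om Op gm ggm x0 oOm oOp MO _ Tx0 Mx0 dm Em; first by rewrite setUC.
have TM := dis _ _ MO TA; rewrite -pE; split; rewrite ?TA; [exact: null|exact: m2|by move=> i; exact: null|by move=> i; apply: m2].
Qed.

Lemma bounded_finite U (M : R) : open U -> U `<=` ball 0 M -> (mu3 U < +oo)%E.
Proof.
move=> oU UM; apply: (@le_lt_trans _ _ (mu3 (ball (0 : pt3 R) `|M|))); last by rewrite mu3_ball// ltry.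
apply: le_measure; rewrite ?inE; [exact: open_measurable3|exact: measurable_ball3|].
by move=> x /UM; apply: le_ball; exact: ler_norm.
Qed.

Lemma fine_sum (I : finType) (F : I -> \bar R) (z : R) : (forall i, 0 <= F i)%E ->
  (\sum_i F i <= z%:E)%E ->
  exists e : I -> R, [/\ forall i, 0 <= e i, forall i, F i = (e i)%:E & \sum_i e i <= z].
Proof.
move=> F0 Fz; have FE i : F i = (fine (F i))%:E.
  rewrite fineK// ge0_fin_numE//; apply: le_lt_trans (ltry z); apply: le_trans Fz.
  by rewrite (bigD1 i)//= leeDl// sume_ge0.
exists (fun i => fine (F i)); split=> // [i|]; first exact: fine_ge0.
by rewrite -lee_fin -sumEFin; under eq_bigr do rewrite -FE.
Qed.

(** The factor 2 in [k1 / (2 * k2)] makes the bound strict, so that an inscribed ball of at least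
    that diameter exists although [inball_diam] is a supremum. *)
Lemma mesh_element Omega (k1 k2 : R) (N : nat) (a : 'I_N -> 'I_4 -> pt3 R) i :
  convex_polyhedral_domain Omega -> 0 < k1 -> 0 < k2 -> conforming_mesh Omega a -> quasi_uniform k1 k2 a ->
  [/\ affinely_independent (a i), tet (a i) `<=` Omega, 0 < mesh_size a,
      diam (tet (a i)) <= mesh_size a & k1 / (2 * k2) * mesh_size a < inball_diam (tet (a i))].
Proof.
move=> pO k10 k20 [ai cl _] qu; have [lam lamE] := barycentric_exists (ai i).
have dh : diam (tet (a i)) <= mesh_size a by apply: le_bigmax.
have h0 : 0 < mesh_size a by exact: lt_le_trans (diam_gt0 (ai i) lamE) dh.
split=> //.
  apply: (open_in_polyhedron pO); first exact: (tet_open (ai i) lamE).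
  rewrite cl => x [l [l0 l1 ->]]; exists i => //; exists l; split=> // k; exact: ltW.
have [q1 q2] := qu i; rewrite -(ltr_pM2l k20); apply: lt_le_trans (le_trans q1 q2).
have -> : k2 * (k1 / (2 * k2) * mesh_size a) = k1 * mesh_size a / 2 by field; rewrite gt_eqF.
by have := mulr_gt0 k10 h0; move: (k1 * _) => z; lra.
Qed.

End Main.

Theorem theorem5 (R : realType) (Omega G Op Om : set (pt3 R))
    (n : pt3 R -> pt3 R) (bp bm k1 k2 : R)
    (hgeo : interface_geometry Omega G Op Om n)
    (hbp : 0 < bp) (hbm : 0 < bm) (hk1 : 0 < k1) (hk2 : 0 < k2) :
  exists h0 C : R, [/\ 0 < h0, 0 < C &
    forall (N : nat) (a : 'I_N -> 'I_4 -> pt3 R) (xs : 'I_N -> pt3 R)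
      (s : bool),
    conforming_mesh Omega a ->
    quasi_uniform k1 k2 a ->
    mesh_size a <= h0 ->
    (forall i, interface_element G (a i) ->
       face_angles_le_right (a i) /\ dihedral_angles_le_right (a i)) ->
    (forall i, interface_element G (a i) ->
       G (xs i) /\ closure (tet (a i)) (xs i)) ->
    forall v : pt3 R -> R,
    in_Htilde2 Omega G Op Om n bp bm v ->
    {within closure Omega, continuous v} ->
    (exists w, is_IFE_interpolant G Op Om n bp bm s a xs v w) /\
    forall w, is_IFE_interpolant G Op Om n bp bm s a xs v w ->
    forall m : nat, (m <= 1)%N ->
    (\sum_(i < N) (Hsemi2 m (tet (a i) `&` Op) (fun x => v x - w x)%R +
                   Hsemi2 m (tet (a i) `&` Om) (fun x => v x - w x)%R) <=
     (C * mesh_size a ^+ (4 - 2 * m)%N)%R%:E *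
     (Hnorm2 2 Op v + Hnorm2 2 Om v))%E].
Proof.
have [r [C H]] := interface_two_sided hgeo.
have [[r0 C0 [oOp oOm]] [OO OpG OmG] cov nG _] := H.
have [pO [_ _ GO] [[_ _ _ OpO] [_ _ _ OmO] _ OE] _ _] := hgeo.
have [kap kap0 kapE] : exists2 kap : R, 0 < kap & kap = k1 / (2 * k2).
  by exists (k1 / (2 * k2)) => //; rewrite divr_gt0// mulr_gt0.
have mu0 : 0 < bm / bp by rewrite divr_gt0.
have [h1 h10 Hh1] := small_step C0 kap0 mu0.
have [K K0 HK] := local_estimate hbp hbm C0 kap0.
have [M OM] : exists M : R, Omega `<=` ball 0 M.
  have [_ [M [_ HM]] _] := pO; exists (M + 2) => x Ox.
  rewrite -ball_normE /= sub0r normrN; apply: (@le_lt_trans _ _ (M + 1)).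
    by apply: (HM (M + 1)) => //; rewrite ltrDl.
  by rewrite ltrD2l ltr1n.
have OpM := subset_trans OpO OM; have OmM := subset_trans OmO OM.
have fOp := bounded_finite oOp OpM; have fOm := bounded_finite oOm OmM.
have kap20 : 0 < kap / 2 by rewrite divr_gt0.
(* The overlap count by volumes: a ball of radius [22 h + 2 h + kap h / 4] contains disjoint balls
   of radius [kap h / 4], one for each energy ball through the point. *)
have [c c0 cE] : exists2 c : R, 0 < c & c = ((48 + kap / 2) / (kap / 2)) ^+ 3.
  by exists (((48 + kap / 2) / (kap / 2)) ^+ 3) => //; rewrite exprn_gt0// divr_gt0// addr_gt0.
have Kc0 : 0 < 24 * 24 * (K * c) by rewrite !mulr_gt0.
have p401 : 0 < 401 :> R by rewrite ltr0n.
(* The constant is 24 from [Hsemi2_affine], times 2 because each side of an element is charged with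
   both energies, times 12 from [energy_overlap]. The 401 makes [400 * h < r] strict. *)
exists (Num.min h1 (r / 401)), (24 * 24 * (K * c)); split; last 1 first.
move=> N a xs s conf qu; rewrite le_min => /andP[hh1 hr'] ang hxs v [_ Hvp Hvm _ flux] /within_continuous_eps cont.
set h := mesh_size a in hh1 hr' *.
have elem i := mesh_element i pO hk1 hk2 conf qu; rewrite -/h -kapE in elem.
have disj i j : i != j -> tet (a i) `&` tet (a j) = set0 by have [_ _ d] := conf; case/d.
have hr : 0 < h -> 400 * h < r.
  move=> h0; move: hr'; rewrite (ler_pdivlMr _ _ p401) => hr'; apply: lt_le_trans hr'.
  by rewrite mulrC (ltr_pM2l h0) ltr_nat.
have Ih i : interface_element G (a i) -> forall x, closure (tet (a i)) x -> `|x - xs i| <= h.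
  move=> /hxs[_ cs] x cx; have [_ _ _ dh _] := elem i; exact: le_trans (norm_le_diam cx cs) dh.
split.
  apply: interpolant_exists => // i.
  have [ai TO h0 dh hin] := elem i; have [lam lamE] := barycentric_exists ai.
  have [IE|NI] := pselect (interface_element G (a i)); last first.
    have [p pE] := affine_interpolation (fun k => v (a i k)) ai.
    by exists (p, p); split=> // k; rewrite /nodal_value /=; case: ifP.
  have [Gs cs] := hxs i IE; have [_ ra] := ang i IE; have [_ _ hd] := Hh1 h h0 hh1.
  have hrr : h < r by have := hr h0; move: h0; clear; lra.
  have [|||dh2 den] := interface_denominator (kap := kap) s H Gs h0 hrr kap0 mu0 ai lamE _ _ _ (erefl _) hd.
  - by move=> k; apply: (Ih i IE); exact: (tet_vertex_closure ai lamE).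
  - by move=> k; apply: (grad_lam_bound ai lamE) => //; exact: mulr_gt0.
  - exact: (dihedral_nonobtuse ai lamE ra).
  have [nn _] := nG _ Gs.
  have c00 : 0 < Num.min 1 (bm / bp) / 2 by rewrite divr_gt0// lt_min ltr01.
  have [p [pS pE]] := piece_exists lamE nn hbp c00 den (fun k => v (a i k)).
  by exists p; split=> // k; rewrite nodal_valueE; exact: pE.
move=> w [p [pI pP wp wm _] pv] m m1.
(* The positivity of the mesh size comes from an element, so an empty mesh is treated apart. *)
have [N0|Npos] := posnP N.
  move: (a) (w); subst N => a' w'; rewrite big_ord0; apply: mule_ge0.
    by rewrite lee_fin; apply: mulr_ge0; [exact: ltW|apply: exprn_ge0; exact: bigmax_ge_id].
  by apply: adde_ge0; apply: sume_ge0 => k _; apply: sume_ge0 => j _;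
    apply: le_ereal_inf_tmp => _ [g _ <-]; exact: N2_ge0.
have h0 : 0 < h by have [] := elem (Ordinal Npos).
have small := Hh1 h h0 hh1; have h400 := hr h0.
have [gp [gm [tp [tm [Hgp Hgm flux0]]]]] := flux.
have [ggp [_ nggp /(_ gp (fun i => (Hgp i).1))[dp ngp]]] := H2_data oOp fOp Hvp.
have [ggm [_ nggm /(_ gm (fun i => (Hgm i).1))[dm ngm]]] := H2_data oOm fOm Hvm.
have Hge0 U : (0 <= Hnorm2 2 U v)%E.
  apply: sume_ge0 => k _; apply: sume_ge0 => j _; apply: le_ereal_inf_tmp => _ [g _ <-]; exact: N2_ge0.
have [hp hpE] : exists hp : R, Hnorm2 2 Op v = hp%:E.
  by exists (fine (Hnorm2 2 Op v)); rewrite fineK// ge0_fin_numE.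
have [hm hmE] : exists hm : R, Hnorm2 2 Om v = hm%:E.
  by exists (fine (Hnorm2 2 Om v)); rewrite fineK// ge0_fin_numE.
rewrite hpE in nggp ngp *; rewrite hmE in nggm ngm *.
pose B i := ball (a i 0) (22 * h).
have mB i : measurable (B i) by exact: measurable_ball3.
have Bc x : \sum_i \1_(B i) x <= c.
  have kh0 : 0 < kap * h by exact: mulr_gt0.
  have [z Hz] : exists z : 'I_N -> pt3 R, forall i, ball (z i) (kap * h / 4) `<=` tet (a i).
    have /choice[z Hz] i : exists z, ball z (kap * h / 4) `<=` tet (a i).
      by have [_ _ _ _ hin] := elem i; exact: inscribed_ball.
    by exists z.
  have rho0 : 0 < kap * h / 4 by exact: divr_gt0.
  have d1 i j : i != j -> ball (z i) (kap * h / 4) `&` ball (z j) (kap * h / 4) = set0.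
    by move=> /disj d; apply/seteqP; split=> // q [/Hz qi /Hz qj]; rewrite -d.
  have d2 i : `|z i - a i 0| <= 2 * h.
    have [ai _ _ dh _] := elem i; have [lam lamE] := barycentric_exists ai.
    have cz : closure (tet (a i)) (z i) by apply: subset_closure; apply: Hz; exact: ballxx.
    have ca : closure (tet (a i)) (a i 0) by exact: (tet_vertex_closure ai lamE).
    by apply: le_trans (norm_le_diam cz ca) _; move: dh h0; clear; lra.
  have h22 : 0 <= 22 * h by rewrite mulr_ge0// ltW.
  have h2 : 0 <= 2 * h by rewrite mulr_ge0// ltW.
  have := overlap x rho0 h22 h2 d1 d2.
  have -> : (kap * h / 4) *+ 2 = kap / 2 * h by rewrite -mulr_natl; field.
  have -> : (22 * h + 2 * h + kap * h / 4) *+ 2 = (48 + kap / 2) * h by rewrite -mulr_natl; field.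
  rewrite !exprMn mulrA (ler_pM2r (exprn_gt0 3 h0)) => ov.
  by rewrite -exprMn in ov; rewrite cE expr_div_n ler_pdivlMr ?exprn_gt0.
have mOp := open_measurable3 oOp; have mOm := open_measurable3 oOm.
have [ep [ep0 epE eps]] := fine_sum (fun i => energy_ge0 (Op `&` B i) gp ggp)
  (energy_overlap mOp dp mB (ltW c0) Bc ngp nggp).
have [em [em0 emE ems]] := fine_sum (fun i => energy_ge0 (Om `&` B i) gm ggm)
  (energy_overlap mOm dm mB (ltW c0) Bc ngm nggm).
pose X q i := 24 * (K * h ^+ q * (ep i + em i)).
have bound i : (Hsemi2 m (tet (a i) `&` Op) (fun x => v x - w x)%R <= (X (4 - 2 * m)%N i)%:E)%E /\
               (Hsemi2 m (tet (a i) `&` Om) (fun x => v x - w x)%R <= (X (4 - 2 * m)%N i)%:E)%E.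
  have [ai TO _ dh hin] := elem i; have [lam lamE] := barycentric_exists ai.
  have [||||b1 b2 b3 b4] := HK Omega G Op Om n r s (a i) (xs i) h v gp gm ggp ggm tp tm (ep i + em i) (p i)
    H OE GO h0 h400 small _ ai TO dh hin _ dp dm (fun i => (Hgp i).2) (fun i => (Hgm i).2) flux0 _ _ cont
    (pI i) (pP i) (pv i).
  - by split=> //; exists M.
  - by move=> IE; have [_ ra] := ang i IE; have [Gs cs] := hxs i IE.
  - by rewrite epE lee_fin lerDl.
  - by rewrite emE lee_fin lerDr.
  have oT := tet_open ai lamE.
  have op : open (tet (a i) `&` Op) by exact: openI.
  have om : open (tet (a i) `&` Om) by exact: openI.
  have sp : tet (a i) `&` Op `<=` Op by move=> x [].
  have sm : tet (a i) `&` Om `<=` Om by move=> x [].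
  have bp' := subset_trans sp OpM; have bm' := subset_trans sm OmM.
  have wdp j : is_wderiv (tet (a i) `&` Op) [:: basis3 j] v (gp j).
    by apply: wderiv_sub (Hgp j).1 => //; exact: open_measurable3.
  have wdm j : is_wderiv (tet (a i) `&` Om) [:: basis3 j] v (gm j).
    by apply: wderiv_sub (Hgm j).1 => //; exact: open_measurable3.
  have [p1 p2] := Hsemi2_affine op (bounded_finite op bp') (ex_intro _ M bp') wdp (wp i) b1 b3.
  have [q1 q2] := Hsemi2_affine om (bounded_finite om bm') (ex_intro _ M bm') wdm (wm i) b2 b4.
  move: m1; case: (m) => [_|[_|//]]; last by split.
  (* The factor 24 is needed only for [m = 1]; here it is granted to [m = 0] so that [X] covers both
     cases. *)
  have le24 : K * h ^+ 4 * (ep i + em i) <= X 4%N i.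
    rewrite /X ler_peMl ?ler1n//; apply: mulr_ge0; last exact: addr_ge0.
    by apply: mulr_ge0; [exact: ltW|apply: exprn_ge0; exact: ltW].
  by split; [apply: le_trans p1 _|apply: le_trans q1 _]; rewrite lee_fin.
apply: (@le_trans _ _ (\sum_(i < N) (X (4 - 2 * m)%N i + X (4 - 2 * m)%N i)%:E)%E).
  by apply: lee_sum => i _; rewrite EFinD; have [h1' h2'] := bound i; exact: leeD.
rewrite sumEFin -EFinD -EFinM lee_fin big_split /= /X -!mulr_sumr big_split /=.
set hq := h ^+ _; have hq0 : 0 <= hq by apply: exprn_ge0; exact: ltW.
have -> : 24 * (K * hq * (\sum_i ep i + \sum_i em i)) + 24 * (K * hq * (\sum_i ep i + \sum_i em i)) =
  24 * 2 * (K * hq) * (\sum_i ep i + \sum_i em i) by ring.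
have -> : 24 * 24 * (K * c) * hq * (hp + hm) = 24 * 2 * (K * hq) * (12 * (c * hp) + 12 * (c * hm)) by ring.
apply: ler_wpM2l; last exact: lerD.
by apply: mulr_ge0 => //; apply: mulr_ge0 => //; exact: ltW.
by rewrite lt_min h10 /=; exact: divr_gt0 r0 p401.
exact: Kc0.
Qed.
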